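(* Let $\lambda\ge0$ with $\lambda\neq1$, and let $M_\lambda=\{\rho^\lambda=0\}$ near $\partial\Delta\times\{0\}$. Fix $0<\alpha<1$. There is a neighborhood $V$ of ${\bm f^0}(\zeta)=(\zeta,0,1,0)$ in the space of maps $\overline\Delta\to\mathbb C^4$ holomorphic on $\Delta$ and of class $\mathcal C^\alpha$ up to $\partial\Delta$ such that the set of lifts ${\bm f}=(f,\tilde f)\in V$ of stationary discs for $M_\lambda$ (i.e. ${\bm f}(\zeta)\in\mathcal NM_\lambda(\zeta)$ for all $\zeta\in\partial\Delta$) is a smooth real submanifold of dimension $8$.
   Context: For $\lambda\ge0$ let $\rho^\lambda(z,w)=|z|^2+|w|^2-\lambda\operatorname{Re}(\bar z^4w^2)-1$, and $\Omega_\lambda=\{\rho^\lambda<0\}$ near $\overline\Delta\times\{0\}$, $\Delta$ the unit disc. For a real hypersurface $M=\{\rho=0\}\subset\mathbb C^n$ and $\zeta\in\partial\Delta$, set $\mathcal NM(\zeta)=\{(z,\tilde z)\in\mathbb C^{2n}: z\in M,\ \tilde z\in\zeta N^*_zM\setminus\{0\}\}$, where $N^*_zM=\mathrm{span}_{\mathbb R}\{\partial\rho(z)\}$, $\partial\rho=(\rho_{z_1},\dots,\rho_{z_n})$. A disc $f:\overline\Delta\to\mathbb C^n$, holomorphic on $\Delta$, continuous on $\overline\Delta$ with $f(\partial\Delta)\subset M$, is stationary for $M$ if it has a lift ${\bm f}=(f,\tilde f):\overline\Delta\to\mathbb C^{2n}$, holomorphic on $\Delta$ and continuous up to the boundary,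 with ${\bm f}(\zeta)\in\mathcal NM(\zeta)$ for all $\zeta\in\partial\Delta$. The disc $f^0(\zeta)=(\zeta,0)$ is stationary with lift ${\bm f^0}=(\zeta,0,1,0)$. *)

(* Defs.v *)
From Stdlib Require Import Reals Lra.
From Stdlib Require Fin.
From Coquelicot Require Import Coquelicot.
Open Scope R_scope.

Definition C2 : Type := (C * C)%type.
Definition C4 : Type := (C2 * C2)%type.

Definition c2plus (u v : C2) : C2 := (Cplus (fst u) (fst v), Cplus (snd u) (snd v)).
Definition c2opp (u : C2) : C2 := (Copp (fst u), Copp (snd u)).
Definition c2cmul (a : C) (u : C2) : C2 := (Cmult a (fst u), Cmult a (snd u)).
Definition c2zero : C2 := (RtoC 0, RtoC 0).

Definition c4plus (u v : C4) : C4 := (c2plus (fst u) (fst v), c2plus (snd u) (snd v)).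
Definition c4opp (u : C4) : C4 := (c2opp (fst u), c2opp (snd u)).
Definition c4minus (u v : C4) : C4 := c4plus u (c4opp v).
Definition c4rscal (r : R) (u : C4) : C4 := (c2cmul (RtoC r) (fst u), c2cmul (RtoC r) (snd u)).
Definition c4zero : C4 := (c2zero, c2zero).

Definition c4norm (u : C4) : R :=
  sqrt (Cmod (fst (fst u)) ^ 2 + Cmod (snd (fst u)) ^ 2
        + Cmod (fst (snd u)) ^ 2 + Cmod (snd (snd u)) ^ 2).

Definition rho (lam : R) (p : C2) : R :=
  let z := fst p in let w := snd p in
  Cmod z ^ 2 + Cmod w ^ 2
  - lam * Re (Cmult (Cmult (Cmult (Cconj z) (Cconj z)) (Cmult (Cconj z) (Cconj z)))
                    (Cmult w w))
  - 1.

Definition wirt_z (r : C2 -> R) (p : C2) : C :=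
  Cmult (RtoC (/ 2))
    (Cminus (RtoC (Derive (fun t => r (Cplus (fst p) (RtoC t), snd p)) 0))
            (Cmult Ci (RtoC (Derive (fun t => r (Cplus (fst p) (Cmult Ci (RtoC t)), snd p)) 0)))).
Definition wirt_w (r : C2 -> R) (p : C2) : C :=
  Cmult (RtoC (/ 2))
    (Cminus (RtoC (Derive (fun t => r (fst p, Cplus (snd p) (RtoC t))) 0))
            (Cmult Ci (RtoC (Derive (fun t => r (fst p, Cplus (snd p) (Cmult Ci (RtoC t)))) 0)))).

Definition drho (r : C2 -> R) (p : C2) : C2 := (wirt_z r p, wirt_w r p).

(** M = {rho = 0}; NM(zeta) = {(p, q) : p in M, q in zeta N*_p M \ {0}},
    where N*_p M = span_R {\partial rho(p)}. *)
Definition in_M (r : C2 -> R) (p : C2) : Prop := r p = 0.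

Definition NM (r : C2 -> R) (zeta : C) (P : C4) : Prop :=
  in_M r (fst P) /\
  (exists c : R, snd P = c2cmul zeta (c2cmul (RtoC c) (drho r (fst P)))) /\
  snd P <> c2zero.

(** * The space A^alpha of maps closed disc -> C^4, holomorphic on the open
    disc, C^alpha up to the boundary.  A map on the closed disc is encoded
    by its extension by zero to C. *)
Definition cdiff_at (g : C -> C) (z : C) : Prop :=
  exists l : C, forall eps, 0 < eps -> exists delta, 0 < delta /\
    forall h : C, 0 < Cmod h < delta ->
      Cmod (Cminus (Cminus (g (Cplus z h)) (g z)) (Cmult l h)) <= eps * Cmod h.

Definition holo_on_disc (F : C -> C4) : Prop :=
  forall z, Cmod z < 1 ->
    cdiff_at (fun u => fst (fst (F u))) z /\ cdiff_at (fun u => snd (fst (F u))) z /\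
    cdiff_at (fun u => fst (snd (F u))) z /\ cdiff_at (fun u => snd (snd (F u))) z.

(** [hbound alpha G c]: the C^alpha norm max(sup|G|, [G]_alpha) on the
    closed disc is at most c. *)
Definition hbound (alpha : R) (G : C -> C4) (c : R) : Prop :=
  (forall z, Cmod z <= 1 -> c4norm (G z) <= c) /\
  (forall z w, Cmod z <= 1 -> Cmod w <= 1 -> z <> w ->
     c4norm (c4minus (G z) (G w)) <= c * Rpower (Cmod (Cminus z w)) alpha).

Definition InA (alpha : R) (F : C -> C4) : Prop :=
  (forall z, 1 < Cmod z -> F z = c4zero) /\
  holo_on_disc F /\
  (exists c, hbound alpha F c).

Definition hball (alpha : R) (F0 : C -> C4) (eps : R) (F : C -> C4) : Prop :=
  exists c, c < eps /\ hbound alpha (fun z => c4minus (F z) (F0 z)) c.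

Definition is_nbhd_A (alpha : R) (F0 : C -> C4) (V : (C -> C4) -> Prop) : Prop :=
  (forall F, V F -> InA alpha F) /\
  exists eps, 0 < eps /\ forall F, InA alpha F -> hball alpha F0 eps F -> V F.

Definition Rn (d : nat) : Type := Fin.t d -> R.

Definition sup_lt {d} (x y : Rn d) (delta : R) : Prop :=
  forall i, Rabs (y i - x i) < delta.

Definition open_Rn {d} (U : Rn d -> Prop) : Prop :=
  forall x, U x -> exists delta, 0 < delta /\ forall y, sup_lt x y delta -> U y.

Definition shift {d} (x : Rn d) (i : Fin.t d) (t : R) : Rn d :=
  fun j => if Fin.eq_dec i j then x j + t else x j.

Definition hcont (alpha : R) {d} (U : Rn d -> Prop) (phi : Rn d -> C -> C4) : Prop :=
  forall x, U x -> forall eps, 0 < eps -> exists delta, 0 < delta /\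
    forall y, U y -> sup_lt x y delta -> hbound alpha (fun z => c4minus (phi y z) (phi x z)) eps.

Definition hpartial (alpha : R) {d} (U : Rn d -> Prop) (phi : Rn d -> C -> C4)
  (i : Fin.t d) (psi : Rn d -> C -> C4) : Prop :=
  forall x, U x -> forall eps, 0 < eps -> exists delta, 0 < delta /\
    forall t, 0 < Rabs t < delta ->
      hbound alpha
        (fun z => c4minus (c4rscal (/ t) (c4minus (phi (shift x i t) z) (phi x z))) (psi x z))
        eps.

Fixpoint hCk (alpha : R) {d} (U : Rn d -> Prop) (k : nat) (phi : Rn d -> C -> C4) : Prop :=
  hcont alpha U phi /\
  match k with
  | O => True
  | S k' => forall i, exists psi, hpartial alpha U phi i psi /\ hCk alpha U k' psi
  end.

Fixpoint finsum {d : nat} : (Fin.t d -> C4) -> C4 :=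
  match d with
  | O => fun _ => c4zero
  | S d' => fun g => c4plus (g Fin.F1) (finsum (fun i => g (Fin.FS i)))
  end.

Definition smooth_immersion (alpha : R) {d} (U : Rn d -> Prop) (phi : Rn d -> C -> C4) : Prop :=
  hcont alpha U phi /\
  exists D : Fin.t d -> Rn d -> C -> C4,
    (forall i, hpartial alpha U phi i (D i) /\ forall k, hCk alpha U k (D i)) /\
    (forall x, U x -> forall a : Rn d,
        (forall z, Cmod z <= 1 -> finsum (fun i => c4rscal (a i) (D i x z)) = c4zero) ->
        forall i, a i = 0).

Definition smooth_submanifold (alpha : R) (d : nat) (S : (C -> C4) -> Prop) : Prop :=
  (forall F, S F -> InA alpha F) /\
  forall F, S F ->
    exists (U : Rn d -> Prop) (phi : Rn d -> C -> C4) (eta : R),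
      open_Rn U /\ 0 < eta /\
      (forall x, U x -> InA alpha (phi x)) /\
      smooth_immersion alpha U phi /\
      (forall G, (S G /\ hball alpha F eta G) <-> exists x, U x /\ phi x = G) /\
      (forall x y, U x -> U y -> phi x = phi y -> x = y) /\
      (forall x, U x -> forall eps, 0 < eps -> exists delta, 0 < delta /\
         forall y, U y -> hball alpha (phi x) delta (phi y) -> sup_lt x y eps).

Definition f0lift (z : C) : C4 :=
  if Rle_dec (Cmod z) 1 then ((z, RtoC 0), (RtoC 1, RtoC 0)) else c4zero.

Definition stationary_lift (r : C2 -> R) (F : C -> C4) : Prop :=
  forall zeta, Cmod zeta = 1 -> NM r zeta (F zeta).

(* Main.v *)
(* Writing z = ζ(1 + p), w, and the conormal part as (1 + u, v), stationarity is a nonlinear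
   Riemann-Hilbert problem on the circle whose linear part is explicitly solvable on Fourier
   coefficients. For λ <> 1 its kernel has real dimension 8, with coordinates z(0), Im z'(0), w(0),
   w'(0) and the real part of the first conormal component at 0. With the auxiliary unknowns
   (1 + conj p)^k w - w the system becomes Y = η(x) + B(Y, Y) in a Banach space of coefficient
   sequences decaying like |n|^-4, so a contraction gives a solution for each small x. It is smooth in
   x because its partial derivatives solve linear equations with the same linear part.
   Conversely, a merely Hölder lift close to the given one is determined by its eight coordinates:
   the difference of two such lifts is zero by an L^2 estimate on the circle, in which the boundary
   equations are combined with the mean value property of squares of holomorphic functions. *)
From Stdlib Require Import Reals Lra Lia ZArith FunctionalExtensionality ProofIrrelevance ClassicalEpsilon.
From Stdlib Require Fin.
From Coquelicot Require Import Coquelicot.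
Require Import Defs.
Open Scope R_scope.

(** Existence and uniqueness live in different classes. Coefficients decaying like |n|^-4 form a
    convolution algebra on which conjugation, shifts and Fourier projections are bounded, so solving
    needs no estimate for the Hilbert transform on Hölder spaces; but such sequences describe only
    part of the Hölder class. A lift near the given one must therefore be matched with a constructed
    one by a separate argument, which uses only continuity up to the circle and holomorphy inside.

    No implicit function theorem is needed. The right inverse of the linear part is normalised so
    that its values have all eight coordinates equal to zero. Hence the solution with parameter x
    has coordinates exactly x, and its partial derivatives have the unit vectors as coordinates:
    injectivity, immersion and continuity of the inverse chart are read off from the coordinates.

    The condition lam <> 1 is used twice, each time through the coefficient w_2: to solve lam w_2 -
    conj w_2 = a in the construction, and to bound V(0) in the uniqueness proof, where ze^2 V is the
    difference of two w-components. *)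

(** * Elementary estimates for complex numbers *)

Lemma C_eq (a b : C) : Re a = Re b -> Im a = Im b -> a = b.
Proof. destruct a, b; simpl; intros -> ->; reflexivity. Qed.

Lemma im_le_Cmod (c : C) : Rabs (Im c) <= Cmod c.
Proof.
  apply Rle_trans with (2 := Rmax_Cmod c). apply Rmax_r.
Qed.

Lemma Cmod_le_ReIm (c : C) : Cmod c <= Rabs (Re c) + Rabs (Im c).
Proof.
  rewrite <- (Rabs_pos_eq (Rabs (Re c) + Rabs (Im c))).
  2:{ generalize (Rabs_pos (Re c)) (Rabs_pos (Im c)); lra. }
  rewrite <- (Rabs_pos_eq (Cmod c)) by apply Cmod_ge_0.
  apply Rsqr_le_abs_0. unfold Rsqr.
  replace (Cmod c * Cmod c) with (Cmod c ^ 2) by ring. rewrite Cmod2_alt.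
  generalize (Rabs_pos (Re c)) (Rabs_pos (Im c)); intros.
  assert (Rabs (Re c) * Rabs (Re c) = Re c ^ 2) by (rewrite <- Rabs_mult; rewrite Rabs_pos_eq; nra).
  assert (Rabs (Im c) * Rabs (Im c) = Im c ^ 2) by (rewrite <- Rabs_mult; rewrite Rabs_pos_eq; nra).
  nra.
Qed.

Lemma Cmod_le_2 (c : C) (k : R) : Rabs (Re c) <= k -> Rabs (Im c) <= k -> Cmod c <= 2 * k.
Proof. intros; generalize (Cmod_le_ReIm c); lra. Qed.

Lemma Cmod_minus_triangle (x y z : C) : Cmod (x - z) <= Cmod (x - y) + Cmod (y - z).
Proof. replace (x - z)%C with ((x - y) + (y - z))%C by ring. apply Cmod_triangle. Qed.

Lemma Cmod_sub (x y : C) : Cmod (x - y) <= Cmod x + Cmod y.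
Proof. rewrite <- (Cmod_opp y). apply Cmod_triangle. Qed.

Lemma Cmod_sym (x y : C) : Cmod (x - y) = Cmod (y - x).
Proof. rewrite <- Cmod_opp. f_equal. ring. Qed.

(** Convergence is mostly recorded with an explicit rate [K / (INR n + 1)]; this Archimedean step
    then replaces a passage to the limit when an equality is squeezed out. *)
Lemma Rle_eps_mult (a K : R) : (forall n : nat, a <= K / (INR n + 1)) -> a <= 0.
Proof.
  intros H. destruct (Rle_or_lt a 0) as [h|h]; [exact h|].
  destruct (archimed_cor1 (a / (Rabs K + 1))) as [N [HN HN0]].
  { apply Rdiv_lt_0_compat; [exact h|]. generalize (Rabs_pos K); lra. }
  specialize (H N). exfalso.
  assert (HK : K <= Rabs K) by apply Rle_abs.
  assert (HP := Rabs_pos K). assert (HI := pos_INR N).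
  assert (Hn : 0 < INR N + 1) by lra.
  apply lt_INR in HN0; simpl in HN0.
  apply (Rmult_lt_compat_r (INR N)) in HN; [|exact HN0].
  rewrite Rinv_l in HN by lra.
  apply (Rmult_lt_compat_r (Rabs K + 1)) in HN; [|lra].
  replace (a / (Rabs K + 1) * INR N * (Rabs K + 1)) with (a * INR N) in HN by (field; lra).
  apply (Rmult_le_compat_r (INR N + 1)) in H; [|lra].
  replace (K / (INR N + 1) * (INR N + 1)) with K in H by (field; lra).
  nra.
Qed.

(** * Weights on the integers *)

Definition wt (k : Z) : R := 1 + IZR (Z.abs k).
(** Decay of order two suffices for absolute convergence; the constant stays visible because sums
    are later bounded by a multiple of it. *)
Definition dom (f : Z -> C) (c : R) : Prop := forall k, Cmod (f k) <= c / wt k ^ 2.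

Lemma wt_ge1 k : 1 <= wt k.
Proof. unfold wt. generalize (IZR_le 0 (Z.abs k) (Z.abs_nonneg k)). lra. Qed.

Lemma wt_pow_pos k n : 0 < wt k ^ n.
Proof. apply pow_lt. generalize (wt_ge1 k); lra. Qed.

Lemma wt_nat (n : nat) : wt (Z.of_nat n) = INR n + 1.
Proof. unfold wt. rewrite Z.abs_eq by lia. rewrite <- INR_IZR_INZ. ring. Qed.

Lemma wt_opp k : wt (- k) = wt k.
Proof. unfold wt. now rewrite Z.abs_opp. Qed.

Lemma wt_neg (n : nat) : wt (-1 - Z.of_nat n) = INR n + 2.
Proof.
  replace (-1 - Z.of_nat n)%Z with (- (Z.of_nat (S n)))%Z by lia.
  rewrite wt_opp, wt_nat, S_INR. ring.
Qed.

Lemma wt_add j k : wt (j + k) <= wt j + wt k - 1.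
Proof. unfold wt. assert (H := IZR_le _ _ (Z.abs_triangle j k)). rewrite plus_IZR in H. lra. Qed.

(** Submultiplicativity bounds shifts, and it lets a product of terms at the frequencies [k] and
    [n - k] be charged to [n]. *)
Lemma wt_mult j k : wt (j + k) <= wt j * wt k.
Proof. generalize (wt_add j k) (wt_ge1 j) (wt_ge1 k). nra. Qed.

Lemma dom_nonneg f c : dom f c -> 0 <= c.
Proof.
  intros H. specialize (H 0%Z). unfold wt in H. simpl in H.
  generalize (Cmod_ge_0 (f 0%Z)). unfold Rdiv in H.
  replace ((1 + 0) * ((1 + 0) * 1)) with 1 in H by ring. rewrite Rinv_1 in H. lra.
Qed.

Lemma div_wt_mono c d k n : c <= d -> c / wt k ^ n <= d / wt k ^ n.
Proof. intros. apply Rmult_le_compat_r; [|assumption]. left; apply Rinv_0_lt_compat, wt_pow_pos. Qed.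

Lemma div_wt_nonneg c k n : 0 <= c -> 0 <= c / wt k ^ n.
Proof. intros. apply Rmult_le_pos; [assumption|]. left; apply Rinv_0_lt_compat, wt_pow_pos. Qed.

Lemma div_wt_le c k n : 0 <= c -> c / wt k ^ n <= c.
Proof.
  intros. rewrite <- (Rmult_1_r c) at 2. apply Rmult_le_compat_l; [assumption|].
  rewrite <- Rinv_1. apply Rinv_le_contravar; [lra|]. apply pow_R1_Rle, wt_ge1.
Qed.

(** * Sums over the integers *)

Section IntegerSums.

Local Arguments Z.sub : simpl never.
Local Arguments Z.add : simpl never.
Local Arguments Z.of_nat : simpl never.

(* The indices run over [-N <= k < N]. *)
Fixpoint psum (f : Z -> C) (N : nat) : C :=
  match N with
  | O => RtoC 0
  | S n => Cplus (psum f n) (Cplus (f (Z.of_nat n)) (f (-1 - Z.of_nat n)%Z))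
  end.

(** Total, because [real] and [Lim_seq] are; the value is meaningful for a family with a [dom]
    bound. *)
Definition CsumZ (f : Z -> C) : C :=
  (real (Lim_seq (fun n => Re (psum f n))), real (Lim_seq (fun n => Im (psum f n)))).

(** Convergence with a rate. Sums are computed by exhibiting a value with this property and invoking
    its uniqueness. *)
Definition isum (f : Z -> C) (s : C) : Prop :=
  exists K, forall N, Cmod (s - psum f N) <= K / (INR N + 1).

Lemma isum_unique f s t : isum f s -> isum f t -> s = t.
Proof.
  intros [K HK] [L HL].
  assert (H : Cmod (s - t) <= 0).
  { apply Rle_eps_mult with (K + L). intros n.
    apply Rle_trans with (1 := Cmod_minus_triangle s (psum f n) t).
    rewrite (Cmod_sym _ t). generalize (HK n) (HL n). unfold Rdiv. lra. }
  assert (E : (s - t = 0)%C) by (apply Cmod_eq_0; generalize (Cmod_ge_0 (s - t)); lra).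
  replace s with ((s - t) + t)%C by ring. rewrite E. ring.
Qed.

(** The increments telescope: the two terms added at step x are at most c/(x+1)^2 + c/(x+2)^2 <=
    4c/(x+1) - 4c/(x+2). *)
Lemma psum_cauchy f c N j : dom f c ->
  Cmod (psum f (N + j) - psum f N) <= 4 * c / (INR N + 1) - 4 * c / (INR (N + j) + 1).
Proof.
  intros Hf. assert (Hc := dom_nonneg _ _ Hf).
  induction j as [|j IH].
  - rewrite Nat.add_0_r. replace (psum f N - psum f N)%C with (RtoC 0) by ring.
    rewrite Cmod_0. lra.
  - rewrite Nat.add_succ_r. simpl psum.
    set (m := (N + j)%nat) in *.
    replace (psum f m + (f (Z.of_nat m) + f (-1 - Z.of_nat m)%Z) - psum f N)%C
      with ((psum f m - psum f N) + (f (Z.of_nat m) + f (-1 - Z.of_nat m)%Z))%C by ring.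
    apply Rle_trans with (1 := Cmod_triangle _ _).
    assert (H1 := Cmod_triangle (f (Z.of_nat m)) (f (-1 - Z.of_nat m)%Z)).
    assert (H2 := Hf (Z.of_nat m)). assert (H3 := Hf (-1 - Z.of_nat m)%Z).
    rewrite wt_nat in H2. rewrite wt_neg in H3. rewrite S_INR.
    assert (Hm := pos_INR m). set (x := INR m) in *.
    assert (c / (x + 1)^2 + c / (x + 2)^2 <= 4 * c / (x + 1) - 4 * c / (x + 1 + 1)).
    { apply Rminus_le.
      replace (c / (x + 1) ^ 2 + c / (x + 2) ^ 2 - (4 * c / (x + 1) - 4 * c / (x + 1 + 1)))
        with (- (c * ((4 * (x+1) * (x+2) - (x+1)^2 - (x+2)^2) / ((x+1)^2 * (x+2)^2)))) by (field; lra).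
      assert (0 <= c * ((4 * (x+1) * (x+2) - (x+1)^2 - (x+2)^2) / ((x+1)^2 * (x+2)^2))); [|lra].
      apply Rmult_le_pos; [assumption|]. apply Rmult_le_pos; [nra|].
      left. apply Rinv_0_lt_compat. apply Rmult_lt_0_compat; apply pow_lt; lra. }
    lra.
Qed.

Lemma psum_cauchy' f c N M : dom f c -> (N <= M)%nat ->
  Cmod (psum f M - psum f N) <= 4 * c / (INR N + 1).
Proof.
  intros Hf HNM. replace M with (N + (M - N))%nat by lia.
  apply Rle_trans with (1 := psum_cauchy _ _ _ _ Hf).
  assert (0 <= 4 * c / (INR (N + (M - N)) + 1)); [|lra].
  apply Rmult_le_pos. generalize (dom_nonneg _ _ Hf); lra.
  left; apply Rinv_0_lt_compat. generalize (pos_INR (N + (M - N))); lra.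
Qed.

Lemma inv_small (K : R) (eps : posreal) : 0 <= K -> exists N : nat, forall n, (N <= n)%nat -> K / (INR n + 1) < eps.
Proof.
  intros HK. destruct (nfloor_ex (K / eps)) as [N HN].
  { apply Rmult_le_pos; [assumption|left; apply Rinv_0_lt_compat, cond_pos]. }
  exists N. intros n Hn. apply le_INR in Hn. assert (He := cond_pos eps).
  apply Rmult_lt_reg_r with (INR n + 1); [generalize (pos_INR n); lra|].
  replace (K / (INR n + 1) * (INR n + 1)) with K by (field; generalize (pos_INR n); lra).
  replace K with (K / eps * eps) by (field; lra).
  rewrite (Rmult_comm eps). apply Rmult_lt_compat_r; lra.
Qed.

Lemma lim_dom (u : nat -> R) (K : R) : 0 <= K ->
  (forall N M, (N <= M)%nat -> Rabs (u M - u N) <= K / (INR N + 1)) ->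
  forall N, Rabs (real (Lim_seq u) - u N) <= K / (INR N + 1).
Proof.
  intros HK H.
  assert (Hex : ex_finite_lim_seq u).
  { apply ex_lim_seq_cauchy_corr. intros eps.
    destruct (inv_small (2 * K) eps) as [N HN]; [lra|]. exists N. intros n m Hn Hm.
    apply Rle_lt_trans with (2 := HN N (le_n N)).
    replace (u n - u m) with ((u n - u N) - (u m - u N)) by ring.
    apply Rle_trans with (1 := Rabs_triang _ _). rewrite Rabs_Ropp.
    generalize (H N n Hn) (H N m Hm). unfold Rdiv; lra. }
  destruct Hex as [l Hl]. rewrite (is_lim_seq_unique _ _ Hl). simpl. intros N.
  apply Rabs_le.
  assert (Hc : is_lim_seq (fun M => u M - u N) (l - u N)).
  { apply is_lim_seq_minus'; [exact Hl|apply is_lim_seq_const]. }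
  split.
  - apply (is_lim_seq_le_loc (fun _ => - (K / (INR N + 1))) (fun M => u M - u N) (- (K / (INR N + 1))) (l - u N)); [|apply is_lim_seq_const|exact Hc].
    exists N. intros M HM. generalize (H N M HM). intros h. apply Rabs_le_between in h. lra.
  - apply (is_lim_seq_le_loc (fun M => u M - u N) (fun _ => (K / (INR N + 1))) (l - u N) (K / (INR N + 1))); [|exact Hc|apply is_lim_seq_const].
    exists N. intros M HM. generalize (H N M HM). intros h. apply Rabs_le_between in h. lra.
Qed.

Lemma CsumZ_psum f c N : dom f c -> Cmod (CsumZ f - psum f N) <= 8 * c / (INR N + 1).
Proof.
  intros Hf. assert (Hc := dom_nonneg _ _ Hf).
  replace (8 * c / (INR N + 1)) with (2 * (4 * c / (INR N + 1))) by (unfold Rdiv; ring).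
  apply Cmod_le_2.
  - apply (lim_dom (fun n => Re (psum f n))); [lra|]. intros n m Hnm.
    apply Rle_trans with (2 := psum_cauchy' _ _ _ _ Hf Hnm). apply (re_le_Cmod (psum f m - psum f n)).
  - apply (lim_dom (fun n => Im (psum f n))); [lra|]. intros n m Hnm.
    apply Rle_trans with (2 := psum_cauchy' _ _ _ _ Hf Hnm). apply (im_le_Cmod (psum f m - psum f n)).
Qed.

Lemma CsumZ_isum f c : dom f c -> isum f (CsumZ f).
Proof. intros H. exists (8 * c). intros N. now apply CsumZ_psum. Qed.

Lemma CsumZ_eq f c s : dom f c -> isum f s -> CsumZ f = s.
Proof. intros H Hs. apply isum_unique with f; [now apply CsumZ_isum with c|assumption]. Qed.

Lemma CsumZ_bound f c : dom f c -> Cmod (CsumZ f) <= 8 * c.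
Proof.
  intros H. generalize (CsumZ_psum f c 0 H). simpl.
  replace (CsumZ f - 0)%C with (CsumZ f) by ring. intros h.
  replace (8 * c / (0 + 1)) with (8 * c) in h by field. exact h.
Qed.

Lemma psum_plus f g N : psum (fun k => f k + g k)%C N = (psum f N + psum g N)%C.
Proof. induction N; simpl; [ring|]. rewrite IHN. ring. Qed.

Lemma psum_scal a f N : psum (fun k => a * f k)%C N = (a * psum f N)%C.
Proof. induction N; simpl; [ring|]. rewrite IHN. ring. Qed.

Lemma psum_conj f N : psum (fun k => Cconj (f k)) N = Cconj (psum f N).
Proof.
  induction N; simpl. apply C_eq; simpl; lra.
  rewrite IHN, !Cplus_conj. reflexivity.
Qed.

(** The range [-N, N) is invariant under k -> -1-k, which swaps the two terms added at each step.
    This reflection is the basic symmetry of the partial sums. *)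
Lemma psum_refl f N : psum (fun k => f (-1 - k)%Z) N = psum f N.
Proof.
  induction N; simpl; [reflexivity|]. rewrite IHN.
  replace (-1 - (-1 - Z.of_nat N))%Z with (Z.of_nat N) by lia. ring.
Qed.

Lemma psum_succ f N :
  psum (fun k => f (k + 1)%Z) N = (psum f N + f (Z.of_nat N) - f (- Z.of_nat N)%Z)%C.
Proof.
  induction N; simpl psum.
  - simpl. change (Z.of_nat 0) with 0%Z. ring.
  - rewrite IHN. replace (-1 - Z.of_nat N + 1)%Z with (- Z.of_nat N)%Z by lia.
    replace (Z.of_nat N + 1)%Z with (Z.of_nat (S N)) by lia.
    replace (- Z.of_nat (S N))%Z with (-1 - Z.of_nat N)%Z by lia. ring.
Qed.

Lemma isum_plus f g s t : isum f s -> isum g t -> isum (fun k => f k + g k)%C (s + t)%C.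
Proof.
  intros [K HK] [L HL]. exists (K + L). intros N. rewrite psum_plus.
  replace (s + t - (psum f N + psum g N))%C with ((s - psum f N) + (t - psum g N))%C by ring.
  apply Rle_trans with (1 := Cmod_triangle _ _). generalize (HK N) (HL N). unfold Rdiv. lra.
Qed.

Lemma isum_scal a f s : isum f s -> isum (fun k => a * f k)%C (a * s)%C.
Proof.
  intros [K HK]. exists (Cmod a * K). intros N. rewrite psum_scal.
  replace (a * s - a * psum f N)%C with (a * (s - psum f N))%C by ring.
  rewrite Cmod_mult. unfold Rdiv. rewrite Rmult_assoc.
  apply Rmult_le_compat_l; [apply Cmod_ge_0|apply HK].
Qed.

Lemma isum_conj f s : isum f s -> isum (fun k => Cconj (f k)) (Cconj s).
Proof.
  intros [K HK]. exists K. intros N. rewrite psum_conj, <- Cminus_conj, Cmod_conj. apply HK.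
Qed.

Lemma isum_refl f s : isum f s -> isum (fun k => f (-1 - k)%Z) s.
Proof. intros [K HK]. exists K. intros N. rewrite psum_refl. apply HK. Qed.

Lemma isum_succ f c s : dom f c -> isum f s -> isum (fun k => f (k + 1)%Z) s.
Proof.
  intros Hf [K HK]. exists (K + 2 * c). intros N. rewrite psum_succ.
  replace (s - (psum f N + f (Z.of_nat N) - f (- Z.of_nat N)%Z))%C with
    ((s - psum f N) - (f (Z.of_nat N) - f (- Z.of_nat N)%Z))%C by ring.
  apply Rle_trans with (1 := Cmod_sub _ _).
  assert (H1 := Cmod_sub (f (Z.of_nat N)) (f (- Z.of_nat N)%Z)).
  assert (H2 := Hf (Z.of_nat N)). assert (H3 := Hf (- Z.of_nat N)%Z).
  rewrite wt_opp in H3. rewrite wt_nat in H2, H3.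
  assert (c / (INR N + 1) ^ 2 <= c / (INR N + 1)).
  { apply Rmult_le_compat_l; [apply (dom_nonneg _ _ Hf)|].
    apply Rinv_le_contravar; generalize (pos_INR N); nra. }
  generalize (HK N). unfold Rdiv in *. lra.
Qed.

Lemma dom_shift f c j : dom f c -> dom (fun k => f (k + j)%Z) (c * wt j ^ 2).
Proof.
  intros Hf k. assert (Hc := dom_nonneg _ _ Hf).
  apply Rle_trans with (1 := Hf (k + j)%Z).
  assert (H1 := wt_mult (k + j) (- j)). rewrite wt_opp in H1.
  replace (k + j + - j)%Z with k in H1 by lia.
  assert (H2 := wt_pow_pos (k + j) 2). assert (H3 := wt_pow_pos k 2).
  unfold Rdiv. rewrite Rmult_assoc. apply Rmult_le_compat_l; [assumption|].
  apply Rmult_le_reg_r with (wt (k + j) ^ 2); [assumption|].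
  rewrite Rinv_l by lra.
  apply Rmult_le_reg_r with (wt k ^ 2); [assumption|].
  replace (wt j ^ 2 * / wt k ^ 2 * wt (k + j) ^ 2 * wt k ^ 2) with ((wt (k + j) * wt j) ^ 2) by (field; generalize (wt_ge1 k); lra).
  rewrite Rmult_1_l. apply pow_incr. generalize (wt_ge1 k); lra.
Qed.

Lemma isum_shift f c s j : dom f c -> isum f s -> isum (fun k => f (k + j)%Z) s.
Proof.
  intros Hf Hs.
  assert (Hnat : forall (n : nat) g d t, dom g d -> isum g t -> isum (fun k => g (k + Z.of_nat n)%Z) t).
  { induction n; intros g d t Hg Ht.
    - replace (fun k => g (k + Z.of_nat 0)%Z) with g; [assumption|].
      apply functional_extensionality; intros k; f_equal; lia.
    - replace (fun k => g (k + Z.of_nat (S n))%Z) with (fun k => (fun m => g (m + 1)%Z) (k + Z.of_nat n)%Z).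
      2:{ apply functional_extensionality; intros k; f_equal; lia. }
      apply (IHn (fun m => g (m + 1)%Z) (d * wt 1 ^ 2)). now apply dom_shift. now apply isum_succ with d. }
  destruct (Z_le_gt_dec 0 j) as [h|h].
  - replace j with (Z.of_nat (Z.to_nat j)) by lia. now apply Hnat with c.
  (* A negative shift is conjugated into a positive one by the reflection k -> -1-k. *)
  - assert (Hr : isum (fun k => f (-1 - k)%Z) s) by now apply isum_refl.
    assert (Hd : dom (fun k => f (-1 - k)%Z) (c * wt 1 ^ 2)).
    { intros k. assert (h1 := dom_shift f c (-1) Hf (- k)%Z). cbv beta in h1.
      rewrite wt_opp in h1. replace (- k + -1)%Z with (-1 - k)%Z in h1 by lia. exact h1. }
    apply (Hnat (Z.to_nat (- j))) with (d := c * wt 1 ^ 2) in Hr; [|exact Hd].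
    apply isum_refl in Hr.
    replace (fun k => f (k + j)%Z) with (fun k : Z => f (-1 - (-1 - k + Z.of_nat (Z.to_nat (- j))))%Z); [exact Hr|].
    apply functional_extensionality; intros k; f_equal; lia.
Qed.

(** The map k -> n-k is the shift by n+1 combined with the reflection k -> -1-k. *)
Lemma isum_rev f c s n : dom f c -> isum f s -> isum (fun k => f (n - k)%Z) s.
Proof.
  intros Hf Hs. apply isum_shift with (j := (n + 1)%Z) (c := c) in Hs; [|exact Hf].
  apply isum_refl in Hs.
  replace (fun k => f (n - k)%Z) with (fun k : Z => f (-1 - k + (n + 1))%Z); [exact Hs|].
  apply functional_extensionality; intros k; f_equal; lia.
Qed.

Lemma dom_rev f c n : dom f c -> dom (fun k => f (n - k)%Z) (c * wt n ^ 2).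
Proof.
  intros Hf k. assert (h := dom_shift f c n Hf (- k)%Z). cbv beta in h.
  rewrite wt_opp in h. replace (- k + n)%Z with (n - k)%Z in h by lia. exact h.
Qed.

Lemma dom_plus f g c d : dom f c -> dom g d -> dom (fun k => f k + g k)%C (c + d).
Proof.
  intros Hf Hg k. apply Rle_trans with (1 := Cmod_triangle _ _).
  generalize (Hf k) (Hg k). unfold Rdiv; lra.
Qed.

Lemma dom_scal a f c : dom f c -> dom (fun k => a * f k)%C (Cmod a * c).
Proof.
  intros Hf k. rewrite Cmod_mult. unfold Rdiv. rewrite Rmult_assoc.
  apply Rmult_le_compat_l; [apply Cmod_ge_0|apply Hf].
Qed.

Lemma dom_conj f c : dom f c -> dom (fun k => Cconj (f k)) c.
Proof. intros Hf k. rewrite Cmod_conj. apply Hf. Qed.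

Lemma CsumZ_plus f g c d : dom f c -> dom g d ->
  CsumZ (fun k => f k + g k)%C = (CsumZ f + CsumZ g)%C.
Proof.
  intros Hf Hg. apply CsumZ_eq with (c + d); [now apply dom_plus|].
  apply isum_plus; [now apply CsumZ_isum with c|now apply CsumZ_isum with d].
Qed.

Lemma CsumZ_scal a f c : dom f c -> CsumZ (fun k => a * f k)%C = (a * CsumZ f)%C.
Proof.
  intros Hf. apply CsumZ_eq with (Cmod a * c); [now apply dom_scal|].
  apply isum_scal. now apply CsumZ_isum with c.
Qed.

Lemma CsumZ_ext f g : (forall k, f k = g k) -> CsumZ f = CsumZ g.
Proof. intros H. f_equal. now apply functional_extensionality. Qed.

Lemma Cmod_RtoC_nonneg (r : R) : 0 <= r -> Cmod (RtoC r) = r.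
Proof. intros. rewrite Cmod_R. now apply Rabs_pos_eq. Qed.

(** A partial sum over [n] commutes with the sum over [k] by additivity. What remains is, for each
    [k], a tail of size 8c/(N+1) times wt(k)^-2; summing these tails costs another factor 8, whence
    64c. *)
Lemma CsumZ_fubini (F : Z -> Z -> C) (c : R) :
  (forall n k, Cmod (F n k) <= c / wt n ^ 2 / wt k ^ 2) ->
  CsumZ (fun n => CsumZ (fun k => F n k)) = CsumZ (fun k => CsumZ (fun n => F n k)).
Proof.
  intros HF.
  assert (Hc : 0 <= c).
  { assert (h := HF 0%Z 0%Z). unfold wt in h. simpl in h.
    replace (c / ((1 + 0) * ((1 + 0) * 1)) / ((1 + 0) * ((1 + 0) * 1))) with c in h by field.
    generalize (Cmod_ge_0 (F 0%Z 0%Z)); lra. }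
  assert (Hrow : forall n, dom (fun k => F n k) (c / wt n ^ 2)) by (intros n k; apply HF).
  assert (Hcol : forall k, dom (fun n => F n k) (c / wt k ^ 2)).
  { intros k n. replace (c / wt k ^ 2 / wt n ^ 2) with (c / wt n ^ 2 / wt k ^ 2) by (unfold Rdiv; ring). apply HF. }
  assert (Hr : dom (fun n => CsumZ (fun k => F n k)) (8 * c)).
  { intros n. apply Rle_trans with (1 := CsumZ_bound _ _ (Hrow n)). unfold Rdiv; lra. }
  assert (Hl : dom (fun k => CsumZ (fun n => F n k)) (8 * c)).
  { intros n. apply Rle_trans with (1 := CsumZ_bound _ _ (Hcol n)). unfold Rdiv; lra. }
  apply CsumZ_eq with (8 * c); [exact Hr|].
  exists (64 * c). intros N.
  assert (Hp : exists d, dom (fun k => psum (fun n => F n k) N) d /\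
      psum (fun n => CsumZ (fun k => F n k)) N = CsumZ (fun k => psum (fun n => F n k) N)).
  { clear Hr Hl. induction N as [|N [d [Hd IH]]].
    - exists 0. split.
      + intros k. cbn [psum]. rewrite Cmod_0. apply div_wt_nonneg; lra.
      + cbn [psum]. symmetry. apply CsumZ_eq with 0.
        * intros k. rewrite Cmod_0. apply div_wt_nonneg; lra.
        * exists 0. intros N. replace (psum (fun _ => RtoC 0) N) with (RtoC 0).
          -- replace (0 - 0)%C with (RtoC 0) by ring. rewrite Cmod_0. unfold Rdiv; lra.
          -- induction N; simpl; [reflexivity|]. rewrite <- IHN. ring.
    - eexists. split.
      + simpl. apply dom_plus; [exact Hd|]. apply dom_plus; apply Hrow.
      + simpl. rewrite IH. rewrite (CsumZ_plus _ _ _ _ Hd (dom_plus _ _ _ _ (Hrow (Z.of_nat N)) (Hrow (-1 - Z.of_nat N)%Z))).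
        now rewrite (CsumZ_plus _ _ _ _ (Hrow (Z.of_nat N)) (Hrow (-1 - Z.of_nat N)%Z)). }
  destruct Hp as [d [Hd ->]].
  set (T := fun k => CsumZ (fun n => F n k)) in *.
  assert (HD : dom (fun k => T k + (RtoC (-1)) * psum (fun n => F n k) N)%C (8 * c / (INR N + 1))).
  { intros k. replace (T k + RtoC (-1) * psum (fun n => F n k) N)%C with (T k - psum (fun n => F n k) N)%C.
    2:{ replace (RtoC (-1)) with (- RtoC 1)%C by (apply C_eq; simpl; ring). ring. }
    apply Rle_trans with (1 := CsumZ_psum _ _ N (Hcol k)). unfold Rdiv; lra. }
  assert (HE := CsumZ_bound _ _ HD).
  rewrite (CsumZ_plus _ _ _ _ Hl (dom_scal (RtoC (-1)) _ _ Hd)) in HE.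
  rewrite (CsumZ_scal _ _ _ Hd) in HE.
  replace (CsumZ T + RtoC (-1) * CsumZ (fun k => psum (fun n => F n k) N))%C
    with (CsumZ T - CsumZ (fun k => psum (fun n => F n k) N))%C in HE.
  2:{ replace (RtoC (-1)) with (- RtoC 1)%C by (apply C_eq; simpl; ring). ring. }
  apply Rle_trans with (1 := HE). unfold Rdiv; lra.
Qed.

End IntegerSums.

(** * Fourier coefficients *)

Definition seqZ := Z -> C.
(** The exponent 4 leaves the summable factor wt^-2 after a loss of two powers of the frequency,
    which is the loss in the second-order Taylor remainder of a power series. *)
Definition nb (a : seqZ) (c : R) : Prop := forall n, Cmod (a n) <= c / wt n ^ 4.

Definition sadd (a b : seqZ) : seqZ := fun n => (a n + b n)%C.
(** Only real scalars: conjugation enters the system, so all operators below are linear over the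
    reals alone. *)
Definition sc (r : R) (a : seqZ) : seqZ := fun n => (RtoC r * a n)%C.
(** On the circle [cj] is complex conjugation, [sh j] multiplication by the [j]-th power of the
    variable, [msk] a Fourier projection, and [conv] the pointwise product. *)
Definition cj (a : seqZ) : seqZ := fun n => Cconj (a (- n)%Z).
Definition sh (j : Z) (a : seqZ) : seqZ := fun n => a (n - j)%Z.
Definition msk (m : Z -> bool) (a : seqZ) : seqZ := fun n => if m n then a n else RtoC 0.
Definition conv (a b : seqZ) : seqZ := fun n => CsumZ (fun k => a k * b (n - k)%Z)%C.
Definition cis (t : R) : C := (cos t, sin t).
Definition ev (a : seqZ) (t : R) : C := CsumZ (fun n => a n * cis (IZR n * t))%C.

Lemma nb_nonneg a c : nb a c -> 0 <= c.
Proof.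
  intros H. specialize (H 0%Z). generalize (Cmod_ge_0 (a 0%Z)). unfold wt in H. simpl in H.
  replace (c / ((1 + 0) * ((1 + 0) * ((1 + 0) * ((1 + 0) * 1))))) with c in H by field. lra.
Qed.

Lemma nb_mono a c d : c <= d -> nb a c -> nb a d.
Proof. intros H Ha n. apply Rle_trans with (1 := Ha n). now apply div_wt_mono. Qed.

Lemma wt4_le_wt2 c n : 0 <= c -> c / wt n ^ 4 <= c / wt n ^ 2.
Proof.
  intros. apply Rmult_le_compat_l; [assumption|]. apply Rinv_le_contravar; [apply wt_pow_pos|].
  apply Rle_pow; [apply wt_ge1|lia].
Qed.

Lemma nb_dom a c : nb a c -> dom a c.
Proof. intros H n. apply Rle_trans with (1 := H n). apply wt4_le_wt2. now apply nb_nonneg with a. Qed.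

Lemma nb_sadd a b c d : nb a c -> nb b d -> nb (sadd a b) (c + d).
Proof.
  intros Ha Hb n. apply Rle_trans with (1 := Cmod_triangle _ _).
  generalize (Ha n) (Hb n). unfold Rdiv; lra.
Qed.

Lemma nb_sc r a c : nb a c -> nb (sc r a) (Rabs r * c).
Proof.
  intros Ha n. unfold sc. rewrite Cmod_mult, Cmod_R. unfold Rdiv. rewrite Rmult_assoc.
  apply Rmult_le_compat_l; [apply Rabs_pos|apply Ha].
Qed.

Lemma nb_cj a c : nb a c -> nb (cj a) c.
Proof. intros Ha n. unfold cj. rewrite Cmod_conj. rewrite <- (wt_opp n). apply Ha. Qed.

Lemma nb_sh j a c : nb a c -> nb (sh j a) (c * wt j ^ 4).
Proof.
  intros Ha n. unfold sh. apply Rle_trans with (1 := Ha (n - j)%Z). assert (Hc := nb_nonneg _ _ Ha).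
  assert (H1 := wt_mult (n - j) j). replace (n - j + j)%Z with n in H1 by lia.
  assert (H2 := wt_pow_pos (n - j) 4). assert (H3 := wt_pow_pos n 4).
  unfold Rdiv. rewrite Rmult_assoc. apply Rmult_le_compat_l; [assumption|].
  apply Rmult_le_reg_r with (wt (n - j) ^ 4); [assumption|].
  rewrite Rinv_l by lra.
  apply Rmult_le_reg_r with (wt n ^ 4); [assumption|].
  replace (wt j ^ 4 * / wt n ^ 4 * wt (n - j) ^ 4 * wt n ^ 4) with ((wt (n - j) * wt j) ^ 4)
    by (field; generalize (wt_ge1 n); lra).
  rewrite Rmult_1_l. apply pow_incr. generalize (wt_ge1 n); lra.
Qed.

Lemma nb_msk m a c : nb a c -> nb (msk m a) c.
Proof.
  intros Ha n. unfold msk. destruct (m n); [apply Ha|].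
  rewrite Cmod_0. apply div_wt_nonneg. now apply nb_nonneg with a.
Qed.

(** Summability in both indices at once, as Fubini requires: the square of wt(n) <= wt(n-k) wt(k)
    gives the decay in [n], and two further powers of wt(k) remain. *)
Lemma conv_term a b c d n k : nb a c -> nb b d ->
  Cmod (a k * b (n - k)%Z) <= c * d / wt n ^ 2 / wt k ^ 2.
Proof.
  intros Ha Hb. rewrite Cmod_mult.
  assert (Hc := nb_nonneg _ _ Ha). assert (Hd := nb_nonneg _ _ Hb).
  apply Rle_trans with (c / wt k ^ 4 * (d / wt (n - k) ^ 4)).
  { apply Rmult_le_compat; try apply Cmod_ge_0; auto. }
  assert (H1 := wt_mult (n - k) k). replace (n - k + k)%Z with n in H1 by lia.
  assert (HA := wt_ge1 k). assert (HB := wt_ge1 (n - k)). assert (HD := wt_ge1 n).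
  set (A := wt k) in *. set (B := wt (n - k)) in *. set (D := wt n) in *.
  replace (c / A ^ 4 * (d / B ^ 4)) with (c * d * / (A ^ 4 * B ^ 4)) by (field; lra).
  replace (c * d / D ^ 2 / A ^ 2) with (c * d * / (D ^ 2 * A ^ 2)) by (field; lra).
  apply Rmult_le_compat_l; [nra|]. apply Rinv_le_contravar.
  - apply Rmult_lt_0_compat; apply pow_lt; lra.
  - replace (A ^ 4 * B ^ 4) with ((A * B) ^ 2 * B ^ 2 * A ^ 2) by ring.
    apply Rmult_le_compat_r; [nra|].
    apply Rle_trans with ((A * B) ^ 2 * 1).
    + rewrite Rmult_1_r. apply pow_incr. lra.
    + apply Rmult_le_compat_l; [nra|]. nra.
Qed.

Lemma conv_dom a b c d n : nb a c -> nb b d -> dom (fun k => a k * b (n - k)%Z)%C (c * d / wt n ^ 2).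
Proof. intros Ha Hb k. now apply conv_term. Qed.

(** If [k] is the smaller of the two frequencies, then wt(n-k) >= wt(n)/2, and the full fourth power
    of the decay in [n] survives at the price 16 = 2^4. *)
Lemma conv_term4 a b c d n k : nb a c -> nb b d -> (Z.abs k <= Z.abs (n - k))%Z ->
  Cmod (a k * b (n - k)%Z) <= 16 * c * d / wt n ^ 4 / wt k ^ 2.
Proof.
  intros Ha Hb Hk. rewrite Cmod_mult.
  assert (Hc := nb_nonneg _ _ Ha). assert (Hd := nb_nonneg _ _ Hb).
  apply Rle_trans with (c / wt k ^ 4 * (d / wt (n - k) ^ 4)).
  { apply Rmult_le_compat; try apply Cmod_ge_0; auto. }
  assert (H1 := wt_add (n - k) k). replace (n - k + k)%Z with n in H1 by lia.
  assert (HA := wt_ge1 k). assert (HB := wt_ge1 (n - k)). assert (HD := wt_ge1 n).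
  assert (HAB : wt k <= wt (n - k)) by (unfold wt; apply IZR_le in Hk; lra).
  set (A := wt k) in *. set (B := wt (n - k)) in *. set (D := wt n) in *.
  replace (c / A ^ 4 * (d / B ^ 4)) with (c * d * / (A ^ 4 * B ^ 4)) by (field; lra).
  replace (16 * c * d / D ^ 4 / A ^ 2) with (c * d * / ((D / 2) ^ 4 * A ^ 2)) by (field; lra).
  apply Rmult_le_compat_l; [nra|]. apply Rinv_le_contravar.
  - apply Rmult_lt_0_compat; apply pow_lt; lra.
  - apply Rle_trans with (B ^ 4 * A ^ 2).
    + apply Rmult_le_compat_r; [nra|]. apply pow_incr. lra.
    + rewrite Rmult_comm. apply Rmult_le_compat_r; [apply pow_le; lra|].
      apply Rle_pow; [lra|lia].
Qed.

(** The algebra property. The sum is cut according to which of [k] and [n - k] is smaller; k -> n-k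
    turns the second half into the first with the factors exchanged. Each half costs 8 * 16, whence
    256. *)
Lemma nb_conv a b c d : nb a c -> nb b d -> nb (conv a b) (256 * (c * d)).
Proof.
  intros Ha Hb n. unfold conv.
  assert (Hc := nb_nonneg _ _ Ha). assert (Hd := nb_nonneg _ _ Hb).
  assert (Hcd : 0 <= 16 * c * d / wt n ^ 4) by (apply div_wt_nonneg; nra).
  pose (f := fun k => (a k * b (n - k)%Z)%C).
  pose (g := fun k => if Z_le_dec (Z.abs k) (Z.abs (n - k)) then f k else RtoC 0).
  pose (h := fun k => if Z_le_dec (Z.abs k) (Z.abs (n - k)) then RtoC 0 else f k).
  assert (Hg : dom g (16 * c * d / wt n ^ 4)).
  { intros k. unfold g, f. destruct (Z_le_dec _ _) as [l|l]; [now apply conv_term4|].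
    rewrite Cmod_0. now apply div_wt_nonneg. }
  assert (Hh : dom (fun k => h (n - k)%Z) (16 * c * d / wt n ^ 4)).
  { intros k. unfold h, f. destruct (Z_le_dec _ _) as [l|l].
    - rewrite Cmod_0. now apply div_wt_nonneg.
    - replace (n - (n - k))%Z with k in * by lia. rewrite Cmult_comm.
      replace (16 * c * d) with (16 * d * c) by ring. apply conv_term4; [assumption|assumption|lia]. }
  assert (Hh' := dom_rev _ _ n Hh). cbv beta in Hh'.
  assert (Hhh : dom h (16 * c * d / wt n ^ 4 * wt n ^ 2)).
  { intros k. specialize (Hh' k). cbv beta in Hh'. replace (n - (n - k))%Z with k in Hh' by lia. exact Hh'. }
  replace (CsumZ (fun k => (a k * b (n - k)%Z)%C)) with (CsumZ g + CsumZ h)%C.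
  2:{ rewrite <- (CsumZ_plus _ _ _ _ Hg Hhh). apply CsumZ_ext. intros k. unfold g, h, f.
      destruct (Z_le_dec _ _); ring. }
  replace (CsumZ h) with (CsumZ (fun k => h (n - k)%Z)).
  2:{ apply CsumZ_eq with (1 := Hh). apply isum_rev with (1 := Hhh). now apply CsumZ_isum with (1 := Hhh). }
  apply Rle_trans with (1 := Cmod_triangle _ _).
  generalize (CsumZ_bound _ _ Hg) (CsumZ_bound _ _ Hh). unfold Rdiv; lra.
Qed.

Lemma conv_add_l a a' b c c' d n : nb a c -> nb a' c' -> nb b d ->
  conv (sadd a a') b n = (conv a b n + conv a' b n)%C.
Proof.
  intros Ha Ha' Hb. unfold conv, sadd.
  rewrite <- (CsumZ_plus _ _ _ _ (conv_dom _ _ _ _ n Ha Hb) (conv_dom _ _ _ _ n Ha' Hb)).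
  apply CsumZ_ext. intros k. ring.
Qed.

Lemma conv_add_r a b b' c d d' n : nb a c -> nb b d -> nb b' d' ->
  conv a (sadd b b') n = (conv a b n + conv a b' n)%C.
Proof.
  intros Ha Hb Hb'. unfold conv, sadd.
  rewrite <- (CsumZ_plus _ _ _ _ (conv_dom _ _ _ _ n Ha Hb) (conv_dom _ _ _ _ n Ha Hb')).
  apply CsumZ_ext. intros k. ring.
Qed.

Lemma conv_sc_l r a b c d n : nb a c -> nb b d -> conv (sc r a) b n = (RtoC r * conv a b n)%C.
Proof.
  intros Ha Hb. unfold conv, sc. rewrite <- (CsumZ_scal _ _ _ (conv_dom _ _ _ _ n Ha Hb)).
  apply CsumZ_ext. intros k. ring.
Qed.

Lemma conv_sc_r r a b c d n : nb a c -> nb b d -> conv a (sc r b) n = (RtoC r * conv a b n)%C.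
Proof.
  intros Ha Hb. unfold conv, sc. rewrite <- (CsumZ_scal _ _ _ (conv_dom _ _ _ _ n Ha Hb)).
  apply CsumZ_ext. intros k. ring.
Qed.

Lemma cis_plus s t : cis (s + t) = (cis s * cis t)%C.
Proof. unfold cis. rewrite cos_plus, sin_plus. apply C_eq; simpl; ring. Qed.

Lemma cis_opp t : cis (- t) = Cconj (cis t).
Proof. unfold cis. rewrite cos_neg, sin_neg. reflexivity. Qed.

Lemma cis_0 : cis 0 = RtoC 1.
Proof. unfold cis. now rewrite cos_0, sin_0. Qed.

Lemma Cmod_cis t : Cmod (cis t) = 1.
Proof.
  unfold Cmod, cis; simpl. replace (cos t * (cos t * 1) + sin t * (sin t * 1)) with 1. apply sqrt_1.
  generalize (sin2_cos2 t). unfold Rsqr. lra.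
Qed.

Lemma cis_conj t : (cis t * Cconj (cis t) = 1)%C.
Proof. rewrite <- cis_opp, <- cis_plus. replace (t + - t) with 0 by ring. apply cis_0. Qed.

Lemma cis_pow t n : (cis t ^ n)%C = cis (INR n * t).
Proof.
  induction n. simpl. rewrite Rmult_0_l. symmetry; apply cis_0.
  rewrite S_INR. simpl Cpow. rewrite IHn, <- cis_plus. f_equal. ring.
Qed.

Lemma ev_dom a c t : nb a c -> dom (fun n => a n * cis (IZR n * t))%C c.
Proof. intros Ha n. rewrite Cmod_mult, Cmod_cis, Rmult_1_r. now apply nb_dom. Qed.

Lemma ev_bound a c t : nb a c -> Cmod (ev a t) <= 8 * c.
Proof. intros Ha. apply CsumZ_bound. now apply ev_dom. Qed.

Lemma ev_sadd a b c d t : nb a c -> nb b d -> ev (sadd a b) t = (ev a t + ev b t)%C.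
Proof.
  intros Ha Hb. unfold ev, sadd. rewrite <- (CsumZ_plus _ _ _ _ (ev_dom _ _ t Ha) (ev_dom _ _ t Hb)).
  apply CsumZ_ext. intros n. ring.
Qed.

Lemma ev_sc r a c t : nb a c -> ev (sc r a) t = (RtoC r * ev a t)%C.
Proof.
  intros Ha. unfold ev, sc. rewrite <- (CsumZ_scal _ _ _ (ev_dom _ _ t Ha)).
  apply CsumZ_ext. intros n. ring.
Qed.

Lemma ev_cj a c t : nb a c -> ev (cj a) t = Cconj (ev a t).
Proof.
  intros Ha. assert (Hd := ev_dom _ _ t Ha). unfold ev.
  apply CsumZ_eq with c. { apply (ev_dom (cj a)). now apply nb_cj. }
  assert (H := isum_rev _ _ _ 0 (dom_conj _ _ Hd) (isum_conj _ _ (CsumZ_isum _ _ Hd))).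
  cbv beta in H.
  replace (fun n => (cj a n * cis (IZR n * t))%C) with
   (fun k : Z => Cconj (a (0 - k)%Z * cis (IZR (0 - k) * t))); [exact H|].
  apply functional_extensionality; intros n. unfold cj. rewrite Cmult_conj, <- cis_opp.
  rewrite minus_IZR. replace (0 - n)%Z with (- n)%Z by lia. f_equal. f_equal. ring.
Qed.

Lemma ev_sh j a c t : nb a c -> ev (sh j a) t = (cis (IZR j * t) * ev a t)%C.
Proof.
  intros Ha. assert (Hd := ev_dom _ _ t Ha). unfold ev at 2. rewrite <- (CsumZ_scal _ _ _ Hd).
  apply CsumZ_eq with (c * wt j ^ 4). { apply (ev_dom (sh j a)). now apply nb_sh. }
  assert (Hd' := dom_scal (cis (IZR j * t)) _ _ Hd).
  assert (H := isum_shift _ _ _ (- j) Hd' (CsumZ_isum _ _ Hd')). cbv beta in H.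
  match goal with |- isum ?f _ => match type of H with isum ?g _ => replace f with g; [exact H|] end end.
  apply functional_extensionality; intros n. unfold sh.
  replace (n + - j)%Z with (n - j)%Z by lia.
  replace (IZR n * t) with (IZR j * t + IZR (n - j) * t) by (rewrite minus_IZR; ring).
  rewrite cis_plus. ring.
Qed.

(** After exchanging the sums, the inner one is the value of [b] shifted by [k], that is, [ev b t]
    times the [k]-th power of the variable. *)
Lemma ev_conv a b c d t : nb a c -> nb b d -> ev (conv a b) t = (ev a t * ev b t)%C.
Proof.
  intros Ha Hb. unfold ev at 1, conv.
  replace (CsumZ (fun n => (CsumZ (fun k => a k * b (n - k)%Z) * cis (IZR n * t))%C))
    with (CsumZ (fun n => CsumZ (fun k => (a k * b (n - k)%Z) * cis (IZR n * t))%C)).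
  2:{ apply CsumZ_ext; intros n. rewrite Cmult_comm.
      rewrite <- (CsumZ_scal _ _ _ (conv_dom _ _ _ _ n Ha Hb)). apply CsumZ_ext; intros k. ring. }
  rewrite (CsumZ_fubini _ (c * d)).
  2:{ intros n k. rewrite Cmod_mult, Cmod_cis, Rmult_1_r. now apply conv_term. }
  unfold ev at 1. rewrite Cmult_comm. rewrite <- (CsumZ_scal _ _ _ (ev_dom _ _ t Ha)).
  apply CsumZ_ext; intros k.
  transitivity (a k * ev (sh k b) t)%C.
  - unfold ev. rewrite <- (CsumZ_scal _ _ _ (ev_dom _ _ t (nb_sh k _ _ Hb))).
    apply CsumZ_ext; intros n. unfold sh. ring.
  - rewrite (ev_sh k b d t Hb). ring.
Qed.

(** * Power series on the closed disc *)

(** Negative frequencies are discarded, so the power series exists for every sequence; it extends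
    the boundary function when they vanish. *)
Definition holterm (a : seqZ) (z : C) (n : Z) : C :=
  if Z_lt_dec n 0 then RtoC 0 else (a n * z ^ (Z.to_nat n))%C.
Definition hol (a : seqZ) (z : C) : C := CsumZ (holterm a z).

Lemma Cmod_pow_le1 z n : Cmod z <= 1 -> Cmod (z ^ n) <= 1.
Proof.
  intros H. rewrite Cmod_pow. rewrite <- (pow1 n). apply pow_incr. split; [apply Cmod_ge_0|assumption].
Qed.

Lemma hol_dom a c z : nb a c -> Cmod z <= 1 -> dom (holterm a z) c.
Proof.
  intros Ha Hz n. unfold holterm. destruct (Z_lt_dec n 0).
  - rewrite Cmod_0. apply div_wt_nonneg. now apply nb_nonneg with a.
  - apply Rle_trans with (2 := nb_dom _ _ Ha n). rewrite Cmod_mult.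
    rewrite <- (Rmult_1_r (Cmod (a n))) at 2. apply Rmult_le_compat_l; [apply Cmod_ge_0|now apply Cmod_pow_le1].
Qed.

Lemma hol_bound a c z : nb a c -> Cmod z <= 1 -> Cmod (hol a z) <= 8 * c.
Proof. intros. apply CsumZ_bound. now apply hol_dom. Qed.

Lemma hol_ev (a : seqZ) t : (forall n, (n < 0)%Z -> a n = 0) -> hol a (cis t) = ev a t.
Proof.
  intros H. apply CsumZ_ext. intros n. unfold holterm. destruct (Z_lt_dec n 0).
  - rewrite H by assumption. ring.
  - rewrite cis_pow, INR_IZR_INZ, Z2Nat.id by lia. reflexivity.
Qed.

Lemma hol_sadd a b c d z : nb a c -> nb b d -> Cmod z <= 1 -> hol (sadd a b) z = (hol a z + hol b z)%C.
Proof.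
  intros Ha Hb Hz. unfold hol.
  rewrite <- (CsumZ_plus _ _ _ _ (hol_dom _ _ _ Ha Hz) (hol_dom _ _ _ Hb Hz)).
  apply CsumZ_ext; intros n. unfold holterm, sadd. destruct (Z_lt_dec n 0); ring.
Qed.

Lemma hol_sc r a c z : nb a c -> Cmod z <= 1 -> hol (sc r a) z = (RtoC r * hol a z)%C.
Proof.
  intros Ha Hz. unfold hol. rewrite <- (CsumZ_scal _ _ _ (hol_dom _ _ _ Ha Hz)).
  apply CsumZ_ext; intros n. unfold holterm, sc. destruct (Z_lt_dec n 0); ring.
Qed.

Lemma Cpow_lip z w n : Cmod z <= 1 -> Cmod w <= 1 -> Cmod (z ^ n - w ^ n) <= INR n * Cmod (z - w).
Proof.
  intros Hz Hw. induction n.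
  - simpl. replace (1 - 1)%C with (RtoC 0) by ring. rewrite Cmod_0. lra.
  - rewrite S_INR. simpl Cpow.
    replace (z * z ^ n - w * w ^ n)%C with (z * (z ^ n - w ^ n) + (z - w) * w ^ n)%C by ring.
    apply Rle_trans with (1 := Cmod_triangle _ _). rewrite !Cmod_mult.
    assert (H := Cmod_pow_le1 w n Hw). assert (h1 := Cmod_ge_0 (z ^ n - w ^ n)).
    assert (h2 := Cmod_ge_0 (z - w)). assert (h3 := Cmod_ge_0 z). assert (h4 := Cmod_ge_0 (w ^ n)). nra.
Qed.

Lemma hol_lip a c z w : nb a c -> Cmod z <= 1 -> Cmod w <= 1 ->
  Cmod (hol a z - hol a w) <= 8 * c * Cmod (z - w).
Proof.
  intros Ha Hz Hw. assert (Hc := nb_nonneg _ _ Ha).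
  assert (Hw' := dom_scal (RtoC (-1)) _ _ (hol_dom _ _ _ Ha Hw)).
  replace (hol a z - hol a w)%C with (CsumZ (fun n => holterm a z n + RtoC (-1) * holterm a w n)%C).
  2:{ rewrite (CsumZ_plus _ _ _ _ (hol_dom _ _ _ Ha Hz) Hw').
      rewrite (CsumZ_scal _ _ _ (hol_dom _ _ _ Ha Hw)). unfold hol.
      replace (RtoC (-1)) with (- RtoC 1)%C by (apply C_eq; simpl; ring). ring. }
  replace (8 * c * Cmod (z - w)) with (8 * (c * Cmod (z - w))) by ring.
  apply CsumZ_bound. intros n. unfold holterm. destruct (Z_lt_dec n 0) as [l|l].
  - replace (0 + RtoC (-1) * 0)%C with (RtoC 0) by ring. rewrite Cmod_0.
    apply div_wt_nonneg. generalize (Cmod_ge_0 (z - w)); nra.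
  - replace (a n * z ^ Z.to_nat n + RtoC (-1) * (a n * w ^ Z.to_nat n))%C with
      (a n * (z ^ Z.to_nat n - w ^ Z.to_nat n))%C.
    2:{ replace (RtoC (-1)) with (- RtoC 1)%C by (apply C_eq; simpl; ring). ring. }
    rewrite Cmod_mult. assert (H1 := Cpow_lip z w (Z.to_nat n) Hz Hw).
    assert (Hn : INR (Z.to_nat n) = wt n - 1).
    { unfold wt. rewrite Z.abs_eq by lia. rewrite INR_IZR_INZ, Z2Nat.id by lia. ring. }
    rewrite Hn in H1. assert (H2 := Ha n). assert (HW := wt_ge1 n).
    apply Rle_trans with (c / wt n ^ 4 * ((wt n - 1) * Cmod (z - w))).
    { apply Rmult_le_compat; auto; apply Cmod_ge_0. }
    replace (c * Cmod (z - w) / wt n ^ 2) with (c / wt n ^ 4 * (wt n ^ 2 * Cmod (z - w))) by (field; lra).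
    apply Rmult_le_compat_l; [now apply div_wt_nonneg|].
    apply Rmult_le_compat_r; [apply Cmod_ge_0|]. nra.
Qed.

Lemma Cpow_taylor z h n : Cmod z <= 1 -> Cmod (z + h) <= 1 ->
  Cmod ((z + h) ^ n - z ^ n - RtoC (INR n) * z ^ (Nat.pred n) * h) <= INR n ^ 2 * Cmod h ^ 2.
Proof.
  intros Hz Hh. induction n as [|n IH].
  - simpl Cpow. replace (1 - 1 - RtoC (INR 0) * 1 * h)%C with (RtoC 0) by (simpl; ring). rewrite Cmod_0.
    simpl; lra.
  - replace ((z + h) ^ S n - z ^ S n - RtoC (INR (S n)) * z ^ Nat.pred (S n) * h)%C with
     ((z + h) * ((z + h) ^ n - z ^ n - RtoC (INR n) * z ^ (Nat.pred n) * h)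
        + RtoC (INR n) * z ^ (Nat.pred n) * (h * h))%C.
    2:{ rewrite S_INR, RtoC_plus. destruct n.
        - simpl. ring.
        - change (Nat.pred (S n)) with n. change (Nat.pred (S (S n))) with (S n). simpl Cpow. ring. }
    apply Rle_trans with (1 := Cmod_triangle _ _). rewrite !Cmod_mult, Cmod_RtoC_nonneg by apply pos_INR.
    rewrite S_INR. assert (H := Cmod_pow_le1 z (Nat.pred n) Hz).
    match type of IH with ?X <= _ => set (x := X) in * end.
    assert (h1 : 0 <= x) by apply Cmod_ge_0.
    assert (h2 := Cmod_ge_0 h). assert (h3 := pos_INR n). assert (h4 := Cmod_ge_0 (z ^ Nat.pred n)).
    assert (h5 := Cmod_ge_0 (z + h)).
    apply Rle_trans with (1 * (INR n ^ 2 * Cmod h ^ 2) + INR n * 1 * (Cmod h * Cmod h)).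
    + apply Rplus_le_compat. apply Rmult_le_compat; auto.
      apply Rmult_le_compat_r; [nra|]. apply Rmult_le_compat_l; auto.
    + nra.
Qed.

(** The derivative is the termwise one, [D]. Its error at [h] is at most 8c|h|^2; the first bound on
    |h| keeps z + h in the disc, the second turns 8c|h| into [eps]. *)
Lemma hol_cdiff a c z : nb a c -> Cmod z < 1 -> cdiff_at (hol a) z.
Proof.
  intros Ha Hz. assert (Hc := nb_nonneg _ _ Ha).
  pose (D := fun n : Z => if Z_lt_dec n 0 then RtoC 0 else (a n * (RtoC (INR (Z.to_nat n)) * z ^ (Nat.pred (Z.to_nat n))))%C).
  assert (Hn : forall n, (0 <= n)%Z -> INR (Z.to_nat n) = wt n - 1).
  { intros n hn. unfold wt. rewrite Z.abs_eq by lia. rewrite INR_IZR_INZ, Z2Nat.id by lia. ring. }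
  assert (HD : dom D c).
  { intros n. unfold D. destruct (Z_lt_dec n 0). rewrite Cmod_0; now apply div_wt_nonneg.
    rewrite !Cmod_mult, Cmod_RtoC_nonneg by apply pos_INR. rewrite Hn by lia.
    assert (H := Cmod_pow_le1 z (Nat.pred (Z.to_nat n)) (Rlt_le _ _ Hz)).
    assert (H2 := Ha n). assert (HW := wt_ge1 n). assert (h4 := Cmod_ge_0 (z ^ Nat.pred (Z.to_nat n))).
    apply Rle_trans with (c / wt n ^ 4 * ((wt n - 1) * 1)).
    { apply Rmult_le_compat; auto; try apply Cmod_ge_0. nra. nra. }
    replace (c / wt n ^ 2) with (c / wt n ^ 4 * (wt n ^ 2)) by (field; lra).
    apply Rmult_le_compat_l; [now apply div_wt_nonneg|]. nra. }
  exists (CsumZ D). intros eps Heps.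
  exists (Rmin (1 - Cmod z) (eps / (8 * c + 1))). split.
  { apply Rmin_pos; [lra|]. apply Rdiv_lt_0_compat; lra. }
  intros h [h0 h1].
  assert (ha := Rmin_l (1 - Cmod z) (eps / (8 * c + 1))).
  assert (hb := Rmin_r (1 - Cmod z) (eps / (8 * c + 1))).
  assert (Hzh : Cmod (z + h) <= 1) by (generalize (Cmod_triangle z h); lra).
  assert (Hz' : Cmod z <= 1) by lra.
  replace (hol a (z + h) - hol a z - CsumZ D * h)%C with
    (CsumZ (fun n => (holterm a (z + h) n + RtoC (-1) * holterm a z n) + (- h) * D n)%C).
  2:{ rewrite (CsumZ_plus _ _ _ _ (dom_plus _ _ _ _ (hol_dom _ _ _ Ha Hzh) (dom_scal (RtoC (-1)) _ _ (hol_dom _ _ _ Ha Hz'))) (dom_scal (-h)%C _ _ HD)).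
      rewrite (CsumZ_plus _ _ _ _ (hol_dom _ _ _ Ha Hzh) (dom_scal (RtoC (-1)) _ _ (hol_dom _ _ _ Ha Hz'))).
      rewrite (CsumZ_scal _ _ _ (hol_dom _ _ _ Ha Hz')), (CsumZ_scal _ _ _ HD). unfold hol.
      replace (RtoC (-1)) with (- RtoC 1)%C by (apply C_eq; simpl; ring). ring. }
  apply Rle_trans with (8 * (c * Cmod h ^ 2)).
  - apply CsumZ_bound. intros n. unfold holterm, D. destruct (Z_lt_dec n 0) as [l|l].
    + replace (0 + RtoC (-1) * 0 + - h * 0)%C with (RtoC 0) by ring. rewrite Cmod_0.
      apply div_wt_nonneg. nra.
    + set (m := Z.to_nat n).
      match goal with |- Cmod ?x <= _ => replace x with
       (a n * ((z + h) ^ m - z ^ m - RtoC (INR m) * z ^ (Nat.pred m) * h))%C end.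
      2:{ replace (RtoC (-1)) with (- RtoC 1)%C by (apply C_eq; simpl; ring). ring. }
      rewrite Cmod_mult. assert (H1 := Cpow_taylor z h m Hz' Hzh).
      unfold m in *. rewrite Hn in * by lia. assert (H2 := Ha n). assert (HW := wt_ge1 n).
      apply Rle_trans with (c / wt n ^ 4 * ((wt n - 1) ^ 2 * Cmod h ^ 2)).
      { apply Rmult_le_compat; auto; apply Cmod_ge_0. }
      replace (c * Cmod h ^ 2 / wt n ^ 2) with (c / wt n ^ 4 * (wt n ^ 2 * Cmod h ^ 2)) by (field; lra).
      apply Rmult_le_compat_l; [now apply div_wt_nonneg|].
      apply Rmult_le_compat_r; [nra|]. nra.
  - replace (8 * (c * Cmod h ^ 2)) with ((8 * c * Cmod h) * Cmod h) by ring.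
    apply Rmult_le_compat_r; [lra|].
    apply Rle_trans with (8 * c * (eps / (8 * c + 1))).
    + apply Rmult_le_compat_l; lra.
    + apply Rle_trans with ((8 * c + 1) * (eps / (8 * c + 1))).
      * apply Rmult_le_compat_r; [|lra]. left. apply Rdiv_lt_0_compat; lra.
      * right. field. lra.
Qed.

(* The components are the Fourier coefficients on the circle of [p, w, d, u, v], where the lift is
   [z = ze (1 + p)], [w], [zt = 1 + u], [wt = v] and the real multiplier is [1 / (1 + d)], and of
   [r_k = (1 + conj p) ^ k w - w] for [k = 1, 2, 3], which make the whole system quadratic. *)
Inductive cmp := Ip | Iw | Id | Iu | Iv | I1 | I2 | I3.

(** * The Banach space of coefficient families *)

Definition nbE (Y : cmp -> seqZ) (c : R) : Prop := forall i, nb (Y i) c.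

(** The bound is carried as a mere existence statement, so by proof irrelevance equality of elements
    is equality of coefficients. *)
Record E := mkE { crd :> cmp -> seqZ; crd_ok : exists c, nbE crd c }.

Lemma E_ext (Y Z : E) : (forall i n, Y i n = Z i n) -> Y = Z.
Proof.
  destruct Y as [y hy], Z as [z hz]; simpl. intros H.
  assert (e : y = z) by (apply functional_extensionality; intros i; apply functional_extensionality; intros n; apply H).
  subst z. f_equal. apply proof_irrelevance.
Qed.

Definition nset (Y : cmp -> seqZ) (r : R) : Prop := exists i n, r = Cmod (Y i n) * wt n ^ 4.
(** The weighted supremum norm over all components and frequencies. The least upper bound is finite
    thanks to the bound carried by the element. *)
Definition nrm (Y : E) : R := real (Lub_Rbar (nset Y)).

Lemma nb_equiv (a : seqZ) c n : Cmod (a n) <= c / wt n ^ 4 <-> Cmod (a n) * wt n ^ 4 <= c.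
Proof.
  assert (H := wt_pow_pos n 4). split; intros h.
  - apply (Rmult_le_compat_r (wt n ^ 4)) in h; [|lra].
    replace (c / wt n ^ 4 * wt n ^ 4) with c in h by (field; generalize (wt_ge1 n); lra). exact h.
  - apply (Rmult_le_reg_r (wt n ^ 4)); [lra|].
    replace (c / wt n ^ 4 * wt n ^ 4) with c by (field; generalize (wt_ge1 n); lra). exact h.
Qed.

Lemma norm_lub (Y : E) : is_lub_Rbar (nset Y) (nrm Y).
Proof.
  unfold nrm. assert (H := Lub_Rbar_correct (nset Y)).
  destruct (Lub_Rbar (nset Y)) as [l| |]; [exact H| |].
  - exfalso. destruct (crd_ok Y) as [c Hc]. destruct H as [_ H].
    apply (H (Finite c)). intros r [i [n ->]]. simpl. apply nb_equiv, Hc.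
  - exfalso. destruct H as [H _]. apply (H (Cmod (Y Ip 0%Z) * wt 0 ^ 4)). now exists Ip, 0%Z.
Qed.

Lemma nb_norm (Y : E) i : nb (Y i) (nrm Y).
Proof.
  intros n. apply nb_equiv. destruct (norm_lub Y) as [H _]. apply (H (Cmod (Y i n) * wt n ^ 4)). now exists i, n.
Qed.

Lemma norm_le (Y : E) c : nbE Y c -> nrm Y <= c.
Proof.
  intros Hc. destruct (norm_lub Y) as [_ H]. apply (H (Finite c)).
  intros r [i [n ->]]. simpl. apply nb_equiv, Hc.
Qed.

Lemma norm_ge0 (Y : E) : 0 <= nrm Y.
Proof. apply nb_nonneg with (Y Ip). apply nb_norm. Qed.

Lemma zero_ok : exists c, nbE (fun _ _ => RtoC 0) c.
Proof. exists 0. intros i n. rewrite Cmod_0. apply div_wt_nonneg; lra. Qed.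
Definition E0 : E := mkE _ zero_ok.

Lemma add_ok (Y Z : E) : exists c, nbE (fun i => sadd (Y i) (Z i)) c.
Proof. exists (nrm Y + nrm Z). intros i. apply nb_sadd; apply nb_norm. Qed.
Definition Eadd (Y Z : E) : E := mkE _ (add_ok Y Z).

Lemma sc_ok r (Y : E) : exists c, nbE (fun i => sc r (Y i)) c.
Proof. exists (Rabs r * nrm Y). intros i. apply nb_sc; apply nb_norm. Qed.
Definition Esc r (Y : E) : E := mkE _ (sc_ok r Y).

Definition Esub (Y Z : E) : E := Eadd Y (Esc (-1) Z).

Lemma norm_add Y Z : nrm (Eadd Y Z) <= nrm Y + nrm Z.
Proof. apply norm_le. intros i. apply nb_sadd; apply nb_norm. Qed.

Lemma norm_sc r Y : nrm (Esc r Y) <= Rabs r * nrm Y.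
Proof. apply norm_le. intros i. apply nb_sc; apply nb_norm. Qed.

Lemma norm_0 : nrm E0 = 0.
Proof.
  apply Rle_antisym; [|apply norm_ge0]. apply norm_le. intros i n. cbn [crd E0]. rewrite Cmod_0. apply div_wt_nonneg; lra.
Qed.

Lemma norm_eq0 Y : nrm Y <= 0 -> Y = E0.
Proof.
  intros H. apply E_ext. intros i n. cbn [crd E0]. apply Cmod_eq_0. apply Rle_antisym; [|apply Cmod_ge_0].
  apply Rle_trans with (1 := nb_norm Y i n).
  apply Rle_trans with (nrm Y). apply div_wt_le. apply norm_ge0. exact H.
Qed.

Ltac Eext := apply E_ext; let i := fresh "i" in let n := fresh "n" in intros i n; simpl; unfold sadd, sc;
  try replace (RtoC (-1)) with (- RtoC 1)%C by (apply C_eq; simpl; ring).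

Lemma norm_sub_sym Y Z : nrm (Esub Y Z) = nrm (Esub Z Y).
Proof.
  assert (H : forall A B, nrm (Esub A B) <= nrm (Esub B A)).
  { intros A B. replace (Esub A B) with (Esc (-1) (Esub B A)) by (Eext; ring).
    apply Rle_trans with (1 := norm_sc _ _).
    replace (Rabs (-1)) with 1 by (rewrite Rabs_left1; lra). lra. }
  apply Rle_antisym; apply H.
Qed.

Lemma norm_sub_tri X Y Z : nrm (Esub X Z) <= nrm (Esub X Y) + nrm (Esub Y Z).
Proof. replace (Esub X Z) with (Eadd (Esub X Y) (Esub Y Z)) by (Eext; ring). apply norm_add. Qed.

Lemma norm_le_sub Y Z : nrm Y <= nrm Z + nrm (Esub Y Z).
Proof. replace Y with (Eadd Z (Esub Y Z)) at 1 by (Eext; ring). apply norm_add. Qed.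

Lemma Esub_eq0 Y Z : nrm (Esub Y Z) <= 0 -> Y = Z.
Proof.
  intros H. apply norm_eq0 in H. replace Y with (Eadd (Esub Y Z) Z) by (Eext; ring). rewrite H. Eext. ring.
Qed.

(** The limit is taken coefficientwise, separately in real and imaginary parts, which doubles the
    constant; the uniform rate then passes to the norm. *)
Lemma E_complete (u : nat -> E) (K : R) :
  (forall N M, (N <= M)%nat -> nrm (Esub (u M) (u N)) <= K / (INR N + 1)) ->
  exists l, forall N, nrm (Esub l (u N)) <= 2 * K / (INR N + 1).
Proof.
  intros H.
  assert (HK : 0 <= K).
  { generalize (H 0%nat 0%nat (le_n _)) (norm_ge0 (Esub (u 0%nat) (u 0%nat))). simpl.
    replace (K / (0 + 1)) with K by field. lra. }
  pose (l := fun i n => (real (Lim_seq (fun N => Re (u N i n))), real (Lim_seq (fun N => Im (u N i n)))) : C).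
  assert (Hl : forall N i, nb (fun n => l i n - u N i n)%C (2 * K / (INR N + 1))).
  { intros N i n.
    assert (Hd : forall N M, (N <= M)%nat -> Cmod (u M i n - u N i n) <= K / wt n ^ 4 / (INR N + 1)).
    { intros N' M HNM. assert (h := nb_norm (Esub (u M) (u N')) i n). simpl in h. unfold sadd, sc in h.
      replace (u M i n - u N' i n)%C with (u M i n + RtoC (-1) * u N' i n)%C.
      2:{ replace (RtoC (-1)) with (- RtoC 1)%C by (apply C_eq; simpl; ring). ring. }
      apply Rle_trans with (1 := h).
      replace (K / wt n ^ 4 / (INR N' + 1)) with (K / (INR N' + 1) / wt n ^ 4) by (unfold Rdiv; ring).
      apply (div_wt_mono _ _ n 4). now apply H. }
    replace (2 * K / (INR N + 1) / wt n ^ 4) with (2 * (K / wt n ^ 4 / (INR N + 1))) by (unfold Rdiv; ring).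
    assert (HK' : 0 <= K / wt n ^ 4) by now apply div_wt_nonneg.
    apply Cmod_le_2.
    - apply (lim_dom (fun N => Re (u N i n))); [assumption|]. intros N' M HNM.
      apply Rle_trans with (2 := Hd N' M HNM). apply (re_le_Cmod (u M i n - u N' i n)).
    - apply (lim_dom (fun N => Im (u N i n))); [assumption|]. intros N' M HNM.
      apply Rle_trans with (2 := Hd N' M HNM). apply (im_le_Cmod (u M i n - u N' i n)). }
  assert (Hok : exists c, nbE l c).
  { exists (2 * K / (INR 0 + 1) + nrm (u 0%nat)). intros i n.
    replace (l i n) with (sadd (fun n => l i n - u 0%nat i n)%C (u 0%nat i) n) by (unfold sadd; ring).
    apply nb_sadd; [apply Hl|apply nb_norm]. }
  exists (mkE l Hok). intros N. apply norm_le. intros i n.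
  assert (h := Hl N i n). simpl. unfold sadd, sc.
  replace (l i n + RtoC (-1) * u N i n)%C with (l i n - u N i n)%C; [exact h|].
  replace (RtoC (-1)) with (- RtoC 1)%C by (apply C_eq; simpl; ring). ring.
Qed.

(** * Bounded real-linear and real-bilinear operators *)

Definition BddLin (L : seqZ -> seqZ) : Prop :=
  (exists K, 0 <= K /\ forall a c, nb a c -> nb (L a) (K * c)) /\
  (forall a b n, L (sadd a b) n = (L a n + L b n)%C) /\
  (forall r a n, L (sc r a) n = (RtoC r * L a n)%C).

Definition BddLinE (l : E -> seqZ) : Prop :=
  (exists K, 0 <= K /\ forall Y, nb (l Y) (K * nrm Y)) /\
  (forall Y Z, l (Eadd Y Z) = sadd (l Y) (l Z)) /\
  (forall r Y, l (Esc r Y) = sc r (l Y)).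

Definition BddBil (T : E -> E -> seqZ) : Prop :=
  (exists K, 0 <= K /\ forall Y Z, nb (T Y Z) (K * (nrm Y * nrm Z))) /\
  (forall Y Y' Z, T (Eadd Y Y') Z = sadd (T Y Z) (T Y' Z)) /\
  (forall Y Z Z', T Y (Eadd Z Z') = sadd (T Y Z) (T Y Z')) /\
  (forall r Y Z, T (Esc r Y) Z = sc r (T Y Z)) /\
  (forall r Y Z, T Y (Esc r Z) = sc r (T Y Z)).

Lemma BddLin_sc r : BddLin (sc r).
Proof.
  split; [|split].
  - exists (Rabs r). split; [apply Rabs_pos|]. intros. now apply nb_sc.
  - intros. unfold sc, sadd. ring.
  - intros. unfold sc. ring.
Qed.

Lemma BddLin_cj : BddLin cj.
Proof.
  split; [|split].
  - exists 1. split; [lra|]. intros. rewrite Rmult_1_l. now apply nb_cj.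
  - intros. unfold cj, sadd. apply Cplus_conj.
  - intros. unfold cj, sc. rewrite Cmult_conj. f_equal. apply C_eq; simpl; ring.
Qed.

Lemma BddLin_sh j : BddLin (sh j).
Proof.
  split; [|split].
  - exists (wt j ^ 4). split; [left; apply wt_pow_pos|]. intros. rewrite Rmult_comm. now apply nb_sh.
  - intros. reflexivity.
  - intros. reflexivity.
Qed.

Lemma BddLin_msk m : BddLin (msk m).
Proof.
  split; [|split].
  - exists 1. split; [lra|]. intros. rewrite Rmult_1_l. now apply nb_msk.
  - intros. unfold msk, sadd. destruct (m n); ring.
  - intros. unfold msk, sc. destruct (m n); ring.
Qed.

Lemma BddLin_comp L M : BddLin L -> BddLin M -> BddLin (fun a => L (M a)).
Proof.
  intros [[K [HK H1]] [H2 H3]] [[K' [HK' H1']] [H2' H3']]. split; [|split].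
  - exists (K * K'). split; [nra|]. intros a c Ha. rewrite Rmult_assoc. auto.
  - intros. rewrite <- H2. replace (M (sadd a b)) with (sadd (M a) (M b)); [reflexivity|].
    apply functional_extensionality; intros. symmetry. apply H2'.
  - intros. rewrite <- H3. replace (M (sc r a)) with (sc r (M a)); [reflexivity|].
    apply functional_extensionality; intros. symmetry. apply H3'.
Qed.

Lemma BddLin_sadd L M : BddLin L -> BddLin M -> BddLin (fun a => sadd (L a) (M a)).
Proof.
  intros [[K [HK H1]] [H2 H3]] [[K' [HK' H1']] [H2' H3']]. split; [|split].
  - exists (K + K'). split; [lra|]. intros a c Ha. rewrite Rmult_plus_distr_r. apply nb_sadd; auto.
  - intros. unfold sadd at 1. rewrite H2, H2'. unfold sadd. ring.
  - intros. unfold sadd at 1. rewrite H3, H3'. unfold sadd. ring.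
Qed.

Lemma BddLinE_crd i : BddLinE (fun Y => Y i).
Proof.
  split; [|split; reflexivity]. exists 1. split; [lra|]. intros. rewrite Rmult_1_l. apply nb_norm.
Qed.

Lemma BddLinE_comp L l : BddLin L -> BddLinE l -> BddLinE (fun Y => L (l Y)).
Proof.
  intros [[K [HK H1]] [H2 H3]] [[K' [HK' H1']] [H2' H3']]. split; [|split].
  - exists (K * K'). split; [nra|]. intros Y. rewrite Rmult_assoc. auto.
  - intros. rewrite H2'. apply functional_extensionality; intros. apply H2.
  - intros. rewrite H3'. apply functional_extensionality; intros. apply H3.
Qed.

Lemma BddLinE_sadd l m : BddLinE l -> BddLinE m -> BddLinE (fun Y => sadd (l Y) (m Y)).
Proof.
  intros [[K [HK H1]] [H2 H3]] [[K' [HK' H1']] [H2' H3']]. split; [|split].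
  - exists (K + K'). split; [lra|]. intros Y. rewrite Rmult_plus_distr_r. apply nb_sadd; auto.
  - intros. rewrite H2, H2'. apply functional_extensionality; intros. unfold sadd. ring.
  - intros. rewrite H3, H3'. apply functional_extensionality; intros. unfold sadd, sc. ring.
Qed.

Lemma BddBil_conv l m : BddLinE l -> BddLinE m -> BddBil (fun Y Z => conv (l Y) (m Z)).
Proof.
  intros [[K [HK H1]] [H2 H3]] [[K' [HK' H1']] [H2' H3']]. split; [|repeat split].
  - exists (256 * (K * K')). split; [nra|]. intros Y Z.
    replace (256 * (K * K') * (nrm Y * nrm Z)) with (256 * ((K * nrm Y) * (K' * nrm Z))) by ring.
    apply nb_conv; auto.
  - intros. rewrite H2. apply functional_extensionality; intros n. unfold sadd at 2. eapply conv_add_l; eauto.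
  - intros. rewrite H2'. apply functional_extensionality; intros n. unfold sadd at 2. eapply conv_add_r; eauto.
  - intros. rewrite H3. apply functional_extensionality; intros n. unfold sc at 2. eapply conv_sc_l; eauto.
  - intros. rewrite H3'. apply functional_extensionality; intros n. unfold sc at 2. eapply conv_sc_r; eauto.
Qed.

Lemma BddBil_comp L T : BddLin L -> BddBil T -> BddBil (fun Y Z => L (T Y Z)).
Proof.
  intros [[K [HK H1]] [H2 H3]] [[K' [HK' H1']] [A1 [A2 [A3 A4]]]]. split; [|repeat split].
  - exists (K * K'). split; [nra|]. intros. rewrite Rmult_assoc. auto.
  - intros. rewrite A1. apply functional_extensionality; intros. apply H2.
  - intros. rewrite A2. apply functional_extensionality; intros. apply H2.
  - intros. rewrite A3. apply functional_extensionality; intros. apply H3.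
  - intros. rewrite A4. apply functional_extensionality; intros. apply H3.
Qed.

Lemma BddBil_sadd T S : BddBil T -> BddBil S -> BddBil (fun Y Z => sadd (T Y Z) (S Y Z)).
Proof.
  intros [[K [HK H1]] [B1 [B2 [B3 B4]]]] [[K' [HK' H1']] [A1 [A2 [A3 A4]]]]. split; [|repeat split].
  - exists (K + K'). split; [lra|]. intros. rewrite Rmult_plus_distr_r. apply nb_sadd; auto.
  - intros. rewrite A1, B1. apply functional_extensionality; intros. unfold sadd. ring.
  - intros. rewrite A2, B2. apply functional_extensionality; intros. unfold sadd. ring.
  - intros. rewrite A3, B3. apply functional_extensionality; intros. unfold sadd, sc. ring.
  - intros. rewrite A4, B4. apply functional_extensionality; intros. unfold sadd, sc. ring.
Qed.

(** * Contractions *)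

(** Converts the geometric rate of a contraction into the rate 1/(n+1) used by [E_complete]. *)
Lemma half_pow_le n : (/2) ^ n <= / (INR n + 1).
Proof.
  assert (H : INR n + 1 <= 2 ^ n).
  { induction n. simpl; lra. rewrite S_INR. simpl. generalize (pos_INR n); lra. }
  rewrite pow_inv. apply Rinv_le_contravar; [generalize (pos_INR n); lra|exact H].
Qed.

Lemma E_fixpoint (T : E -> E) (rad : R) : 0 <= rad ->
  (forall Y, nrm Y <= rad -> nrm (T Y) <= rad) ->
  (forall Y Z, nrm Y <= rad -> nrm Z <= rad -> nrm (Esub (T Y) (T Z)) <= / 2 * nrm (Esub Y Z)) ->
  exists Y, nrm Y <= rad /\ T Y = Y.
Proof.
  intros Hrad Hmap Hlip.
  pose (u := fix u (n : nat) := match n with O => E0 | S k => T (u k) end).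
  assert (Hu : forall n, nrm (u n) <= rad).
  { induction n; simpl. rewrite norm_0; lra. auto. }
  assert (Hs : forall n, nrm (Esub (u (S n)) (u n)) <= rad * (/2) ^ n).
  { induction n.
    - simpl. apply Rle_trans with (nrm (T E0)).
      + replace (Esub (T E0) E0) with (T E0) by (Eext; ring). lra.
      + rewrite Rmult_1_r. apply Hmap. rewrite norm_0; lra.
    - change (u (S (S n))) with (T (u (S n))). change (u (S n)) with (T (u n)) at 2.
      apply Rle_trans with (1 := Hlip _ _ (Hu (S n)) (Hu n)). simpl pow. lra. }
  assert (Hc : forall N M, (N <= M)%nat -> nrm (Esub (u M) (u N)) <= 2 * rad / (INR N + 1)).
  { intros N M HNM.
    assert (G : forall j, nrm (Esub (u (N + j)%nat) (u N)) <= 2 * rad * ((/2) ^ N - (/2)^(N + j))).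
    { induction j.
      - rewrite Nat.add_0_r. replace (Esub (u N) (u N)) with E0 by (Eext; ring). rewrite norm_0. lra.
      - rewrite Nat.add_succ_r. apply Rle_trans with (1 := norm_sub_tri _ (u (N + j)%nat) _).
        generalize (Hs (N + j)%nat). simpl pow. lra. }
    replace M with (N + (M - N))%nat by lia. apply Rle_trans with (1 := G _).
    assert (h := half_pow_le N).
    assert (0 <= (/2) ^ (N + (M - N))) by (apply pow_le; lra).
    unfold Rdiv. apply Rmult_le_compat_l; lra. }
  destruct (E_complete u (2 * rad) Hc) as [l Hl].
  assert (Hlr : nrm l <= rad).
  { apply Rminus_le. apply Rle_eps_mult with (2 * (2 * rad)). intros n.
    generalize (norm_le_sub l (u n)) (Hl n) (Hu n). lra. }
  exists l. split; [exact Hlr|]. apply Esub_eq0.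
  apply Rle_eps_mult with (2 * (2 * (2 * rad))). intros n.
  apply Rle_trans with (1 := norm_sub_tri _ (u (S n)) _).
  assert (h1 := Hlip _ _ Hlr (Hu n)). change (T (u n)) with (u (S n)) in h1.
  rewrite (norm_sub_sym (u (S n))). assert (h2 := Hl n). assert (h3 := Hl (S n)). rewrite S_INR in h3.
  assert (h4 := pos_INR n).
  assert (2 * (2 * rad) / (INR n + 1 + 1) <= 2 * (2 * rad) / (INR n + 1)).
  { apply Rmult_le_compat_l; [lra|]. apply Rinv_le_contravar; lra. }
  assert (h5 := norm_ge0 (Esub l (u n))).
  replace (2 * (2 * (2 * rad)) / (INR n + 1)) with (2 * (2 * rad) / (INR n + 1) + 2 * (2 * rad) / (INR n + 1)) by (field; lra).
  lra.
Qed.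

(** * Quadratic equations *)

Record Ebil (B : E -> E -> E) (K : R) : Prop := {
  bil_K : 0 <= K;
  bil_bound : forall Y Z, nrm (B Y Z) <= K * (nrm Y * nrm Z);
  bil_add_l : forall Y Y' Z, B (Eadd Y Y') Z = Eadd (B Y Z) (B Y' Z);
  bil_add_r : forall Y Z Z', B Y (Eadd Z Z') = Eadd (B Y Z) (B Y Z');
  bil_sc_l : forall r Y Z, B (Esc r Y) Z = Esc r (B Y Z);
  bil_sc_r : forall r Y Z, B Y (Esc r Z) = Esc r (B Y Z)
}.

(** Limits along an arbitrary family of sets: one notion covers continuity in the parameter and
    difference quotients in one variable, with the same rules for sums and for [B]. *)
Definition Elim {T : Type} (F : (T -> Prop) -> Prop) (g : T -> E) (l : E) : Prop :=
  forall eps, 0 < eps -> F (fun t => nrm (Esub (g t) l) <= eps).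

Lemma Elim_const {T} (F : (T -> Prop) -> Prop) {HF : Filter F} e : Elim F (fun _ => e) e.
Proof.
  intros eps He. apply filter_forall. intros _. replace (Esub e e) with E0 by (Eext; ring). rewrite norm_0; lra.
Qed.

Lemma Elim_ext {T} (F : (T -> Prop) -> Prop) {HF : Filter F} g h l :
  F (fun t => g t = h t) -> Elim F g l -> Elim F h l.
Proof.
  intros He Hg eps Heps. apply filter_imp with (2 := filter_and _ _ He (Hg eps Heps)).
  intros t [-> H]; exact H.
Qed.

Lemma Elim_add {T} (F : (T -> Prop) -> Prop) {HF : Filter F} g h l m :
  Elim F g l -> Elim F h m -> Elim F (fun t => Eadd (g t) (h t)) (Eadd l m).
Proof.
  intros Hg Hh eps Heps.
  assert (He2 : 0 < eps / 2) by lra.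
  apply filter_imp with (2 := filter_and _ _ (Hg _ He2) (Hh _ He2)). intros t [H1 H2].
  replace (Esub (Eadd (g t) (h t)) (Eadd l m)) with (Eadd (Esub (g t) l) (Esub (h t) m)) by (Eext; ring).
  apply Rle_trans with (1 := norm_add _ _). lra.
Qed.

Lemma Elim_dom {T} (F : (T -> Prop) -> Prop) {HF : Filter F} g h l c :
  0 <= c -> F (fun t => nrm (Esub (g t) l) <= c * nrm (h t)) -> Elim F h E0 -> Elim F g l.
Proof.
  intros Hc He Hh eps Heps.
  assert (He2 : 0 < eps / (c + 1)) by (apply Rdiv_lt_0_compat; lra).
  apply filter_imp with (2 := filter_and _ _ He (Hh _ He2)). intros t [H1 H2].
  apply Rle_trans with (1 := H1).
  replace (Esub (h t) E0) with (h t) in H2 by (Eext; ring).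
  apply Rle_trans with (c * (eps / (c + 1))); [now apply Rmult_le_compat_l|].
  apply Rle_trans with ((c + 1) * (eps / (c + 1))); [apply Rmult_le_compat_r; lra|].
  right; field; lra.
Qed.

Lemma Elim_sub0 {T} (F : (T -> Prop) -> Prop) {HF : Filter F} g l :
  Elim F g l -> Elim F (fun t => Esub (g t) l) E0.
Proof.
  intros Hg eps Heps. apply filter_imp with (2 := Hg eps Heps). intros t H.
  replace (Esub (Esub (g t) l) E0) with (Esub (g t) l) by (Eext; ring). exact H.
Qed.

Section Quadratic.

Variables (B : E -> E -> E) (K rad : R).
Hypothesis HB : Ebil B K.
Hypothesis Hrad : 0 < rad.
Hypothesis HKrad : 8 * K * rad <= 1.

Let HK := bil_K _ _ HB.

Lemma B_sub_l Y Y' Z : B (Esub Y Y') Z = Esub (B Y Z) (B Y' Z).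
Proof. unfold Esub. now rewrite (bil_add_l _ _ HB), (bil_sc_l _ _ HB). Qed.
Lemma B_sub_r Y Z Z' : B Y (Esub Z Z') = Esub (B Y Z) (B Y Z').
Proof. unfold Esub. now rewrite (bil_add_r _ _ HB), (bil_sc_r _ _ HB). Qed.

(** Since 8 K rad <= 1, each of [B Y] and [B _ Y] has norm at most 1/8 for [Y] in the ball. Both the
    quadratic map and its linearisation are then contractions of ratio 1/4. *)
Lemma B_small Y Z : nrm Y <= rad -> nrm (B Y Z) <= / 8 * nrm Z.
Proof.
  intros H. apply Rle_trans with (1 := bil_bound _ _ HB Y Z). rewrite <- Rmult_assoc.
  apply Rmult_le_compat_r; [apply norm_ge0|]. assert (K * nrm Y <= K * rad) by (apply Rmult_le_compat_l; auto). lra.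
Qed.

Lemma B_small' Y Z : nrm Y <= rad -> nrm (B Z Y) <= / 8 * nrm Z.
Proof.
  intros H. apply Rle_trans with (1 := bil_bound _ _ HB Z Y). rewrite (Rmult_comm (nrm Z)), <- Rmult_assoc.
  apply Rmult_le_compat_r; [apply norm_ge0|]. assert (K * nrm Y <= K * rad) by (apply Rmult_le_compat_l; auto). lra.
Qed.

Lemma Elim_B {T} (F : (T -> Prop) -> Prop) {HF : Filter F} g h l m :
  Elim F g l -> Elim F h m -> Elim F (fun t => B (g t) (h t)) (B l m).
Proof.
  intros Hg Hh eps Heps.
  set (M := K * (nrm m + 1 + nrm l) + 1).
  assert (HM : 0 < M) by (unfold M; generalize (norm_ge0 m) (norm_ge0 l); nra).
  set (e := Rmin 1 (eps / M)).
  assert (He : 0 < e) by (apply Rmin_pos; [lra|now apply Rdiv_lt_0_compat]).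
  assert (He1 : e <= 1) by apply Rmin_l. assert (He2 : e <= eps / M) by apply Rmin_r.
  apply filter_imp with (2 := filter_and _ _ (Hg _ He) (Hh _ He)). intros t [H1 H2].
  replace (Esub (B (g t) (h t)) (B l m)) with (Eadd (B (Esub (g t) l) (h t)) (B l (Esub (h t) m))).
  2:{ rewrite B_sub_l, B_sub_r. Eext; ring. }
  apply Rle_trans with (1 := norm_add _ _).
  assert (h1 := bil_bound _ _ HB (Esub (g t) l) (h t)).
  assert (h2 := bil_bound _ _ HB l (Esub (h t) m)).
  assert (h3 := norm_le_sub (h t) m).
  assert (h4 := norm_ge0 m). assert (h5 := norm_ge0 l). assert (h6 := norm_ge0 (Esub (g t) l)).
  assert (h7 := norm_ge0 (Esub (h t) m)). assert (h8 := norm_ge0 (h t)).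
  apply Rle_trans with (e * M).
  - apply Rle_trans with (K * (e * (nrm m + 1)) + K * (nrm l * e)).
    + apply Rplus_le_compat; [apply Rle_trans with (1 := h1)|apply Rle_trans with (1 := h2)];
      (apply Rmult_le_compat_l; [exact HK|]).
      * apply Rmult_le_compat; lra.
      * apply Rmult_le_compat_l; lra.
    + unfold M. nra.
  - replace eps with (eps / M * M) by (field; lra). apply Rmult_le_compat_r; lra.
Qed.

(** The equation Y = eta + B(Y, Y) linearised at [Y]. Differentiating in a direction in which [eta]
    has derivative [G] gives exactly this equation for the derivative of [Y]. *)
Definition is_lsol (Y G Z : E) : Prop := Z = Eadd G (Eadd (B Y Z) (B Z Y)).

Lemma lsol_bound Y G Z : nrm Y <= rad -> is_lsol Y G Z -> nrm Z <= 2 * nrm G.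
Proof.
  intros HY HZ. unfold is_lsol in HZ.
  assert (h : nrm Z <= nrm G + (/ 8 * nrm Z + / 8 * nrm Z)).
  { rewrite HZ at 1. apply Rle_trans with (1 := norm_add _ _). apply Rplus_le_compat_l.
    apply Rle_trans with (1 := norm_add _ _). apply Rplus_le_compat; [now apply B_small|now apply B_small']. }
  generalize (norm_ge0 Z). lra.
Qed.

Lemma lsol_ex Y G : nrm Y <= rad -> exists Z, is_lsol Y G Z.
Proof.
  intros HY.
  destruct (E_fixpoint (fun Z => Eadd G (Eadd (B Y Z) (B Z Y))) (2 * nrm G)) as [Z [_ HZ]].
  - generalize (norm_ge0 G); lra.
  - intros Z HZ. apply Rle_trans with (1 := norm_add _ _).
    assert (h := norm_add (B Y Z) (B Z Y)). generalize (B_small Y Z HY) (B_small' Y Z HY) (norm_ge0 G). lra.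
  - intros Z Z' _ _.
    replace (Esub (Eadd G (Eadd (B Y Z) (B Z Y))) (Eadd G (Eadd (B Y Z') (B Z' Y))))
      with (Eadd (B Y (Esub Z Z')) (B (Esub Z Z') Y)) by (rewrite B_sub_l, B_sub_r; Eext; ring).
    apply Rle_trans with (1 := norm_add _ _).
    generalize (B_small Y (Esub Z Z') HY) (B_small' Y (Esub Z Z') HY) (norm_ge0 (Esub Z Z')). lra.
  - exists Z. now symmetry.
Qed.

(** Chosen by [epsilon], hence total; for [Y] in the ball the a priori bound [lsol_bound], applied
    to differences, makes the choice unique. *)
Definition lsol (Y G : E) : E := epsilon (inhabits E0) (is_lsol Y G).

Lemma lsol_spec Y G : nrm Y <= rad -> is_lsol Y G (lsol Y G).
Proof. intros H. apply (epsilon_spec (inhabits E0) (is_lsol Y G)). now apply lsol_ex. Qed.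

Lemma is_lsol_sub Y G G' Z Z' : is_lsol Y G Z -> is_lsol Y G' Z' -> is_lsol Y (Esub G G') (Esub Z Z').
Proof.
  unfold is_lsol. intros H H'. rewrite B_sub_l, B_sub_r. rewrite H at 1. rewrite H' at 1. Eext; ring.
Qed.

Lemma is_lsol_sc Y G Z r : is_lsol Y G Z -> is_lsol Y (Esc r G) (Esc r Z).
Proof.
  unfold is_lsol. intros H. rewrite (bil_sc_l _ _ HB), (bil_sc_r _ _ HB). rewrite H at 1. Eext; ring.
Qed.

Lemma Elim_lsol {T} (F : (T -> Prop) -> Prop) {HF : Filter F} Y (g h : T -> E) l : nrm Y <= rad ->
  F (fun t => is_lsol Y (g t) (h t)) -> Elim F g l -> Elim F h (lsol Y l).
Proof.
  intros HY He Hg. apply Elim_dom with (h := fun t => Esub (g t) l) (c := 2); [exact HF|lra| |now apply Elim_sub0].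
  apply filter_imp with (2 := He). intros t Ht. apply lsol_bound with Y; [exact HY|].
  apply is_lsol_sub; [exact Ht|now apply lsol_spec].
Qed.

Definition is_ysol (eta Y : E) : Prop := nrm Y <= rad /\ Y = Eadd eta (B Y Y).
Definition ysol (eta : E) : E := epsilon (inhabits E0) (is_ysol eta).

Lemma ysol_spec eta : nrm eta <= rad / 2 -> is_ysol eta (ysol eta).
Proof.
  intros H. apply (epsilon_spec (inhabits E0) (is_ysol eta)).
  destruct (E_fixpoint (fun Y => Eadd eta (B Y Y)) rad) as [Y [HY1 HY2]].
  - lra.
  - intros Y HY. apply Rle_trans with (1 := norm_add _ _). generalize (B_small Y Y HY). lra.
  - intros Y Z HY HZ.
    replace (Esub (Eadd eta (B Y Y)) (Eadd eta (B Z Z))) with (Eadd (B (Esub Y Z) Y) (B Z (Esub Y Z)))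
      by (rewrite B_sub_l, B_sub_r; Eext; ring).
    apply Rle_trans with (1 := norm_add _ _).
    generalize (B_small' Y (Esub Y Z) HY) (B_small Z (Esub Y Z) HZ) (norm_ge0 (Esub Y Z)). lra.
  - exists Y. split; [exact HY1|now symmetry].
Qed.

(** The identity B(Y, Y) - B(Y', Y') = B(Y - Y', Y) + B(Y', Y - Y') makes the difference of the
    quadratic terms at most a quarter of the difference of the solutions. Taking equal data gives
    uniqueness. *)
Lemma ysol_lip eta eta' Y Y' : is_ysol eta Y -> is_ysol eta' Y' ->
  nrm (Esub Y Y') <= 2 * nrm (Esub eta eta').
Proof.
  intros [h1 h2] [h1' h2'].
  assert (h : nrm (Esub Y Y') <= nrm (Esub eta eta') + (/ 8 * nrm (Esub Y Y') + / 8 * nrm (Esub Y Y'))).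
  { replace (Esub Y Y') with (Eadd (Esub eta eta') (Eadd (B (Esub Y Y') Y) (B Y' (Esub Y Y')))) at 1.
    2:{ rewrite B_sub_l, B_sub_r.
        assert (e : forall i n, Y i n = (eta i n + B Y Y i n)%C) by (intros; rewrite h2 at 1; reflexivity).
        assert (e' : forall i n, Y' i n = (eta' i n + B Y' Y' i n)%C) by (intros; rewrite h2' at 1; reflexivity).
        Eext. rewrite e, e'. ring. }
    apply Rle_trans with (1 := norm_add _ _). apply Rplus_le_compat_l.
    apply Rle_trans with (1 := norm_add _ _). apply Rplus_le_compat; [now apply B_small'|now apply B_small]. }
  generalize (norm_ge0 (Esub Y Y')). lra.
Qed.

Variables (d : nat) (eta : Rn d -> E) (kap : Fin.t d -> E) (Ce : R) (dm : Rn d -> Prop).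
Hypothesis Hce : 0 <= Ce.
Hypothesis Heta_shift : forall x i t, eta (shift x i t) = Eadd (eta x) (Esc t (kap i)).
Hypothesis Heta_lip : forall x y delta, sup_lt x y delta -> nrm (Esub (eta y) (eta x)) <= Ce * delta.
Hypothesis Hdm : forall x, dm x -> nrm (eta x) <= rad / 2.
Hypothesis Hdm_open : open_Rn dm.

(** Only points of [dm] are tested, because the fixed point is specified only where [eta] is
    small. *)
Definition near_in (x : Rn d) (P : Rn d -> Prop) : Prop :=
  exists delta, 0 < delta /\ forall y, dm y -> sup_lt x y delta -> P y.
Definition near0 (P : R -> Prop) : Prop := exists delta, 0 < delta /\ forall t, 0 < Rabs t < delta -> P t.

Lemma sup_lt_mono (x y : Rn d) a b : a <= b -> sup_lt x y a -> sup_lt x y b.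
Proof. intros H Hs i. generalize (Hs i). lra. Qed.

#[local] Instance near_in_filter x : Filter (near_in x).
Proof.
  constructor.
  - exists 1. split; [lra|trivial].
  - intros P Q [d1 [h1 H1]] [d2 [h2 H2]]. exists (Rmin d1 d2). split; [now apply Rmin_pos|].
    intros y Hy Hs. split; [apply H1|apply H2]; auto; apply sup_lt_mono with (2 := Hs); [apply Rmin_l|apply Rmin_r].
  - intros P Q HPQ [d1 [h1 H1]]. exists d1. split; auto.
Qed.

#[local] Instance near0_filter : Filter near0.
Proof.
  constructor.
  - exists 1. split; [lra|trivial].
  - intros P Q [d1 [h1 H1]] [d2 [h2 H2]]. exists (Rmin d1 d2). split; [now apply Rmin_pos|].
    intros y Hy. generalize (Rmin_l d1 d2) (Rmin_r d1 d2). intros. split; [apply H1|apply H2]; lra.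
  - intros P Q HPQ [d1 [h1 H1]]. exists d1. split; auto.
Qed.

Lemma shift_sup (x : Rn d) i t delta : 0 < delta -> Rabs t < delta -> sup_lt x (shift x i t) delta.
Proof.
  intros Hd Ht j. unfold shift. destruct (Fin.eq_dec i j).
  - replace (x j + t - x j) with t by ring. exact Ht.
  - replace (x j - x j) with 0 by ring. now rewrite Rabs_R0.
Qed.

Lemma near0_dm x i : dm x -> near0 (fun t => dm (shift x i t)).
Proof.
  intros Hx. destruct (Hdm_open x Hx) as [delta [h1 h2]]. exists delta. split; [exact h1|].
  intros t Ht. apply h2. apply shift_sup; lra.
Qed.

Lemma near_in_near0 x i P : dm x -> near_in x P -> near0 (fun t => P (shift x i t)).
Proof.
  intros Hx [delta [h1 h2]].
  apply filter_imp with (2 := filter_and _ _ (near0_dm x i Hx) (ex_intro _ delta (conj h1 (fun t Ht => Ht)) : near0 (fun t => 0 < Rabs t < delta))).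
  intros t [H1 H2]. apply h2; [exact H1|]. apply shift_sup; lra.
Qed.

Definition Econt (f : Rn d -> E) : Prop := forall x, dm x -> Elim (near_in x) f (f x).
Definition Epart (i : Fin.t d) (f g : Rn d -> E) : Prop := forall x, dm x ->
  Elim near0 (fun t => Esc (/ t) (Esub (f (shift x i t)) (f x))) (g x).

Lemma Econt_shift f x i : Econt f -> dm x -> Elim near0 (fun t => f (shift x i t)) (f x).
Proof. intros H Hx eps He. apply (near_in_near0 x i (fun y => nrm (Esub (f y) (f x)) <= eps) Hx). now apply H. Qed.

Definition Ysol (x : Rn d) : E := ysol (eta x).

Lemma Ysol_spec x : dm x -> is_ysol (eta x) (Ysol x).
Proof. intros H. now apply ysol_spec, Hdm. Qed.

Lemma Ysol_rad x : dm x -> nrm (Ysol x) <= rad.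
Proof. intros H. now apply (Ysol_spec x H). Qed.

(* All iterated partial derivatives of the solution stay in this class, because differentiating
   either fixed-point equation yields a linear equation with the same linear part. *)
Inductive diff_closed : (Rn d -> E) -> Prop :=
| diff_closed_Y : diff_closed Ysol
| diff_closed_const e : diff_closed (fun _ => e)
| diff_closed_add f g : diff_closed f -> diff_closed g -> diff_closed (fun x => Eadd (f x) (g x))
| diff_closed_B f g : diff_closed f -> diff_closed g -> diff_closed (fun x => B (f x) (g x))
| diff_closed_lsol f : diff_closed f -> diff_closed (fun x => lsol (Ysol x) (f x)).

Lemma near_in_dm x : near_in x dm.
Proof. exists 1. split; [lra|auto]. Qed.

Lemma Ysol_cont : Econt Ysol.
Proof.
  intros x Hx. apply Elim_dom with (h := fun y => Esub (eta y) (eta x)) (c := 2); [apply near_in_filter|lra| |].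
  - apply filter_imp with (2 := near_in_dm x). intros y Hy. apply ysol_lip; now apply Ysol_spec.
  - intros eps He. exists (eps / (Ce + 1)). split; [apply Rdiv_lt_0_compat; lra|].
    intros y _ Hs. replace (Esub (Esub (eta y) (eta x)) E0) with (Esub (eta y) (eta x)) by (Eext; ring).
    apply Rle_trans with (1 := Heta_lip _ _ _ Hs).
    apply Rle_trans with ((Ce + 1) * (eps / (Ce + 1))); [apply Rmult_le_compat_r|right; field; lra].
    left; apply Rdiv_lt_0_compat; lra. lra.
Qed.

(** Changing the base point amounts to changing the right-hand side: the difference solves the
    linear equation based at [y] alone, so [lsol_bound] controls it. Continuity uses this form, and
    differentiation uses it with [x] and [y] exchanged. *)
Lemma lsol_diff f x y : dm x -> dm y ->
  is_lsol (Ysol y) (Eadd (Esub (f y) (f x)) (Eadd (B (Esub (Ysol y) (Ysol x)) (lsol (Ysol x) (f x)))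
                       (B (lsol (Ysol x) (f x)) (Esub (Ysol y) (Ysol x)))))
    (Esub (lsol (Ysol y) (f y)) (lsol (Ysol x) (f x))).
Proof.
  intros Hx Hy. assert (h := lsol_spec _ (f x) (Ysol_rad x Hx)). assert (h' := lsol_spec _ (f y) (Ysol_rad y Hy)).
  unfold is_lsol in *. set (z := lsol (Ysol x) (f x)) in *. set (z' := lsol (Ysol y) (f y)) in *.
  rewrite !B_sub_l, !B_sub_r. rewrite h' at 1. rewrite h at 1. Eext; ring.
Qed.

Lemma lsol_cont f : Econt f -> Econt (fun x => lsol (Ysol x) (f x)).
Proof.
  intros Hf x Hx. set (z := lsol (Ysol x) (f x)).
  apply Elim_dom with (c := 2) (h := fun y => Eadd (Esub (f y) (f x)) (Eadd (B (Esub (Ysol y) (Ysol x)) z)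
                       (B z (Esub (Ysol y) (Ysol x))))); [apply near_in_filter|lra| |].
  - apply filter_imp with (2 := near_in_dm x). intros y Hy. apply lsol_bound with (Ysol y); [now apply Ysol_rad|].
    now apply lsol_diff.
  - replace E0 with (Eadd E0 (Eadd (B E0 z) (B z E0))).
    2:{ replace E0 with (Esc 0 E0) by (Eext; ring). rewrite (bil_sc_l _ _ HB), (bil_sc_r _ _ HB). Eext; ring. }
    assert (HY : Elim (near_in x) (fun y => Esub (Ysol y) (Ysol x)) E0) by (apply Elim_sub0; [typeclasses eauto|now apply Ysol_cont]).
    apply Elim_add; [typeclasses eauto|apply Elim_sub0; [typeclasses eauto|now apply Hf]|].
    apply Elim_add; [typeclasses eauto| |]; (apply Elim_B; [typeclasses eauto| |]); try exact HY; apply Elim_const; typeclasses eauto.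
Qed.

Lemma diff_closed_cont f : diff_closed f -> Econt f.
Proof.
  induction 1.
  - apply Ysol_cont.
  - intros x Hx. apply Elim_const. typeclasses eauto.
  - intros x Hx. apply Elim_add; [typeclasses eauto|now apply IHdiff_closed1|now apply IHdiff_closed2].
  - intros x Hx. apply Elim_B; [typeclasses eauto|now apply IHdiff_closed1|now apply IHdiff_closed2].
  - now apply lsol_cont.
Qed.

Lemma near0_neq0 : near0 (fun t => t <> 0).
Proof. exists 1. split; [lra|]. intros t [h _] ->. rewrite Rabs_R0 in h. lra. Qed.

(** With D the increment of the solution, D/t solves the equation linearised at [x] with right-hand
    side kap + B(D/t, D). Since D/t stays bounded by 2 |kap|, the extra term is of the order of |D|
    and tends to 0 by continuity. *)
Lemma Ysol_part i : Epart i Ysol (fun x => lsol (Ysol x) (kap i)).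
Proof.
  intros x Hx.
  apply Elim_dom with (c := 4 * K * nrm (kap i)) (h := fun t => Esub (Ysol (shift x i t)) (Ysol x)); [apply near0_filter| | |].
  - generalize (norm_ge0 (kap i)); nra.
  - apply filter_imp with (2 := filter_and _ _ near0_neq0 (near0_dm x i Hx)). intros t [Ht Hd].
    assert (h := Ysol_spec _ Hd). assert (h' := Ysol_spec _ Hx).
    assert (hl := ysol_lip _ _ _ _ h h'). rewrite Heta_shift in hl.
    replace (Esub (Eadd (eta x) (Esc t (kap i))) (eta x)) with (Esc t (kap i)) in hl by (Eext; ring).
    set (D := Esub (Ysol (shift x i t)) (Ysol x)) in *.
    assert (hD : nrm (Esc (/ t) D) <= 2 * nrm (kap i)).
    { apply Rle_trans with (1 := norm_sc _ _). assert (h1 := norm_sc t (kap i)).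
      assert (h2 : 0 < Rabs (/ t)) by (apply Rabs_pos_lt, Rinv_neq_0_compat; exact Ht).
      apply Rle_trans with (Rabs (/ t) * (2 * (Rabs t * nrm (kap i)))).
      - apply Rmult_le_compat_l; lra.
      - rewrite Rabs_inv. right. field. now apply Rabs_no_R0. }
    replace (4 * K * nrm (kap i) * nrm D) with (2 * (K * (2 * nrm (kap i) * nrm D))) by ring.
    apply Rle_trans with (2 * nrm (B (Esc (/ t) D) D)).
    + apply lsol_bound with (Ysol x); [now apply Ysol_rad|].
      replace (B (Esc (/ t) D) D) with (Esub (Eadd (kap i) (B (Esc (/ t) D) D)) (kap i)) by (Eext; ring).
      apply is_lsol_sub; [|apply lsol_spec; now apply Ysol_rad].
      replace (Eadd (kap i) (B (Esc (/ t) D) D)) with (Esc (/ t) (Eadd (Esc t (kap i)) (B D D))).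
      2:{ rewrite (bil_sc_l _ _ HB). Eext. rewrite RtoC_inv by exact Ht. assert (RtoC t <> 0) by (intros hh; apply RtoC_inj in hh; auto). field; assumption. }
      apply is_lsol_sc. unfold is_lsol.
      destruct h as [_ h]. destruct h' as [_ h']. rewrite Heta_shift in h. unfold D.
      set (y := Ysol x) in *. set (y' := Ysol (shift x i t)) in *.
      rewrite !B_sub_l, !B_sub_r. rewrite h at 1. rewrite h' at 1. Eext; ring.
    + apply Rmult_le_compat_l; [lra|]. apply Rle_trans with (1 := bil_bound _ _ HB _ _).
      apply Rmult_le_compat_l; [exact HK|]. apply Rmult_le_compat_r; [apply norm_ge0|exact hD].
  - apply Elim_sub0; [typeclasses eauto|]. apply Econt_shift; [apply Ysol_cont|exact Hx].
Qed.

Lemma diff_closed_part f i : diff_closed f -> exists g, diff_closed g /\ Epart i f g.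
Proof.
  induction 1 as [|e|f g Hf [f' [Hf1 Hf2]] Hg [g' [Hg1 Hg2]]|f g Hf [f' [Hf1 Hf2]] Hg [g' [Hg1 Hg2]]|f Hf [f' [Hf1 Hf2]]].
  - eexists. split; [|apply Ysol_part]. apply diff_closed_lsol, diff_closed_const.
  - exists (fun _ => E0). split; [apply diff_closed_const|]. intros x Hx.
    apply Elim_ext with (fun _ => E0); [typeclasses eauto| |apply Elim_const; typeclasses eauto].
    apply filter_forall. intros t. Eext; ring.
  - exists (fun x => Eadd (f' x) (g' x)). split; [now apply diff_closed_add|]. intros x Hx.
    apply Elim_ext with (fun t => Eadd (Esc (/ t) (Esub (f (shift x i t)) (f x))) (Esc (/ t) (Esub (g (shift x i t)) (g x))));
      [typeclasses eauto| |apply Elim_add; [typeclasses eauto|now apply Hf2|now apply Hg2]].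
    apply filter_forall. intros t. Eext; ring.
  - exists (fun x => Eadd (B (f' x) (g x)) (B (f x) (g' x))). split; [apply diff_closed_add; now apply diff_closed_B|]. intros x Hx.
    apply Elim_ext with (fun t => Eadd (B (Esc (/ t) (Esub (f (shift x i t)) (f x))) (g (shift x i t)))
                                    (B (f x) (Esc (/ t) (Esub (g (shift x i t)) (g x))))); [typeclasses eauto| |].
    + apply filter_forall. intros t. rewrite (bil_sc_l _ _ HB), (bil_sc_r _ _ HB), B_sub_l, B_sub_r. Eext; ring.
    + apply Elim_add; [typeclasses eauto| |]; (apply Elim_B; [typeclasses eauto| |]).
      * now apply Hf2.
      * apply Econt_shift; [now apply diff_closed_cont|exact Hx].
      * apply Elim_const; typeclasses eauto.
      * now apply Hg2.
  - set (Z := fun x => lsol (Ysol x) (f x)).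
    set (Y' := fun x => lsol (Ysol x) (kap i)).
    exists (fun x => lsol (Ysol x) (Eadd (f' x) (Eadd (B (Y' x) (Z x)) (B (Z x) (Y' x))))).
    assert (HZ : diff_closed Z) by now apply diff_closed_lsol.
    assert (HY' : diff_closed Y') by apply diff_closed_lsol, diff_closed_const.
    split; [apply diff_closed_lsol; repeat apply diff_closed_add; try apply diff_closed_B; assumption|]. intros x Hx.
    pose (q := fun t => Esc (/ t) (Esub (Ysol (shift x i t)) (Ysol x))).
    apply Elim_lsol with (g := fun t => Eadd (Esc (/ t) (Esub (f (shift x i t)) (f x)))
        (Eadd (B (q t) (Z (shift x i t))) (B (Z (shift x i t)) (q t)))); [typeclasses eauto|now apply Ysol_rad| |].
    + apply filter_imp with (2 := near0_dm x i Hx). intros t Hd.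
      (* [lsol_diff] is used from the moving point to [x], so that the linear equation is based at
         the fixed [x] and [Elim_lsol] applies; this reverses all signs. *)
      replace (Eadd (Esc (/ t) (Esub (f (shift x i t)) (f x)))
        (Eadd (B (q t) (Z (shift x i t))) (B (Z (shift x i t)) (q t)))) with
       (Esc (/ t) (Esc (-1) (Eadd (Esub (f x) (f (shift x i t))) (Eadd (B (Esub (Ysol x) (Ysol (shift x i t))) (Z (shift x i t)))
                       (B (Z (shift x i t)) (Esub (Ysol x) (Ysol (shift x i t)))))))).
      2:{ unfold q. rewrite (bil_sc_l _ _ HB), (bil_sc_r _ _ HB), !B_sub_l, !B_sub_r. Eext; ring. }
      apply is_lsol_sc.
      replace (Esub (Z (shift x i t)) (Z x)) with (Esc (-1) (Esub (Z x) (Z (shift x i t)))) by (Eext; ring).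
      apply is_lsol_sc. now apply (lsol_diff f (shift x i t) x).
    + assert (hz : Elim near0 (fun t => Z (shift x i t)) (Z x)) by (apply Econt_shift; [now apply diff_closed_cont|exact Hx]).
      assert (hq : Elim near0 q (Y' x)) by now apply Ysol_part.
      apply Elim_add; [typeclasses eauto|now apply Hf2|].
      apply Elim_add; [typeclasses eauto| |]; (apply Elim_B; [typeclasses eauto| |]); assumption.
Qed.

End Quadratic.

(** * The stationarity system *)

(* Polarised nonlinear terms of [sysp], [sysu] and [sysv]. *)
Definition q1 (lam : R) (Y Z : E) : seqZ :=
  sadd (sc (-1) (conv (Y Ip) (cj (Z Ip))))
    (sadd (sc (-1) (conv (Y Iw) (cj (Z Iw))))
      (sc lam (sh (-4) (conv (sadd (Y Iw) (Y I2)) (sadd (Z Iw) (Z I2)))))).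
Definition e1 (lam : R) (Y Z : E) : seqZ := sc (1 / 2) (sadd (q1 lam Y Z) (cj (q1 lam Y Z))).
Definition e2 (lam : R) (Y Z : E) : seqZ :=
  sadd (sc (-1) (conv (Y Id) (Z Iu)))
    (sc (-2 * lam) (sh 4 (cj (conv (sadd (Y Iw) (Y I1)) (sadd (Z Iw) (Z I2)))))).
Definition e3 (lam : R) (Y Z : E) : seqZ :=
  sadd (sc (-1) (conv (Y Id) (Z Iv)))
    (sc (- lam) (sh (-3) (conv (cj (Y Ip)) (sadd (sc 4 (Z Iw)) (sadd (Z I1) (sadd (Z I2) (Z I3))))))).

(** Solves p + conj p = a for real-valued [a] by the positive frequencies and half of the mean. The
    frequency -1 and the imaginary part of the mean are left to the kernel. *)
Definition Pp (a : seqZ) : seqZ :=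
  sadd (msk (fun n => (0 <? n)%Z) a) (msk (fun n => (n =? 0)%Z) (sc (1 / 2) a)).
(** At a frequency n < 0 the third equation reads lam w_{n+3} - conj w_{1-n} = a_n, as v_n = 0. With
    w_0 = w_1 = 0 this gives w_m = - conj a_{1-m} for m >= 3, while n = -1 involves both w_2 and its
    conjugate and is combined with its own conjugate. *)
Definition Pw (lam : R) (a : seqZ) : seqZ :=
  sadd (msk (fun n => (3 <=? n)%Z) (sc (-1) (sh 1 (cj a))))
    (msk (fun n => (n =? 2)%Z) (sc (- / (1 - lam ^ 2)) (sadd (sc lam (sh 3 a)) (sh 1 (cj a))))).
(** At frequencies n >= 0 the equation gives v_n. The term conj w_{1-n} involves only w_0 and w_1,
    which [Pw] sets to zero, so it is absent. *)
Definition Pv (lam : R) (a : seqZ) : seqZ :=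
  msk (fun n => (0 <=? n)%Z) (sadd a (sc (- lam) (sh (-3) (Pw lam a)))).
Definition Pasym (a : seqZ) : seqZ := sadd a (sc (-1) (cj a)).
(** For n > 0, eliminating d_n by the reality of [d] gives u_n = e2_n - conj e2_{-n} - p_n for the
    particular solution, where p_n = e1_n; [Pu1] supplies the last term. At n = 0 only the imaginary
    part is determined, whence the half. *)
Definition Pu2 (a : seqZ) : seqZ :=
  sadd (msk (fun n => (0 <? n)%Z) (Pasym a)) (msk (fun n => (n =? 0)%Z) (sc (1 / 2) (Pasym a))).
Definition Pu1 (a : seqZ) : seqZ := msk (fun n => (0 <? n)%Z) (sc (-1) a).

(* Right inverse of the linear operators [p + conj p], [u + d - conj p] and
   [v - ze conj w + lam ze^-3 w], applied to [e1, e2, e3]; the coefficient [w_2] solves a real linear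
   system of determinant [lam ^ 2 - 1]. The kernel of these operators is the range of [etaraw]. *)
Definition Braw (lam : R) (Y Z : E) (i : cmp) : seqZ :=
  match i with
  | Ip => Pp (e1 lam Y Z)
  | Iw => Pw lam (e3 lam Y Z)
  | Id => sadd (cj (Pp (e1 lam Y Z)))
            (sadd (e2 lam Y Z) (sc (-1) (sadd (Pu1 (e1 lam Y Z)) (Pu2 (e2 lam Y Z)))))
  | Iu => sadd (Pu1 (e1 lam Y Z)) (Pu2 (e2 lam Y Z))
  | Iv => Pv lam (e3 lam Y Z)
  | I1 => conv (cj (Y Ip)) (Z Iw)
  | I2 => conv (cj (Y Ip)) (sadd (sc 2 (Z Iw)) (Z I1))
  | I3 => conv (cj (Y Ip)) (sadd (sc 3 (Z Iw)) (sadd (Z I1) (Z I2)))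
  end.

Ltac bdd_lin := repeat first [apply (BddLin_sadd (fun a => _) (fun a => _)) | apply BddLin_sc | apply BddLin_cj | apply BddLin_sh | apply BddLin_msk
  | apply (BddLin_comp (sc _)); [apply BddLin_sc|] | apply (BddLin_comp cj); [apply BddLin_cj|] | apply (BddLin_comp (sh _)); [apply BddLin_sh|]
  | apply (BddLin_comp (msk _)); [apply BddLin_msk|]].

Lemma BddLin_id : BddLin (fun a => a).
Proof.
  split; [|split; reflexivity]. exists 1. split; [lra|]. intros. now rewrite Rmult_1_l.
Qed.

Lemma BddLin_Pp : BddLin Pp.
Proof. unfold Pp. bdd_lin. Qed.
Lemma BddLin_Pw lam : BddLin (Pw lam).
Proof. unfold Pw. bdd_lin. Qed.
Lemma BddLin_Pv lam : BddLin (Pv lam).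
Proof. unfold Pv. apply (BddLin_comp (msk _)); [apply BddLin_msk|]. apply BddLin_sadd; [apply BddLin_id|].
  apply (BddLin_comp (sc _)); [apply BddLin_sc|]. apply (BddLin_comp (sh _)); [apply BddLin_sh|]. apply BddLin_Pw. Qed.
Lemma BddLin_Pasym : BddLin Pasym.
Proof. unfold Pasym. apply BddLin_sadd; [apply BddLin_id|]. bdd_lin. Qed.
Lemma BddLin_Pu2 : BddLin Pu2.
Proof. unfold Pu2. apply BddLin_sadd; apply (BddLin_comp (msk _)); try apply BddLin_msk; try apply BddLin_Pasym.
  apply (BddLin_comp (sc _)); [apply BddLin_sc|]. apply BddLin_Pasym. Qed.
Lemma BddLin_Pu1 : BddLin Pu1.
Proof. unfold Pu1. bdd_lin. Qed.

Ltac bdd_linE := repeat first [apply BddLinE_crd | apply BddLinE_sadd | apply (BddLinE_comp (sc _)); [apply BddLin_sc|]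
  | apply (BddLinE_comp cj); [apply BddLin_cj|] | apply (BddLinE_comp (sh _)); [apply BddLin_sh|]].
Ltac bdd_bil := repeat first [apply BddBil_sadd | apply BddBil_conv; bdd_linE | apply (BddBil_comp (sc _)); [apply BddLin_sc|]
  | apply (BddBil_comp cj); [apply BddLin_cj|] | apply (BddBil_comp (sh _)); [apply BddLin_sh|]].

Lemma BddBil_q1 lam : BddBil (q1 lam).
Proof. unfold q1. bdd_bil. Qed.
Lemma BddBil_e1 lam : BddBil (e1 lam).
Proof.
  unfold e1. apply (BddBil_comp (sc _)); [apply BddLin_sc|]. apply BddBil_sadd; [apply BddBil_q1|].
  apply (BddBil_comp cj); [apply BddLin_cj|]. apply BddBil_q1.
Qed.
Lemma BddBil_e2 lam : BddBil (e2 lam).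
Proof. unfold e2. bdd_bil. Qed.
Lemma BddBil_e3 lam : BddBil (e3 lam).
Proof. unfold e3. bdd_bil. Qed.

Lemma BddBil_raw lam i : BddBil (fun Y Z => Braw lam Y Z i).
Proof.
  assert (Hu : BddBil (fun Y Z => sadd (Pu1 (e1 lam Y Z)) (Pu2 (e2 lam Y Z)))).
  { apply BddBil_sadd; [apply (BddBil_comp Pu1); [apply BddLin_Pu1|apply BddBil_e1]|apply (BddBil_comp Pu2); [apply BddLin_Pu2|apply BddBil_e2]]. }
  assert (Hp : BddBil (fun Y Z => Pp (e1 lam Y Z))) by (apply (BddBil_comp Pp); [apply BddLin_Pp|apply BddBil_e1]).
  destruct i; cbn [Braw].
  - exact Hp.
  - apply (BddBil_comp (Pw lam)); [apply BddLin_Pw|apply BddBil_e3].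
  - apply BddBil_sadd; [|apply BddBil_sadd; [apply BddBil_e2|]].
    + apply (BddBil_comp cj); [apply BddLin_cj|exact Hp].
    + apply (BddBil_comp (sc (-1))); [apply BddLin_sc|exact Hu].
  - exact Hu.
  - apply (BddBil_comp (Pv lam)); [apply BddLin_Pv|apply BddBil_e3].
  - bdd_bil.
  - bdd_bil.
  - bdd_bil.
Qed.

Lemma Braw_bound lam : exists K, 0 <= K /\ forall Y Z, nbE (Braw lam Y Z) (K * (nrm Y * nrm Z)).
Proof.
  destruct (BddBil_raw lam Ip) as [[K1 [k1 H1]] _]. destruct (BddBil_raw lam Iw) as [[K2 [k2 H2]] _].
  destruct (BddBil_raw lam Id) as [[K3 [k3 H3]] _]. destruct (BddBil_raw lam Iu) as [[K4 [k4 H4]] _].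
  destruct (BddBil_raw lam Iv) as [[K5 [k5 H5]] _]. destruct (BddBil_raw lam I1) as [[K6 [k6 H6]] _].
  destruct (BddBil_raw lam I2) as [[K7 [k7 H7]] _]. destruct (BddBil_raw lam I3) as [[K8 [k8 H8]] _].
  exists (K1 + K2 + K3 + K4 + K5 + K6 + K7 + K8). split; [lra|].
  intros Y Z. assert (H : 0 <= nrm Y * nrm Z) by (generalize (norm_ge0 Y) (norm_ge0 Z); nra).
  intros i. destruct i; [generalize (H1 Y Z)|generalize (H2 Y Z)|generalize (H3 Y Z)|generalize (H4 Y Z)|
    generalize (H5 Y Z)|generalize (H6 Y Z)|generalize (H7 Y Z)|generalize (H8 Y Z)];
  apply nb_mono; apply Rmult_le_compat_r; lra.
Qed.

Lemma Bop_ok lam Y Z : exists c, nbE (Braw lam Y Z) c.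
Proof. destruct (Braw_bound lam) as [K [_ H]]. eexists. apply H. Qed.
Definition Bop lam Y Z : E := mkE _ (Bop_ok lam Y Z).

Lemma Bop_bil lam : exists K, Ebil (Bop lam) K.
Proof.
  destruct (Braw_bound lam) as [K [HK H]]. exists K. constructor.
  - exact HK.
  - intros Y Z. apply norm_le. apply H.
  - intros. apply E_ext; intros i n. destruct (BddBil_raw lam i) as [_ [h _]]. simpl. now rewrite h.
  - intros. apply E_ext; intros i n. destruct (BddBil_raw lam i) as [_ [_ [h _]]]. simpl. now rewrite h.
  - intros. apply E_ext; intros i n. destruct (BddBil_raw lam i) as [_ [_ [_ [h _]]]]. simpl. now rewrite h.
  - intros. apply E_ext; intros i n. destruct (BddBil_raw lam i) as [_ [_ [_ [_ h]]]]. simpl. now rewrite h.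
Qed.

(** * The kernel of the linear part and its parameters *)

(** Numbers the coordinates by [nat], which avoids dependent case analysis on [Fin.t]. Every index
    from 7 on means the last coordinate, and [coordE] and [coordF] follow the same convention. *)
Definition f8 (x : Rn 8) (k : nat) : R :=
  match k with
  | 0 => x Fin.F1
  | 1 => x (Fin.FS Fin.F1)
  | 2 => x (Fin.FS (Fin.FS Fin.F1))
  | 3 => x (Fin.FS (Fin.FS (Fin.FS Fin.F1)))
  | 4 => x (Fin.FS (Fin.FS (Fin.FS (Fin.FS Fin.F1))))
  | 5 => x (Fin.FS (Fin.FS (Fin.FS (Fin.FS (Fin.FS Fin.F1)))))
  | 6 => x (Fin.FS (Fin.FS (Fin.FS (Fin.FS (Fin.FS (Fin.FS Fin.F1))))))
  | _ => x (Fin.FS (Fin.FS (Fin.FS (Fin.FS (Fin.FS (Fin.FS (Fin.FS Fin.F1)))))))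
  end%nat.

Lemma fin8_ind (P : Fin.t 8 -> Prop) :
  P Fin.F1 -> P (Fin.FS Fin.F1) -> P (Fin.FS (Fin.FS Fin.F1)) -> P (Fin.FS (Fin.FS (Fin.FS Fin.F1))) ->
  P (Fin.FS (Fin.FS (Fin.FS (Fin.FS Fin.F1)))) -> P (Fin.FS (Fin.FS (Fin.FS (Fin.FS (Fin.FS Fin.F1))))) ->
  P (Fin.FS (Fin.FS (Fin.FS (Fin.FS (Fin.FS (Fin.FS Fin.F1)))))) ->
  P (Fin.FS (Fin.FS (Fin.FS (Fin.FS (Fin.FS (Fin.FS (Fin.FS Fin.F1))))))) -> forall i, P i.
Proof.
  intros. do 8 (apply (Fin.caseS' i); [assumption|clear i; intros i]). apply (Fin.case0 (fun _ => _) i).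
Qed.

Definition xa (x : Rn 8) : C := (f8 x 0, f8 x 1).
Definition xA (x : Rn 8) : C := (f8 x 3, f8 x 4).
Definition xB (x : Rn 8) : C := (f8 x 5, f8 x 6).

(** The kernel element with free p_{-1}, Im p_0, w_0, w_1, Re u_0. The rest is forced: p_1 by p +
    conj p = 0; w_3 and w_4 by the frequencies -2 and -3 of the third operator, v_0 and v_1 by its
    frequencies 0 and 1; the other values of [u] and [d] by the second operator and the reality of
    [d]. *)
Definition etaraw (lam : R) (x : Rn 8) (i : cmp) : seqZ := fun n =>
  match i, n with
  | Ip, Zneg 1 => xa x
  | Ip, Z0 => (0, f8 x 2)
  | Ip, Zpos 1 => (- Cconj (xa x))%C
  | Iw, Z0 => xA x
  | Iw, Zpos 1 => xB x
  | Iw, Zpos 3 => (RtoC lam * Cconj (xB x))%C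
  | Iw, Zpos 4 => (RtoC lam * Cconj (xA x))%C
  | Id, Zneg 1 => (- xa x)%C
  | Id, Z0 => (- f8 x 7, 0)
  | Id, Zpos 1 => (- Cconj (xa x))%C
  | Iu, Z0 => (f8 x 7, - f8 x 2)
  | Iu, Zpos 1 => (2 * Cconj (xa x))%C
  | Iv, Z0 => (RtoC (1 - lam ^ 2) * Cconj (xB x))%C
  | Iv, Zpos 1 => (RtoC (1 - lam ^ 2) * Cconj (xA x))%C
  | _, _ => RtoC 0
  end.

(** 625 = 5^4 is the largest weight on the support |n| <= 4; the second factor bounds the individual
    coefficients. *)
Definition Ceta (lam : R) : R := 625 * (4 * (2 + Rabs lam + lam ^ 2)).

Lemma etaraw_supp lam x i n : (4 < Z.abs n)%Z -> etaraw lam x i n = 0.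
Proof.
  intros H. unfold etaraw.
  destruct i; destruct n as [|[[[?|?|]|[?|?|]|]|[[?|?|]|[?|?|]|]|]|[?|?|]]; try reflexivity; lia.
Qed.

Lemma etaraw_bound lam x i n M : 0 <= M -> (forall j, Rabs (x j) <= M) ->
  Cmod (etaraw lam x i n) <= 4 * (2 + Rabs lam + lam ^ 2) * M.
Proof.
  intros HM H.
  assert (Hl := Rabs_pos lam). assert (Hl2 : 0 <= lam ^ 2) by nra.
  assert (Hk : forall k, Rabs (f8 x k) <= M) by (intros k; destruct k as [|[|[|[|[|[|[|k]]]]]]]; apply H).
  assert (Hc : forall u v k l, Rabs u <= M -> Rabs v <= M -> k = u -> l = v -> Cmod (k, l) <= 2 * M).
  { intros u v k l h1 h2 -> ->. apply Cmod_le_2; assumption. }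
  assert (Hz : forall r c, Rabs r <= 2 + Rabs lam + lam ^ 2 -> Cmod c <= 2 * M -> Cmod (RtoC r * c) <= 4 * (2 + Rabs lam + lam ^ 2) * M).
  { intros r c h1 h2. rewrite Cmod_mult, Cmod_R.
    apply Rle_trans with ((2 + Rabs lam + lam ^ 2) * (2 * M)); [apply Rmult_le_compat; auto; [apply Rabs_pos|apply Cmod_ge_0]|nra]. }
  assert (H1 : 2 * M <= 4 * (2 + Rabs lam + lam ^ 2) * M) by nra.
  assert (Hxa : Cmod (xa x) <= 2 * M) by (apply Cmod_le_2; apply Hk).
  assert (HxA : Cmod (xA x) <= 2 * M) by (apply Cmod_le_2; apply Hk).
  assert (HxB : Cmod (xB x) <= 2 * M) by (apply Cmod_le_2; apply Hk).
  assert (H0 : Cmod 0 <= 4 * (2 + Rabs lam + lam ^ 2) * M) by (rewrite Cmod_0; nra).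
  assert (R1 : Rabs (1 - lam ^ 2) <= 2 + Rabs lam + lam ^ 2).
  { apply Rabs_le. split; lra. }
  assert (Hll : Rabs lam <= 2 + Rabs lam + lam ^ 2) by lra.
  unfold etaraw. destruct i; destruct n as [|[[[?|?|]|[?|?|]|]|[[?|?|]|[?|?|]|]|]|[?|?|]]; try exact H0;
    try (apply Hz; [assumption|rewrite Cmod_conj; assumption]);
    try (apply Rle_trans with (2 := H1); rewrite ?Cmod_opp, ?Cmod_conj; assumption);
    try (apply Rle_trans with (2 := H1); apply Cmod_le_2; simpl; rewrite ?Rabs_Ropp, ?Rabs_R0; first [assumption|apply H]).
  apply (Hz 2); [rewrite Rabs_pos_eq; lra|rewrite Cmod_conj; assumption].
Qed.

Lemma etaraw_nb lam x M : 0 <= M -> (forall j, Rabs (x j) <= M) -> nbE (etaraw lam x) (Ceta lam * M).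
Proof.
  intros HM H i n. destruct (Z_lt_le_dec 4 (Z.abs n)) as [h|h].
  - rewrite etaraw_supp by assumption. rewrite Cmod_0. apply div_wt_nonneg. unfold Ceta.
    assert (Hl := Rabs_pos lam). assert (Hl2 : 0 <= lam ^ 2) by nra. nra.
  - apply nb_equiv. apply Rle_trans with (4 * (2 + Rabs lam + lam ^ 2) * M * 5 ^ 4).
    + apply Rmult_le_compat; [apply Cmod_ge_0|left; apply wt_pow_pos|now apply etaraw_bound|].
      apply pow_incr. split; [generalize (wt_ge1 n); lra|]. unfold wt. apply IZR_le in h. lra.
    + unfold Ceta. right. ring.
Qed.

Lemma eta_ok lam x : exists c, nbE (etaraw lam x) c.
Proof.
  exists (Ceta lam * (Rabs (f8 x 0) + Rabs (f8 x 1) + Rabs (f8 x 2) + Rabs (f8 x 3) + Rabs (f8 x 4) + Rabs (f8 x 5) + Rabs (f8 x 6) + Rabs (f8 x 7))).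
  generalize (Rabs_pos (f8 x 0)) (Rabs_pos (f8 x 1)) (Rabs_pos (f8 x 2)) (Rabs_pos (f8 x 3))
    (Rabs_pos (f8 x 4)) (Rabs_pos (f8 x 5)) (Rabs_pos (f8 x 6)) (Rabs_pos (f8 x 7)). intros.
  apply etaraw_nb; [lra|]. intros j. apply (fin8_ind (fun j => Rabs (x j) <= _)); simpl in *; lra.
Qed.
Definition eta lam x : E := mkE _ (eta_ok lam x).

Lemma eta_bound lam x M : 0 <= M -> (forall j, Rabs (x j) <= M) -> nrm (eta lam x) <= Ceta lam * M.
Proof. intros. apply norm_le. now apply etaraw_nb. Qed.

Lemma eta_lin lam x y r (z : Rn 8) : (forall j, z j = x j + r * y j) ->
  eta lam z = Eadd (eta lam x) (Esc r (eta lam y)).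
Proof.
  intros H. assert (Hk : forall k, f8 z k = f8 x k + r * f8 y k).
  { intros k; destruct k as [|[|[|[|[|[|[|k]]]]]]]; apply H. }
  apply E_ext; intros i n. simpl. unfold sadd, sc, etaraw.
  destruct i; destruct n as [|[[[?|?|]|[?|?|]|]|[[?|?|]|[?|?|]|]|]|[?|?|]]; unfold xa, xA, xB; rewrite ?Hk;
    apply C_eq; simpl; ring.
Qed.

Definition unitv {d} (i j : Fin.t d) : R := if Fin.eq_dec i j then 1 else 0.
Definition kap lam (i : Fin.t 8) : E := eta lam (unitv i).

Lemma eta_shift lam x i t : eta lam (shift x i t) = Eadd (eta lam x) (Esc t (kap lam i)).
Proof. apply eta_lin. intros j. unfold shift, unitv. destruct (Fin.eq_dec i j); ring. Qed.

Lemma eta_lip lam x y delta : sup_lt x y delta -> nrm (Esub (eta lam y) (eta lam x)) <= Ceta lam * delta.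
Proof.
  intros H.
  assert (Hd : 0 <= delta) by (generalize (H Fin.F1) (Rabs_pos (y Fin.F1 - x Fin.F1)); lra).
  replace (Esub (eta lam y) (eta lam x)) with (eta lam (fun j => y j - x j)).
  - apply eta_bound; [exact Hd|]. intros j. left. apply H.
  - apply eta_lin. intros j. ring.
Qed.

Lemma Cconj_R (r : R) : Cconj (RtoC r) = RtoC r.
Proof. apply C_eq; simpl; ring. Qed.

(** * Fixed points satisfy the equations between Fourier coefficients *)

Section Solution.
Variables (lam : R) (x : Rn 8) (Y : E).
Hypothesis Hlam : 1 - lam ^ 2 <> 0.
Hypothesis HY : Y = Eadd (eta lam x) (Bop lam Y Y).

Let hY i n : Y i n = (etaraw lam x i n + Braw lam Y Y i n)%C.
Proof. rewrite HY at 1. reflexivity. Qed.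

Ltac zc := repeat match goal with
  | |- context [Z.ltb ?a ?b] => destruct (Z.ltb_spec a b); try lia
  | |- context [Z.leb ?a ?b] => destruct (Z.leb_spec a b); try lia
  | |- context [Z.eqb ?a ?b] => destruct (Z.eqb_spec a b); try lia
  end.

Lemma e1_herm n : Cconj (e1 lam Y Y (- n)%Z) = e1 lam Y Y n.
Proof.
  unfold e1, sc, sadd, cj. rewrite Cmult_conj, Cplus_conj, Cconj_conj, Cconj_R, Z.opp_involutive. ring.
Qed.

Lemma e1_real0 : Cconj (e1 lam Y Y 0%Z) = e1 lam Y Y 0%Z.
Proof. exact (e1_herm 0%Z). Qed.

Lemma eta_far i n : (4 < n \/ n < -1)%Z -> etaraw lam x i n = 0.
Proof.
  intros H. unfold etaraw.
  destruct i; destruct n as [|[[[?|?|]|[?|?|]|]|[[?|?|]|[?|?|]|]|]|[?|?|]]; try reflexivity; lia.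
Qed.

(** The frequency -1 is exempt: in z = ze (1 + p) it becomes the constant term of the holomorphic
    function z. *)
Lemma sol_p_neg n : (n < -1)%Z -> Y Ip n = 0.
Proof.
  intros Hn. rewrite hY, eta_far by lia. cbn [Braw]. unfold Pp, sadd, msk. zc. ring.
Qed.

Lemma sol_w_neg n : (n < 0)%Z -> Y Iw n = 0.
Proof.
  intros Hn. rewrite hY. cbn [Braw]. unfold Pw, sadd, msk. zc. destruct n; try lia. simpl. ring.
Qed.

Lemma sol_u_neg n : (n < 0)%Z -> Y Iu n = 0.
Proof.
  intros Hn. rewrite hY. cbn [Braw]. unfold Pu1, Pu2, sadd, msk. zc. destruct n; try lia. simpl. ring.
Qed.

Lemma sol_v_neg n : (n < 0)%Z -> Y Iv n = 0.
Proof.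
  intros Hn. rewrite hY. cbn [Braw]. unfold Pv, msk. zc. destruct n; try lia. simpl. ring.
Qed.

Lemma Zcases n : (n = 0 \/ n = 1 \/ n = -1 \/ 1 < n \/ n < -1)%Z.
Proof. lia. Qed.

Lemma RtoC_half (c : C) : (RtoC (1 / 2) * c + RtoC (1 / 2) * c = c)%C.
Proof. replace (RtoC (1/2) * c + RtoC (1/2) * c)%C with (RtoC (1/2 + 1/2) * c)%C by (rewrite RtoC_plus; ring).
  replace (1/2+1/2) with 1 by field. ring. Qed.

Lemma sol_p : sadd (Y Ip) (cj (Y Ip)) = e1 lam Y Y.
Proof.
  apply functional_extensionality; intros n. unfold sadd at 1, cj. rewrite !hY. cbn [Braw].
  unfold Pp, sadd, msk, sc. rewrite !Cplus_conj.
  destruct (Zcases n) as [->|[->|[->|[h|h]]]].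
  - simpl. rewrite Cmult_conj, Cconj_R, e1_real0.
    transitivity (RtoC (1/2) * e1 lam Y Y 0%Z + RtoC (1/2) * e1 lam Y Y 0%Z)%C; [|apply RtoC_half].
    apply C_eq; simpl; ring.
  - simpl. apply C_eq; simpl; ring.
  - simpl. rewrite <- e1_herm. apply C_eq; simpl; ring.
  - rewrite (eta_far _ (- n)) by lia. zc. rewrite Cconj_R.
    assert (h2 : etaraw lam x Ip n = 0) by (destruct n as [|[?|?|]|]; simpl; try lia; reflexivity).
    rewrite h2, ?Cplus_conj, ?Cconj_R. ring.
  - rewrite (eta_far _ n) by lia. zc. rewrite Cconj_R.
    assert (h2 : etaraw lam x Ip (- n)%Z = 0) by (destruct n as [| |[?|?|]]; simpl; try lia; reflexivity).
    rewrite h2, <- (e1_herm n), ?Cplus_conj, ?Cconj_R. ring.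
Qed.

Lemma sol_u : sadd (Y Iu) (Y Id) = sadd (cj (Y Ip)) (e2 lam Y Y).
Proof.
  apply functional_extensionality; intros n. unfold sadd at 1 2, cj. rewrite !hY. cbn [Braw].
  assert (H : (etaraw lam x Iu n + etaraw lam x Id n)%C = Cconj (etaraw lam x Ip (- n)%Z)).
  { destruct (Zcases n) as [->|[->|[->|[h|h]]]].
    - apply C_eq; simpl; ring.
    - apply C_eq; simpl; ring.
    - apply C_eq; simpl; ring.
    - rewrite (eta_far _ (- n)) by lia. destruct n as [|[?|?|]|]; simpl; try lia; apply C_eq; simpl; ring.
    - rewrite !(eta_far _ n) by lia. destruct n as [| |[?|?|]]; simpl; try lia; apply C_eq; simpl; ring. }
  rewrite Cplus_conj, <- H. unfold sadd, cj, sc.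
  replace (RtoC (-1)) with (- RtoC 1)%C by (apply C_eq; simpl; ring). ring.
Qed.

(** In [Braw] the component [d] is whatever makes the second equation hold; that it is real is the
    property for which the particular [u] was chosen. *)
Lemma sol_d_real : cj (Y Id) = Y Id.
Proof.
  apply functional_extensionality; intros n. unfold cj. rewrite !hY. cbn [Braw].
  assert (H : Cconj (etaraw lam x Id (- n)%Z) = etaraw lam x Id n).
  { destruct (Zcases n) as [->|[->|[->|[h|h]]]].
    - apply C_eq; simpl; ring.
    - apply C_eq; simpl; ring.
    - apply C_eq; simpl; ring.
    - rewrite (eta_far _ (- n)) by lia. destruct n as [|[?|?|]|]; simpl; try lia; apply C_eq; simpl; ring.
    - rewrite !(eta_far _ n) by lia. destruct n as [| |[?|?|]]; simpl; try lia; apply C_eq; simpl; ring. }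
  rewrite Cplus_conj, H. f_equal.
  unfold Pu1, Pu2, Pasym, Pp, sadd, cj, msk, sc. rewrite ?Z.opp_involutive.
  assert (He := e1_herm n). assert (He' := e1_herm (- n)). rewrite Z.opp_involutive in He'.
  assert (Hm : RtoC (-1) = (- RtoC 1)%C) by (apply C_eq; simpl; ring).
  destruct (Ztrichotomy n 0) as [h|[h|h]].
  - zc; rewrite ?Cplus_conj, ?Cmult_conj, ?Cplus_conj, ?Cmult_conj, ?Cconj_conj, ?Cconj_R, ?He, ?He', ?Hm. ring.
  - subst n. simpl. rewrite ?Cplus_conj, ?Cmult_conj, ?Cplus_conj, ?Cmult_conj, ?Cconj_conj, ?Cconj_R, ?e1_real0.
    apply C_eq; simpl; field.
  - zc; rewrite ?Cplus_conj, ?Cmult_conj, ?Cplus_conj, ?Cmult_conj, ?Cconj_conj, ?Cconj_R, ?He, ?He', ?Hm. ring.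
Qed.

Lemma eta_w n : (n < 0 \/ n = 2 \/ 4 < n)%Z -> etaraw lam x Iw n = 0.
Proof.
  intros H. destruct n as [|[[[?|?|]|[?|?|]|]|[[?|?|]|[?|?|]|]|]|[?|?|]]; try reflexivity; lia.
Qed.

Lemma eta_v n : (n < 0 \/ 1 < n)%Z -> etaraw lam x Iv n = 0.
Proof.
  intros H. destruct n as [|[?|?|]|[?|?|]]; try reflexivity; lia.
Qed.

(** Frequency by frequency: v_n - conj w_{1-n} + lam w_{n+3} = a_n. Only -3 <= n <= 1 meets the
    kernel coefficients or the exceptional w_2, and these frequencies are checked one by one. *)
Lemma sol_v : Y Iv = sadd (sh 1 (cj (Y Iw))) (sadd (sc (- lam) (sh (-3) (Y Iw))) (e3 lam Y Y)).
Proof.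
  apply functional_extensionality; intros n. unfold sadd, sc, sh, cj. rewrite !hY. cbn [Braw].
  set (e := e3 lam Y Y).
  assert (Hl : (1 - RtoC lam ^ 2 <> 0)%C).
  { intros h. apply Hlam. apply RtoC_inj. rewrite RtoC_minus, RtoC_pow. exact h. }
  assert (Hfar : (n < -3 \/ n = -3 \/ n = -2 \/ n = -1 \/ n = 0 \/ n = 1 \/ 1 < n)%Z) by lia.
  unfold Pv, Pw, sadd, msk, sc, sh, cj.
  destruct Hfar as [h|[->|[->|[->|[->|[->|h]]]]]].
  - rewrite eta_v, !eta_w by lia. zc. replace (- (- (n - 1) - 1))%Z with n by lia.
    rewrite ?Cplus_conj, ?Cmult_conj, ?Cconj_conj, ?Cconj_R.
    replace (RtoC (-1)) with (- RtoC 1)%C by (apply C_eq; simpl; ring). ring.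
  - simpl. rewrite ?Cplus_conj, ?Cmult_conj, ?Cplus_conj, ?Cmult_conj, ?Cconj_conj, ?Cconj_R.
    replace (RtoC (-1)) with (- RtoC 1)%C by (apply C_eq; simpl; ring). rewrite RtoC_opp. ring.
  - simpl. rewrite ?Cplus_conj, ?Cmult_conj, ?Cplus_conj, ?Cmult_conj, ?Cconj_conj, ?Cconj_R.
    replace (RtoC (-1)) with (- RtoC 1)%C by (apply C_eq; simpl; ring). rewrite RtoC_opp. ring.
  (* Frequency -1 couples w_2 with its own conjugate; recovering a_{-1} requires cancelling the
     division by 1 - lam^2. *)
  - cbn -[Cplus Cmult Cconj RtoC pow e].
    rewrite ?Cplus_conj, ?Cmult_conj, ?Cplus_conj, ?Cmult_conj, ?Cconj_conj, ?Cconj_R.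
    rewrite !RtoC_opp, RtoC_inv, RtoC_minus, RtoC_pow by exact Hlam.
    simpl Z.opp. simpl Z.sub. field. exact Hl.
  - simpl. rewrite ?Cplus_conj, ?Cmult_conj, ?Cplus_conj, ?Cmult_conj, ?Cconj_conj, ?Cconj_R.
    apply C_eq; simpl; ring.
  - simpl. rewrite ?Cplus_conj, ?Cmult_conj, ?Cplus_conj, ?Cmult_conj, ?Cconj_conj, ?Cconj_R.
    apply C_eq; simpl; ring.
  - rewrite eta_v by lia.
    assert (H3 : etaraw lam x Iw (n - -3)%Z = 0) by (apply eta_w; lia).
    assert (H4 : etaraw lam x Iw (- (n - 1))%Z = 0) by (apply eta_w; lia).
    rewrite H3, H4. zc. rewrite ?Cplus_conj, ?Cmult_conj, ?Cconj_conj, ?Cconj_R. ring.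
Qed.

End Solution.

(** * The defining function and its conormal bundle *)

(** In real coordinates the Wirtinger derivatives reduce to derivatives of one-variable
    polynomials. *)
Lemma rho_poly lam (x y a b : R) :
  rho lam ((x, y), (a, b)) = x ^ 2 + y ^ 2 + (a ^ 2 + b ^ 2)
    - lam * ((((x ^ 2 - y ^ 2) ^ 2 - 4 * x ^ 2 * y ^ 2) * (a ^ 2 - b ^ 2))
             + 8 * (x ^ 2 - y ^ 2) * x * y * a * b) - 1.
Proof.
  unfold rho. rewrite !Cmod2_alt. simpl. ring.
Qed.

Lemma wirt_z_rho lam z w :
  wirt_z (rho lam) (z, w) = (Cconj z - 2 * RtoC lam * (z * z * z) * (Cconj w * Cconj w))%C.
Proof.
  destruct z as [x y], w as [a b]. unfold wirt_z.
  set (D1 := Derive _ 0). set (D2 := Derive _ 0).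
  assert (H1 : D1 = 2 * x - lam * ((4 * (x ^ 2 - y ^ 2) * x - 8 * x * y ^ 2) * (a ^ 2 - b ^ 2) + 8 * (3 * x ^ 2 - y ^ 2) * y * a * b)).
  { unfold D1. rewrite (Derive_ext _ (fun t => rho lam ((x + t, y), (a, b)))).
    2:{ intros t. f_equal. unfold Cplus; simpl. rewrite Rplus_0_r. reflexivity. }
    erewrite Derive_ext by (intros t; apply rho_poly).
    apply is_derive_unique. auto_derive; [trivial|]. simpl. ring. }
  assert (H2 : D2 = 2 * y - lam * ((- 4 * (x ^ 2 - y ^ 2) * y - 8 * x ^ 2 * y) * (a ^ 2 - b ^ 2) + 8 * (x ^ 2 - 3 * y ^ 2) * x * a * b)).
  { unfold D2. rewrite (Derive_ext _ (fun t => rho lam ((x, y + t), (a, b)))).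
    2:{ intros t. f_equal. unfold Cplus, Cmult; simpl. f_equal. f_equal; ring. }
    erewrite Derive_ext by (intros t; apply rho_poly).
    apply is_derive_unique. auto_derive; [trivial|]. simpl. ring. }
  rewrite H1, H2. apply C_eq; simpl; field.
Qed.

Lemma wirt_w_rho lam z w :
  wirt_w (rho lam) (z, w) = (Cconj w - RtoC lam * (Cconj z * Cconj z * (Cconj z * Cconj z)) * w)%C.
Proof.
  destruct z as [x y], w as [a b]. unfold wirt_w.
  set (D1 := Derive _ 0). set (D2 := Derive _ 0).
  assert (H1 : D1 = 2 * a - lam * ((((x ^ 2 - y ^ 2) ^ 2 - 4 * x ^ 2 * y ^ 2) * 2 * a) + 8 * (x ^ 2 - y ^ 2) * x * y * b)).
  { unfold D1. rewrite (Derive_ext _ (fun t => rho lam ((x, y), (a + t, b)))).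
    2:{ intros t. f_equal. unfold Cplus; simpl. rewrite Rplus_0_r. reflexivity. }
    erewrite Derive_ext by (intros t; apply rho_poly).
    apply is_derive_unique. auto_derive; [trivial|]. simpl. ring. }
  assert (H2 : D2 = 2 * b - lam * ((((x ^ 2 - y ^ 2) ^ 2 - 4 * x ^ 2 * y ^ 2) * (- 2 * b)) + 8 * (x ^ 2 - y ^ 2) * x * y * a)).
  { unfold D2. rewrite (Derive_ext _ (fun t => rho lam ((x, y), (a, b + t)))).
    2:{ intros t. f_equal. unfold Cplus, Cmult; simpl. f_equal. f_equal; ring. }
    erewrite Derive_ext by (intros t; apply rho_poly).
    apply is_derive_unique. auto_derive; [trivial|]. simpl. ring. }
  rewrite H1, H2. apply C_eq; simpl; field.
Qed.

Lemma rho_C lam z w : RtoC (rho lam (z, w)) =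
  (z * Cconj z + w * Cconj w
   - RtoC lam * ((Cconj z ^ 4 * w ^ 2 + z ^ 4 * Cconj w ^ 2) / 2) - 1)%C.
Proof.
  unfold rho. cbv zeta. cbn [fst snd].
  rewrite !RtoC_minus, RtoC_plus, !Cmod2_conj, RtoC_mult, re_alt.
  rewrite !Cmult_conj, !Cconj_conj. simpl Cpow. field.
Qed.

(* [NM (rho lam) ze] in the unknowns [p, w, d, u, v]. *)
Definition sysp lam (ze p w : C) : Prop :=
  (p + Cconj p = - p * Cconj p - w * Cconj w
     + RtoC lam * ((Cconj ze ^ 4 * (1 + Cconj p) ^ 4 * w ^ 2 + ze ^ 4 * (1 + p) ^ 4 * Cconj w ^ 2) / 2))%C.
Definition sysu lam (ze p w : C) (d : R) (u : C) : Prop :=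
  (u + RtoC d - Cconj p = - RtoC d * u - 2 * RtoC lam * ze ^ 4 * (1 + p) ^ 3 * Cconj w ^ 2)%C.
Definition sysv lam (ze p w : C) (d : R) (v : C) : Prop :=
  (v - ze * Cconj w + RtoC lam * Cconj ze ^ 3 * w
     = - RtoC d * v - RtoC lam * Cconj ze ^ 3 * ((1 + Cconj p) ^ 4 - 1) * w)%C.

Lemma RtoC_neq0 (r : R) : r <> 0 -> RtoC r <> 0.
Proof. intros H h; apply RtoC_inj in h; auto. Qed.

(** Taking the multiplier as 1/(1 + d) places it on the side of the conormal components, where it
    enters only through the quadratic terms d u and d v. *)
Lemma NM_of_sys lam ze p w d u v : (ze * Cconj ze = 1)%C ->
  sysp lam ze p w -> sysu lam ze p w d u -> sysv lam ze p w d v -> 1 + d <> 0 -> (1 + u <> 0)%C ->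
  NM (rho lam) ze ((ze * (1 + p), w), (1 + u, v))%C.
Proof.
  intros Hz Hp Hu Hv Hd H1u. assert (Hd' : (1 + RtoC d <> 0)%C).
  { rewrite <- RtoC_plus. now apply RtoC_neq0. }
  unfold NM. cbn [fst snd]. split; [|split].
  - unfold in_M. apply RtoC_inj. rewrite rho_C, !Cmult_conj, !Cplus_conj, Cconj_R. unfold sysp in Hp.
    transitivity ((ze * Cconj ze - 1) * (1 + p) * (1 + Cconj p) + ((p + Cconj p) - (- p * Cconj p - w * Cconj w
     + RtoC lam * ((Cconj ze ^ 4 * (1 + Cconj p) ^ 4 * w ^ 2 + ze ^ 4 * (1 + p) ^ 4 * Cconj w ^ 2) / 2))))%C.
    + field.
    + rewrite Hz, Hp. ring.
  - exists (/ (1 + d)). unfold drho, c2cmul. cbn [fst snd]. rewrite wirt_z_rho, wirt_w_rho.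
    rewrite RtoC_inv by exact Hd. rewrite RtoC_plus, !Cmult_conj, !Cplus_conj, Cconj_R.
    assert (Hz3 : (ze * Cconj ze ^ 4 = Cconj ze ^ 3)%C).
    { transitivity ((ze * Cconj ze) * Cconj ze ^ 3)%C; [simpl; ring|]. rewrite Hz; ring. }
    f_equal.
    + unfold sysu in Hu.
      transitivity (/ (1 + RtoC d) * ((1 + RtoC d) * (1 + u)))%C; [field; exact Hd'|].
      replace ((1 + RtoC d) * (1 + u))%C with (1 + Cconj p + (u + RtoC d - Cconj p) + RtoC d * u)%C by ring.
      rewrite Hu.
      replace (1 + Cconj p)%C with ((ze * Cconj ze) * (1 + Cconj p))%C at 1 by (rewrite Hz; ring). simpl. ring.
    + unfold sysv in Hv.
      transitivity (/ (1 + RtoC d) * ((1 + RtoC d) * v))%C; [field; exact Hd'|].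
      replace ((1 + RtoC d) * v)%C with ((v - ze * Cconj w + RtoC lam * Cconj ze ^ 3 * w) + RtoC d * v + ze * Cconj w - RtoC lam * Cconj ze ^ 3 * w)%C by ring.
      rewrite Hv. rewrite <- Hz3. simpl. ring.
  - intros h. apply H1u. exact (f_equal fst h).
Qed.

(** Membership gives zt = c s with [c] real and nonzero, so s / zt is the real number 1/c. The real
    part in the formula for [d] only serves to produce a real number. *)
Lemma sys_of_NM lam (ze z w zt v : C) : (ze * Cconj ze = 1)%C -> (zt <> 0)%C ->
  NM (rho lam) ze ((z, w), (zt, v)) ->
  let p := (Cconj ze * z - 1)%C in
  let d := Re ((1 + Cconj p - 2 * RtoC lam * ze ^ 4 * (1 + p) ^ 3 * Cconj w ^ 2) / zt) - 1 in
  sysp lam ze p w /\ sysu lam ze p w d (zt - 1)%C /\ sysv lam ze p w d v.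
Proof.
  intros Hz Hzt [HM [[c Hc] _]] p d. cbn [fst snd] in *. unfold in_M in HM.
  assert (Ez : z = (ze * (1 + p))%C).
  { unfold p. transitivity ((ze * Cconj ze) * z)%C; [rewrite Hz; ring|ring]. }
  unfold drho, c2cmul in Hc. cbn [fst snd] in Hc. rewrite wirt_z_rho, wirt_w_rho in Hc.
  injection Hc as Hc1 Hc2.
  rewrite Ez, !Cmult_conj, !Cplus_conj, Cconj_R in Hc1, Hc2.
  set (s := (1 + Cconj p - 2 * RtoC lam * ze ^ 4 * (1 + p) ^ 3 * Cconj w ^ 2)%C) in *.
  assert (Hs : zt = (RtoC c * s)%C).
  { rewrite Hc1. unfold s.
    replace (1 + Cconj p)%C with ((ze * Cconj ze) * (1 + Cconj p))%C at 2 by (rewrite Hz; ring). simpl. ring. }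
  assert (Hc0 : c <> 0).
  { intros ->. apply Hzt. rewrite Hs. ring. }
  assert (Hcc : RtoC c <> 0) by now apply RtoC_neq0.
  assert (Hs0 : s <> 0). { intros h. apply Hzt. rewrite Hs, h. ring. }
  assert (Hd : d = / c - 1).
  { unfold d. fold s. rewrite Hs. replace (s / (RtoC c * s))%C with (RtoC (/ c)).
    - reflexivity.
    - rewrite RtoC_inv by exact Hc0. field. now split. }
  rewrite Hd. clearbody d. split; [|split].
  - unfold sysp. assert (H0 : RtoC (rho lam (z, w)) = 0) by now rewrite HM.
    rewrite rho_C, Ez, !Cmult_conj, !Cplus_conj, Cconj_R in H0.
    transitivity ((- p * Cconj p - w * Cconj w
     + RtoC lam * ((Cconj ze ^ 4 * (1 + Cconj p) ^ 4 * w ^ 2 + ze ^ 4 * (1 + p) ^ 4 * Cconj w ^ 2) / 2)) + (0 - (ze * Cconj ze - 1) * (1 + p) * (1 + Cconj p)))%C.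
    2:{ rewrite Hz. ring. }
    rewrite <- H0. field.
  - unfold sysu. rewrite RtoC_minus, RtoC_inv by exact Hc0.
    replace (zt - 1 + (/ RtoC c - 1) - Cconj p)%C with (/ RtoC c * zt - 1 - Cconj p + (1 - / RtoC c) * (zt - 1))%C by ring.
    rewrite Hs at 1. replace (/ RtoC c * (RtoC c * s))%C with s by (field; exact Hcc).
    unfold s. ring.
  - unfold sysv. rewrite RtoC_minus, RtoC_inv by exact Hc0.
    assert (Hz3 : (ze * Cconj ze ^ 4 = Cconj ze ^ 3)%C).
    { transitivity ((ze * Cconj ze) * Cconj ze ^ 3)%C; [simpl; ring|]. rewrite Hz; ring. }
    rewrite <- Hz3.
    replace (- (/ RtoC c - 1) * v)%C with (v - / RtoC c * v)%C by ring.
    assert (Hv : (/ RtoC c * v = ze * (Cconj w - RtoC lam * (Cconj ze * (1 + Cconj p) * (Cconj ze * (1 + Cconj p)) *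
       (Cconj ze * (1 + Cconj p) * (Cconj ze * (1 + Cconj p)))) * w))%C) by (rewrite Hc2; field; exact Hcc).
    rewrite Hv. simpl. ring.
Qed.

(** * From coefficient families to Hölder maps of the disc *)

Lemma C4_eq (u v : C4) : fst (fst u) = fst (fst v) -> snd (fst u) = snd (fst v) ->
  fst (snd u) = fst (snd v) -> snd (snd u) = snd (snd v) -> u = v.
Proof. destruct u as [[a b] [c d]], v as [[a' b'] [c' d']]; simpl. intros -> -> -> ->. reflexivity. Qed.

Ltac c4 := apply C4_eq; cbn [c4minus c4plus c4opp c4rscal c4zero c2plus c2opp c2cmul c2zero fst snd]; try ring.

Lemma c4norm_le_sum u : c4norm u <= Cmod (fst (fst u)) + Cmod (snd (fst u)) + Cmod (fst (snd u)) + Cmod (snd (snd u)).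
Proof.
  unfold c4norm. generalize (Cmod_ge_0 (fst (fst u))) (Cmod_ge_0 (snd (fst u))) (Cmod_ge_0 (fst (snd u))) (Cmod_ge_0 (snd (snd u))).
  generalize (Cmod (fst (fst u))) (Cmod (snd (fst u))) (Cmod (fst (snd u))) (Cmod (snd (snd u))). intros a b c d ? ? ? ?.
  rewrite <- (sqrt_Rsqr (a + b + c + d)) by lra. apply sqrt_le_1; unfold Rsqr; nra.
Qed.

Lemma c4norm_ge u :
  Cmod (fst (fst u)) <= c4norm u /\ Cmod (snd (fst u)) <= c4norm u /\
  Cmod (fst (snd u)) <= c4norm u /\ Cmod (snd (snd u)) <= c4norm u.
Proof.
  destruct u as [[a b] [c d]]. unfold c4norm. cbn [fst snd].
  assert (Hs : forall (x : C) y, Cmod x ^ 2 <= y -> Cmod x <= sqrt y).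
  { intros x y Hxy. rewrite <- (sqrt_pow2 (Cmod x) (Cmod_ge_0 x)). apply sqrt_le_1_alt. exact Hxy. }
  generalize (pow2_ge_0 (Cmod a)) (pow2_ge_0 (Cmod b)) (pow2_ge_0 (Cmod c)) (pow2_ge_0 (Cmod d)). intros.
  repeat split; (apply Hs; lra).
Qed.

Lemma hbound_mono alpha G c d : c <= d -> hbound alpha G c -> hbound alpha G d.
Proof.
  intros Hcd [H1 H2]. split.
  - intros z Hz. generalize (H1 z Hz). lra.
  - intros z w Hz Hw Hzw. apply Rle_trans with (1 := H2 z w Hz Hw Hzw).
    apply Rmult_le_compat_r; [|exact Hcd]. left. apply exp_pos.
Qed.

Lemma hbound_ext alpha G G' c : (forall z, Cmod z <= 1 -> G z = G' z) -> hbound alpha G c -> hbound alpha G' c.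
Proof.
  intros H [H1 H2]. split.
  - intros z Hz. rewrite <- H by assumption. auto.
  - intros z w Hz Hw. rewrite <- !H by assumption. auto.
Qed.

(** Turns Lipschitz into Hölder bounds on the disc: distances there are at most 2, and r <= r^alpha
    when r <= 1. *)
Lemma Rpower_lip alpha r : 0 < alpha < 1 -> 0 < r <= 2 -> r <= 2 * Rpower r alpha.
Proof.
  intros Ha Hr. destruct (Rle_or_lt r 1) as [h|h].
  - assert (r <= Rpower r alpha).
    { rewrite <- (Rpower_1 r) at 1 by lra. unfold Rpower.
      assert (ln r <= 0) by (rewrite <- ln_1; destruct h as [h| ->]; [left; apply ln_increasing; lra|lra]).
      destruct (Req_dec (ln r) 0) as [e|e]; [rewrite e, !Rmult_0_r; lra|].
      left. apply exp_increasing. nra. }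
    assert (0 < Rpower r alpha) by apply exp_pos. lra.
  - assert (1 <= Rpower r alpha).
    { rewrite <- (Rpower_O r) by lra. apply Rle_Rpower; lra. }
    lra.
Qed.

Lemma Cmod_pos_neq (z w : C) : z <> w -> 0 < Cmod (z - w).
Proof.
  intros H. apply Cmod_gt_0. intros h. apply H.
  replace z with ((z - w) + w)%C by ring. rewrite h. ring.
Qed.

Lemma hbound_lip alpha G c : 0 < alpha < 1 -> 0 <= c ->
  (forall z, Cmod z <= 1 -> c4norm (G z) <= c) ->
  (forall z w, Cmod z <= 1 -> Cmod w <= 1 -> c4norm (c4minus (G z) (G w)) <= c * Cmod (z - w)) ->
  hbound alpha G (2 * c).
Proof.
  intros Ha Hc H1 H2. split.
  - intros z Hz. generalize (H1 z Hz). lra.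
  - intros z w Hz Hw Hzw. apply Rle_trans with (1 := H2 z w Hz Hw).
    replace (2 * c * Rpower (Cmod (Cminus z w)) alpha) with (c * (2 * Rpower (Cmod (Cminus z w)) alpha)) by ring.
    apply Rmult_le_compat_l; [exact Hc|]. apply Rpower_lip; [exact Ha|].
    split; [now apply Cmod_pos_neq|]. generalize (Cmod_sub z w). unfold Cminus in *. lra.
Qed.

Lemma c4norm_triangle u v : c4norm (c4plus u v) <= 4 * (c4norm u + c4norm v).
Proof.
  apply Rle_trans with (1 := c4norm_le_sum _).
  destruct (c4norm_ge u) as [? [? [? ?]]]. destruct (c4norm_ge v) as [? [? [? ?]]].
  destruct u as [[a b] [c d]], v as [[a' b'] [c' d']]. cbn [c4plus c2plus fst snd] in *.
  generalize (Cmod_triangle a a') (Cmod_triangle b b') (Cmod_triangle c c') (Cmod_triangle d d'). lra.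
Qed.

(** The deviation from [f0lift], linear in [Y]; the shift appears because z - ze = ze p. The value
    off the closed disc is zero, as the encoding of maps demands. *)
Definition hols (Y : E) (z : C) : C4 :=
  if Rle_dec (Cmod z) 1 then ((hol (sh 1 (Y Ip)) z, hol (Y Iw) z), (hol (Y Iu) z, hol (Y Iv) z)) else c4zero.

Lemma nb_sh1 (Y : E) : nb (sh 1 (Y Ip)) (16 * nrm Y).
Proof.
  assert (H := nb_sh 1 _ _ (nb_norm Y Ip)). unfold wt in H. simpl in H.
  eapply nb_mono; [|exact H]. right. ring.
Qed.

Lemma hols_add Y Z z : hols (Eadd Y Z) z = c4plus (hols Y z) (hols Z z).
Proof.
  unfold hols. destruct (Rle_dec (Cmod z) 1) as [h|h]; [|c4].
  c4; [|eapply hol_sadd; eauto using nb_norm ..].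
  apply (hol_sadd (sh 1 (Y Ip)) (sh 1 (Z Ip)) (16 * nrm Y) (16 * nrm Z)); auto using nb_sh1.
Qed.

Lemma hols_sc r Y z : hols (Esc r Y) z = c4rscal r (hols Y z).
Proof.
  unfold hols. destruct (Rle_dec (Cmod z) 1) as [h|h]; [|c4].
  c4; [|eapply hol_sc; eauto using nb_norm ..].
  apply (hol_sc r (sh 1 (Y Ip)) (16 * nrm Y)); auto using nb_sh1.
Qed.

Lemma hols_sub Y Z z : hols (Esub Y Z) z = c4minus (hols Y z) (hols Z z).
Proof.
  unfold Esub. rewrite hols_add, hols_sc. c4; replace (RtoC (-1)) with (- RtoC 1)%C by (apply C_eq; simpl; ring); ring.
Qed.

(** 152 = 8 (16 + 1 + 1 + 1): the sum of a series costs 8, and the shift by one costs 2^4. Passing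
    from Lipschitz to Hölder later doubles this to 304. *)
Lemma hols_sup Y z : Cmod z <= 1 -> c4norm (hols Y z) <= 152 * nrm Y.
Proof.
  intros Hz. apply Rle_trans with (1 := c4norm_le_sum _). unfold hols.
  destruct (Rle_dec (Cmod z) 1) as [_|n]; [|contradiction]. cbn [fst snd].
  generalize (hol_bound _ _ z (nb_sh1 Y) Hz) (hol_bound _ _ z (nb_norm Y Iw) Hz)
    (hol_bound _ _ z (nb_norm Y Iu) Hz) (hol_bound _ _ z (nb_norm Y Iv) Hz). lra.
Qed.

Lemma hols_lip Y z w : Cmod z <= 1 -> Cmod w <= 1 -> c4norm (c4minus (hols Y z) (hols Y w)) <= 152 * nrm Y * Cmod (z - w).
Proof.
  intros Hz Hw. apply Rle_trans with (1 := c4norm_le_sum _). unfold hols.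
  destruct (Rle_dec (Cmod z) 1) as [_|n]; [|contradiction].
  destruct (Rle_dec (Cmod w) 1) as [_|n]; [|contradiction].
  cbn [c4minus c4plus c4opp c2plus c2opp fst snd].
  generalize (hol_lip _ _ z w (nb_sh1 Y) Hz Hw) (hol_lip _ _ z w (nb_norm Y Iw) Hz Hw)
    (hol_lip _ _ z w (nb_norm Y Iu) Hz Hw) (hol_lip _ _ z w (nb_norm Y Iv) Hz Hw). unfold Cminus. lra.
Qed.

Lemma hols_hbound alpha Y c : 0 < alpha < 1 -> nrm Y <= c -> hbound alpha (hols Y) (304 * c).
Proof.
  intros Ha Hc. assert (h := norm_ge0 Y).
  apply hbound_mono with (2 * (152 * nrm Y)); [lra|].
  apply hbound_lip; [exact Ha|lra|apply hols_sup|intros; now apply hols_lip].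
Qed.

Lemma cdiff_ext_loc f g z r : 0 < r -> (forall u, Cmod (u - z) < r -> f u = g u) -> cdiff_at f z -> cdiff_at g z.
Proof.
  intros Hr H [l Hl]. exists l. intros eps He. destruct (Hl eps He) as [d [Hd Hd']].
  exists (Rmin d r). split; [now apply Rmin_pos|]. intros h Hh.
  assert (h1 := Rmin_l d r). assert (h2 := Rmin_r d r).
  rewrite <- !H.
  - apply Hd'. lra.
  - replace (z - z)%C with (RtoC 0) by ring. now rewrite Cmod_0.
  - replace (z + h - z)%C with h by ring. lra.
Qed.

Lemma cdiff_plus f g z : cdiff_at f z -> cdiff_at g z -> cdiff_at (fun u => f u + g u)%C z.
Proof.
  intros [l Hl] [m Hm]. exists (l + m)%C. intros eps He.
  destruct (Hl (eps / 2)) as [d1 [Hd1 H1]]; [lra|]. destruct (Hm (eps / 2)) as [d2 [Hd2 H2]]; [lra|].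
  exists (Rmin d1 d2). split; [now apply Rmin_pos|]. intros h Hh.
  assert (h1 := Rmin_l d1 d2). assert (h2 := Rmin_r d1 d2).
  replace (f (z + h) + g (z + h) - (f z + g z) - (l + m) * h)%C with
    ((f (z + h) - f z - l * h) + (g (z + h) - g z - m * h))%C by ring.
  apply Rle_trans with (1 := Cmod_triangle _ _).
  assert (a1 := H1 h ltac:(lra)). assert (a2 := H2 h ltac:(lra)). lra.
Qed.

Lemma cdiff_const c z : cdiff_at (fun _ => c) z.
Proof.
  exists 0. intros eps He. exists 1. split; [lra|]. intros h _.
  replace (c - c - 0 * h)%C with (RtoC 0) by ring. rewrite Cmod_0. generalize (Cmod_ge_0 h); nra.
Qed.

Lemma cdiff_id z : cdiff_at (fun u => u) z.
Proof.
  exists 1. intros eps He. exists 1. split; [lra|]. intros h _.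
  replace (z + h - z - 1 * h)%C with (RtoC 0) by ring. rewrite Cmod_0. generalize (Cmod_ge_0 h); nra.
Qed.

Definition param (Y : E) (z : C) : C4 := c4plus (f0lift z) (hols Y z).

Lemma param_in Y z : Cmod z <= 1 ->
  param Y z = ((z + hol (sh 1 (Y Ip)) z, 0 + hol (Y Iw) z), (1 + hol (Y Iu) z, 0 + hol (Y Iv) z))%C.
Proof.
  intros Hz. unfold param, f0lift, hols. destruct (Rle_dec (Cmod z) 1); [reflexivity|contradiction].
Qed.

Lemma disc_nbhd z u : Cmod (u - z) < 1 - Cmod z -> Cmod u <= 1.
Proof. intros H. replace u with ((u - z) + z)%C by ring. generalize (Cmod_triangle (u - z) z). lra. Qed.

Lemma param_InA alpha Y : 0 < alpha < 1 -> InA alpha (param Y).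
Proof.
  intros Ha. split; [|split].
  - intros z Hz. unfold param, f0lift, hols. destruct (Rle_dec (Cmod z) 1); [lra|]. c4.
  - intros z Hz.
    repeat split.
    + apply cdiff_ext_loc with (f := fun u => (u + hol (sh 1 (Y Ip)) u)%C) (r := 1 - Cmod z); [lra| |].
      * intros u Hu. rewrite param_in by now apply disc_nbhd with z. reflexivity.
      * apply cdiff_plus; [apply cdiff_id|apply hol_cdiff with (1 := nb_sh1 Y); exact Hz].
    + apply cdiff_ext_loc with (f := fun u => (0 + hol (Y Iw) u)%C) (r := 1 - Cmod z); [lra| |].
      * intros u Hu. rewrite param_in by now apply disc_nbhd with z. reflexivity.
      * apply cdiff_plus; [apply cdiff_const|apply hol_cdiff with (1 := nb_norm Y Iw); exact Hz].
    + apply cdiff_ext_loc with (f := fun u => (1 + hol (Y Iu) u)%C) (r := 1 - Cmod z); [lra| |].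
      * intros u Hu. rewrite param_in by now apply disc_nbhd with z. reflexivity.
      * apply cdiff_plus; [apply cdiff_const|apply hol_cdiff with (1 := nb_norm Y Iu); exact Hz].
    + apply cdiff_ext_loc with (f := fun u => (0 + hol (Y Iv) u)%C) (r := 1 - Cmod z); [lra| |].
      * intros u Hu. rewrite param_in by now apply disc_nbhd with z. reflexivity.
      * apply cdiff_plus; [apply cdiff_const|apply hol_cdiff with (1 := nb_norm Y Iv); exact Hz].
  - assert (h := norm_ge0 Y). exists (2 * (8 + 4 * (152 * nrm Y))).
    assert (Hf0 : forall u : C, Cmod u <= 2 -> forall v, Cmod v <= 1 -> c4norm ((u, RtoC 0), (v, RtoC 0)) <= Cmod u + Cmod v).
    { intros u _ v _. apply Rle_trans with (1 := c4norm_le_sum _). simpl. rewrite !Cmod_0. lra. }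
    apply hbound_lip; [exact Ha|lra| |].
    + intros z Hz. unfold param. apply Rle_trans with (1 := c4norm_triangle _ _).
      assert (h1 := hols_sup Y z Hz). assert (h2 : c4norm (f0lift z) <= 2); [|lra].
      unfold f0lift. destruct (Rle_dec (Cmod z) 1); [|contradiction].
      apply Rle_trans with (Cmod z + Cmod 1); [apply Hf0; [lra|rewrite Cmod_1; lra]|rewrite Cmod_1; lra].
    + intros z w Hz Hw. replace (c4minus (param Y z) (param Y w)) with
        (c4plus (c4minus (f0lift z) (f0lift w)) (c4minus (hols Y z) (hols Y w))) by (unfold param; c4).
      apply Rle_trans with (1 := c4norm_triangle _ _).
      assert (h1 := hols_lip Y z w Hz Hw). assert (h2 : c4norm (c4minus (f0lift z) (f0lift w)) <= Cmod (z - w)).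
      2:{ generalize (Cmod_ge_0 (z - w)). nra. }
      unfold f0lift. destruct (Rle_dec (Cmod z) 1); [|contradiction]. destruct (Rle_dec (Cmod w) 1); [|contradiction].
      apply Rle_trans with (1 := c4norm_le_sum _).
      cbn [c4minus c4plus c4opp c2plus c2opp fst snd].
      replace (0 + - 0)%C with (RtoC 0) by ring. replace (1 + - (1))%C with (RtoC 0) by ring. rewrite Cmod_0.
      unfold Cminus; lra.
Qed.

Ltac cpush := repeat first [rewrite Cplus_conj | rewrite Cminus_conj | rewrite Cmult_conj | rewrite Copp_conj
  | rewrite Cpow_conj | rewrite Cconj_conj | rewrite Cconj_R].

(** * Stationarity of the constructed discs *)

Section Stationary.
Variables (lam : R) (x : Rn 8) (Y : E).
Hypothesis Hlam : 1 - lam ^ 2 <> 0.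
Hypothesis HY : Y = Eadd (eta lam x) (Bop lam Y Y).
Hypothesis Hsmall : 8 * nrm Y < 1.

Let N := nb_norm Y.
Let HYi i : (forall n, etaraw lam x i n = 0) -> Y i = Braw lam Y Y i.
Proof.
  intros H. apply functional_extensionality; intros n. rewrite HY at 1. cbn. unfold sadd. rewrite H. ring.
Qed.

Lemma cis4 t : cis (4 * t) = (cis t ^ 4)%C.
Proof. rewrite cis_pow. f_equal. simpl; ring. Qed.
Lemma cis_m4 t : cis (-4 * t) = (Cconj (cis t) ^ 4)%C.
Proof. replace (-4 * t) with (- (4 * t)) by ring. rewrite cis_opp, cis4, Cpow_conj. reflexivity. Qed.
Lemma cis_m3 t : cis (-3 * t) = (Cconj (cis t) ^ 3)%C.
Proof. replace (-3 * t) with (- (3 * t)) by ring. rewrite cis_opp, <- Cpow_conj, cis_pow. do 2 f_equal. simpl; ring. Qed.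

Ltac nbt := repeat first [apply N | apply nb_sadd | apply nb_sc | apply nb_cj | apply nb_sh | apply nb_conv].
Ltac evs := repeat first
  [ erewrite ev_sadd by nbt | erewrite ev_sc by nbt | erewrite ev_cj by nbt | erewrite ev_sh by nbt | erewrite ev_conv by nbt ].

(** With q = conj p, the geometric sum ((1+q)^k - 1) w = q (sum over j < k of (1+q)^j w), together
    with (1+q)^j w = w + r_j, turns the equations for [I1], [I2], [I3] into the intended closed
    forms; [e3] uses the same identity for k = 4. *)
Let r1 t : ev (Y I1) t = (Cconj (ev (Y Ip) t) * ev (Y Iw) t)%C.
Proof. rewrite (HYi I1) by reflexivity. cbn [Braw]. evs. reflexivity. Qed.
Let r2 t : ev (Y I2) t = ((1 + Cconj (ev (Y Ip) t)) ^ 2 * ev (Y Iw) t - ev (Y Iw) t)%C.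
Proof. rewrite (HYi I2) by reflexivity. cbn [Braw]. evs. rewrite r1. simpl. ring. Qed.
Let r3 t : ev (Y I3) t = ((1 + Cconj (ev (Y Ip) t)) ^ 3 * ev (Y Iw) t - ev (Y Iw) t)%C.
Proof. rewrite (HYi I3) by reflexivity. cbn [Braw]. evs. rewrite r1, r2. simpl. ring. Qed.

Lemma sol_sysp t : sysp lam (cis t) (ev (Y Ip) t) (ev (Y Iw) t).
Proof.
  unfold sysp. assert (h := sol_p lam x Y HY). apply (f_equal (fun a => ev a t)) in h.
  unfold e1, q1 in h. revert h. evs. rewrite r2, cis_m4. intros ->.
  rewrite RtoC_div by lra.
  replace (RtoC (-1)) with (- RtoC 1)%C by (apply C_eq; simpl; ring).
  cpush.
  simpl. field.
Qed.

Lemma d_real t : ev (Y Id) t = RtoC (Re (ev (Y Id) t)).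
Proof.
  assert (h := sol_d_real lam x Y HY). apply (f_equal (fun a => ev a t)) in h. revert h. evs. intros h.
  apply C_eq; [reflexivity|]. apply (f_equal Im) in h. simpl in h. simpl. lra.
Qed.

Lemma sol_sysu t : sysu lam (cis t) (ev (Y Ip) t) (ev (Y Iw) t) (Re (ev (Y Id) t)) (ev (Y Iu) t).
Proof.
  unfold sysu. rewrite <- d_real. assert (h := sol_u lam x Y HY). apply (f_equal (fun a => ev a t)) in h.
  unfold e2 in h. revert h. evs. rewrite r1, r2, cis4. intros h.
  transitivity (ev (Y Iu) t + ev (Y Id) t - Cconj (ev (Y Ip) t))%C; [ring|]. rewrite h.
  replace (RtoC (-1)) with (- RtoC 1)%C by (apply C_eq; simpl; ring).
  replace (RtoC (-2 * lam)) with (- (2 * RtoC lam))%C by (apply C_eq; simpl; ring).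
  cpush.
  simpl. ring.
Qed.

Lemma sol_sysv t : sysv lam (cis t) (ev (Y Ip) t) (ev (Y Iw) t) (Re (ev (Y Id) t)) (ev (Y Iv) t).
Proof.
  unfold sysv. rewrite <- d_real. assert (h := sol_v lam x Y Hlam HY). apply (f_equal (fun a => ev a t)) in h.
  unfold e3 in h. revert h. evs. rewrite r1, r2, r3, cis_m3, Rmult_1_l. intros h.
  rewrite h at 1.
  replace (RtoC (-1)) with (- RtoC 1)%C by (apply C_eq; simpl; ring).
  rewrite RtoC_opp. simpl. ring.
Qed.

Lemma sol_onesided :
  (forall n, (n < 0)%Z -> sh 1 (Y Ip) n = 0) /\ (forall n, (n < 0)%Z -> Y Iw n = 0) /\
  (forall n, (n < 0)%Z -> Y Iu n = 0) /\ (forall n, (n < 0)%Z -> Y Iv n = 0).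
Proof.
  repeat split; intros n Hn.
  - unfold sh. apply sol_p_neg with (1 := HY). lia.
  - apply sol_w_neg with (1 := HY). lia.
  - apply sol_u_neg with (1 := HY). lia.
  - apply sol_v_neg with (1 := HY). lia.
Qed.

Lemma param_cis t : param Y (cis t) =
  ((cis t * (1 + ev (Y Ip) t), ev (Y Iw) t), (1 + ev (Y Iu) t, ev (Y Iv) t))%C.
Proof.
  rewrite param_in by (rewrite Cmod_cis; lra).
  destruct sol_onesided as [h1 [h2 [h3 h4]]].
  rewrite (hol_ev _ t h1), (hol_ev _ t h2), (hol_ev _ t h3), (hol_ev _ t h4). evs. rewrite Rmult_1_l.
  c4.
Qed.

Lemma Cmod_lt1_neq (u : C) : Cmod u < 1 -> (1 + u <> 0)%C.
Proof.
  intros H h. assert (e : (u = - (1))%C) by (replace u with ((1 + u) - 1)%C by ring; rewrite h; ring).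
  rewrite e, Cmod_m1 in H. lra.
Qed.

Lemma cis_surj z : Cmod z = 1 -> exists t, z = cis t.
Proof.
  intros H. destruct z as [a b]. assert (H2 : a ^ 2 + b ^ 2 = 1).
  { assert (h := Cmod2_alt (a, b)). rewrite H in h. simpl in *. lra. }
  assert (Ha : -1 <= a <= 1) by nra.
  destruct (Rle_or_lt 0 b) as [hb|hb].
  - exists (acos a). unfold cis. rewrite cos_acos, sin_acos by lra. f_equal.
    symmetry. apply sqrt_lem_1; unfold Rsqr; nra.
  - exists (- acos a). unfold cis. rewrite cos_neg, sin_neg, cos_acos, sin_acos by lra. f_equal.
    replace b with (- (- b)) by ring. f_equal. symmetry. apply sqrt_lem_1; unfold Rsqr; nra.
Qed.

(** Smallness of [Y] makes |d| and |u| less than 1 on the circle: the multiplier 1/(1 + d) exists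
    and the conormal component 1 + u does not vanish. *)
Lemma param_stationary : stationary_lift (rho lam) (param Y).
Proof.
  intros z Hz. destruct (cis_surj z Hz) as [t ->]. rewrite param_cis.
  assert (hb : forall i, Cmod (ev (Y i) t) < 1).
  { intros i. apply Rle_lt_trans with (1 := ev_bound _ _ t (N i)). exact Hsmall. }
  apply NM_of_sys with (d := Re (ev (Y Id) t)).
  - apply cis_conj.
  - apply sol_sysp.
  - apply sol_sysu.
  - apply sol_sysv.
  - assert (h := hb Id). assert (h' := re_le_Cmod (ev (Y Id) t)). apply Rabs_le_between in h'. lra.
  - apply Cmod_lt1_neq, hb.
Qed.

End Stationary.

(** * Integrals of complex-valued functions *)

Definition Ccont (f : R -> C) (t : R) : Prop := continuous (fun t => Re (f t)) t /\ continuous (fun t => Im (f t)) t.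
Definition Cint (f : R -> C) (a b : R) : C := (RInt (fun t => Re (f t)) a b, RInt (fun t => Im (f t)) a b).

Lemma Ccont_ex_Re f a b : (forall t, Ccont f t) -> ex_RInt (fun t => Re (f t)) a b.
Proof. intros H. apply (@ex_RInt_continuous R_CompleteNormedModule). intros t _. apply H. Qed.
Lemma Ccont_ex_Im f a b : (forall t, Ccont f t) -> ex_RInt (fun t => Im (f t)) a b.
Proof. intros H. apply (@ex_RInt_continuous R_CompleteNormedModule). intros t _. apply H. Qed.

Lemma Cint_plus f g a b : (forall t, Ccont f t) -> (forall t, Ccont g t) ->
  Cint (fun t => f t + g t)%C a b = (Cint f a b + Cint g a b)%C.
Proof.
  intros Hf Hg. apply C_eq; simpl.
  - apply (RInt_plus (V := R_CompleteNormedModule)); now apply Ccont_ex_Re.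
  - apply (RInt_plus (V := R_CompleteNormedModule)); now apply Ccont_ex_Im.
Qed.

Lemma RInt_lin (u v : R -> R) p q a b : ex_RInt u a b -> ex_RInt v a b ->
  RInt (fun t => p * u t + q * v t) a b = p * RInt u a b + q * RInt v a b.
Proof.
  intros Hu Hv. apply is_RInt_unique.
  apply (is_RInt_plus (V := R_NormedModule) (fun t => scal p (u t)) (fun t => scal q (v t)));
  apply (is_RInt_scal (V := R_NormedModule)); apply (RInt_correct (V := R_CompleteNormedModule)); assumption.
Qed.

Lemma Cint_scal c f a b : (forall t, Ccont f t) -> Cint (fun t => c * f t)%C a b = (c * Cint f a b)%C.
Proof.
  intros Hf. assert (HR := Ccont_ex_Re f a b Hf). assert (HI := Ccont_ex_Im f a b Hf).
  apply C_eq; simpl.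
  - rewrite <- (Rmult_1_l (fst c * _ - _)).
    rewrite (RInt_ext _ (fun t => fst c * Re (f t) + (- snd c) * Im (f t))).
    + rewrite RInt_lin by assumption. ring.
    + intros; unfold Re, Im; simpl; ring.
  - rewrite (RInt_ext _ (fun t => fst c * Im (f t) + snd c * Re (f t))).
    + rewrite RInt_lin by assumption. reflexivity.
    + intros; unfold Re, Im; simpl; ring.
Qed.

Lemma Cint_Chasles f a b c : (forall t, Ccont f t) -> (Cint f a b + Cint f b c)%C = Cint f a c.
Proof.
  intros Hf. apply C_eq; simpl.
  - apply (RInt_Chasles (V := R_CompleteNormedModule) (fun t => Re (f t))); now apply Ccont_ex_Re.
  - apply (RInt_Chasles (V := R_CompleteNormedModule) (fun t => Im (f t))); now apply Ccont_ex_Im.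
Qed.

Lemma Cint_ext f g a b : (forall t, Rmin a b < t < Rmax a b -> f t = g t) -> Cint f a b = Cint g a b.
Proof. intros H. apply C_eq; apply RInt_ext; intros t Ht; now rewrite H. Qed.

Lemma RInt_bound (f : R -> R) a b M : a <= b -> (forall t, continuous f t) ->
  (forall t, a <= t <= b -> Rabs (f t) <= M) -> Rabs (RInt f a b) <= M * (b - a).
Proof.
  intros Hab Hc HM. rewrite Rmult_comm.
  apply (abs_RInt_le_const f a b M Hab); [|exact HM].
  apply (@ex_RInt_continuous R_CompleteNormedModule). auto.
Qed.

(** The factor 2 comes from bounding real and imaginary parts separately; no sharp constant is
    required of it. *)
Lemma Cint_bound f a b M : a <= b -> (forall t, Ccont f t) ->
  (forall t, a <= t <= b -> Cmod (f t) <= M) -> Cmod (Cint f a b) <= 2 * (M * (b - a)).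
Proof.
  intros Hab Hc HM. apply Cmod_le_2.
  - apply RInt_bound; [exact Hab|intros; apply Hc|]. intros t Ht. apply Rle_trans with (2 := HM t Ht). apply re_le_Cmod.
  - apply RInt_bound; [exact Hab|intros; apply Hc|]. intros t Ht. apply Rle_trans with (2 := HM t Ht). apply im_le_Cmod.
Qed.

Lemma Ccont_plus f g t : Ccont f t -> Ccont g t -> Ccont (fun t => f t + g t)%C t.
Proof.
  intros [f1 f2] [g1 g2]. split; simpl.
  - apply (continuous_plus (V := R_NormedModule) (fun t => fst (f t)) (fun t => fst (g t))); assumption.
  - apply (continuous_plus (V := R_NormedModule) (fun t => snd (f t)) (fun t => snd (g t))); assumption.
Qed.

Lemma Ccont_mult f g t : Ccont f t -> Ccont g t -> Ccont (fun t => f t * g t)%C t.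
Proof.
  intros [f1 f2] [g1 g2]. unfold Re, Im in *. split; simpl.
  - apply (continuous_minus (V := R_NormedModule) (fun t => fst (f t) * fst (g t)) (fun t => snd (f t) * snd (g t)));
    apply (continuous_mult (K := R_AbsRing)); assumption.
  - apply (continuous_plus (V := R_NormedModule) (fun t => fst (f t) * snd (g t)) (fun t => snd (f t) * fst (g t)));
    apply (continuous_mult (K := R_AbsRing)); assumption.
Qed.

Lemma Ccont_const c t : Ccont (fun _ => c) t.
Proof. split; apply continuous_const. Qed.

Lemma Ccont_conj f t : Ccont f t -> Ccont (fun t => Cconj (f t)) t.
Proof.
  intros [f1 f2]. split; simpl; [exact f1|].
  apply (continuous_opp (V := R_NormedModule) (fun t => snd (f t))). exact f2.
Qed.

Lemma Ccont_ext f g t : (forall t, f t = g t) -> Ccont f t -> Ccont g t.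
Proof. intros H. replace g with f; [auto|]. now apply functional_extensionality. Qed.

Lemma Ccont_eps (f : R -> C) t : (forall eps, 0 < eps -> exists d, 0 < d /\ forall s, Rabs (s - t) < d -> Cmod (f s - f t) <= eps) -> Ccont f t.
Proof.
  intros H.
  assert (G : forall g : R -> R, (forall s, Rabs (g s - g t) <= Cmod (f s - f t)) -> continuous g t).
  { intros g Hg. apply continuity_pt_filterlim. intros eps He.
    destruct (H (eps / 2)) as [d [Hd Hd']]; [lra|]. exists d. split; [exact Hd|].
    intros s [_ Hs]. simpl in *. unfold Rdist in *. apply Rle_lt_trans with (1 := Hg s).
    apply Rle_lt_trans with (1 := Hd' s Hs). lra. }
  split; apply G; intros s.
  - apply (re_le_Cmod (f s - f t)).
  - apply (im_le_Cmod (f s - f t)).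
Qed.

Lemma Ccont_eps_inv (f : R -> C) t : Ccont f t -> forall eps, 0 < eps -> exists d, 0 < d /\ forall s, Rabs (s - t) < d -> Cmod (f s - f t) <= eps.
Proof.
  intros [H1 H2] eps He.
  assert (G : forall g : R -> R, continuous g t -> exists d, 0 < d /\ forall s, Rabs (s - t) < d -> Rabs (g s - g t) <= eps / 2).
  { intros g Hg. apply continuity_pt_filterlim in Hg. destruct (Hg (eps / 2)) as [d [Hd Hd']]; [lra|].
    exists d. split; [exact Hd|]. intros s Hs. destruct (Req_dec t s) as [<-|n].
    - replace (g t - g t) with 0 by ring. rewrite Rabs_R0; lra.
    - left. apply (Hd' s). split; [split; [exact I|exact n]|exact Hs]. }
  destruct (G _ H1) as [d1 [h1 h1']]. destruct (G _ H2) as [d2 [h2 h2']].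
  exists (Rmin d1 d2). split; [now apply Rmin_pos|]. intros s Hs.
  assert (a1 := Rmin_l d1 d2). assert (a2 := Rmin_r d1 d2).
  replace eps with (2 * (eps / 2)) by field.
  apply Cmod_le_2; [apply h1'; lra|apply h2'; lra].
Qed.

Lemma Ceq_minus (p q : C) : (p - q = 0)%C -> p = q.
Proof. intros H. replace p with ((p - q) + q)%C by ring. rewrite H. ring. Qed.

(** * Goursat's theorem *)

Definition cont2 (g : C -> C) (p : C) : Prop :=
  forall eps, 0 < eps -> exists d, 0 < d /\ forall q, Cmod (q - p) < d -> Cmod (g q - g p) <= eps.

Lemma Cmod_pair_x (s s0 t : R) : Cmod ((s, t) - (s0, t)) = Rabs (s - s0).
Proof. replace (Cminus (s, t) (s0, t)) with (RtoC (s - s0)) by (apply C_eq; simpl; ring). apply Cmod_R. Qed.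
Lemma Cmod_pair_y (s t t0 : R) : Cmod ((s, t) - (s, t0)) = Rabs (t - t0).
Proof.
  replace (Cminus (s, t) (s, t0)) with (Ci * RtoC (t - t0))%C by (apply C_eq; simpl; ring).
  rewrite Cmod_mult, Cmod_R, Cmod_Ci. ring.
Qed.

Lemma cont2_x g y : (forall p, cont2 g p) -> forall t, Ccont (fun x => g (x, y)) t.
Proof.
  intros H t. apply Ccont_eps. intros eps He. destruct (H (t, y) eps He) as [d [Hd Hd']].
  exists d. split; [exact Hd|]. intros s Hs. apply Hd'. now rewrite Cmod_pair_x.
Qed.
Lemma cont2_y g x : (forall p, cont2 g p) -> forall t, Ccont (fun y => g (x, y)) t.
Proof.
  intros H t. apply Ccont_eps. intros eps He. destruct (H (x, t) eps He) as [d [Hd Hd']].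
  exists d. split; [exact Hd|]. intros s Hs. apply Hd'. now rewrite Cmod_pair_y.
Qed.

(** The integral of g(z) dz along the boundary of the rectangle [a, b] x [c, d],
    counterclockwise. *)
Definition rint (g : C -> C) (a b c d : R) : C :=
  (Cint (fun x => g (x, c)) a b + Ci * Cint (fun y => g (b, y)) c d
   - Cint (fun x => g (x, d)) a b - Ci * Cint (fun y => g (a, y)) c d)%C.

Lemma rint_split4 g a b c d m n : (forall p, cont2 g p) ->
  rint g a b c d = (rint g a m c n + rint g m b c n + rint g a m n d + rint g m b n d)%C.
Proof.
  intros H. unfold rint.
  rewrite <- (Cint_Chasles (fun x => g (x, c)) a m b) by now apply cont2_x.
  rewrite <- (Cint_Chasles (fun x => g (x, d)) a m b) by now apply cont2_x.
  rewrite <- (Cint_Chasles (fun y => g (a, y)) c n d) by now apply cont2_y.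
  rewrite <- (Cint_Chasles (fun y => g (b, y)) c n d) by now apply cont2_y.
  ring.
Qed.

Lemma Cint_lin_x (A B : C) a b y :
  Cint (fun x => A + B * (x, y))%C a b = (A * RtoC (b - a) + B * ((RtoC ((b ^ 2 - a ^ 2) / 2)) + Ci * RtoC (y * (b - a))))%C.
Proof.
  assert (HR : forall k l, RInt (fun x => k + l * x) a b = k * (b - a) + l * ((b ^ 2 - a ^ 2) / 2)).
  { intros k l. apply is_RInt_unique.
    replace (k * (b - a) + l * ((b ^ 2 - a ^ 2) / 2)) with
      (minus (k * b + l * (b ^ 2 / 2)) (k * a + l * (a ^ 2 / 2))).
    2:{ unfold minus, plus, opp; simpl. field. }
    apply (is_RInt_derive (V := R_CompleteNormedModule) (fun x => k * x + l * (x ^ 2 / 2))).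
    - intros x _. auto_derive; [trivial|]. field.
    - intros x _. apply continuity_pt_filterlim. reg. }
  destruct A as [a1 a2], B as [b1 b2]. apply C_eq; simpl.
  - rewrite (RInt_ext _ (fun x => (a1 - b2 * y) + b1 * x)). rewrite HR. field.
    intros; simpl; ring.
  - rewrite (RInt_ext _ (fun x => (a2 + b1 * y) + b2 * x)). rewrite HR. field.
    intros; simpl; ring.
Qed.

Lemma Cint_lin_y (A B : C) c d x :
  Cint (fun y => A + B * (x, y))%C c d = (A * RtoC (d - c) + B * ((RtoC (x * (d - c))) + Ci * RtoC ((d ^ 2 - c ^ 2) / 2)))%C.
Proof.
  assert (HR : forall k l, RInt (fun x => k + l * x) c d = k * (d - c) + l * ((d ^ 2 - c ^ 2) / 2)).
  { intros k l. apply is_RInt_unique.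
    replace (k * (d - c) + l * ((d ^ 2 - c ^ 2) / 2)) with
      (minus (k * d + l * (d ^ 2 / 2)) (k * c + l * (c ^ 2 / 2))).
    2:{ unfold minus, plus, opp; simpl. field. }
    apply (is_RInt_derive (V := R_CompleteNormedModule) (fun x => k * x + l * (x ^ 2 / 2))).
    - intros t _. auto_derive; [trivial|]. field.
    - intros t _. apply continuity_pt_filterlim. reg. }
  destruct A as [a1 a2], B as [b1 b2]. apply C_eq; simpl.
  - rewrite (RInt_ext _ (fun y => (a1 + b1 * x) + (- b2) * y)). rewrite HR. field.
    intros; simpl; ring.
  - rewrite (RInt_ext _ (fun y => (a2 + b2 * x) + b1 * y)). rewrite HR. field.
    intros; simpl; ring.
Qed.

Lemma rint_lin A B a b c d : rint (fun p => A + B * p)%C a b c d = 0.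
Proof.
  unfold rint. rewrite !Cint_lin_x, !Cint_lin_y. destruct A as [a1 a2], B as [b1 b2].
  apply C_eq; simpl; field.
Qed.

Lemma cont2_lin A B p : cont2 (fun q => A + B * q)%C p.
Proof.
  intros eps He. assert (h := Cmod_ge_0 B). exists (eps / (Cmod B + 1)). split; [apply Rdiv_lt_0_compat; lra|].
  intros q Hq. replace (A + B * q - (A + B * p))%C with (B * (q - p))%C by ring. rewrite Cmod_mult.
  apply Rle_trans with ((Cmod B + 1) * (eps / (Cmod B + 1))).
  - apply Rmult_le_compat; try apply Cmod_ge_0; lra.
  - right; field; lra.
Qed.

Lemma cont2_sub g h p : cont2 g p -> cont2 h p -> cont2 (fun q => g q - h q)%C p.
Proof.
  intros Hg Hh eps He. destruct (Hg (eps / 2)) as [d1 [h1 h1']]; [lra|]. destruct (Hh (eps / 2)) as [d2 [h2 h2']]; [lra|].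
  exists (Rmin d1 d2). split; [now apply Rmin_pos|]. intros q Hq.
  assert (a1 := Rmin_l d1 d2). assert (a2 := Rmin_r d1 d2).
  replace (g q - h q - (g p - h p))%C with ((g q - g p) - (h q - h p))%C by ring.
  apply Rle_trans with (1 := Cmod_sub _ _). generalize (h1' q ltac:(lra)) (h2' q ltac:(lra)). lra.
Qed.

Lemma Cint_minus f g a b : (forall t, Ccont f t) -> (forall t, Ccont g t) ->
  Cint (fun t => f t - g t)%C a b = (Cint f a b - Cint g a b)%C.
Proof.
  intros Hf Hg. rewrite (Cint_ext _ (fun t => f t + (- (1)) * g t)%C) by (intros; ring).
  rewrite (Cint_plus f (fun t => (- (1)) * g t)%C).
  - rewrite (Cint_scal (- (1)) g) by assumption. ring.
  - assumption.
  - intros t. apply Ccont_mult; [apply Ccont_const|apply Hg].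
Qed.

Lemma rint_bound g a b c d M : a <= b -> c <= d -> (forall p, cont2 g p) ->
  (forall x y, a <= x <= b -> c <= y <= d -> Cmod (g (x, y)) <= M) ->
  Cmod (rint g a b c d) <= 4 * M * ((b - a) + (d - c)).
Proof.
  intros Hab Hcd Hg HM. unfold rint.
  assert (H1 : Cmod (Cint (fun x => g (x, c)) a b) <= 2 * (M * (b - a))).
  { apply Cint_bound; [exact Hab|now apply cont2_x|]. intros; apply HM; lra. }
  assert (H2 : Cmod (Ci * Cint (fun y => g (b, y)) c d) <= 2 * (M * (d - c))).
  { rewrite Cmod_mult, Cmod_Ci, Rmult_1_l. apply Cint_bound; [exact Hcd|now apply cont2_y|]. intros; apply HM; lra. }
  assert (H3 : Cmod (Cint (fun x => g (x, d)) a b) <= 2 * (M * (b - a))).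
  { apply Cint_bound; [exact Hab|now apply cont2_x|]. intros; apply HM; lra. }
  assert (H4 : Cmod (Ci * Cint (fun y => g (a, y)) c d) <= 2 * (M * (d - c))).
  { rewrite Cmod_mult, Cmod_Ci, Rmult_1_l. apply Cint_bound; [exact Hcd|now apply cont2_y|]. intros; apply HM; lra. }
  eapply Rle_trans; [apply Cmod_sub|]. eapply Rle_trans; [apply Rplus_le_compat_r; apply Cmod_sub|].
  eapply Rle_trans; [do 2 apply Rplus_le_compat_r; apply Cmod_triangle|]. lra.
Qed.

Lemma rint_minus g h a b c d : (forall p, cont2 g p) -> (forall p, cont2 h p) ->
  rint (fun q => g q - h q)%C a b c d = (rint g a b c d - rint h a b c d)%C.
Proof.
  intros Hg Hh. unfold rint.
  rewrite (Cint_minus (fun x => g (x, c)) (fun x => h (x, c))) by (now apply cont2_x).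
  rewrite (Cint_minus (fun x => g (x, d)) (fun x => h (x, d))) by (now apply cont2_x).
  rewrite (Cint_minus (fun y => g (a, y)) (fun y => h (a, y))) by (now apply cont2_y).
  rewrite (Cint_minus (fun y => g (b, y)) (fun y => h (b, y))) by (now apply cont2_y).
  ring.
Qed.

Definition rect : Type := (R * R * R * R)%type.
Definition rint_mod (g : C -> C) (r : rect) : R := let '(a, b, c, d) := r in Cmod (rint g a b c d).
Definition quarter (r r' : rect) : Prop :=
  let '(a, b, c, d) := r in let '(a', b', c', d') := r' in
  (b' - a' = (b - a) / 2 /\ d' - c' = (d - c) / 2 /\ a <= a' /\ b' <= b /\ c <= c' /\ d' <= d).

(** The integral is the sum over the four quarters, so one of them carries at least a quarter of its
    modulus. *)
Lemma rint_quarter g r : (forall p, cont2 g p) ->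
  (let '(a, b, c, d) := r in a <= b /\ c <= d) ->
  exists r', quarter r r' /\ rint_mod g r <= 4 * rint_mod g r'.
Proof.
  destruct r as [[[a b] c] d]. intros Hg [Hab Hcd]. simpl.
  set (m := (a + b) / 2). set (n := (c + d) / 2).
  assert (H := rint_split4 g a b c d m n Hg). apply (f_equal Cmod) in H.
  assert (H1 := Cmod_triangle (rint g a m c n + rint g m b c n + rint g a m n d) (rint g m b n d)).
  assert (H2 := Cmod_triangle (rint g a m c n + rint g m b c n) (rint g a m n d)).
  assert (H3 := Cmod_triangle (rint g a m c n) (rint g m b c n)).
  destruct (Rle_or_lt (Cmod (rint g a b c d)) (4 * Cmod (rint g a m c n))).
  { exists (a, m, c, n). split; [unfold m, n; lra|exact H0]. }
  destruct (Rle_or_lt (Cmod (rint g a b c d)) (4 * Cmod (rint g m b c n))).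
  { exists (m, b, c, n). split; [unfold m, n; lra|exact H4]. }
  destruct (Rle_or_lt (Cmod (rint g a b c d)) (4 * Cmod (rint g a m n d))).
  { exists (a, m, n, d). split; [unfold m, n; lra|exact H5]. }
  exists (m, b, n, d). split; [unfold m, n; lra|]. simpl. lra.
Qed.

(** Bisection: nested rectangles shrink to a point p of the closed rectangle. Near p the function is
    affine up to eps |z - p|, and affine functions have zero boundary integral. *)
Lemma goursat (g : C -> C) (a b c d : R) : a <= b -> c <= d -> (forall p, cont2 g p) ->
  (forall x y, a <= x <= b -> c <= y <= d -> cdiff_at g (x, y)) ->
  rint g a b c d = 0.
Proof.
  intros Hab Hcd Hg Hdiff.
  pose (nxt := fun r : rect => epsilon (inhabits r) (fun r' => quarter r r' /\ rint_mod g r <= 4 * rint_mod g r')).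
  pose (u := fix u n := match n with O => (a, b, c, d) | S k => nxt (u k) end : rect).
  pose (A := fun n => fst (fst (fst (u n)))). pose (B := fun n => snd (fst (fst (u n)))).
  pose (Cc := fun n => snd (fst (u n))). pose (D := fun n => snd (u n)).
  assert (Eu : forall n, u n = (A n, B n, Cc n, D n)).
  { intros n. unfold A, B, Cc, D. destruct (u n) as [[[? ?] ?] ?]. reflexivity. }
  assert (Hu : forall n, A n <= B n /\ Cc n <= D n /\ quarter (u n) (u (S n)) /\ rint_mod g (u n) <= 4 * rint_mod g (u (S n))).
  { assert (G : forall n, A n <= B n /\ Cc n <= D n -> quarter (u n) (u (S n)) /\ rint_mod g (u n) <= 4 * rint_mod g (u (S n))).
    { intros n Hn. change (u (S n)) with (nxt (u n)). unfold nxt.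
      apply (epsilon_spec (inhabits (u n)) (fun r' => quarter (u n) r' /\ rint_mod g (u n) <= 4 * rint_mod g r')).
      apply rint_quarter; [exact Hg|]. rewrite Eu. exact Hn. }
    assert (G2 : forall n, A n <= B n /\ Cc n <= D n).
    { induction n; [split; assumption|]. destruct (G n IHn) as [q _]. rewrite (Eu n), (Eu (S n)) in q. simpl in q. lra. }
    intros n. destruct (G2 n). destruct (G n (G2 n)). auto. }
  assert (Hq : forall n, B (S n) - A (S n) = (B n - A n) / 2 /\ D (S n) - Cc (S n) = (D n - Cc n) / 2 /\
      A n <= A (S n) /\ B (S n) <= B n /\ Cc n <= Cc (S n) /\ D (S n) <= D n).
  { intros n. destruct (Hu n) as [_ [_ [q _]]]. rewrite (Eu n), (Eu (S n)) in q. exact q. }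
  assert (Hmono : forall n k, A n <= A (n + k)%nat /\ B (n + k)%nat <= B n /\ Cc n <= Cc (n + k)%nat /\ D (n + k)%nat <= D n).
  { intros n k. induction k; [rewrite Nat.add_0_r; lra|]. rewrite Nat.add_succ_r. generalize (Hq (n + k)%nat). lra. }
  assert (HAB : forall n m, A n <= B m /\ Cc n <= D m).
  { intros n m. generalize (Hmono n m) (Hmono m n) (Hu (n + m)%nat). rewrite (Nat.add_comm m n). intros. lra. }
  assert (Hlim : exists px py, (forall n, A n <= px <= B n) /\ (forall n, Cc n <= py <= D n)).
  { destruct (completeness (fun x => exists n, x = A n)) as [px [h1 h2]].
    - exists (B 0%nat). intros x [n ->]. apply HAB.
    - now exists (A 0%nat), 0%nat.
    - destruct (completeness (fun x => exists n, x = Cc n)) as [py [h3 h4]].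
      + exists (D 0%nat). intros x [n ->]. apply HAB.
      + now exists (Cc 0%nat), 0%nat.
      + exists px, py. split; intros n; split.
        * apply h1. now exists n.
        * apply h2. intros x [m ->]. apply HAB.
        * apply h3. now exists n.
        * apply h4. intros x [m ->]. apply HAB. }
  destruct Hlim as [px [py [Hpx Hpy]]].
  assert (Hsz : forall n, B n - A n = (b - a) * (/2) ^ n /\ D n - Cc n = (d - c) * (/2) ^ n).
  { induction n; [simpl; unfold A, B, Cc, D; simpl; lra|]. generalize (Hq n). simpl pow. intros. lra. }
  assert (Hbig : forall n, rint_mod g (a, b, c, d) <= 4 ^ n * rint_mod g (u n)).
  { induction n; [simpl; lra|]. apply Rle_trans with (1 := IHn). simpl pow.
    replace (4 * 4 ^ n * rint_mod g (u (S n))) with (4 ^ n * (4 * rint_mod g (u (S n)))) by ring.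
    apply Rmult_le_compat_l; [apply pow_le; lra|]. apply Hu. }
  set (S0 := (b - a) + (d - c)).
  assert (HS0 : 0 <= S0) by (unfold S0; lra).
  assert (Hsmall : forall eps, 0 < eps -> rint_mod g (a, b, c, d) <= eps * (4 * S0 ^ 2)).
  { intros eps He.
    destruct (Hdiff px py) as [l Hl]; [apply (Hpx 0%nat)|apply (Hpy 0%nat)|].
    destruct (Hl eps He) as [del [Hdel Hd]].
    destruct (pow_lt_1_zero (/2)) with (y := del / (S0 + 1)) as [N HN].
    { rewrite Rabs_pos_eq; lra. } { apply Rdiv_lt_0_compat; lra. }
    specialize (HN N (le_n N)). rewrite Rabs_pos_eq in HN by (apply pow_le; lra).
    set (h := (/2) ^ N) in *. assert (Hh : 0 < h) by (apply pow_lt; lra).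
    assert (HSd : S0 * h < del).
    { apply Rle_lt_trans with ((S0 + 1) * h); [nra|].
      replace del with ((S0 + 1) * (del / (S0 + 1))) by (field; lra). apply Rmult_lt_compat_l; lra. }
    set (p := (px, py) : C) in *.
    (* The first-order expansion of [g] at p; subtracting it leaves the boundary integral unchanged
       by [rint_lin]. *)
    pose (L := fun q => ((g p - l * p) + l * q)%C).
    assert (HL : forall q, cont2 L q) by (intros q; apply cont2_lin).
    assert (E1 : rint g (A N) (B N) (Cc N) (D N) = rint (fun q => g q - L q)%C (A N) (B N) (Cc N) (D N)).
    { rewrite rint_minus by assumption. unfold L. rewrite rint_lin. ring. }
    apply Rle_trans with (1 := Hbig N). rewrite (Eu N). unfold rint_mod. rewrite E1.
    destruct (Hsz N) as [z1 z2]. fold h in z1, z2.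
    apply Rle_trans with (4 ^ N * (4 * (eps * (S0 * h)) * ((B N - A N) + (D N - Cc N)))).
    - apply Rmult_le_compat_l; [apply pow_le; lra|].
      apply rint_bound; [apply (HAB N N)|apply (HAB N N)|intros q; apply cont2_sub; auto|].
      intros x y Hx Hy.
      assert (Hmod : Cmod ((x, y) - p) <= S0 * h).
      { apply Rle_trans with (1 := Cmod_le_ReIm _). simpl.
        assert (Rabs (x + - px) <= B N - A N) by (apply Rabs_le; generalize (Hpx N); lra).
        assert (Rabs (y + - py) <= D N - Cc N) by (apply Rabs_le; generalize (Hpy N); lra).
        unfold S0. lra. }
      destruct (Req_dec (Cmod ((x, y) - p)) 0) as [e|e].
      + apply Cmod_eq_0, Ceq_minus in e. rename e into e'.
        rewrite e'. unfold L. replace (g p - (g p - l * p + l * p))%C with (RtoC 0) by ring. rewrite Cmod_0.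
        apply Rmult_le_pos; nra.
      + assert (h0 := Cmod_ge_0 ((x, y) - p)).
        specialize (Hd ((x, y) - p)%C ltac:(lra)).
        assert (Ep : forall q : C, (p + (q - p) = q)%C) by (intros; ring). rewrite Ep in Hd.
        unfold L. replace (g (x, y) - (g p - l * p + l * (x, y)))%C with (g (x, y) - g p - l * ((x, y) - p))%C by ring.
        apply Rle_trans with (1 := Hd). apply Rmult_le_compat_l; lra.
    - rewrite z1, z2.
      (* The perimeter and the distance to p both scale like h = 2^-N, and h^2 exactly compensates
         the factor 4^N lost in the bisection. *)
      assert (E4 : 4 ^ N * (h * h) = 1).
      { unfold h. rewrite <- !Rpow_mult_distr. replace (4 * (/2 * /2)) with 1 by field. apply pow1. }
      right. replace (4 ^ N * (4 * (eps * (S0 * h)) * ((b - a) * h + (d - c) * h))) with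
        ((4 ^ N * (h * h)) * (eps * (4 * S0 * ((b - a) + (d - c))))) by ring.
      rewrite E4. unfold S0. ring. }
  apply Cmod_eq_0. apply Rle_antisym; [|apply Cmod_ge_0].
  apply Rle_eps_mult with (4 * S0 ^ 2). intros n.
  assert (hn := pos_INR n).
  apply Rle_trans with (1 := Hsmall (/ (INR n + 1)) ltac:(apply Rinv_0_lt_compat; lra)). unfold Rdiv. lra.
Qed.

(** * The complex exponential and rules for complex derivatives *)

Definition expC (p : C) : C := (RtoC (exp (Re p)) * cis (Im p))%C.

Lemma Cmod_expC p : Cmod (expC p) = exp (Re p).
Proof. unfold expC. rewrite Cmod_mult, Cmod_cis, Rmult_1_r, Cmod_RtoC_nonneg; [reflexivity|left; apply exp_pos]. Qed.

Lemma expC_plus p q : expC (p + q) = (expC p * expC q)%C.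
Proof.
  unfold expC. destruct p as [a b], q as [c d]. simpl. rewrite exp_plus, cis_plus, RtoC_mult. ring.
Qed.

Lemma lim_small (f : R -> R) l : derivable_pt_lim f 0 l -> forall eps, 0 < eps ->
  exists d, 0 < d /\ forall h, Rabs h < d -> Rabs (f h - f 0 - l * h) <= eps * Rabs h.
Proof.
  intros H eps He. destruct (H eps He) as [d Hd]. exists d. split; [apply cond_pos|]. intros h Hh.
  destruct (Req_dec h 0) as [->|n].
  - replace (f 0 - f 0 - l * 0) with 0 by ring. rewrite Rabs_R0. lra.
  - specialize (Hd h n Hh). rewrite Rplus_0_l in Hd.
    replace (f h - f 0 - l * h) with (((f h - f 0) / h - l) * h) by (field; exact n).
    rewrite Rabs_mult. apply Rmult_le_compat_r; [apply Rabs_pos|lra].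
Qed.

Lemma expC_small eps : 0 < eps -> exists d, 0 < d /\ forall h, Cmod h < d -> Cmod (expC h - 1 - h) <= eps * Cmod h.
Proof.
  (* The bound 1/2 gives exp s <= 3; with it each component of the error is at most 5 e |h|, which
     the bound eps / 20 absorbs. *)
  intros He. set (e := Rmin (1 / 2) (eps / 20)).
  assert (He0 : 0 < e) by (apply Rmin_pos; lra).
  assert (He1 : e <= 1 / 2) by apply Rmin_l. assert (He2 : e <= eps / 20) by apply Rmin_r.
  assert (D1 : derivable_pt_lim exp 0 1) by (generalize (derivable_pt_lim_exp 0); now rewrite exp_0).
  assert (D2 : derivable_pt_lim sin 0 1) by (generalize (derivable_pt_lim_sin 0); now rewrite cos_0).
  assert (D3 : derivable_pt_lim cos 0 0) by (generalize (derivable_pt_lim_cos 0); rewrite sin_0, Ropp_0; auto).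
  destruct (lim_small _ _ D1 e He0) as [d1 [h1 H1]]. destruct (lim_small _ _ D2 e He0) as [d2 [h2 H2]].
  destruct (lim_small _ _ D3 e He0) as [d3 [h3 H3]].
  exists (Rmin (Rmin d1 d2) (Rmin d3 e)). split; [repeat apply Rmin_pos; try assumption; lra|].
  intros [s t] Hh.
  assert (a1 := Rmin_l (Rmin d1 d2) (Rmin d3 e)). assert (a2 := Rmin_r (Rmin d1 d2) (Rmin d3 e)).
  assert (a3 := Rmin_l d1 d2). assert (a4 := Rmin_r d1 d2). assert (a5 := Rmin_l d3 e). assert (a6 := Rmin_r d3 e).
  assert (b1 := re_le_Cmod (s, t)). assert (b2 := im_le_Cmod (s, t)). simpl in b1, b2.
  set (m := Cmod (s, t)) in *.
  specialize (H1 s ltac:(lra)). specialize (H2 t ltac:(lra)). specialize (H3 t ltac:(lra)).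
  rewrite exp_0 in H1. rewrite sin_0 in H2. rewrite cos_0 in H3.
  replace (sin t - 0 - 1 * t) with (sin t - t) in H2 by ring.
  replace (cos t - 1 - 0 * t) with (cos t - 1) in H3 by ring.
  assert (Hm0 : 0 <= m) by apply Cmod_ge_0.
  assert (Pt := Rabs_pos t). assert (Ps := Rabs_pos s).
  assert (Es : e * Rabs s <= e * m) by (apply Rmult_le_compat_l; lra).
  assert (Et : e * Rabs t <= e * m) by (apply Rmult_le_compat_l; lra).
  assert (Em : e * m <= 1 / 2 * m) by (apply Rmult_le_compat_r; lra).
  assert (Pm : 0 <= eps * m) by (apply Rmult_le_pos; lra).
  assert (Ee : e * m <= eps / 20 * m) by (apply Rmult_le_compat_r; lra).
  assert (Hs : Rabs (exp s - 1) <= 2 * m).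
  { replace (exp s - 1) with ((exp s - 1 - 1 * s) + s) by ring. apply Rle_trans with (1 := Rabs_triang _ _). lra. }
  assert (Hs2 : 0 <= exp s <= 3) by (split; [left; apply exp_pos|]; apply Rabs_le_between in Hs; lra).
  apply Rle_trans with (2 * (eps / 2 * m)); [|lra].
  apply Cmod_le_2.
  - simpl. replace (exp s * cos t - 0 * sin t + - (1) + - s) with (exp s * (cos t - 1) + (exp s - 1 - 1 * s)) by ring.
    apply Rle_trans with (1 := Rabs_triang _ _). rewrite Rabs_mult, (Rabs_pos_eq (exp s)) by lra.
    assert (exp s * Rabs (cos t - 1) <= 3 * (e * m)).
    { apply Rmult_le_compat; try lra. apply Rabs_pos. }
    lra.
  - simpl. replace (exp s * sin t + 0 * cos t + - 0 + - t) with (exp s * (sin t - t) + (exp s - 1) * t) by ring.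
    apply Rle_trans with (1 := Rabs_triang _ _). rewrite !Rabs_mult, (Rabs_pos_eq (exp s)) by lra.
    assert (exp s * Rabs (sin t - t) <= 3 * (e * m)).
    { apply Rmult_le_compat; try lra. apply Rabs_pos. }
    assert (Rabs (exp s - 1) * Rabs t <= 2 * m * e).
    { apply Rle_trans with (2 * m * m); [apply Rmult_le_compat; try lra; apply Rabs_pos|]. assert (m * m <= m * e) by (apply Rmult_le_compat_l; lra). lra. }
    lra.
Qed.

Lemma cdiff_expC p : cdiff_at expC p.
Proof.
  exists (expC p). intros eps He.
  assert (Hp : 0 < Cmod (expC p)) by (rewrite Cmod_expC; apply exp_pos).
  destruct (expC_small (eps / Cmod (expC p))) as [d [Hd H]]; [now apply Rdiv_lt_0_compat|].
  exists d. split; [exact Hd|]. intros h [_ Hh].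
  rewrite expC_plus. replace (expC p * expC h - expC p - expC p * h)%C with (expC p * (expC h - 1 - h))%C by ring.
  rewrite Cmod_mult. apply Rle_trans with (Cmod (expC p) * (eps / Cmod (expC p) * Cmod h)).
  - apply Rmult_le_compat_l; [lra|]. now apply H.
  - right; field; lra.
Qed.

Lemma cdiff_cont2 g p : cdiff_at g p -> cont2 g p.
Proof.
  intros [l Hl] eps He. destruct (Hl 1) as [d [Hd H]]; [lra|]. assert (hl := Cmod_ge_0 l).
  exists (Rmin d (eps / (Cmod l + 1))). split; [apply Rmin_pos; [exact Hd|apply Rdiv_lt_0_compat; lra]|].
  intros q Hq. assert (a1 := Rmin_l d (eps / (Cmod l + 1))). assert (a2 := Rmin_r d (eps / (Cmod l + 1))).
  destruct (Req_dec (Cmod (q - p)) 0) as [e|e].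
  - apply Cmod_eq_0, Ceq_minus in e. rewrite e. replace (g p - g p)%C with (RtoC 0) by ring. rewrite Cmod_0. lra.
  - assert (h0 := Cmod_ge_0 (q - p)). specialize (H (q - p)%C ltac:(lra)).
    replace (p + (q - p))%C with q in H by ring.
    replace (g q - g p)%C with ((g q - g p - l * (q - p)) + l * (q - p))%C by ring.
    apply Rle_trans with (1 := Cmod_triangle _ _). rewrite Cmod_mult.
    apply Rle_trans with ((Cmod l + 1) * (eps / (Cmod l + 1))); [|right; field; lra].
    apply Rle_trans with ((Cmod l + 1) * Cmod (q - p)); [lra|]. apply Rmult_le_compat_l; lra.
Qed.

Lemma cdiff_comp f g p : cdiff_at g p -> cdiff_at f (g p) -> cdiff_at (fun q => f (g q)) p.
Proof.
  intros Hg0 [l Hl]. assert (Hgc := cdiff_cont2 _ _ Hg0). destruct Hg0 as [m Hm]. exists (l * m)%C. intros eps He.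
  assert (hl := Cmod_ge_0 l). assert (hm := Cmod_ge_0 m).
  set (e1 := eps / (2 * (Cmod m + 1))). assert (He1 : 0 < e1) by (apply Rdiv_lt_0_compat; lra).
  set (e2 := Rmin 1 (eps / (2 * (Cmod l + 1)))).
  assert (He2 : 0 < e2) by (apply Rmin_pos; [lra|apply Rdiv_lt_0_compat; lra]).
  destruct (Hl e1 He1) as [d1 [Hd1 H1]]. destruct (Hm e2 He2) as [d2 [Hd2 H2]].
  destruct (Hgc (d1 / 2)) as [d3 [Hd3 H3]]; [lra|].
  exists (Rmin d2 d3). split; [now apply Rmin_pos|]. intros h Hh.
  assert (a1 := Rmin_l d2 d3). assert (a2 := Rmin_r d2 d3).
  specialize (H2 h ltac:(lra)). specialize (H3 (p + h)%C). replace (p + h - p)%C with h in H3 by ring.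
  specialize (H3 ltac:(lra)). set (k := (g (p + h)%C - g p)%C) in *.
  assert (hh := Cmod_ge_0 h).
  assert (Hk : Cmod k <= (Cmod m + 1) * Cmod h).
  { replace k with ((k - m * h) + m * h)%C by ring. apply Rle_trans with (1 := Cmod_triangle _ _). rewrite Cmod_mult.
    assert (e2 <= 1) by apply Rmin_l. nra. }
  assert (Hf : Cmod (f (g (p + h)%C) - f (g p) - l * k) <= e1 * Cmod k).
  { destruct (Req_dec (Cmod k) 0) as [e|e].
    - rewrite e. apply Cmod_eq_0 in e. unfold k in e. apply Ceq_minus in e. unfold k. rewrite e.
      replace (f (g p) - f (g p) - l * (g p - g p))%C with (RtoC 0) by ring. rewrite Cmod_0; lra.
    - assert (h0 := Cmod_ge_0 k). specialize (H1 k ltac:(lra)).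
      replace (g p + k)%C with (g (p + h)%C) in H1 by (unfold k; ring). exact H1. }
  replace (f (g (p + h)%C) - f (g p) - l * m * h)%C with ((f (g (p + h)%C) - f (g p) - l * k) + l * (k - m * h))%C by ring.
  apply Rle_trans with (1 := Cmod_triangle _ _). rewrite Cmod_mult.
  apply Rle_trans with (e1 * ((Cmod m + 1) * Cmod h) + (Cmod l + 1) * (eps / (2 * (Cmod l + 1)) * Cmod h)).
  - apply Rplus_le_compat.
    + apply Rle_trans with (1 := Hf). apply Rmult_le_compat_l; lra.
    + apply Rmult_le_compat; try apply Cmod_ge_0; [lra|]. apply Rle_trans with (1 := H2).
      apply Rmult_le_compat_r; [exact hh|apply Rmin_r].
  - right. unfold e1. field. lra.
Qed.

Lemma cdiff_mult f g p : cdiff_at f p -> cdiff_at g p -> cdiff_at (fun q => f q * g q)%C p.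
Proof.
  intros Hf Hg0. assert (Hgc := cdiff_cont2 _ _ Hg0). destruct Hf as [l Hl]. destruct Hg0 as [m Hm].
  exists (l * g p + f p * m)%C. intros eps He.
  assert (hl := Cmod_ge_0 l). assert (hf := Cmod_ge_0 (f p)). assert (hg := Cmod_ge_0 (g p)).
  set (e1 := eps / (3 * (Cmod (g p) + 1))). assert (He1 : 0 < e1) by (apply Rdiv_lt_0_compat; lra).
  set (e2 := eps / (3 * (Cmod (f p) + 1))). assert (He2 : 0 < e2) by (apply Rdiv_lt_0_compat; lra).
  set (e3 := Rmin 1 (eps / (3 * (Cmod l + 1)))).
  assert (He3 : 0 < e3) by (apply Rmin_pos; [lra|apply Rdiv_lt_0_compat; lra]).
  set (e4 := Rmin e1 1). assert (He4 : 0 < e4) by (apply Rmin_pos; lra).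
  destruct (Hl e1 He1) as [d1 [Hd1 H1]]. destruct (Hm e2 He2) as [d2 [Hd2 H2]].
  set (e5 := Rmin 1 (eps / (3 * (Cmod l + e1 + 1)))).
  assert (He5 : 0 < e5) by (apply Rmin_pos; [lra|apply Rdiv_lt_0_compat; lra]).
  destruct (Hgc e5 He5) as [d3 [Hd3 H3]].
  exists (Rmin (Rmin d1 d2) d3). split; [repeat apply Rmin_pos; try assumption; lra|]. intros h Hh.
  assert (a1 := Rmin_l (Rmin d1 d2) d3). assert (a2 := Rmin_r (Rmin d1 d2) d3).
  assert (a3 := Rmin_l d1 d2). assert (a4 := Rmin_r d1 d2).
  specialize (H1 h ltac:(lra)). specialize (H2 h ltac:(lra)).
  specialize (H3 (p + h)%C). replace (p + h - p)%C with h in H3 by ring. specialize (H3 ltac:(lra)).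
  replace (f (p + h)%C * g (p + h)%C - f p * g p - (l * g p + f p * m) * h)%C with
    ((f (p + h)%C - f p - l * h) * g p + f p * (g (p + h)%C - g p - m * h) + (f (p + h)%C - f p) * (g (p + h)%C - g p))%C by ring.
  assert (hh := Cmod_ge_0 h).
  assert (Hfk : Cmod (f (p + h)%C - f p) <= (Cmod l + e1 + 1) * Cmod h).
  { replace (f (p + h)%C - f p)%C with ((f (p + h)%C - f p - l * h) + l * h)%C by ring.
    apply Rle_trans with (1 := Cmod_triangle _ _). rewrite Cmod_mult. nra. }
  apply Rle_trans with (1 := Cmod_triangle _ _). eapply Rle_trans; [apply Rplus_le_compat_r, Cmod_triangle|].
  rewrite !Cmod_mult.
  assert (T1 : Cmod (f (p + h)%C - f p - l * h) * Cmod (g p) <= eps / 3 * Cmod h).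
  { apply Rle_trans with ((e1 * Cmod h) * (Cmod (g p) + 1)); [apply Rmult_le_compat; try apply Cmod_ge_0; lra|].
    right. unfold e1. field. lra. }
  assert (T2 : Cmod (f p) * Cmod (g (p + h)%C - g p - m * h) <= eps / 3 * Cmod h).
  { apply Rle_trans with ((Cmod (f p) + 1) * (e2 * Cmod h)); [apply Rmult_le_compat; try apply Cmod_ge_0; lra|].
    right. unfold e2. field. lra. }
  assert (T3 : Cmod (f (p + h)%C - f p) * Cmod (g (p + h)%C - g p) <= eps / 3 * Cmod h).
  { apply Rle_trans with ((Cmod l + e1 + 1) * Cmod h * (eps / (3 * (Cmod l + e1 + 1)))).
    - apply Rmult_le_compat; try apply Cmod_ge_0; [exact Hfk|]. apply Rle_trans with (1 := H3). apply Rmin_r.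
    - right. field. lra. }
  lra.
Qed.

Lemma cdiff_inv (z : C) : z <> 0 -> cdiff_at (fun u => / u)%C z.
Proof.
  intros Hz. assert (hz : 0 < Cmod z) by (now apply Cmod_gt_0).
  exists (- / (z * z))%C. intros eps He.
  set (m := Cmod z) in *.
  exists (Rmin (m / 2) (eps * m ^ 3 / 2)). split.
  { apply Rmin_pos; [lra|]. assert (0 < m ^ 3) by (apply pow_lt; lra). nra. }
  intros h Hh.
  assert (a1 := Rmin_l (m / 2) (eps * m ^ 3 / 2)). assert (a2 := Rmin_r (m / 2) (eps * m ^ 3 / 2)).
  assert (Hzh : m / 2 <= Cmod (z + h)).
  { assert (t := Cmod_sub (z + h) h). replace (z + h - h)%C with z in t by ring. fold m in t. lra. }
  assert (Hzh0 : (z + h <> 0)%C) by (apply Cmod_gt_0; lra).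
  replace (/ (z + h) - / z - - / (z * z) * h)%C with (h * h / (z * z * (z + h)))%C by (field; now split).
  assert (Hnz : (z * z * (z + h) <> 0)%C) by (repeat apply Cmult_neq_0; assumption).
  rewrite Cmod_div by exact Hnz. rewrite !Cmod_mult. fold m.
  assert (hh := Cmod_ge_0 h).
  apply Rle_trans with (Cmod h * Cmod h / (m * m * (m / 2))).
  - apply Rmult_le_compat_l; [nra|]. apply Rinv_le_contravar; [nra|]. apply Rmult_le_compat_l; nra.
  - apply Rle_trans with (Cmod h * (eps * m ^ 3 / 2) / (m * m * (m / 2))).
    + apply Rmult_le_compat_r; [left; apply Rinv_0_lt_compat; nra|]. apply Rmult_le_compat_l; lra.
    + right. field. lra.
Qed.

(** * Circle means *)

Definition dcont (f : C -> C) : Prop := forall z, Cmod z <= 1 -> forall eps, 0 < eps ->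
  exists d, 0 < d /\ forall w, Cmod w <= 1 -> Cmod (w - z) < d -> Cmod (f w - f z) <= eps.

(** A retraction onto the half plane Re p <= 0. It makes [log_pull f] continuous on the whole plane,
    as [goursat] requires, although [f] is only controlled on the closed disc. *)
Definition clamp (p : C) : C := (Rmin (Re p) 0, Im p).
(** Logarithmic polar coordinates: s + i t stands for radius exp s and angle t. Annuli become
    rectangles, periodic in t. *)
Definition log_pull (f : C -> C) (p : C) : C := f (expC (clamp p)).
Definition circle_int (f : C -> C) (s : R) : C := Cint (fun t => log_pull f (s, t)) 0 (2 * PI).

Lemma clamp_lip p q : Cmod (clamp q - clamp p) <= 2 * Cmod (q - p).
Proof.
  assert (h1 := re_le_Cmod (q - p)). assert (h2 := im_le_Cmod (q - p)). simpl in h1, h2.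
  apply Cmod_le_2.
  - simpl. apply Rle_trans with (2 := h1). unfold Re. unfold Rmin.
    destruct (Rle_dec (fst q) 0), (Rle_dec (fst p) 0); apply Rabs_le; split_Rabs; lra.
  - exact h2.
Qed.

Lemma clamp_re p : Re (clamp p) <= 0.
Proof. apply Rmin_r. Qed.

Lemma Cmod_expC_clamp p : Cmod (expC (clamp p)) <= 1.
Proof. rewrite Cmod_expC, <- exp_0. generalize (clamp_re p). intros [h|h]; [left; now apply exp_increasing|right; now rewrite h]. Qed.

Lemma log_pull_cont f : dcont f -> forall p, cont2 (log_pull f) p.
Proof.
  intros Hf p eps He. destruct (Hf (expC (clamp p)) (Cmod_expC_clamp p) eps He) as [d [Hd H]].
  destruct (cdiff_cont2 _ _ (cdiff_expC (clamp p)) (d / 2)) as [d' [Hd' H']]; [lra|].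
  exists (d' / 2). split; [lra|]. intros q Hq. apply H; [apply Cmod_expC_clamp|].
  apply Rle_lt_trans with (d / 2); [|lra]. apply H'. generalize (clamp_lip p q). lra.
Qed.

Lemma log_pull_cdiff f s t : s < 0 -> cdiff_at f (expC (s, t)) -> cdiff_at (log_pull f) (s, t).
Proof.
  intros Hs Hf. apply cdiff_ext_loc with (f := fun q => f (expC q)) (r := - s); [lra| |].
  - intros u Hu. unfold log_pull. do 2 f_equal. destruct u as [a b]. unfold clamp. simpl. f_equal.
    assert (h := re_le_Cmod ((a, b) - (s, t))). change (Re ((a, b) - (s, t))) with (a + - s) in h.
    symmetry. apply Rmin_left. apply Rabs_le_between in h. unfold Cminus in *. lra.
  - apply cdiff_comp; [apply cdiff_expC|exact Hf].
Qed.

Lemma log_pull_per f s : log_pull f (s, 2 * PI) = log_pull f (s, 0).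
Proof.
  unfold log_pull. f_equal. unfold expC, clamp, cis; simpl.
  replace (2 * PI) with (0 + 2 * PI) by ring. rewrite (cos_plus 0), (sin_plus 0), cos_2PI, sin_2PI, cos_0, sin_0.
  f_equal; f_equal; ring.
Qed.

(** In Goursat's theorem for [s0, s1] x [0, 2 PI] the two horizontal sides cancel by periodicity,
    and the two vertical sides are the circle integrals. *)
Lemma circle_int_const_open f s0 s1 : dcont f -> s0 <= s1 -> s1 < 0 ->
  (forall z, exp s0 <= Cmod z <= exp s1 -> cdiff_at f z) -> circle_int f s0 = circle_int f s1.
Proof.
  intros Hf H01 H1 Hd.
  assert (HPI := PI_RGT_0).
  assert (h : rint (log_pull f) s0 s1 0 (2 * PI) = 0).
  { apply goursat; [exact H01|lra|now apply log_pull_cont|]. intros x y Hx Hy.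
    apply log_pull_cdiff; [lra|]. apply Hd. rewrite Cmod_expC. simpl.
    split; [destruct (proj1 Hx) as [l|l]|destruct (proj2 Hx) as [l|l]]; try (left; now apply exp_increasing); right; now rewrite l. }
  unfold rint in h.
  rewrite (Cint_ext (fun x => log_pull f (x, 2 * PI)) (fun x => log_pull f (x, 0))) in h by (intros; apply log_pull_per).
  unfold circle_int. set (A := Cint (fun x => log_pull f (x, 0)) s0 s1) in *.
  set (X := Cint (fun t => log_pull f (s1, t)) 0 (2 * PI)) in *. set (Y := Cint (fun t => log_pull f (s0, t)) 0 (2 * PI)) in *.
  assert (E : (Y - X = Ci * (A + Ci * X - A - Ci * Y))%C) by (apply C_eq; simpl; ring).
  rewrite h in E. apply Ceq_minus. rewrite E. ring.
Qed.

(** Uniform continuity of the integrand on a compact rectangle around the given radius. *)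
Lemma circle_int_cont f s : dcont f -> Ccont (circle_int f) s.
Proof.
  intros Hf. assert (Hg := log_pull_cont f Hf).
  assert (HPI := PI_RGT_0).
  assert (G : forall pr : C -> R, (forall a b, Rabs (pr a - pr b) <= Cmod (a - b)) ->
     forall eps : posreal, exists d : posreal, forall u v, s - 1 <= u <= s + 1 -> 0 <= v <= 2 * PI ->
       Rabs (u - s) < d -> Rabs (pr (log_pull f (u, v)) - pr (log_pull f (s, v))) < eps).
  { intros pr Hpr eps.
    destruct (uniform_continuity_2d (fun x y => pr (log_pull f (x, y))) (s - 1) (s + 1) 0 (2 * PI)) with (eps := eps) as [d Hd].
    - intros x y _ _ e. destruct (Hg (x, y) (e / 2)) as [d [Hd H]]; [generalize (cond_pos e); lra|].
      assert (Hd2 : 0 < d / 2) by lra. exists (mkposreal _ Hd2). intros u v Hu Hv. simpl in *.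
      apply Rle_lt_trans with (1 := Hpr _ _). apply Rle_lt_trans with (e / 2); [|generalize (cond_pos e); lra].
      apply H. apply Rle_lt_trans with (1 := Cmod_le_ReIm _). simpl. unfold Rminus in *. lra.
    - exists d. intros u v Hu Hv Hus. apply (Hd s v u v); auto; try lra.
      replace (v - v) with 0 by ring. rewrite Rabs_R0. apply cond_pos. }
  apply Ccont_eps. intros eps He.
  assert (He' : 0 < eps / (16 * PI)) by (apply Rdiv_lt_0_compat; lra).
  destruct (G Re (fun a b => re_le_Cmod (a - b)) (mkposreal _ He')) as [d1 H1].
  destruct (G Im (fun a b => im_le_Cmod (a - b)) (mkposreal _ He')) as [d2 H2].
  exists (Rmin 1 (Rmin d1 d2)). split; [repeat apply Rmin_pos; try apply cond_pos; lra|].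
  intros u Hu. assert (a1 := Rmin_l 1 (Rmin d1 d2)). assert (a2 := Rmin_r 1 (Rmin d1 d2)).
  assert (a3 := Rmin_l d1 d2). assert (a4 := Rmin_r d1 d2).
  assert (Hu1 : Rabs (u - s) < 1) by lra. assert (Hu1' := Rlt_le _ _ Hu1). apply Rabs_le_between in Hu1'.
  unfold circle_int. rewrite <- Cint_minus by (now apply cont2_y).
  apply Rle_trans with (2 * (2 * (eps / (16 * PI)) * (2 * PI - 0))); [|replace (2 * (2 * (eps / (16 * PI)) * (2 * PI - 0))) with (eps / 2) by (field; lra); lra].
  apply Cint_bound; [lra| |].
  - intros t. apply Ccont_ext with (fun t => log_pull f (u, t) + (- (1)) * log_pull f (s, t))%C; [intros; ring|].
    apply Ccont_plus; [now apply cont2_y|]. apply Ccont_mult; [apply Ccont_const|now apply cont2_y].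
  - intros t Ht. apply Cmod_le_2.
    + left. apply (H1 u t); lra.
    + left. apply (H2 u t); lra.
Qed.

(** Nothing is known about derivatives on the two bounding circles, one of which may be the unit
    circle; the annulus is shrunk by [e] on both sides and continuity of the integral closes the
    gap. *)
Lemma circle_int_const f s0 s1 : dcont f -> s0 <= s1 <= 0 ->
  (forall z, exp s0 < Cmod z < exp s1 -> cdiff_at f z) -> circle_int f s0 = circle_int f s1.
Proof.
  intros Hf [H01 H1] Hd. destruct (Req_dec s0 s1) as [->|n]; [reflexivity|].
  apply Ceq_minus. apply Cmod_eq_0. apply Rle_antisym; [|apply Cmod_ge_0].
  apply Rle_eps_mult with 2. intros k. assert (hk := pos_INR k).
  set (eps := / (INR k + 1)). assert (Heps : 0 < eps) by (apply Rinv_0_lt_compat; lra).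
  destruct (Ccont_eps_inv _ _ (circle_int_cont f s0 Hf) eps Heps) as [d0 [D0 E0]].
  destruct (Ccont_eps_inv _ _ (circle_int_cont f s1 Hf) eps Heps) as [d1 [D1 E1]].
  set (e := Rmin (Rmin (d0 / 2) (d1 / 2)) ((s1 - s0) / 3)).
  assert (He : 0 < e) by (unfold e; repeat apply Rmin_pos; lra).
  assert (b1 : e <= d0 / 2) by (unfold e; apply Rle_trans with (1 := Rmin_l _ _); apply Rmin_l).
  assert (b2 : e <= d1 / 2) by (unfold e; apply Rle_trans with (1 := Rmin_l _ _); apply Rmin_r).
  assert (b3 : e <= (s1 - s0) / 3) by (unfold e; apply Rmin_r).
  assert (Hm : circle_int f (s0 + e) = circle_int f (s1 - e)).
  { apply circle_int_const_open; [exact Hf|lra|lra|]. intros z [z1 z2]. apply Hd. split.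
    - apply Rlt_le_trans with (2 := z1). apply exp_increasing. lra.
    - apply Rle_lt_trans with (1 := z2). apply exp_increasing. lra. }
  replace (circle_int f s0 - circle_int f s1)%C with ((circle_int f s0 - circle_int f (s0 + e)) + (circle_int f (s1 - e) - circle_int f s1))%C by (rewrite Hm; ring).
  apply Rle_trans with (1 := Cmod_triangle _ _). rewrite (Cmod_sym (circle_int f s0)).
  assert (F0 : Cmod (circle_int f (s0 + e) - circle_int f s0) <= eps) by (apply E0; replace (s0 + e - s0) with e by ring; rewrite Rabs_pos_eq; lra).
  assert (F1 : Cmod (circle_int f (s1 - e) - circle_int f s1) <= eps) by (apply E1; replace (s1 - e - s1) with (- e) by ring; rewrite Rabs_Ropp, Rabs_pos_eq; lra).
  unfold eps in *. unfold Rdiv. lra.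
Qed.

Lemma RInt_constR (c a b : R) : RInt (fun _ => c) a b = c * (b - a).
Proof. rewrite RInt_const. unfold scal; simpl; unfold mult; simpl. ring. Qed.

Lemma Cint_const c a b : Cint (fun _ => c) a b = (RtoC (b - a) * c)%C.
Proof. apply C_eq; simpl; rewrite RInt_constR; unfold Re, Im; ring. Qed.

Definition mean (h : R -> C) : C := (RtoC (/ (2 * PI)) * Cint h 0 (2 * PI))%C.

(* The integrals over circles of radius [r] are locally constant in [r] off the exceptional radius,
   and continuous there. *)
Lemma mean_value f r : dcont f -> 0 <= r < 1 ->
  (forall z, 0 < Cmod z < 1 -> Cmod z <> r -> cdiff_at f z) -> mean (fun t => f (cis t)) = f 0.
Proof.
  intros Hf Hr Hd. assert (HPI := PI_RGT_0).
  assert (H0 : circle_int f 0 = (RtoC (2 * PI) * f 0)%C).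
  { apply Ceq_minus, Cmod_eq_0. apply Rle_antisym; [|apply Cmod_ge_0].
    apply Rle_eps_mult with 1. intros k. assert (hk := pos_INR k).
    assert (Heps : 0 < / (INR k + 1) / (4 * PI)) by (apply Rdiv_lt_0_compat; [apply Rinv_0_lt_compat|]; lra).
    destruct (Hf (RtoC 0) ltac:(rewrite Cmod_0; lra) _ Heps) as [d [Dd H]].
    (* The small circle has to lie inside the exceptional one, hence d' <= r; for r = 0 there is
       nothing to avoid and 1 is a harmless default. *)
    set (d' := Rmin d (if Req_EM_T r 0 then 1 else r)).
    assert (Hd' : 0 < d') by (unfold d'; apply Rmin_pos; [exact Dd|destruct (Req_EM_T r 0); lra]).
    assert (Hd1 : d' <= d) by apply Rmin_l.
    assert (Hd2 : d' <= 1 /\ (r <> 0 -> d' <= r)).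
    { unfold d'. destruct (Req_EM_T r 0); split; intros; try contradiction; try apply Rmin_r.
      apply Rle_trans with (1 := Rmin_r _ _). lra. }
    set (s0 := ln (d' / 2)).
    assert (Es0 : exp s0 = d' / 2) by (apply exp_ln; lra).
    assert (Hs0 : s0 < 0) by (apply exp_lt_inv; rewrite Es0, exp_0; lra).
    assert (HM : circle_int f s0 = circle_int f 0).
    { destruct (Req_dec r 0) as [r0|r0].
      - apply circle_int_const; [exact Hf|lra|]. rewrite exp_0, Es0. intros z Hz. apply Hd; lra.
      - assert (Er : exp (ln r) = r) by (apply exp_ln; lra).
        assert (Hlr : ln r < 0) by (apply exp_lt_inv; rewrite Er, exp_0; lra).
        assert (Hs0r : s0 < ln r) by (apply exp_lt_inv; rewrite Er, Es0; generalize (proj2 Hd2 r0); lra).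
        transitivity (circle_int f (ln r)); apply circle_int_const; try exact Hf; try lra; rewrite ?exp_0, ?Er, ?Es0; intros z Hz; apply Hd; lra. }
    rewrite <- HM.
    replace (RtoC (2 * PI) * f 0)%C with (Cint (fun _ => f 0) 0 (2 * PI)) by (rewrite Cint_const, Rminus_0_r; reflexivity).
    unfold circle_int. rewrite <- Cint_minus; [|apply cont2_y; now apply log_pull_cont|intros; apply Ccont_const].
    apply Rle_trans with (2 * (/ (INR k + 1) / (4 * PI) * (2 * PI - 0))); [|right; field; lra].
    apply Cint_bound; [lra| |].
    - intros t. apply Ccont_ext with (fun t => log_pull f (s0, t) + (- (1)) * f 0)%C; [intros; ring|].
      apply Ccont_plus; [apply cont2_y; now apply log_pull_cont|]. apply Ccont_const.
    - intros t _. unfold log_pull. apply H; [apply Cmod_expC_clamp|].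
      replace (expC (clamp (s0, t)) - 0)%C with (expC (clamp (s0, t))) by ring. rewrite Cmod_expC.
      simpl. rewrite Rmin_left by lra. rewrite Es0. lra. }
  unfold mean. unfold circle_int in H0. rewrite (Cint_ext _ (fun t => log_pull f (0, t))).
  - rewrite H0. rewrite Cmult_assoc, <- RtoC_mult. replace (/ (2 * PI) * (2 * PI)) with 1 by (field; lra). ring.
  - intros t _. unfold log_pull, clamp, expC. simpl. rewrite Rmin_left by lra. rewrite exp_0. f_equal. ring.
Qed.

(** * The disc algebra *)

Definition dcontat (f : C -> C) (z : C) : Prop := forall eps, 0 < eps ->
  exists d, 0 < d /\ forall w, Cmod w <= 1 -> Cmod (w - z) < d -> Cmod (f w - f z) <= eps.

Lemma cont2_dcontat f z : cont2 f z -> dcontat f z.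
Proof. intros H eps He. destruct (H eps He) as [d [Hd h]]. exists d. split; auto. Qed.

Lemma dcontat_plus f g z : dcontat f z -> dcontat g z -> dcontat (fun u => f u + g u)%C z.
Proof.
  intros Hf Hg eps He. destruct (Hf (eps / 2)) as [d1 [D1 H1]]; [lra|]. destruct (Hg (eps / 2)) as [d2 [D2 H2]]; [lra|].
  exists (Rmin d1 d2). split; [now apply Rmin_pos|]. intros w Hw Hwz.
  assert (a1 := Rmin_l d1 d2). assert (a2 := Rmin_r d1 d2).
  replace (f w + g w - (f z + g z))%C with ((f w - f z) + (g w - g z))%C by ring.
  apply Rle_trans with (1 := Cmod_triangle _ _). generalize (H1 w Hw ltac:(lra)) (H2 w Hw ltac:(lra)). lra.
Qed.

Lemma dcontat_mult f g z : dcontat f z -> dcontat g z -> dcontat (fun u => f u * g u)%C z.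
Proof.
  intros Hf Hg eps He. assert (hf := Cmod_ge_0 (f z)). assert (hg := Cmod_ge_0 (g z)).
  set (K := Cmod (f z) + Cmod (g z) + 1).
  assert (HK : 0 < K) by (unfold K; lra).
  set (e := Rmin 1 (eps / K)). assert (He0 : 0 < e) by (apply Rmin_pos; [lra|now apply Rdiv_lt_0_compat]).
  destruct (Hf e He0) as [d1 [D1 H1]]. destruct (Hg e He0) as [d2 [D2 H2]].
  exists (Rmin d1 d2). split; [now apply Rmin_pos|]. intros w Hw Hwz.
  assert (a1 := Rmin_l d1 d2). assert (a2 := Rmin_r d1 d2).
  specialize (H1 w Hw ltac:(lra)). specialize (H2 w Hw ltac:(lra)).
  replace (f w * g w - f z * g z)%C with ((f w - f z) * (g w - g z) + ((f w - f z) * g z + f z * (g w - g z)))%C by ring.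
  apply Rle_trans with (1 := Cmod_triangle _ _). eapply Rle_trans; [apply Rplus_le_compat_l, Cmod_triangle|].
  rewrite !Cmod_mult. assert (e <= 1) by apply Rmin_l. assert (e <= eps / K) by apply Rmin_r.
  assert (p1 := Cmod_ge_0 (f w - f z)). assert (p2 := Cmod_ge_0 (g w - g z)).
  apply Rle_trans with (e * K).
  - unfold K. assert (Cmod (f w - f z) * Cmod (g w - g z) <= e * 1) by (apply Rmult_le_compat; lra).
    assert (Cmod (f w - f z) * Cmod (g z) <= e * Cmod (g z)) by (apply Rmult_le_compat_r; lra).
    assert (Cmod (f z) * Cmod (g w - g z) <= Cmod (f z) * e) by (apply Rmult_le_compat_l; lra). lra.
  - replace eps with (eps / K * K) by (field; lra). apply Rmult_le_compat_r; lra.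
Qed.

Lemma dcontat_ext_loc f g z r : 0 < r -> (forall u, Cmod (u - z) < r -> f u = g u) -> dcontat f z -> dcontat g z.
Proof.
  intros Hr He Hf eps Heps. destruct (Hf eps Heps) as [d [Hd H]]. exists (Rmin d r). split; [now apply Rmin_pos|].
  intros w Hw Hwz. assert (a1 := Rmin_l d r). assert (a2 := Rmin_r d r).
  rewrite <- !He; [apply H; auto; lra| |lra]. replace (z - z)%C with (RtoC 0) by ring. now rewrite Cmod_0.
Qed.

Definition Adisc (f : C -> C) : Prop := dcont f /\ forall z, Cmod z < 1 -> cdiff_at f z.

Lemma Adisc_plus f g : Adisc f -> Adisc g -> Adisc (fun u => f u + g u)%C.
Proof.
  intros [f1 f2] [g1 g2]. split.
  - intros z Hz. apply (dcontat_plus f g z); [exact (f1 z Hz)|exact (g1 z Hz)].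
  - intros z Hz. apply cdiff_plus; auto.
Qed.

Lemma Adisc_mult f g : Adisc f -> Adisc g -> Adisc (fun u => f u * g u)%C.
Proof.
  intros [f1 f2] [g1 g2]. split.
  - intros z Hz. apply (dcontat_mult f g z); [exact (f1 z Hz)|exact (g1 z Hz)].
  - intros z Hz. apply cdiff_mult; auto.
Qed.

Lemma Adisc_cdiff f : (forall z, Cmod z <= 1 -> cdiff_at f z) -> Adisc f.
Proof.
  intros H. split.
  - intros z Hz. apply (cont2_dcontat f z). now apply cdiff_cont2, H.
  - intros z Hz. apply H. lra.
Qed.

Lemma Adisc_const c : Adisc (fun _ => c).
Proof. apply Adisc_cdiff. intros; apply cdiff_const. Qed.
Lemma Adisc_id : Adisc (fun u => u).
Proof. apply Adisc_cdiff. intros; apply cdiff_id. Qed.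

Lemma Adisc_minus f g : Adisc f -> Adisc g -> Adisc (fun u => f u - g u)%C.
Proof.
  intros Hf Hg.
  replace (fun u => f u - g u)%C with (fun u => f u + (- (1)) * g u)%C by (apply functional_extensionality; intros; ring).
  apply (Adisc_plus f); [exact Hf|]. apply (Adisc_mult (fun _ => (- (1))%C)); [apply Adisc_const|exact Hg].
Qed.

Lemma Ccont_cis_id t : Ccont cis t.
Proof. split; simpl; [apply continuous_cos|apply continuous_sin]. Qed.

Lemma Ccont_cis f : dcont f -> forall t, Ccont (fun t => f (cis t)) t.
Proof.
  intros Hf t. apply Ccont_eps. intros eps He.
  destruct (Hf (cis t)) with (eps := eps) as [d [Hd H]]; [rewrite Cmod_cis; lra|exact He|].
  destruct (Ccont_eps_inv _ _ (Ccont_cis_id t) (d / 2)) as [d' [Hd' H']]; [lra|].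
  exists d'. split; [exact Hd'|]. intros s Hs. apply H; [rewrite Cmod_cis; lra|].
  apply Rle_lt_trans with (1 := H' s Hs). lra.
Qed.

Ltac ccont := lazymatch goal with
  | |- Ccont (fun t => (@?f t + @?g t)%C) _ => apply (Ccont_plus f g); ccont
  | |- Ccont (fun t => (@?f t * @?g t)%C) _ => apply (Ccont_mult f g); ccont
  | |- Ccont (fun t => Cconj (@?f t)) _ => apply (Ccont_conj f); ccont
  | |- Ccont (fun _ => ?c) _ => apply (Ccont_const c)
  | |- Ccont cis _ => apply Ccont_cis_id
  | |- Ccont (fun t => cis t) _ => apply Ccont_cis_id
  | |- _ => solve [auto]
  end.

Lemma mean_plus f g : (forall t, Ccont f t) -> (forall t, Ccont g t) -> mean (fun t => f t + g t)%C = (mean f + mean g)%C.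
Proof. intros Hf Hg. unfold mean. rewrite Cint_plus by assumption. ring. Qed.

Lemma mean_scal c f : (forall t, Ccont f t) -> mean (fun t => c * f t)%C = (c * mean f)%C.
Proof. intros Hf. unfold mean. rewrite Cint_scal by assumption. ring. Qed.

Lemma mean_minus f g : (forall t, Ccont f t) -> (forall t, Ccont g t) -> mean (fun t => f t - g t)%C = (mean f - mean g)%C.
Proof. intros Hf Hg. unfold mean. rewrite Cint_minus by assumption. ring. Qed.

Lemma mean_ext f g : (forall t, f t = g t) -> mean f = mean g.
Proof. intros H. f_equal. now apply functional_extensionality. Qed.

Lemma mean_conj f : (forall t, Ccont f t) -> mean (fun t => Cconj (f t)) = Cconj (mean f).
Proof.
  intros Hf. assert (E : Cint (fun t => Cconj (f t)) 0 (2 * PI) = Cconj (Cint f 0 (2 * PI))).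
  { apply C_eq; simpl; [reflexivity|].
    rewrite (RInt_ext _ (fun t => -1 * Im (f t) + 0 * Im (f t))) by (intros; unfold Im; simpl; ring).
    rewrite RInt_lin by now apply Ccont_ex_Im. unfold Im. ring. }
  unfold mean. rewrite Cmult_conj, E. f_equal. apply C_eq; simpl; ring.
Qed.

Lemma mean_const c : mean (fun _ => c) = c.
Proof.
  unfold mean. rewrite Cint_const, Cmult_assoc, <- RtoC_mult.
  replace (/ (2 * PI) * (2 * PI - 0)) with 1 by (field; generalize PI_RGT_0; lra). ring.
Qed.

Lemma mean_bound f M : (forall t, Ccont f t) -> (forall t, Cmod (f t) <= M) -> Cmod (mean f) <= 2 * M.
Proof.
  intros Hf HM. assert (HPI := PI_RGT_0). unfold mean. rewrite Cmod_mult, Cmod_RtoC_nonneg.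
  2:{ left; apply Rinv_0_lt_compat; lra. }
  assert (h := Cint_bound f 0 (2 * PI) M ltac:(lra) Hf (fun t _ => HM t)).
  apply Rle_trans with (/ (2 * PI) * (2 * (M * (2 * PI - 0)))).
  - apply Rmult_le_compat_l; [left; apply Rinv_0_lt_compat; lra|exact h].
  - right; field; lra.
Qed.

Lemma Adisc_mean f : Adisc f -> mean (fun t => f (cis t)) = f 0.
Proof. intros [f1 f2]. apply mean_value with 0; [exact f1|lra|]. intros z Hz _. apply f2. lra. Qed.

(** * Cauchy's formula *)

Lemma one_sub_neq0 a z : Cmod a < 1 -> Cmod z <= 1 -> (1 - a * z <> 0)%C.
Proof.
  intros Ha Hz h. apply Ceq_minus in h. apply (f_equal Cmod) in h. rewrite Cmod_1, Cmod_mult in h.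
  assert (h1 := Cmod_ge_0 a). assert (h2 := Cmod_ge_0 z). nra.
Qed.

Lemma cdiff_one_sub_inv a z : (1 - a * z <> 0)%C -> cdiff_at (fun u => / (1 - a * u))%C z.
Proof.
  intros H. apply (cdiff_comp (fun v => / v)%C (fun u => 1 - a * u)%C).
  - apply cdiff_ext_loc with (f := fun u => (1 + (- a) * u)%C) (r := 1); [lra|intros; ring|].
    apply cdiff_plus; [apply cdiff_const|]. apply cdiff_mult; [apply cdiff_const|apply cdiff_id].
  - now apply cdiff_inv.
Qed.

(** The Cauchy kernel on the unit circle: with ze = cis t, dze / (2 PI i (ze - a)) equals dt / (2
    PI) times 1 / (1 - a conj ze). *)
Definition ker (a : C) (t : R) : C := (/ (1 - a * Cconj (cis t)))%C.

Lemma ker_conj a t : Cmod a < 1 -> ker a t = Cconj (/ (1 - Cconj a * cis t))%C.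
Proof.
  intros Ha. unfold ker. rewrite Cinv_conj.
  - rewrite Cminus_conj, Cmult_conj, Cconj_conj. do 2 f_equal. apply C_eq; simpl; ring.
  - apply one_sub_neq0; [now rewrite Cmod_conj|rewrite Cmod_cis; lra].
Qed.

Lemma Adisc_ker a : Cmod a < 1 -> Adisc (fun u => / (1 - Cconj a * u))%C.
Proof.
  intros Ha. apply Adisc_cdiff. intros z Hz. apply cdiff_one_sub_inv.
  apply one_sub_neq0; [now rewrite Cmod_conj|exact Hz].
Qed.

Lemma ker_cont a : Cmod a < 1 -> forall t, Ccont (ker a) t.
Proof.
  intros Ha t. apply Ccont_ext with (fun t => Cconj (/ (1 - Cconj a * cis t))%C); [intros; symmetry; now apply ker_conj|].
  apply Ccont_conj. apply (Ccont_cis (fun u => / (1 - Cconj a * u))%C). now apply Adisc_ker.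
Qed.

Lemma ker_mean a : Cmod a < 1 -> mean (ker a) = 1.
Proof.
  intros Ha. rewrite (mean_ext _ (fun t => Cconj (/ (1 - Cconj a * cis t))%C)) by (intros; now apply ker_conj).
  rewrite mean_conj by (apply (Ccont_cis (fun u => / (1 - Cconj a * u))%C); now apply Adisc_ker).
  rewrite (Adisc_mean (fun u => / (1 - Cconj a * u))%C) by now apply Adisc_ker.
  replace (1 - Cconj a * 0)%C with (RtoC 1) by ring. rewrite <- RtoC_inv by lra. rewrite Rinv_1. apply C_eq; simpl; ring.
Qed.

(** The mean value property applied to z (f(z) - f(a)) / (z - a), which vanishes at 0 and equals (f
    - f(a)) times the kernel on the circle. At [a] this function is only known to be continuous, and
    this is why [mean_value] tolerates an exceptional radius, here |a|. *)
Lemma cauchy f a : Adisc f -> Cmod a < 1 -> f a = mean (fun t => f (cis t) * ker a t)%C.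
Proof.
  intros [f1 f2] Ha. destruct (f2 a Ha) as [l Hl].
  pose (q := fun z : C => if excluded_middle_informative (z = a) then l else ((f z - f a) / (z - a))%C).
  pose (g := fun z : C => (z * q z)%C).
  assert (Hq : forall z, z <> a -> cdiff_at f z -> cdiff_at q z).
  { intros z Hz Hfz. assert (hz := Cmod_pos_neq _ _ Hz).
    apply cdiff_ext_loc with (f := fun u => ((f u + (- f a)) * / (u + (- a)))%C) (r := Cmod (z - a)); [exact hz| |].
    - intros u Hu. unfold q. destruct (excluded_middle_informative (u = a)) as [e|e].
      + subst u. rewrite Cmod_sym in Hu. lra.
      + reflexivity.
    - apply cdiff_mult; [apply cdiff_plus; [exact Hfz|apply cdiff_const]|].
      apply (cdiff_comp (fun v => / v)%C (fun u => u + - a)%C); [apply cdiff_plus; [apply cdiff_id|apply cdiff_const]|].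
      apply cdiff_inv. intros h. apply Hz. now apply Ceq_minus. }
  assert (Hqc : dcont q).
  { intros z Hz. destruct (excluded_middle_informative (z = a)) as [e|e].
    - subst z. intros eps He. destruct (Hl eps He) as [d [Hd H]]. exists d. split; [exact Hd|].
      intros w Hw Hwa. unfold q at 2. destruct (excluded_middle_informative (a = a)) as [_|n]; [|contradiction].
      unfold q. destruct (excluded_middle_informative (w = a)) as [e|e].
      + replace (l - l)%C with (RtoC 0) by ring. rewrite Cmod_0. lra.
      + assert (hw := Cmod_pos_neq _ _ e). specialize (H (w - a)%C (conj hw Hwa)).
        replace (a + (w - a))%C with w in H by ring.
        assert (hn : (w - a <> 0)%C) by now apply Cmod_gt_0.
        replace ((f w - f a) / (w - a) - l)%C with ((f w - f a - l * (w - a)) / (w - a))%C by (field; exact hn).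
        rewrite Cmod_div by exact hn.
        apply Rle_trans with (eps * Cmod (w - a) / Cmod (w - a)); [|right; field; lra].
        apply Rmult_le_compat_r; [left; now apply Rinv_0_lt_compat|exact H].
    - assert (hz := Cmod_pos_neq _ _ e).
      apply (dcontat_ext_loc (fun u => ((f u + (- f a)) * / (u + (- a)))%C) q z (Cmod (z - a))); [exact hz| |].
      + intros u Hu. unfold q. destruct (excluded_middle_informative (u = a)) as [e'|e'].
        * subst u. rewrite Cmod_sym in Hu. lra.
        * reflexivity.
      + apply dcontat_mult.
        * apply dcontat_plus; [exact (f1 z Hz)|]. apply cont2_dcontat, cdiff_cont2, cdiff_const.
        * apply cont2_dcontat, cdiff_cont2.
          apply (cdiff_comp (fun v => / v)%C (fun u => u + - a)%C); [apply cdiff_plus; [apply cdiff_id|apply cdiff_const]|].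
          apply cdiff_inv. intros h. apply e. now apply Ceq_minus. }
  assert (Hg : dcont g).
  { intros z Hz. apply (dcontat_mult (fun u => u) q z); [apply cont2_dcontat, cdiff_cont2, cdiff_id|exact (Hqc z Hz)]. }
  assert (Hm : mean (fun t => g (cis t)) = g 0).
  { apply mean_value with (Cmod a); [exact Hg|split; [apply Cmod_ge_0|exact Ha]|].
    intros z Hz Hza. apply cdiff_mult; [apply cdiff_id|]. apply Hq; [intros ->; lra|]. apply f2. lra. }
  assert (Hfk : forall t, Ccont (fun t => f (cis t) * ker a t)%C t).
  { intros t. apply Ccont_mult; [now apply Ccont_cis|now apply ker_cont]. }
  assert (E : mean (fun t => g (cis t)) = (mean (fun t => f (cis t) * ker a t) - f a)%C).
  { transitivity (mean (fun t => f (cis t) * ker a t - f a * ker a t)%C).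
    - apply mean_ext. intros t. unfold g, q, ker. destruct (excluded_middle_informative (cis t = a)) as [e|e].
      + exfalso. rewrite <- e, Cmod_cis in Ha. lra.
      + assert (hn : (cis t - a <> 0)%C) by (intros h; apply e; now apply Ceq_minus).
        assert (hc := cis_conj t).
        assert (hk : (1 - a * Cconj (cis t) <> 0)%C) by (apply one_sub_neq0; [exact Ha|rewrite Cmod_conj, Cmod_cis; lra]).
        replace (cis t - a)%C with (cis t * (1 - a * Cconj (cis t)))%C.
        2:{ transitivity (cis t - a * (cis t * Cconj (cis t)))%C; [ring|rewrite hc; ring]. }
        assert (hct : cis t <> 0). { intros h. rewrite h in hc. apply (f_equal Re) in hc. simpl in hc. lra. }
        field. now split.
    - rewrite mean_minus.
      + rewrite (mean_scal (f a)) by now apply ker_cont. rewrite ker_mean by exact Ha. ring.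
      + exact Hfk.
      + intros t. apply Ccont_mult; [apply Ccont_const|now apply ker_cont]. }
  rewrite Hm in E. unfold g in E. symmetry. apply Ceq_minus. rewrite <- E. ring.
Qed.

Lemma Ccont_bounded h : (forall t, Ccont h t) -> exists M, forall t, 0 <= t <= 2 * PI -> Cmod (h t) <= M.
Proof.
  intros Hc. destruct (continuity_ab_maj (fun t => Cmod (h t)) 0 (2 * PI)) as [Mx [H _]].
  - generalize PI_RGT_0; lra.
  - intros c _ eps He. destruct (Ccont_eps_inv _ _ (Hc c) (eps / 2)) as [d [Hd H]]; [lra|].
    exists d. split; [exact Hd|]. intros s [_ Hs]. simpl in *. unfold Rdist in *.
    apply Rle_lt_trans with (Cmod (h s - h c)); [|generalize (H s Hs); lra].
    apply Rabs_le. assert (a1 := Cmod_triangle (h s - h c) (h c)). assert (a2 := Cmod_sub (h s) (h s - h c)).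
    replace (h s - h c + h c)%C with (h s) in a1 by ring. replace (h s - (h s - h c))%C with (h c) in a2 by ring. lra.
  - exists (Cmod (h Mx)). exact H.
Qed.

(** * Division by the variable *)

(** For [f] in the disc algebra this is f'(0), expressed as a Fourier coefficient so that it only
    refers to boundary values. *)
Definition c1 (f : C -> C) : C := mean (fun t => f (cis t) * Cconj (cis t))%C.
Definition divz (f : C -> C) (z : C) : C :=
  if excluded_middle_informative (z = 0) then c1 f else (f z / z)%C.

Lemma divz_eq (f : C -> C) (z : C) : f 0 = 0 -> f z = (z * divz f z)%C.
Proof.
  intros H. unfold divz. destruct (excluded_middle_informative (z = 0)) as [->|n].
  - rewrite H. ring.
  - field. exact n.
Qed.

Lemma Ccis_conj t : Ccont (fun t => Cconj (cis t)) t.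
Proof. apply Ccont_conj, Ccont_cis_id. Qed.

(** Only the origin needs work, where Cauchy's formula provides a Taylor expansion with explicit
    remainder: f(h)/h = c1 f + h l + h^2 mean(rem), so the quotient has derivative l at 0. *)
Lemma Adisc_divz (f : C -> C) : Adisc f -> f 0 = 0 -> Adisc (divz f).
Proof.
  intros Hf H0. assert (Hf' := Hf). destruct Hf' as [f1 f2].
  assert (Hfar : forall z : C, z <> 0 -> 0 < Cmod z /\ forall u, Cmod (u - z) < Cmod z -> (f u * / u)%C = divz f u).
  { intros z Hz. split; [now apply Cmod_gt_0|]. intros u Hu. unfold divz.
    destruct (excluded_middle_informative (u = 0)) as [->|n]; [|reflexivity].
    exfalso. replace (0 - z)%C with (- z)%C in Hu by ring. rewrite Cmod_opp in Hu. lra. }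
  assert (Hd : forall z, Cmod z < 1 -> cdiff_at (divz f) z).
  { intros z Hz. destruct (excluded_middle_informative (z = 0)) as [->|n].
    2:{ destruct (Hfar z n) as [h1 h2]. apply cdiff_ext_loc with (2 := h2); [exact h1|].
        apply cdiff_mult; [now apply f2|now apply cdiff_inv]. }
    destruct (Ccont_bounded (fun t => f (cis t))) as [M HM].
    { now apply Ccont_cis. }
    assert (HM0 : 0 <= M) by (apply Rle_trans with (2 := HM 0 ltac:(generalize PI_RGT_0; lra)); apply Cmod_ge_0).
    pose (cb := fun t => Cconj (cis t)).
    assert (Hfc : forall t, Ccont (fun t => f (cis t)) t) by now apply Ccont_cis.
    assert (Hcb : forall t, Ccont cb t) by (intros; apply Ccis_conj).
    pose (l := mean (fun t => f (cis t) * (cb t * cb t))%C).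
    exists l. intros eps He.
    exists (Rmin (1 / 2) (eps / (8 * M + 1))). split; [apply Rmin_pos; [lra|apply Rdiv_lt_0_compat; lra]|].
    intros h Hh. assert (a1 := Rmin_l (1 / 2) (eps / (8 * M + 1))). assert (a2 := Rmin_r (1 / 2) (eps / (8 * M + 1))).
    assert (hh : Cmod h < 1) by lra. assert (hn : h <> 0) by (apply Cmod_gt_0; lra).
    replace (0 + h)%C with h by ring.
    (* With c = conj ze, the kernel expands as 1 + h c + h^2 c^2 + h^3 c^3 / (1 - h c); this is the
       last term times f. For |h| < 1/2 the kernel is at most 4, which bounds the mean of [rem] by 8
       M. *)
    pose (rem := fun t => (f (cis t) * (cb t * cb t * cb t * ker h t))%C).
    assert (Hrc : forall t, Ccont rem t).
    { assert (Hk := ker_cont h hh). intros t. unfold rem. ccont. }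
    assert (E : f h = (h * c1 f + (h * h) * l + (h * h * h) * mean rem)%C).
    { rewrite (cauchy f h Hf hh).
      rewrite (mean_ext _ (fun t => (f (cis t) + h * (f (cis t) * cb t)) + ((h * h) * (f (cis t) * (cb t * cb t)) + (h * h * h) * rem t))%C).
      - rewrite !mean_plus, !mean_scal, (Adisc_mean f Hf), H0; [unfold c1, l, cb; ring|..];
        intros; ccont.
      - intros t. unfold rem, ker. fold (cb t).
        assert (hk : (1 - h * cb t <> 0)%C) by (apply one_sub_neq0; [exact hh|unfold cb; rewrite Cmod_conj, Cmod_cis; lra]).
        field. exact hk. }
    unfold divz at 1. destruct (excluded_middle_informative (h = 0)) as [e|_]; [contradiction|].
    unfold divz. destruct (excluded_middle_informative (RtoC 0 = 0)) as [_|n]; [|exfalso; now apply n].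
    replace (f h / h - c1 f - l * h)%C with (h * h * mean rem)%C by (rewrite E; field; exact hn).
    rewrite !Cmod_mult.
    assert (Hr : Cmod (mean rem) <= 8 * M).
    { unfold mean. rewrite Cmod_mult, Cmod_RtoC_nonneg.
      2:{ left; apply Rinv_0_lt_compat; generalize PI_RGT_0; lra. }
      assert (HPI := PI_RGT_0).
      apply Rle_trans with (/ (2 * PI) * (2 * (4 * M * (2 * PI - 0)))); [|right; field; lra].
      apply Rmult_le_compat_l; [left; apply Rinv_0_lt_compat; lra|].
      apply Cint_bound; [lra|exact Hrc|]. intros t Ht. unfold rem. rewrite !Cmod_mult. unfold cb. rewrite !Cmod_conj, !Cmod_cis.
      assert (Hk : Cmod (ker h t) <= 4).
      { unfold ker. rewrite Cmod_inv by (apply one_sub_neq0; [exact hh|rewrite Cmod_conj, Cmod_cis; lra]).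
        replace 4 with (/ / 4) by field. apply Rinv_le_contravar; [lra|].
        assert (s := Cmod_sub 1 (1 - (1 - h * Cconj (cis t)))).
        assert (s' := Cmod_triangle (1 - h * Cconj (cis t)) (h * Cconj (cis t))).
        replace (1 - h * Cconj (cis t) + h * Cconj (cis t))%C with (RtoC 1) in s' by ring.
        rewrite Cmod_1, Cmod_mult, Cmod_conj, Cmod_cis in s'. lra. }
      generalize (HM t Ht) (Cmod_ge_0 (f (cis t))) (Cmod_ge_0 (ker h t)). nra. }
    assert (hm := Cmod_ge_0 (mean rem)).
    replace (Cmod h * Cmod h * Cmod (mean rem)) with (Cmod h * Cmod (mean rem) * Cmod h) by ring.
    apply Rmult_le_compat_r; [lra|].
    apply Rle_trans with (eps / (8 * M + 1) * (8 * M + 1)); [|right; field; lra].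
    apply Rmult_le_compat; lra. }
  split; [|exact Hd].
  intros z [Hz|Hz].
  - apply (cont2_dcontat (divz f) z). now apply cdiff_cont2, Hd.
  - assert (hz : z <> 0) by (intros ->; rewrite Cmod_0 in Hz; lra).
    destruct (Hfar z hz) as [h1 h2]. apply (dcontat_ext_loc (fun u => f u * / u)%C (divz f) z (Cmod z)); [exact h1|exact h2|].
    apply dcontat_mult; [exact (f1 z (Req_le _ _ Hz))|]. apply cont2_dcontat, cdiff_cont2. now apply cdiff_inv.
Qed.

(** * Real means *)

Definition mR (h : R -> R) : R := / (2 * PI) * RInt h 0 (2 * PI).

Lemma ex_RInt_cont (h : R -> R) a b : (forall t, continuous h t) -> ex_RInt h a b.
Proof. intros H. apply (@ex_RInt_continuous R_CompleteNormedModule). auto. Qed.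

Lemma mR_lin (u v : R -> R) p q : (forall t, continuous u t) -> (forall t, continuous v t) ->
  mR (fun t => p * u t + q * v t) = p * mR u + q * mR v.
Proof. intros Hu Hv. unfold mR. rewrite RInt_lin by now apply ex_RInt_cont. ring. Qed.

Lemma mR_le (u v : R -> R) : (forall t, continuous u t) -> (forall t, continuous v t) -> (forall t, u t <= v t) -> mR u <= mR v.
Proof.
  intros Hu Hv H. unfold mR. assert (HPI := PI_RGT_0). apply Rmult_le_compat_l; [left; apply Rinv_0_lt_compat; lra|].
  apply RInt_le; [lra|now apply ex_RInt_cont|now apply ex_RInt_cont|auto].
Qed.

Lemma mR_const c : mR (fun _ => c) = c.
Proof. unfold mR. rewrite RInt_constR. field. generalize PI_RGT_0; lra. Qed.

(** A positive value at an interior point persists on an interval and would make the mean positive.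
    The endpoints, both over the point 1 of the circle, are recovered later by continuity. *)
Lemma mR_zero (u : R -> R) : (forall t, continuous u t) -> (forall t, 0 <= u t) -> mR u <= 0 ->
  forall t, 0 < t < 2 * PI -> u t = 0.
Proof.
  intros Hc Hp Hm t Ht. destruct (Rle_lt_or_eq_dec _ _ (Hp t)) as [h|h]; [|now symmetry].
  exfalso. assert (HPI := PI_RGT_0).
  assert (Hm' : RInt u 0 (2 * PI) <= 0).
  { unfold mR in Hm. apply Rmult_le_reg_l with (/ (2 * PI)); [apply Rinv_0_lt_compat; lra|]. lra. }
  assert (hc := Hc t). apply continuity_pt_filterlim in hc. destruct (hc (u t) h) as [d [Hd H]].
  set (e := Rmin (d / 2) (Rmin (t / 2) ((2 * PI - t) / 2))).
  assert (He : 0 < e) by (unfold e; repeat apply Rmin_pos; lra).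
  assert (e1 : e <= d / 2) by apply Rmin_l.
  assert (e2 : e <= t / 2) by (apply Rle_trans with (1 := Rmin_r _ _); apply Rmin_l).
  assert (e3 : e <= (2 * PI - t) / 2) by (apply Rle_trans with (1 := Rmin_r _ _); apply Rmin_r).
  assert (Hpos : forall a b, a <= b -> 0 <= RInt u a b) by (intros; apply RInt_ge_0; auto; now apply ex_RInt_cont).
  assert (Hin : 0 < RInt u (t - e) (t + e)).
  { apply RInt_gt_0; [lra| |auto]. intros s Hs. destruct (Req_dec t s) as [<-|n]; [exact h|].
    assert (hs : Rabs (u s - u t) < u t).
    { apply (H s). split; [split; [exact I|exact n]|]. simpl. unfold Rdist. apply Rabs_def1; lra. }
    apply Rabs_def2 in hs. lra. }
  assert (E : RInt u 0 (2 * PI) = RInt u 0 (t - e) + (RInt u (t - e) (t + e) + RInt u (t + e) (2 * PI))).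
  { rewrite <- (RInt_Chasles (V := R_CompleteNormedModule) u 0 (t - e) (2 * PI)) by now apply ex_RInt_cont.
    rewrite <- (RInt_Chasles (V := R_CompleteNormedModule) u (t - e) (t + e) (2 * PI)) by now apply ex_RInt_cont. reflexivity. }
  generalize (Hpos 0 (t - e) ltac:(lra)) (Hpos (t + e) (2 * PI) ltac:(lra)). lra.
Qed.

Lemma Re_mean f : Re (mean f) = mR (fun t => Re (f t)).
Proof. unfold mean, mR. simpl. unfold Re. ring. Qed.
Lemma Im_mean f : Im (mean f) = mR (fun t => Im (f t)).
Proof. unfold mean, mR. simpl. unfold Im. ring. Qed.

(** A missing boundary point does not affect Cauchy's formula, so the function vanishes inside, and
    then on the whole circle by radial approach. *)
Lemma Adisc_vanish_open (f : C -> C) : Adisc f -> (forall t, 0 < t < 2 * PI -> f (cis t) = 0) ->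
  forall z, Cmod z <= 1 -> f z = 0.
Proof.
  intros Hf H.
  assert (Hin : forall z, Cmod z < 1 -> f z = 0).
  { intros z Hz. rewrite (cauchy f z Hf Hz). unfold mean.
    rewrite (Cint_ext _ (fun _ => RtoC 0)).
    - rewrite Cint_const. ring.
    - intros t Ht. assert (HPI := PI_RGT_0). rewrite Rmin_left, Rmax_right in Ht by lra. rewrite H by exact Ht. ring. }
  intros z [Hz|Hz]; [now apply Hin|].
  apply Cmod_eq_0. apply Rle_antisym; [|apply Cmod_ge_0]. apply Rle_eps_mult with 1. intros k.
  assert (hk := pos_INR k). assert (He : 0 < 1 / (INR k + 1)) by (apply Rdiv_lt_0_compat; lra).
  destruct (proj1 Hf z (Req_le _ _ Hz) _ He) as [d [Hd h]].
  set (r := Rmin (d / 2) (1 / 2)). assert (Hr : 0 < r) by (apply Rmin_pos; lra).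
  assert (r1 : r <= d / 2) by apply Rmin_l. assert (r2 : r <= 1 / 2) by apply Rmin_r.
  assert (Hw : Cmod (RtoC (1 - r) * z) = 1 - r) by (rewrite Cmod_mult, Hz, Cmod_RtoC_nonneg; lra).
  assert (hw := h (RtoC (1 - r) * z)%C ltac:(lra)).
  rewrite (Hin (RtoC (1 - r) * z)%C ltac:(lra)) in hw.
  replace (0 - f z)%C with (- f z)%C in hw by ring. rewrite (Cmod_opp (f z)) in hw. apply hw.
  replace (RtoC (1 - r) * z - z)%C with (RtoC (- r) * z)%C.
  - rewrite Cmod_mult, Hz, Cmod_R, Rabs_Ropp, Rabs_pos_eq by lra. lra.
  - replace (1 - r) with (1 + - r) by ring. rewrite RtoC_plus. ring.
Qed.

Lemma cont_Re (f : R -> C) : (forall t, Ccont f t) -> forall t, continuous (fun t => Re (f t)) t.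
Proof. intros H t. apply H. Qed.
Lemma cont_Im (f : R -> C) : (forall t, Ccont f t) -> forall t, continuous (fun t => Im (f t)) t.
Proof. intros H t. apply H. Qed.

Lemma cont_mul (u v : R -> R) (t : R) : continuous u t -> continuous v t -> continuous (fun t => u t * v t) t.
Proof. intros Hu Hv. exact (continuous_mult (K := R_AbsRing) u v t Hu Hv). Qed.
Lemma cont_add (u v : R -> R) (t : R) : continuous u t -> continuous v t -> continuous (fun t => u t + v t) t.
Proof. intros Hu Hv. exact (continuous_plus (V := R_NormedModule) u v t Hu Hv). Qed.
Lemma cont_sq (u : R -> R) (t : R) : continuous u t -> continuous (fun t => u t ^ 2) t.
Proof.
  intros H. apply (continuous_ext (fun t => u t * u t)); [intros; simpl; ring|]. exact (cont_mul u u t H H).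
Qed.
Lemma cont_mod2 (f : R -> C) : (forall t, Ccont f t) -> forall t, continuous (fun t => Cmod (f t) ^ 2) t.
Proof.
  intros H t. apply (continuous_ext (fun t => Re (f t) ^ 2 + Im (f t) ^ 2)); [intros; now rewrite Cmod2_alt|].
  apply (cont_add (fun t => Re (f t) ^ 2) (fun t => Im (f t) ^ 2)).
  - apply (cont_sq (fun t => Re (f t))). apply H.
  - apply (cont_sq (fun t => Im (f t))). apply H.
Qed.

Ltac cont := lazymatch goal with
  | |- continuous (fun s => @?a s + @?b s) _ => apply (cont_add a b); cont
  | |- continuous (fun s => @?a s * @?b s) _ => apply (cont_mul a b); cont
  | |- continuous (fun s => (Cmod (@?a s)) ^ 2) _ => apply (cont_mod2 a); intros; auto
  | |- continuous (fun s => (@?a s) ^ 2) _ => apply (cont_sq a); cont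
  | |- continuous (fun _ => ?c) _ => apply continuous_const
  | |- continuous (fun s => Re (@?a s)) _ => apply (cont_Re a); intros; auto
  | |- continuous (fun s => Im (@?a s)) _ => apply (cont_Im a); intros; auto
  | |- _ => solve [auto]
  end.

Lemma mR_ext u v : (forall t, u t = v t) -> mR u = mR v.
Proof. intros H. f_equal. now apply functional_extensionality. Qed.

Lemma mR_plus (u v : R -> R) : (forall t, continuous u t) -> (forall t, continuous v t) -> mR (fun t => u t + v t) = mR u + mR v.
Proof. intros Hu Hv. rewrite (mR_ext _ (fun t => 1 * u t + 1 * v t)) by (intros; ring). rewrite mR_lin by assumption. ring. Qed.

Lemma mR_scal k (u : R -> R) : (forall t, continuous u t) -> mR (fun t => k * u t) = k * mR u.
Proof. intros Hu. rewrite (mR_ext _ (fun t => k * u t + 0 * u t)) by (intros; ring). rewrite mR_lin by assumption. ring. Qed.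

Lemma mR_jensen (u : R -> R) : (forall t, continuous u t) -> mR u ^ 2 <= mR (fun t => u t ^ 2).
Proof.
  intros Hu. assert (H : 0 <= mR (fun t => 1 * u t ^ 2 + (-2 * mR u) * u t + mR u ^ 2)).
  { rewrite <- (mR_const 0). apply mR_le.
    - intros; apply continuous_const.
    - intros t. cont.
    - intros t. generalize (pow2_ge_0 (u t - mR u)). lra. }
  rewrite (mR_plus (fun t => 1 * u t ^ 2 + (-2 * mR u) * u t) (fun _ => mR u ^ 2)) in H.
  - rewrite (mR_lin (fun t => u t ^ 2) u), mR_const in H; [lra|intros; cont|exact Hu].
  - intros t. cont.
  - intros; apply continuous_const.
Qed.

Lemma mR_split f : (forall t, Ccont f t) -> mR (fun t => Cmod (f t) ^ 2) = mR (fun t => Re (f t) ^ 2) + mR (fun t => Im (f t) ^ 2).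
Proof.
  intros H. rewrite (mR_ext _ (fun t => Re (f t) ^ 2 + Im (f t) ^ 2)) by (intros; apply Cmod2_alt).
  apply mR_plus; intros; cont.
Qed.

(* The mean value property of [f ^ 2] stands in for Parseval's identity. *)
Lemma Adisc_square f : Adisc f ->
  mR (fun t => Re (f (cis t)) ^ 2) - mR (fun t => Im (f (cis t)) ^ 2) = Re (f 0) ^ 2 - Im (f 0) ^ 2.
Proof.
  intros Hf. assert (Hc := Ccont_cis f (proj1 Hf)).
  assert (h := Adisc_mean _ (Adisc_mult f f Hf Hf)). cbv beta in h. apply (f_equal Re) in h. rewrite Re_mean in h.
  rewrite (mR_ext _ (fun t => 1 * Re (f (cis t)) ^ 2 + (-1) * Im (f (cis t)) ^ 2)) in h by (intros; unfold Re, Im; simpl; ring).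
  rewrite (mR_lin (fun t => Re (f (cis t)) ^ 2) (fun t => Im (f (cis t)) ^ 2)) in h by (intros; cont).
  unfold Re, Im in *. simpl in h. simpl. lra.
Qed.

Lemma Cmod_mean_sq f : (forall t, Ccont f t) -> Cmod (mean f) ^ 2 <= mR (fun t => Cmod (f t) ^ 2).
Proof.
  intros H. rewrite Cmod2_alt, Re_mean, Im_mean, mR_split by exact H.
  generalize (mR_jensen (fun t => Re (f t)) (cont_Re f H)) (mR_jensen (fun t => Im (f t)) (cont_Im f H)). lra.
Qed.

(** * Uniqueness *)

(** The factor in W <= kappa Q of [energy_w]; the second summand is the cost of the value V(0) and
    degenerates as lam approaches 1. *)
Definition kappa (lam : R) : R := 1 + 2 * lam / (1 - lam) ^ 2.
(** The sum of the bounds for the components p, w, u, v: here 36 = 2 + 22 + 12, where the 12 and the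
    last term belong to v, and 4 kappa to w. *)
Definition energy_const (lam : R) : R := 36 + 4 * kappa lam + 12 * (1 + lam ^ 2) * kappa lam.

(* [dz, dw, du, dv] are the differences of two lifts with the same eight coordinates; the three
   estimates say that the linear part of the system is small relative to the difference. *)
Section Energy.
Variables (lam b : R) (dz dw du dv : C -> C).
Hypothesis Hlam0 : 0 <= lam.
Hypothesis Hlam1 : lam <> 1.
Hypotheses (Az : Adisc dz) (Aw : Adisc dw) (Au : Adisc du) (Av : Adisc dv).
Hypotheses (z0 : dz 0 = 0) (z1 : Im (c1 dz) = 0) (w0 : dw 0 = 0) (w1 : c1 dw = 0) (u0 : Re (du 0) = 0).

Definition dp (t : R) : C := (Cconj (cis t) * dz (cis t))%C.
Definition Sd (t : R) : R := Cmod (dp t) + Cmod (dw (cis t)) + Cmod (du (cis t)) + Cmod (dv (cis t)).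
Definition nd (t : R) : R := Cmod (dp t) ^ 2 + Cmod (dw (cis t)) ^ 2 + (Cmod (du (cis t)) ^ 2 + Cmod (dv (cis t)) ^ 2).
Definition E3d (t : R) : C := (dv (cis t) - cis t * Cconj (dw (cis t)) + RtoC lam * Cconj (cis t) ^ 3 * dw (cis t))%C.

Hypothesis HbL : b ^ 2 * energy_const lam < 1.
Hypothesis H1 : forall t, Rabs (2 * Re (dp t)) <= b * Sd t.
Hypothesis H2 : forall t, Rabs (Im (du (cis t) + dp t)) <= b * Sd t.
Hypothesis H3 : forall t, Cmod (E3d t) <= b * Sd t.

Let P := divz dz.
Let AP : Adisc P. Proof. now apply Adisc_divz. Qed.
Let dpP t : dp t = P (cis t).
Proof. unfold dp, P. rewrite (divz_eq dz (cis t) z0). rewrite Cmult_assoc, (Cmult_comm (Cconj _)), cis_conj. ring. Qed.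
Let cdp : forall t, Ccont dp t.
Proof. intros t. apply Ccont_ext with (fun t => P (cis t)); [intros; symmetry; apply dpP|]. apply Ccont_cis, AP. Qed.
Let cw := Ccont_cis dw (proj1 Aw).
Let cu := Ccont_cis du (proj1 Au).
Let cv := Ccont_cis dv (proj1 Av).
Let cnd : forall t, continuous nd t.
Proof. intros t. unfold nd. cont. Qed.
Let N := mR nd.

(** [Sd] has four summands, so its square is at most 4 times the sum of squares [nd]. *)
Let bound_sq (x : R -> R) : (forall t, continuous x t) -> (forall t, Rabs (x t) <= b * Sd t) -> mR (fun t => x t ^ 2) <= 4 * b ^ 2 * N.
Proof.
  intros Hx Hxb. unfold N. rewrite <- mR_scal by exact cnd. apply mR_le.
  - intros; cont.
  - intros t. cont.
  - intros t. apply Rle_trans with ((b * Sd t) ^ 2).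
    + rewrite <- (pow2_abs (x t)). apply pow_incr. split; [apply Rabs_pos|apply Hxb].
    + rewrite Rpow_mult_distr. replace (4 * b ^ 2 * nd t) with (b ^ 2 * (4 * nd t)) by ring.
      apply Rmult_le_compat_l; [apply pow2_ge_0|]. unfold Sd, nd.
      generalize (Cmod (dp t)) (Cmod (dw (cis t))) (Cmod (du (cis t))) (Cmod (dv (cis t))). intros x1 x2 x3 x4.
      generalize (pow2_ge_0 (x1 - x2)) (pow2_ge_0 (x1 - x3)) (pow2_ge_0 (x1 - x4)) (pow2_ge_0 (x2 - x3)) (pow2_ge_0 (x2 - x4)) (pow2_ge_0 (x3 - x4)). lra.
Qed.

Lemma energy_reP : mR (fun t => Re (P (cis t)) ^ 2) <= b ^ 2 * N.
Proof.
  assert (h := bound_sq (fun t => 2 * Re (dp t)) ltac:(intros; cont) H1).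
  rewrite (mR_ext _ (fun t => 4 * Re (P (cis t)) ^ 2)) in h by (intros; rewrite dpP; ring).
  rewrite mR_scal in h by (intros; apply (cont_sq (fun t => Re (P (cis t)))); apply (Ccont_cis P (proj1 AP))). lra.
Qed.

Lemma P0_real : Im (P 0) = 0.
Proof.
  unfold P, divz. destruct (ClassicalEpsilon.excluded_middle_informative (RtoC 0 = 0)) as [_|n]; [exact z1|exfalso; now apply n].
Qed.

(** The first equation controls Re P only. Since P(0) is real, the mean value of P^2 makes the mean
    square of Im P at most that of Re P. *)
Lemma energy_p : mR (fun t => Cmod (dp t) ^ 2) <= 2 * b ^ 2 * N.
Proof.
  rewrite (mR_ext _ (fun t => Cmod (P (cis t)) ^ 2)) by (intros; now rewrite dpP).
  rewrite (mR_split (fun t => P (cis t))) by apply (Ccont_cis P (proj1 AP)).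
  assert (h := Adisc_square P AP). rewrite P0_real in h. generalize energy_reP (pow2_ge_0 (Re (P 0))). simpl in *. lra.
Qed.

(** Taking imaginary parts removes the real unknown [d] from the second equation, and Im(u - conj p)
    = Im(u + p) is the imaginary part of a holomorphic function. Its real part is then controlled by
    the normalisation Re du(0) = 0, through Re g(0) = Re P(0). *)
Let g (z : C) : C := (du z + P z)%C.
Let Ag : Adisc g. Proof. now apply Adisc_plus. Qed.
Let cg := Ccont_cis g (proj1 Ag).

Lemma energy_g : mR (fun t => Cmod (g (cis t)) ^ 2) <= 9 * b ^ 2 * N.
Proof.
  rewrite (mR_split (fun t => g (cis t))) by exact cg.
  assert (hI : mR (fun t => Im (g (cis t)) ^ 2) <= 4 * b ^ 2 * N).
  { apply (bound_sq (fun t => Im (g (cis t)))); [intros; apply cg|]. intros t. unfold g. rewrite <- dpP. apply H2. }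
  assert (h := Adisc_square g Ag).
  assert (hR : Re (g 0) ^ 2 <= b ^ 2 * N).
  { assert (h0 : Re (g 0) = Re (du 0) + Re (P 0)) by reflexivity. rewrite u0, Rplus_0_l in h0. rewrite h0.
    rewrite <- (Adisc_mean P AP), Re_mean.
    apply Rle_trans with (2 := energy_reP). apply (mR_jensen (fun t => Re (P (cis t)))). intros; apply (Ccont_cis P (proj1 AP)). }
  generalize (pow2_ge_0 (Im (g 0))). lra.
Qed.

Lemma Cmod2_plus x y : Cmod (x + y) ^ 2 <= 2 * Cmod x ^ 2 + 2 * Cmod y ^ 2.
Proof.
  apply Rle_trans with ((Cmod x + Cmod y) ^ 2).
  - apply pow_incr. split; [apply Cmod_ge_0|apply Cmod_triangle].
  - generalize (pow2_ge_0 (Cmod x - Cmod y)). lra.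
Qed.

Lemma energy_u : mR (fun t => Cmod (du (cis t)) ^ 2) <= 22 * b ^ 2 * N.
Proof.
  apply Rle_trans with (mR (fun t => 2 * Cmod (g (cis t)) ^ 2 + 2 * Cmod (dp t) ^ 2)).
  - apply mR_le; [intros; cont|intros; cont|].
    intros t. replace (du (cis t)) with (g (cis t) + (- dp t))%C by (unfold g; rewrite dpP; ring).
    rewrite <- (Cmod_opp (dp t)). apply Cmod2_plus.
  - rewrite (mR_lin (fun t => Cmod (g (cis t)) ^ 2) (fun t => Cmod (dp t) ^ 2)) by (intros; cont).
    generalize energy_g energy_p. lra.
Qed.

Let V1 := divz dw.
Let AV1 : Adisc V1. Proof. now apply Adisc_divz. Qed.
Let V10 : V1 0 = 0.
Proof. unfold V1, divz. destruct (ClassicalEpsilon.excluded_middle_informative (RtoC 0 = 0)) as [_|n]; [exact w1|exfalso; now apply n]. Qed.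
(** The normalisations on [dw] at 0 are vanishing to second order: dw = ze^2 V. *)
Let V := divz V1.
Let AV : Adisc V. Proof. now apply Adisc_divz. Qed.
Let dwV t : dw (cis t) = (cis t ^ 2 * V (cis t))%C.
Proof. rewrite (divz_eq dw (cis t) w0). fold V1. rewrite (divz_eq V1 (cis t) V10). fold V. simpl. ring. Qed.
Let cV := Ccont_cis V (proj1 AV).

(** Multiplied by ze, the third linear form becomes ze dv - conj V + lam V. The unknown dv now
    carries a factor vanishing at 0, so it drops out when tested against constants and against V. *)
Let e (t : R) : C := (cis t * E3d t)%C.
Let e_eq t : e t = (cis t * dv (cis t) - Cconj (V (cis t)) + RtoC lam * V (cis t))%C.
Proof.
  unfold e, E3d. rewrite dwV. assert (hc := cis_conj t). rewrite Cmult_conj, Cpow_conj.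
  transitivity (cis t * dv (cis t) - (cis t * Cconj (cis t)) ^ 2 * Cconj (V (cis t)) + RtoC lam * (cis t * Cconj (cis t)) ^ 3 * V (cis t))%C.
  - simpl. ring.
  - rewrite hc. simpl. ring.
Qed.
Let cE3 : forall t, Ccont E3d t.
Proof.
  intros t. unfold E3d.
  apply Ccont_ext with (fun t => (dv (cis t) + (- (1)) * (cis t * Cconj (dw (cis t)))) + RtoC lam * (Cconj (cis t) * (Cconj (cis t) * Cconj (cis t))) * dw (cis t))%C.
  { intros; simpl; ring. }
  ccont.
Qed.
Let ce : forall t, Ccont e t.
Proof. intros t. apply Ccont_mult; [apply Ccont_cis_id|apply cE3]. Qed.
Let mod_e t : Cmod (e t) = Cmod (E3d t).
Proof. unfold e. rewrite Cmod_mult, Cmod_cis. ring. Qed.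

Let energy_e : mR (fun t => Cmod (e t) ^ 2) <= 4 * b ^ 2 * N.
Proof.
  unfold N. rewrite <- mR_scal by exact cnd. apply mR_le.
  - intros; cont.
  - intros t. cont.
  - intros t. rewrite mod_e. apply Rle_trans with ((b * Sd t) ^ 2).
    + apply pow_incr. split; [apply Cmod_ge_0|apply H3].
    + rewrite Rpow_mult_distr. replace (4 * b ^ 2 * nd t) with (b ^ 2 * (4 * nd t)) by ring.
      apply Rmult_le_compat_l; [apply pow2_ge_0|]. unfold Sd, nd.
      generalize (Cmod (dp t)) (Cmod (dw (cis t))) (Cmod (du (cis t))) (Cmod (dv (cis t))). intros x1 x2 x3 x4.
      generalize (pow2_ge_0 (x1 - x2)) (pow2_ge_0 (x1 - x3)) (pow2_ge_0 (x1 - x4)) (pow2_ge_0 (x2 - x3)) (pow2_ge_0 (x2 - x4)) (pow2_ge_0 (x3 - x4)). lra.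
Qed.

(* [lam <> 1] enters here: the equation only determines [lam V(0) - conj V(0)]. *)
Lemma energy_V0 : (1 - lam) ^ 2 * Cmod (V 0) ^ 2 <= mR (fun t => Cmod (e t) ^ 2).
Proof.
  assert (hm : mean e = (RtoC lam * V 0 - Cconj (V 0))%C).
  { rewrite (mean_ext _ (fun t => (cis t * dv (cis t) + (RtoC lam * V (cis t) + (- (1)) * Cconj (V (cis t)))))%C) by (intros; rewrite e_eq; ring).
    assert (h := Adisc_mean _ (Adisc_mult (fun u => u) dv Adisc_id Av)). cbv beta in h.
    rewrite !mean_plus, !mean_scal, mean_conj, h, (Adisc_mean V AV); [ring|..];
      intros; ccont. }
  assert (hj := Cmod_mean_sq e ce). apply Rle_trans with (2 := hj). rewrite hm.
  assert (t1 := Cmod_triangle (RtoC lam * V 0 - Cconj (V 0)) (Cconj (V 0))).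
  replace (RtoC lam * V 0 - Cconj (V 0) + Cconj (V 0))%C with (RtoC lam * V 0)%C in t1 by ring.
  assert (t2 := Cmod_sub (RtoC lam * V 0) (RtoC lam * V 0 - Cconj (V 0))).
  replace (RtoC lam * V 0 - (RtoC lam * V 0 - Cconj (V 0)))%C with (Cconj (V 0)) in t2 by ring.
  rewrite Cmod_mult, Cmod_RtoC_nonneg, Cmod_conj in t1, t2 by exact Hlam0.
  set (X := Cmod (RtoC lam * V 0 - Cconj (V 0))) in *. set (v := Cmod (V 0)) in *.
  replace ((1 - lam) ^ 2 * v ^ 2) with (Rabs ((1 - lam) * v) ^ 2) by (rewrite pow2_abs; ring).
  apply pow_incr. split; [apply Rabs_pos|]. apply Rabs_le. lra.
Qed.

(** Testing against V gives mean(e V) = lam V(0)^2 - mean |V|^2. With Q the mean of |e|^2 and W that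
    of |V|^2, this yields W <= lam |V(0)|^2 + Q/2 + W/2, and [energy_V0] bounds the first term. *)
Lemma energy_w : mR (fun t => Cmod (dw (cis t)) ^ 2) <= 4 * kappa lam * b ^ 2 * N.
Proof.
  rewrite (mR_ext _ (fun t => Cmod (V (cis t)) ^ 2)).
  2:{ intros t. rewrite dwV, Cmod_mult, Cmod_pow, Cmod_cis. ring. }
  set (W := mR (fun t => Cmod (V (cis t)) ^ 2)). set (Q := mR (fun t => Cmod (e t) ^ 2)).
  assert (hm : mean (fun t => e t * V (cis t))%C = (RtoC lam * (V 0 * V 0) - mean (fun t => V (cis t) * Cconj (V (cis t))))%C).
  { rewrite (mean_ext _ (fun t => (cis t * (dv (cis t) * V (cis t)) + (RtoC lam * (V (cis t) * V (cis t)) + (- (1)) * (V (cis t) * Cconj (V (cis t))))))%C) by (intros; rewrite e_eq; ring).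
    assert (h := Adisc_mean _ (Adisc_mult (fun u => u) _ Adisc_id (Adisc_mult dv V Av AV))). cbv beta in h.
    assert (h' := Adisc_mean _ (Adisc_mult V V AV AV)). cbv beta in h'.
    rewrite !mean_plus, !mean_scal, h, h'; [ring|..];
      intros; ccont. }
  apply (f_equal Re) in hm. rewrite Re_mean in hm.
  assert (hW : Re (mean (fun t => V (cis t) * Cconj (V (cis t)))%C) = W).
  { rewrite Re_mean. apply mR_ext. intros t. rewrite <- Cmod2_conj. reflexivity. }
  assert (hm' : mR (fun t => Re (e t * V (cis t))) = Re (RtoC lam * (V 0 * V 0)) - W).
  { rewrite hm, <- hW. reflexivity. }
  assert (hl : - (1 / 2 * Q + 1 / 2 * W) <= mR (fun t => Re (e t * V (cis t)))).
  { unfold Q, W. rewrite <- (mR_lin (fun t => Cmod (e t) ^ 2) (fun t => Cmod (V (cis t)) ^ 2)) by (intros; cont).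
    rewrite <- (Rmult_1_l (mR (fun t => _ + _))), Ropp_mult_distr_l.
    rewrite <- mR_scal by (intros; cont).
    apply mR_le.
    - intros; cont.
    - intros. apply (cont_Re (fun t => e t * V (cis t))%C). intros; apply Ccont_mult; [apply ce|apply cV].
    - intros t. assert (h := re_le_Cmod (e t * V (cis t))). rewrite Cmod_mult in h. apply Rabs_le_between in h.
      generalize (pow2_ge_0 (Cmod (e t) - Cmod (V (cis t)))). lra. }
  assert (h0 : Re (RtoC lam * (V 0 * V 0)) <= lam * Cmod (V 0) ^ 2).
  { apply Rle_trans with (1 := Rle_abs _). apply Rle_trans with (1 := re_le_Cmod _). rewrite !Cmod_mult, Cmod_RtoC_nonneg by exact Hlam0. right; ring. }
  assert (hV := energy_V0). fold Q in hV. assert (hQ : Q <= 4 * b ^ 2 * N) by exact energy_e.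
  assert (hl1 : 0 < (1 - lam) ^ 2) by (apply pow2_gt_0; lra).
  assert (hv : Cmod (V 0) ^ 2 <= Q / (1 - lam) ^ 2).
  { apply Rmult_le_reg_l with ((1 - lam) ^ 2); [exact hl1|]. replace ((1 - lam) ^ 2 * (Q / (1 - lam) ^ 2)) with Q by (field; lra). exact hV. }
  assert (hlv : lam * Cmod (V 0) ^ 2 <= lam * (Q / (1 - lam) ^ 2)) by (now apply Rmult_le_compat_l).
  apply Rle_trans with (kappa lam * Q).
  - unfold kappa. replace ((1 + 2 * lam / (1 - lam) ^ 2) * Q) with (Q + 2 * (lam * (Q / (1 - lam) ^ 2))) by (field; lra). lra.
  - replace (4 * kappa lam * b ^ 2 * N) with (kappa lam * (4 * b ^ 2 * N)) by ring.
    apply Rmult_le_compat_l; [|exact hQ]. unfold kappa.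
    assert (0 <= 2 * lam / (1 - lam) ^ 2) by (apply Rmult_le_pos; [lra|left; now apply Rinv_0_lt_compat]). lra.
Qed.

Lemma energy_v : mR (fun t => Cmod (dv (cis t)) ^ 2) <= 3 * (4 * b ^ 2 * N + (1 + lam ^ 2) * (4 * kappa lam * b ^ 2 * N)).
Proof.
  apply Rle_trans with (mR (fun t => 3 * Cmod (e t) ^ 2 + (3 * (1 + lam ^ 2)) * Cmod (dw (cis t)) ^ 2)).
  - apply mR_le; [intros; cont|intros; cont|].
    intros t. rewrite mod_e.
    replace (dv (cis t)) with (E3d t + (cis t * Cconj (dw (cis t)) + (- (RtoC lam * Cconj (cis t) ^ 3 * dw (cis t)))))%C by (unfold E3d; ring).
    assert (h1 := Cmod_triangle (E3d t) (cis t * Cconj (dw (cis t)) + (- (RtoC lam * Cconj (cis t) ^ 3 * dw (cis t))))).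
    assert (h2 := Cmod_triangle (cis t * Cconj (dw (cis t))) (- (RtoC lam * Cconj (cis t) ^ 3 * dw (cis t)))).
    rewrite Cmod_opp, !Cmod_mult, Cmod_pow, !Cmod_conj, !Cmod_cis, Cmod_RtoC_nonneg in h2 by exact Hlam0.
    match type of h1 with ?X <= _ => set (x := X) in * end. assert (hx : 0 <= x) by apply Cmod_ge_0.
    set (a := Cmod (E3d t)) in *. set (c := Cmod (dw (cis t))) in *.
    apply Rle_trans with ((a + c + lam * c) ^ 2).
    + apply pow_incr. split; [exact hx|]. rewrite pow1 in h2. lra.
    + generalize (pow2_ge_0 (a - c)) (pow2_ge_0 (a - lam * c)) (pow2_ge_0 (c - lam * c)). lra.
  - rewrite (mR_lin (fun t => Cmod (e t) ^ 2) (fun t => Cmod (dw (cis t)) ^ 2)) by (intros; cont).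
    assert (h := energy_e). assert (h' := energy_w).
    assert (3 * (1 + lam ^ 2) * mR (fun t => Cmod (dw (cis t)) ^ 2) <= 3 * (1 + lam ^ 2) * (4 * kappa lam * b ^ 2 * N)).
    { apply Rmult_le_compat_l; [nra|exact h']. }
    lra.
Qed.

(** The four bounds add up to N <= b^2 energy_const N with a factor below 1, which forces N = 0. *)
Lemma energy_zero t : 0 < t < 2 * PI -> nd t = 0.
Proof.
  apply mR_zero; [exact cnd| |].
  - intros s. unfold nd. repeat apply Rplus_le_le_0_compat; apply pow2_ge_0.
  - assert (hN : N = mR (fun t => Cmod (dp t) ^ 2) + mR (fun t => Cmod (dw (cis t)) ^ 2)
       + (mR (fun t => Cmod (du (cis t)) ^ 2) + mR (fun t => Cmod (dv (cis t)) ^ 2))).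
    { unfold N, nd. rewrite (mR_plus (fun t => Cmod (dp t) ^ 2 + Cmod (dw (cis t)) ^ 2) (fun t => Cmod (du (cis t)) ^ 2 + Cmod (dv (cis t)) ^ 2))
        by (intros; cont).
      rewrite !mR_plus by (intros; cont). reflexivity. }
    fold N. generalize energy_p energy_w energy_u energy_v. intros a1 a2 a3 a4.
    assert (hf : N <= (b ^ 2 * energy_const lam) * N) by (unfold energy_const; lra).
    nra.
Qed.

End Energy.

(** * Components of a lift *)

Definition cz (F : C -> C4) (u : C) : C := fst (fst (F u)).
Definition cw (F : C -> C4) (u : C) : C := snd (fst (F u)).
Definition cu (F : C -> C4) (u : C) : C := fst (snd (F u)).
Definition cv (F : C -> C4) (u : C) : C := snd (snd (F u)).

Lemma c4minus_norm_ge u v :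
  Cmod (fst (fst u) - fst (fst v)) <= c4norm (c4minus u v) /\ Cmod (snd (fst u) - snd (fst v)) <= c4norm (c4minus u v) /\
  Cmod (fst (snd u) - fst (snd v)) <= c4norm (c4minus u v) /\ Cmod (snd (snd u) - snd (snd v)) <= c4norm (c4minus u v).
Proof. exact (c4norm_ge (c4minus u v)). Qed.

Lemma holder_dcont alpha c f : 0 < alpha ->
  (forall z w, Cmod z <= 1 -> Cmod w <= 1 -> z <> w -> Cmod (f z - f w) <= c * Rpower (Cmod (Cminus z w)) alpha) -> dcont f.
Proof.
  intros Ha H z Hz eps He.
  set (k := Rabs c + 1). assert (Hk : 0 < k) by (unfold k; generalize (Rabs_pos c); lra).
  exists (Rpower (eps / k) (/ alpha)). split; [apply exp_pos|].
  intros w Hw Hwz. destruct (ClassicalEpsilon.excluded_middle_informative (w = z)) as [->|n].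
  - replace (f z - f z)%C with (RtoC 0) by ring. rewrite Cmod_0; lra.
  - apply Rle_trans with (1 := H w z Hw Hz n).
    assert (hp : 0 < Cmod (w - z)) by now apply Cmod_pos_neq.
    assert (h : Rpower (Cmod (w - z)) alpha <= eps / k).
    { replace (eps / k) with (Rpower (Rpower (eps / k) (/ alpha)) alpha).
      - apply Rle_Rpower_l; [lra|lra].
      - rewrite Rpower_mult. replace (/ alpha * alpha) with 1 by (field; lra). apply Rpower_1.
        now apply Rdiv_lt_0_compat. }
    assert (h0 : 0 < Rpower (Cmod (w - z)) alpha) by apply exp_pos.
    apply Rle_trans with (k * (eps / k)); [|right; field; lra].
    apply Rle_trans with (k * Rpower (Cmod (w - z)) alpha).
    + apply Rmult_le_compat_r; [lra|]. unfold k. generalize (Rle_abs c). lra.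
    + apply Rmult_le_compat_l; lra.
Qed.

(** The uniqueness argument uses Hölder regularity only through this: continuity up to the boundary
    and holomorphy inside. *)
Lemma InA_Adisc alpha F : 0 < alpha -> InA alpha F -> Adisc (cz F) /\ Adisc (cw F) /\ Adisc (cu F) /\ Adisc (cv F).
Proof.
  intros Ha [_ [Hh [c [_ Hc]]]].
  assert (G : forall z w, Cmod z <= 1 -> Cmod w <= 1 -> z <> w ->
     Cmod (cz F z - cz F w) <= c * Rpower (Cmod (Cminus z w)) alpha /\
     Cmod (cw F z - cw F w) <= c * Rpower (Cmod (Cminus z w)) alpha /\
     Cmod (cu F z - cu F w) <= c * Rpower (Cmod (Cminus z w)) alpha /\
     Cmod (cv F z - cv F w) <= c * Rpower (Cmod (Cminus z w)) alpha).
  { intros z w Hz Hw Hn. assert (h := Hc z w Hz Hw Hn). destruct (c4minus_norm_ge (F z) (F w)) as [h1 [h2 [h3 h4]]].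
    unfold cz, cw, cu, cv. repeat split; eapply Rle_trans; eauto. }
  repeat split.
  1,3,5,7: apply (holder_dcont alpha c); [exact Ha|intros z w Hz Hw Hn; now apply (G z w Hz Hw Hn)].
  all: intros z Hz; apply (Hh z Hz).
Qed.

(** * Pointwise Lipschitz estimates for the nonlinear terms *)

Lemma prodlip (a a' b b' : C) A B x y : Cmod a <= A -> Cmod b' <= B -> Cmod (a - a') <= x -> Cmod (b - b') <= y ->
  Cmod (a * b - a' * b') <= A * y + x * B.
Proof.
  intros Ha Hb Hx Hy. replace (a * b - a' * b')%C with (a * (b - b') + (a - a') * b')%C by ring.
  apply Rle_trans with (1 := Cmod_triangle _ _). rewrite !Cmod_mult.
  apply Rplus_le_compat; apply Rmult_le_compat; auto; apply Cmod_ge_0.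
Qed.

Lemma powlip (a a' : C) x : Cmod a <= 2 -> Cmod a' <= 2 -> Cmod (a - a') <= x ->
  Cmod (a ^ 3 - a' ^ 3) <= 12 * x /\ Cmod (a ^ 4 - a' ^ 4) <= 32 * x.
Proof.
  intros Ha Ha' Hx.
  assert (h2 : Cmod (a * a - a' * a') <= 4 * x) by (generalize (prodlip a a' a a' 2 2 x x Ha Ha' Hx Hx); lra).
  assert (m2 : Cmod (a' * a') <= 4) by (rewrite Cmod_mult; generalize (Cmod_ge_0 a'); nra).
  assert (m2' : Cmod (a * a) <= 4) by (rewrite Cmod_mult; generalize (Cmod_ge_0 a); nra).
  split.
  - replace (a ^ 3 - a' ^ 3)%C with (a * (a * a) - a' * (a' * a'))%C by (simpl; ring).
    generalize (prodlip a a' (a * a) (a' * a') 2 4 x (4 * x) Ha m2 Hx h2). lra.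
  - replace (a ^ 4 - a' ^ 4)%C with ((a * a) * (a * a) - (a' * a') * (a' * a'))%C by (simpl; ring).
    generalize (prodlip _ _ _ _ 4 4 (4 * x) (4 * x) m2' m2 h2 h2). lra.
Qed.

Section Pointwise.
Variables (lam eta : R) (ze p w u v p' w' u' v' : C) (d d' : R).
Hypothesis Hlam : 0 <= lam.
Hypothesis Heta : 0 <= eta <= 1 / 2.
Hypothesis Heta2 : eta * (2 + 32 * lam) <= 1.
Hypothesis Hze : Cmod ze = 1.
Hypotheses (Bp : Cmod p <= eta) (Bw : Cmod w <= eta) (Bv : Cmod v <= eta) (Bu : Cmod u <= eta) (Bd : Rabs d <= eta).
Hypotheses (Bp' : Cmod p' <= eta) (Bw' : Cmod w' <= eta) (Bv' : Cmod v' <= eta) (Bu' : Cmod u' <= eta) (Bd' : Rabs d' <= eta).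
Hypotheses (E1 : sysp lam ze p w) (E2 : sysu lam ze p w d u) (E3 : sysv lam ze p w d v).
Hypotheses (E1' : sysp lam ze p' w') (E2' : sysu lam ze p' w' d' u') (E3' : sysv lam ze p' w' d' v').

Let S := Cmod (p - p') + Cmod (w - w') + Cmod (u - u') + Cmod (v - v').
Let D := Rabs (d - d').

Let hP : Cmod (p - p') <= S.
Proof. unfold S. generalize (Cmod_ge_0 (w - w')) (Cmod_ge_0 (u - u')) (Cmod_ge_0 (v - v')). lra. Qed.
Let hW : Cmod (w - w') <= S.
Proof. unfold S. generalize (Cmod_ge_0 (p - p')) (Cmod_ge_0 (u - u')) (Cmod_ge_0 (v - v')). lra. Qed.
Let hPW : Cmod (p - p') + Cmod (w - w') <= S.
Proof. unfold S. generalize (Cmod_ge_0 (u - u')) (Cmod_ge_0 (v - v')). lra. Qed.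
Let S0 : 0 <= S. Proof. apply Rle_trans with (2 := hP). apply Cmod_ge_0. Qed.

Let one q : Cmod q <= eta -> Cmod (1 + q) <= 2.
Proof. intros h. apply Rle_trans with (1 := Cmod_triangle _ _). rewrite Cmod_1. lra. Qed.
Let oned q q' : Cmod (1 + q - (1 + q')) = Cmod (q - q').
Proof. f_equal. ring. Qed.
Let conjd q q' : Cmod (Cconj q - Cconj q') = Cmod (q - q').
Proof. now rewrite <- Cminus_conj, Cmod_conj. Qed.
Let sq2 (a a' : C) : Cmod a <= eta -> Cmod a' <= eta -> Cmod (a ^ 2 - a' ^ 2) <= 2 * eta * Cmod (a - a').
Proof.
  intros h h'. replace (a ^ 2 - a' ^ 2)%C with (a * a - a' * a')%C by (simpl; ring).
  generalize (prodlip a a' a a' _ _ _ _ h h' (Rle_refl _) (Rle_refl _)). lra.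
Qed.
Let sqb (a : C) : Cmod a <= eta -> Cmod (a ^ 2) <= eta.
Proof. intros h. rewrite Cmod_pow. generalize (Cmod_ge_0 a). simpl. nra. Qed.

(** The square of [a] supplies a factor [eta] whether [q] or [a] varies. Such a factor in every
    nonlinear term is what makes the linear forms small relative to the difference of the
    solutions. *)
Let quart (k q q' a a' : C) : Cmod k = 1 -> Cmod q <= eta -> Cmod q' <= eta -> Cmod a <= eta -> Cmod a' <= eta ->
  Cmod (k * (1 + q) ^ 4 * a ^ 2 - k * (1 + q') ^ 4 * a' ^ 2) <= 32 * eta * (Cmod (q - q') + Cmod (a - a')).
Proof.
  intros Hk hq hq' ha ha'.
  replace (k * (1 + q) ^ 4 * a ^ 2 - k * (1 + q') ^ 4 * a' ^ 2)%C with (k * ((1 + q) ^ 4 * a ^ 2 - (1 + q') ^ 4 * a' ^ 2))%C by ring.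
  rewrite Cmod_mult, Hk, Rmult_1_l.
  assert (h4 : Cmod ((1 + q) ^ 4) <= 16).
  { rewrite Cmod_pow. replace 16 with (2 ^ 4) by ring. apply pow_incr. split; [apply Cmod_ge_0|now apply one]. }
  destruct (powlip (1 + q) (1 + q') (Cmod (q - q')) (one q hq) (one q' hq')) as [_ h]; [rewrite oned; lra|].
  generalize (prodlip _ _ _ _ _ _ _ _ h4 (sqb a' ha') h (sq2 a a' ha ha')). lra.
Qed.

Lemma pointwise1 : Rabs (2 * Re (p - p')) <= eta * (5 + 32 * lam) * S.
Proof.
  assert (Hc : RtoC (2 * Re (p - p')) = ((p + Cconj p) - (p' + Cconj p'))%C).
  { apply C_eq; simpl; ring. }
  rewrite <- Cmod_R, Hc, E1, E1'.
  assert (hk : Cmod (Cconj ze ^ 4) = 1) by (rewrite Cmod_pow, Cmod_conj, Hze; ring).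
  assert (hk' : Cmod (ze ^ 4) = 1) by (rewrite Cmod_pow, Hze; ring).
  assert (q1 := quart (Cconj ze ^ 4) (Cconj p) (Cconj p') w w' hk ltac:(now rewrite Cmod_conj) ltac:(now rewrite Cmod_conj) Bw Bw').
  assert (q2 := quart (ze ^ 4) p p' (Cconj w) (Cconj w') hk' Bp Bp' ltac:(now rewrite Cmod_conj) ltac:(now rewrite Cmod_conj)).
  rewrite conjd in q1, q2.
  assert (q3 := prodlip p p' (Cconj p) (Cconj p') eta eta _ _ Bp ltac:(now rewrite Cmod_conj) (Rle_refl _) (Req_le _ _ (conjd p p'))).
  assert (q4 := prodlip w w' (Cconj w) (Cconj w') eta eta _ _ Bw ltac:(now rewrite Cmod_conj) (Rle_refl _) (Req_le _ _ (conjd w w'))).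
  set (A := (Cconj ze ^ 4 * (1 + Cconj p) ^ 4 * w ^ 2)%C) in *. set (A' := (Cconj ze ^ 4 * (1 + Cconj p') ^ 4 * w' ^ 2)%C) in *.
  set (B := (ze ^ 4 * (1 + p) ^ 4 * Cconj w ^ 2)%C) in *. set (B' := (ze ^ 4 * (1 + p') ^ 4 * Cconj w' ^ 2)%C) in *.
  match goal with |- Cmod ?X <= _ => replace X with
    ((- (p * Cconj p - p' * Cconj p')) + ((- (w * Cconj w - w' * Cconj w')) + RtoC (lam / 2) * ((A - A') + (B - B'))))%C end.
  2:{ unfold Rdiv. rewrite RtoC_mult, RtoC_inv by lra. field. }
  eapply Rle_trans; [apply Cmod_triangle|]. eapply Rle_trans; [apply Rplus_le_compat_l, Cmod_triangle|].
  rewrite !Cmod_opp, Cmod_mult, Cmod_RtoC_nonneg by lra.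
  assert (q5 := Cmod_triangle (A - A') (B - B')).
  assert (q6 : lam / 2 * Cmod (A - A' + (B - B')) <= lam / 2 * (64 * eta * S)).
  { apply Rmult_le_compat_l; [lra|]. nra. }
  assert (0 <= eta * S) by nra. assert (eta * Cmod (p - p') + eta * Cmod (w - w') <= eta * S) by nra. nra.
Qed.

Let E2d := ((u - u') + RtoC (d - d') - Cconj (p - p'))%C.

Let e2_bound : Cmod E2d <= eta * ((1 + 32 * lam) * S + D).
Proof.
  unfold E2d.
  replace (u - u' + RtoC (d - d') - Cconj (p - p'))%C with ((u + RtoC d - Cconj p) - (u' + RtoC d' - Cconj p'))%C
    by (rewrite RtoC_minus, Cminus_conj; ring).
  rewrite E2, E2'.
  destruct (powlip (1 + p) (1 + p') (Cmod (p - p')) (one p Bp) (one p' Bp')) as [h3 _]; [rewrite oned; lra|].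
  assert (b3 : Cmod ((1 + p) ^ 3) <= 8).
  { rewrite Cmod_pow. replace 8 with (2 ^ 3) by ring. apply pow_incr. split; [apply Cmod_ge_0|now apply one]. }
  assert (q1 := prodlip ((1 + p) ^ 3) ((1 + p') ^ 3) (Cconj w ^ 2) (Cconj w' ^ 2) 8 eta _ _ b3
     (sqb (Cconj w') ltac:(now rewrite Cmod_conj)) h3 (sq2 (Cconj w) (Cconj w') ltac:(now rewrite Cmod_conj) ltac:(now rewrite Cmod_conj))).
  rewrite conjd in q1.
  assert (q2 := prodlip (RtoC d) (RtoC d') u u' eta eta D _ ltac:(now rewrite Cmod_R) Bu'
     ltac:(rewrite <- RtoC_minus, Cmod_R; apply Rle_refl) (Rle_refl _)).
  match goal with |- Cmod ?X <= _ => replace X with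
    ((- (RtoC d * u - RtoC d' * u')) + (- (RtoC (2 * lam) * (ze ^ 4 * ((1 + p) ^ 3 * Cconj w ^ 2 - (1 + p') ^ 3 * Cconj w' ^ 2)))))%C end.
  2:{ rewrite RtoC_mult. ring. }
  eapply Rle_trans; [apply Cmod_triangle|]. rewrite !Cmod_opp, !(Cmod_mult _ (_ * _)), (Cmod_mult _ (_ - _)), Cmod_pow, Hze, pow1, Cmod_RtoC_nonneg by lra.
  match type of q1 with ?X <= _ => set (x := X) in * end.
  assert (hx : x <= 16 * (eta * S)).
  { assert (eta * Cmod (p - p') + eta * Cmod (w - w') <= eta * S) by nra.
    assert (0 <= eta * Cmod (p - p')) by (apply Rmult_le_pos; [lra|apply Cmod_ge_0]). lra. }
  assert (hu : Cmod (u - u') <= S).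
  { unfold S. generalize (Cmod_ge_0 (p - p')) (Cmod_ge_0 (w - w')) (Cmod_ge_0 (v - v')). lra. }
  assert (eta * Cmod (u - u') <= eta * S) by (apply Rmult_le_compat_l; lra).
  assert (lam * x <= lam * (16 * (eta * S))) by (now apply Rmult_le_compat_l). lra.
Qed.

(** The multipliers are eliminated here. The second equation bounds D by S plus |E2d|, and the term
    eta D in the bound for E2d is absorbed because eta <= 1/2. *)
Let d_bound : D <= 4 * S.
Proof.
  assert (h : D <= Cmod E2d + S).
  { unfold D. rewrite <- Cmod_R.
    replace (RtoC (d - d')) with (E2d + (- (u - u') + Cconj (p - p')))%C by (unfold E2d; ring).
    apply Rle_trans with (1 := Cmod_triangle _ _). apply Rplus_le_compat_l.
    apply Rle_trans with (1 := Cmod_triangle _ _). rewrite Cmod_opp, Cmod_conj. unfold S.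
    generalize (Cmod_ge_0 (w - w')) (Cmod_ge_0 (v - v')). lra. }
  assert (h2 := e2_bound). assert (hD : 0 <= D) by apply Rabs_pos.
  assert (eta * D <= 1 / 2 * D) by (apply Rmult_le_compat_r; lra).
  assert (eta * (2 + 32 * lam) * S <= 1 * S) by (apply Rmult_le_compat_r; lra).
  assert (0 <= eta * S) by nra. lra.
Qed.

Lemma pointwise2 : Rabs (Im ((u - u') + (p - p'))) <= eta * (5 + 32 * lam) * S.
Proof.
  replace (Im (u - u' + (p - p'))) with (Im E2d) by (unfold E2d; simpl; ring).
  apply Rle_trans with (1 := im_le_Cmod _). apply Rle_trans with (1 := e2_bound).
  assert (h := d_bound). assert (eta * D <= eta * (4 * S)) by (apply Rmult_le_compat_l; lra). lra.
Qed.

Lemma pointwise3 : Cmod ((v - v') - ze * Cconj (w - w') + RtoC lam * Cconj ze ^ 3 * (w - w')) <= eta * (5 + 32 * lam) * S.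
Proof.
  replace ((v - v') - ze * Cconj (w - w') + RtoC lam * Cconj ze ^ 3 * (w - w'))%C with
    ((v - ze * Cconj w + RtoC lam * Cconj ze ^ 3 * w) - (v' - ze * Cconj w' + RtoC lam * Cconj ze ^ 3 * w'))%C
    by (rewrite Cminus_conj; ring).
  rewrite E3, E3'.
  assert (c1p : Cmod (Cconj p) <= eta) by now rewrite Cmod_conj. assert (c1p' : Cmod (Cconj p') <= eta) by now rewrite Cmod_conj.
  destruct (powlip (1 + Cconj p) (1 + Cconj p') (Cmod (p - p')) (one _ c1p) (one _ c1p')) as [_ h4]; [rewrite oned, conjd; lra|].
  assert (b4 : Cmod ((1 + Cconj p) ^ 4 - 1) <= 32 * eta).
  { destruct (powlip (1 + Cconj p) 1 eta (one _ c1p)) as [_ h]; [rewrite Cmod_1; lra|replace (1 + Cconj p - 1)%C with (Cconj p) by ring; exact c1p|].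
    replace (1 ^ 4)%C with (RtoC 1) in h by (simpl; ring). exact h. }
  assert (h4' : Cmod ((1 + Cconj p) ^ 4 - 1 - ((1 + Cconj p') ^ 4 - 1)) <= 32 * Cmod (p - p')).
  { replace ((1 + Cconj p) ^ 4 - 1 - ((1 + Cconj p') ^ 4 - 1))%C with ((1 + Cconj p) ^ 4 - (1 + Cconj p') ^ 4)%C by ring. exact h4. }
  assert (q1 := prodlip _ _ w w' _ _ _ _ b4 Bw' h4' (Rle_refl _)).
  assert (q2 := prodlip (RtoC d) (RtoC d') v v' eta eta D _ ltac:(now rewrite Cmod_R) Bv'
     ltac:(rewrite <- RtoC_minus, Cmod_R; apply Rle_refl) (Rle_refl _)).
  match goal with |- Cmod ?X <= _ => replace X with
    ((- (RtoC d * v - RtoC d' * v')) + (- (RtoC lam * (Cconj ze ^ 3 * (((1 + Cconj p) ^ 4 - 1) * w - ((1 + Cconj p') ^ 4 - 1) * w')))))%C end.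
  2:{ ring. }
  eapply Rle_trans; [apply Cmod_triangle|]. rewrite !Cmod_opp, !(Cmod_mult _ (_ * _)), (Cmod_mult _ (_ - _)), Cmod_pow, Cmod_conj, Hze, pow1, Cmod_RtoC_nonneg by lra.
  match type of q1 with ?X <= _ => set (x := X) in * end.
  assert (hx : x <= 32 * (eta * S)).
  { assert (eta * Cmod (p - p') + eta * Cmod (w - w') <= eta * S) by nra. lra. }
  assert (hv : Cmod (v - v') <= S).
  { unfold S. generalize (Cmod_ge_0 (p - p')) (Cmod_ge_0 (w - w')) (Cmod_ge_0 (u - u')). lra. }
  assert (eta * Cmod (v - v') <= eta * S) by (apply Rmult_le_compat_l; lra).
  assert (h := d_bound). assert (eta * D <= eta * (4 * S)) by (apply Rmult_le_compat_l; lra).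
  assert (lam * x <= lam * (32 * (eta * S))) by (now apply Rmult_le_compat_l). lra.
Qed.

End Pointwise.

(** The multiplier is not a component of the lift, so closeness of lifts says nothing directly about
    [d]. The second equation expresses it by small quantities and by d u, which |u| <= 1/2 allows to
    be absorbed. *)
Lemma small_d lam eps ze p w u d : 0 <= lam -> 0 <= eps <= 1 / 2 -> Cmod ze = 1 ->
  Cmod p <= eps -> Cmod w <= eps -> Cmod u <= eps -> sysu lam ze p w d u -> Rabs d <= (4 + 32 * lam) * eps.
Proof.
  intros Hl He Hz Hp Hw Hu E.
  assert (H : (RtoC d = Cconj p - u - 2 * RtoC lam * ze ^ 4 * (1 + p) ^ 3 * Cconj w ^ 2 - RtoC d * u)%C).
  { replace (RtoC d) with ((u + RtoC d - Cconj p) + (Cconj p - u))%C at 1 by ring. rewrite E. ring. }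
  apply (f_equal Cmod) in H. rewrite Cmod_R in H.
  assert (h1 := Cmod_sub (Cconj p - u - 2 * RtoC lam * ze ^ 4 * (1 + p) ^ 3 * Cconj w ^ 2) (RtoC d * u)).
  assert (h2 := Cmod_sub (Cconj p - u) (2 * RtoC lam * ze ^ 4 * (1 + p) ^ 3 * Cconj w ^ 2)).
  assert (h3 := Cmod_sub (Cconj p) u). rewrite Cmod_conj in h3.
  rewrite Cmod_mult, Cmod_R in h1.
  replace (2 * RtoC lam * ze ^ 4 * (1 + p) ^ 3 * Cconj w ^ 2)%C with (RtoC (2 * lam) * (ze ^ 4 * ((1 + p) ^ 3 * Cconj w ^ 2)))%C in * by (rewrite RtoC_mult; ring).
  assert (h4 : Cmod (RtoC (2 * lam) * (ze ^ 4 * ((1 + p) ^ 3 * Cconj w ^ 2))) <= 2 * lam * (8 * eps)).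
  { rewrite !Cmod_mult, !Cmod_pow, Hz, pow1, Rmult_1_l, Cmod_conj, Cmod_RtoC_nonneg by lra.
    apply Rmult_le_compat_l; [lra|].
    assert (Cmod (1 + p) ^ 3 <= 8).
    { replace 8 with (2 ^ 3) by ring. apply pow_incr. split; [apply Cmod_ge_0|]. apply Rle_trans with (1 := Cmod_triangle _ _). rewrite Cmod_1; lra. }
    assert (Cmod w ^ 2 <= eps) by (generalize (Cmod_ge_0 w); simpl; nra).
    apply Rmult_le_compat; try assumption; apply pow_le, Cmod_ge_0. }
  assert (h5 : Rabs d * Cmod u <= Rabs d * (1 / 2)) by (apply Rmult_le_compat_l; [apply Rabs_pos|lra]).
  lra.
Qed.

Lemma uniqueness lam alpha : 0 <= lam -> lam <> 1 -> 0 < alpha < 1 ->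
  exists eps, 0 < eps /\ forall F G, InA alpha F -> InA alpha G ->
    stationary_lift (rho lam) F -> stationary_lift (rho lam) G ->
    (forall z, Cmod z <= 1 -> c4norm (c4minus (F z) (f0lift z)) <= eps) ->
    (forall z, Cmod z <= 1 -> c4norm (c4minus (G z) (f0lift z)) <= eps) ->
    cz F 0 = cz G 0 -> Im (c1 (cz F)) = Im (c1 (cz G)) -> cw F 0 = cw G 0 -> c1 (cw F) = c1 (cw G) ->
    Re (cu F 0) = Re (cu G 0) -> F = G.
Proof.
  intros Hl Hl1 Ha.
  assert (HL : 0 < energy_const lam).
  { unfold energy_const, kappa. assert (0 <= 2 * lam / (1 - lam) ^ 2).
    { apply Rmult_le_pos; [lra|]. left. apply Rinv_0_lt_compat. apply pow2_gt_0. lra. }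
    assert (0 <= 12 * (1 + lam ^ 2)) by nra. nra. }
  (* The pointwise estimates have constant b = eta (5 + 32 lam). The first bound gives b <= 1/2, the
     second b (energy_const + 1) <= 1/2, and together b^2 energy_const < 1. *)
  set (eta := Rmin (/ (2 * (5 + 32 * lam))) (/ (2 * (5 + 32 * lam) * (energy_const lam + 1)))).
  assert (Heta : 0 < eta) by (apply Rmin_pos; apply Rinv_0_lt_compat; nra).
  assert (Heta1 : eta * (5 + 32 * lam) <= 1 / 2).
  { apply Rle_trans with (/ (2 * (5 + 32 * lam)) * (5 + 32 * lam)); [apply Rmult_le_compat_r; [lra|apply Rmin_l]|right; field; lra]. }
  assert (Heta2 : eta * (5 + 32 * lam) <= / (2 * (energy_const lam + 1))).
  { apply Rle_trans with (/ (2 * (5 + 32 * lam) * (energy_const lam + 1)) * (5 + 32 * lam)); [apply Rmult_le_compat_r; [lra|apply Rmin_r]|right; field; lra]. }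
  set (b := eta * (5 + 32 * lam)) in *. assert (Hb : 0 <= b) by (unfold b; nra).
  assert (HbL : b ^ 2 * energy_const lam < 1).
  { assert (b * (energy_const lam + 1) <= 1 / 2).
    { apply Rle_trans with (/ (2 * (energy_const lam + 1)) * (energy_const lam + 1)); [apply Rmult_le_compat_r; lra|right; field; lra]. }
    nra. }
  (* The loss in [small_d] is 4 + 32 lam, so this radius keeps the multiplier below [eta] as
     well. *)
  exists (eta / (4 + 32 * lam)). split; [apply Rdiv_lt_0_compat; lra|].
  set (eps := eta / (4 + 32 * lam)).
  assert (Eeps : (4 + 32 * lam) * eps = eta) by (unfold eps; field; lra).
  assert (Heps : 0 < eps) by (apply Rdiv_lt_0_compat; lra).
  assert (Hle : 0 <= lam * eta) by (apply Rmult_le_pos; lra).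
  assert (Heta3 : eta <= 1 / 2) by (unfold b in Heta1; lra).
  assert (Hle' : 0 <= lam * eps) by (apply Rmult_le_pos; lra).
  assert (Heps2 : eps <= eta) by lra.
  intros F G HF HG SF SG CF CG k1 k2 k3 k4 k5.
  destruct (InA_Adisc alpha F ltac:(lra) HF) as [Fz [Fw [Fu Fv]]].
  destruct (InA_Adisc alpha G ltac:(lra) HG) as [Gz [Gw [Gu Gv]]].
  assert (Hsys : forall H, stationary_lift (rho lam) H -> (forall z, Cmod z <= 1 -> c4norm (c4minus (H z) (f0lift z)) <= eps) ->
    forall t, exists d, Rabs d <= eta /\ Cmod (Cconj (cis t) * cz H (cis t) - 1) <= eta /\ Cmod (cw H (cis t)) <= eta /\
      Cmod (cu H (cis t) - 1) <= eta /\ Cmod (cv H (cis t)) <= eta /\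
      sysp lam (cis t) (Cconj (cis t) * cz H (cis t) - 1) (cw H (cis t)) /\
      sysu lam (cis t) (Cconj (cis t) * cz H (cis t) - 1) (cw H (cis t)) d (cu H (cis t) - 1) /\
      sysv lam (cis t) (Cconj (cis t) * cz H (cis t) - 1) (cw H (cis t)) d (cv H (cis t))).
  { intros H SH CH t. assert (Hc : Cmod (cis t) = 1) by apply Cmod_cis.
    assert (CHt := CH (cis t) ltac:(lra)). unfold f0lift in CHt. destruct (Rle_dec (Cmod (cis t)) 1) as [_|n]; [|lra].
    destruct (c4minus_norm_ge (H (cis t)) ((cis t, RtoC 0), (RtoC 1, RtoC 0))) as [n1 [n2 [n3 n4]]].
    apply (fun a => Rle_trans _ _ _ a CHt) in n1. apply (fun a => Rle_trans _ _ _ a CHt) in n2.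
    apply (fun a => Rle_trans _ _ _ a CHt) in n3. apply (fun a => Rle_trans _ _ _ a CHt) in n4.
    change (Cmod (cz H (cis t) - cis t) <= eps) in n1. change (Cmod (cw H (cis t) - 0) <= eps) in n2.
    change (Cmod (cu H (cis t) - 1) <= eps) in n3. change (Cmod (cv H (cis t) - 0) <= eps) in n4.
    replace (cw H (cis t) - 0)%C with (cw H (cis t)) in n2 by ring. replace (cv H (cis t) - 0)%C with (cv H (cis t)) in n4 by ring.
    assert (n1' : Cmod (Cconj (cis t) * cz H (cis t) - 1) <= eps).
    { replace (Cconj (cis t) * cz H (cis t) - 1)%C with (Cconj (cis t) * (cz H (cis t) - cis t) + (cis t * Cconj (cis t) - 1))%C by ring.
      rewrite cis_conj. replace (Cconj (cis t) * (cz H (cis t) - cis t) + (1 - 1))%C with (Cconj (cis t) * (cz H (cis t) - cis t))%C by ring.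
      rewrite Cmod_mult, Cmod_conj, Hc. lra. }
    assert (hz : (cu H (cis t) <> 0)%C).
    { intros h. rewrite h in n3. replace (0 - 1)%C with (- (1))%C in n3 by ring. rewrite Cmod_m1 in n3. lra. }
    assert (hNM : NM (rho lam) (cis t) ((cz H (cis t), cw H (cis t)), (cu H (cis t), cv H (cis t)))).
    { replace ((cz H (cis t), cw H (cis t)), (cu H (cis t), cv H (cis t))) with (H (cis t)).
      - apply SH. exact Hc.
      - unfold cz, cw, cu, cv. destruct (H (cis t)) as [[? ?] [? ?]]. reflexivity. }
    destruct (sys_of_NM lam (cis t) _ _ _ _ (cis_conj t) hz hNM) as [s1 [s2 s3]].
    eexists. split; [rewrite <- Eeps; eapply small_d; [exact Hl| |exact Hc| | | |exact s2]; lra|].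
    repeat split; try eassumption; lra. }
  assert (HFs := Hsys F SF CF). assert (HGs := Hsys G SG CG). clear Hsys.
  pose (dz := fun z => (cz F z - cz G z)%C). pose (dw := fun z => (cw F z - cw G z)%C).
  pose (du := fun z => (cu F z - cu G z)%C). pose (dv := fun z => (cv F z - cv G z)%C).
  assert (Az : Adisc dz) by now apply Adisc_minus. assert (Aw : Adisc dw) by now apply Adisc_minus.
  assert (Au : Adisc du) by now apply Adisc_minus. assert (Av : Adisc dv) by now apply Adisc_minus.
  assert (Hc1 : forall f g, Adisc f -> Adisc g -> c1 (fun z => f z - g z)%C = (c1 f - c1 g)%C).
  { intros f g Hf Hg. unfold c1. rewrite <- mean_minus.
    - apply mean_ext. intros; ring.
    - intros t. apply (Ccont_mult (fun t => f (cis t))); [now apply Ccont_cis, Hf|apply Ccis_conj].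
    - intros t. apply (Ccont_mult (fun t => g (cis t))); [now apply Ccont_cis, Hg|apply Ccis_conj]. }
  assert (Hdp : forall t, dp dz t = ((Cconj (cis t) * cz F (cis t) - 1) - (Cconj (cis t) * cz G (cis t) - 1))%C).
  { intros t. unfold dp, dz. ring. }
  assert (HS : forall t, Sd dz dw du dv t = Cmod ((Cconj (cis t) * cz F (cis t) - 1) - (Cconj (cis t) * cz G (cis t) - 1)) + Cmod (cw F (cis t) - cw G (cis t))
     + Cmod ((cu F (cis t) - 1) - (cu G (cis t) - 1)) + Cmod (cv F (cis t) - cv G (cis t))).
  { intros t. unfold Sd. rewrite Hdp. do 2 f_equal. unfold du. f_equal. ring. }
  assert (Hn : forall t, 0 < t < 2 * PI -> nd dz dw du dv t = 0).
  { assert (Hpt : forall t, Rabs (2 * Re (dp dz t)) <= b * Sd dz dw du dv t /\ Rabs (Im (du (cis t) + dp dz t)) <= b * Sd dz dw du dv t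
       /\ Cmod (E3d lam dw dv t) <= b * Sd dz dw du dv t).
    { intros t. rewrite HS, Hdp. unfold E3d, du, dw, dv.
      destruct (HFs t) as [d [D0 [D1 [D2 [D3 [D4 [S1 [S2 S3]]]]]]]].
      destruct (HGs t) as [d' [D0' [D1' [D2' [D3' [D4' [S1' [S2' S3']]]]]]]].
      assert (hc := Cmod_cis t).
      assert (he : 0 <= eta <= 1 / 2) by lra.
      assert (he2 : eta * (2 + 32 * lam) <= 1) by (unfold b in Heta1; lra).
      split; [|split].
      - eapply pointwise1; eassumption.
      - replace (cu F (cis t) - cu G (cis t))%C with (cu F (cis t) - 1 - (cu G (cis t) - 1))%C by ring.
        eapply (pointwise2 lam eta (cis t)) with (d := d) (d' := d'); eassumption.
      - eapply (pointwise3 lam eta (cis t)) with (d := d) (d' := d'); eassumption. }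
    intros t Ht. apply (energy_zero lam b dz dw du dv Hl Hl1 Az Aw Au Av).
    - unfold dz. rewrite k1. ring.
    - unfold dz. rewrite Hc1 by assumption. change (Im (c1 (cz F)) + - Im (c1 (cz G)) = 0). rewrite k2. ring.
    - unfold dw. rewrite k3. ring.
    - unfold dw. rewrite Hc1 by assumption. rewrite k4. ring.
    - change (Re (cu F 0) + - Re (cu G 0) = 0). rewrite k5. ring.
    - exact HbL.
    - intros; apply Hpt.
    - intros; apply Hpt.
    - intros; apply Hpt.
    - exact Ht. }
  assert (Hz : forall t, 0 < t < 2 * PI -> dz (cis t) = 0 /\ dw (cis t) = 0 /\ du (cis t) = 0 /\ dv (cis t) = 0).
  { intros t Ht. assert (h := Hn t Ht). unfold nd in h.
    assert (hsq : forall c, Cmod c ^ 2 = 0 -> c = 0).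
    { intros c hc. apply Cmod_eq_0. nra. }
    generalize (pow2_ge_0 (Cmod (dp dz t))) (pow2_ge_0 (Cmod (dw (cis t)))) (pow2_ge_0 (Cmod (du (cis t)))) (pow2_ge_0 (Cmod (dv (cis t)))).
    intros. repeat split; try (apply hsq; lra).
    assert (hp : dp dz t = 0) by (apply hsq; lra). unfold dp in hp.
    transitivity (cis t * (Cconj (cis t) * dz (cis t)))%C; [|rewrite hp; ring].
    rewrite Cmult_assoc, cis_conj. ring. }
  apply functional_extensionality. intros z. destruct (Rle_or_lt (Cmod z) 1) as [h|h].
  - assert (V1 := Adisc_vanish_open dz Az (fun t Ht => proj1 (Hz t Ht)) z h).
    assert (V2 := Adisc_vanish_open dw Aw (fun t Ht => proj1 (proj2 (Hz t Ht))) z h).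
    assert (V3 := Adisc_vanish_open du Au (fun t Ht => proj1 (proj2 (proj2 (Hz t Ht)))) z h).
    assert (V4 := Adisc_vanish_open dv Av (fun t Ht => proj2 (proj2 (proj2 (Hz t Ht)))) z h).
    apply C4_eq; apply Ceq_minus; assumption.
  - destruct HF as [f0 _]. destruct HG as [g0 _]. now rewrite f0, g0.
Qed.

(** * Taylor coefficients of power series *)

Lemma isum_delta (c : C) : isum (fun n => if (n =? 0)%Z then c else RtoC 0) c.
Proof.
  exists (Cmod c). intros N. destruct N as [|N].
  - simpl. replace (c - 0)%C with c by ring. right. field.
  - assert (E : psum (fun n => if (n =? 0)%Z then c else RtoC 0) (S N) = c).
    { induction N as [|N IH].
      - simpl. ring.
      - change (psum (fun n => if (n =? 0)%Z then c else RtoC 0) (S (S N))) with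
          (psum (fun n => if (n =? 0)%Z then c else RtoC 0) (S N) + ((if (Z.of_nat (S N) =? 0)%Z then c else RtoC 0)
             + (if (-1 - Z.of_nat (S N) =? 0)%Z then c else RtoC 0)))%C.
        rewrite IH. destruct (Z.eqb_spec (Z.of_nat (S N)) 0); [lia|]. destruct (Z.eqb_spec (-1 - Z.of_nat (S N)) 0); [lia|]. ring. }
    rewrite E. replace (c - c)%C with (RtoC 0) by ring. rewrite Cmod_0.
    apply Rmult_le_pos; [apply Cmod_ge_0|]. left; apply Rinv_0_lt_compat. generalize (pos_INR (S N)); lra.
Qed.

(** One step of Horner's scheme; it yields both the value at 0 and, in [c1_hol], the next
    coefficient. *)
Lemma hol_unfold a c z : nb a c -> Cmod z <= 1 -> hol a z = (a 0%Z + z * hol (sh (-1) a) z)%C.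
Proof.
  intros Ha Hz. apply CsumZ_eq with (1 := hol_dom a c z Ha Hz).
  assert (Hb := nb_sh (-1) _ _ Ha). assert (Hd := hol_dom _ _ _ Hb Hz).
  assert (Hs := isum_scal z _ _ (CsumZ_isum _ _ Hd)).
  apply isum_shift with (c := Cmod z * (c * wt (-1) ^ 4)) (j := (-1)%Z) in Hs; [|now apply dom_scal].
  assert (H := isum_plus _ _ _ _ (isum_delta (a 0%Z)) Hs).
  match type of H with isum ?f _ => replace (holterm a z) with f; [exact H|] end.
  apply functional_extensionality; intros n. unfold holterm, sh.
  destruct (Z.eqb_spec n 0) as [->|n0].
  - simpl. ring.
  - destruct (Z_lt_dec n 0) as [l|l]; destruct (Z_lt_dec (n + -1) 0) as [l'|l']; try lia; [ring|].
    replace (n + -1 - -1)%Z with n by lia.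
    replace (Z.to_nat n) with (S (Z.to_nat (n + -1))) by lia. simpl Cpow. ring.
Qed.

Lemma hol_0 a c : nb a c -> hol a 0 = a 0%Z.
Proof. intros Ha. rewrite (hol_unfold a c) by (try rewrite Cmod_0; auto; lra). ring. Qed.

Lemma Adisc_hol a c : nb a c -> Adisc (hol a).
Proof.
  intros Ha. split.
  - intros z Hz eps He. assert (Hc := nb_nonneg _ _ Ha). exists (eps / (8 * c + 1)). split; [apply Rdiv_lt_0_compat; lra|].
    intros w Hw Hwz. apply Rle_trans with (1 := hol_lip a c w z Ha Hw Hz).
    apply Rle_trans with ((8 * c + 1) * (eps / (8 * c + 1))); [|right; field; lra].
    apply Rmult_le_compat; try lra. apply Cmod_ge_0.
  - intros z Hz. now apply hol_cdiff with c.
Qed.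

Lemma mean_cis : mean cis = 0.
Proof. exact (Adisc_mean (fun u => u) Adisc_id). Qed.

(** After multiplication by conj ze the series splits into a_0 conj ze, of mean zero, and the
    shifted series, whose mean is its value a_1 at 0. *)
Lemma c1_hol a c : nb a c -> c1 (hol a) = a 1%Z.
Proof.
  intros Ha. unfold c1. assert (Hb := nb_sh (-1) _ _ Ha).
  assert (Hcb := Ccont_cis _ (proj1 (Adisc_hol _ _ Hb))).
  rewrite (mean_ext _ (fun t => a 0%Z * Cconj (cis t) + hol (sh (-1) a) (cis t))%C).
  - rewrite mean_plus, mean_scal, mean_conj, mean_cis, (Adisc_mean _ (Adisc_hol _ _ Hb)), (hol_0 _ _ Hb).
    + unfold sh. simpl. apply C_eq; unfold Re, Im; simpl; ring.
    + intros; ccont.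
    + intros; ccont.
    + intros; ccont.
    + exact Hcb.
  - intros t. rewrite (hol_unfold a c (cis t) Ha) by (rewrite Cmod_cis; lra).
    transitivity (a 0%Z * Cconj (cis t) + (cis t * Cconj (cis t)) * hol (sh (-1) a) (cis t))%C; [ring|].
    rewrite cis_conj. ring.
Qed.

Lemma c1_ext f g : (forall t, f (cis t) = g (cis t)) -> c1 f = c1 g.
Proof. intros H. apply mean_ext. intros t. now rewrite H. Qed.

(** * The eight real coordinates *)

(* The coefficient of index [-1] of [p] is [z(0)], since [z = ze (1 + p)]. *)
Definition coordE (Y : E) (k : nat) : R :=
  match k with
  | 0 => Re (Y Ip (-1)%Z) | 1 => Im (Y Ip (-1)%Z) | 2 => Im (Y Ip 0%Z)
  | 3 => Re (Y Iw 0%Z) | 4 => Im (Y Iw 0%Z) | 5 => Re (Y Iw 1%Z) | 6 => Im (Y Iw 1%Z)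
  | _ => Re (Y Iu 0%Z)
  end%nat.

(** The same eight numbers read off from the map by values at 0 and boundary integrals, so that they
    apply to every Hölder lift. The last one is shifted because zt = 1 + u. *)
Definition coordF (F : C -> C4) (k : nat) : R :=
  match k with
  | 0 => Re (cz F (RtoC 0)) | 1 => Im (cz F (RtoC 0)) | 2 => Im (c1 (cz F))
  | 3 => Re (cw F (RtoC 0)) | 4 => Im (cw F (RtoC 0)) | 5 => Re (c1 (cw F)) | 6 => Im (c1 (cw F))
  | _ => (Re (cu F (RtoC 0)) - 1)%R
  end%nat.

Ltac nat8 k := destruct k as [|[|[|[|[|[|[|k]]]]]]].

Lemma coordE_add Y Z k : coordE (Eadd Y Z) k = coordE Y k + coordE Z k.
Proof. nat8 k; reflexivity. Qed.
Lemma coordE_sc r Y k : coordE (Esc r Y) k = r * coordE Y k.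
Proof. nat8 k; simpl; unfold sc, Re, Im; simpl; ring. Qed.
Lemma coordE_eta lam x k : coordE (eta lam x) k = f8 x k.
Proof. nat8 k; reflexivity. Qed.

(** This is the normalisation of the right inverse: nothing is put at the frequencies -1 of p, 0 and
    1 of w, nor into Im p_0 and Re u_0. Fixed points and linearised solutions thus inherit the
    coordinates of their data. *)
Lemma coordE_B lam Y Z k : coordE (Bop lam Y Z) k = 0.
Proof.
  nat8 k; simpl; unfold Pp, Pw, Pu1, Pu2, Pasym, e1, sadd, msk, sc, cj; simpl; unfold Re, Im; simpl; try ring.
Qed.

Lemma coordF_param Y k : coordF (param Y) k = coordE Y k.
Proof.
  assert (H0 : Cmod 0 <= 1) by (rewrite Cmod_0; lra).
  assert (hz : cz (param Y) 0 = Y Ip (-1)%Z).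
  { unfold cz. rewrite param_in by exact H0. cbn [fst snd]. rewrite (hol_0 _ _ (nb_sh1 Y)). unfold sh. simpl. ring. }
  assert (hw : cw (param Y) 0 = Y Iw 0%Z).
  { unfold cw. rewrite param_in by exact H0. cbn [fst snd]. rewrite (hol_0 _ _ (nb_norm Y Iw)). ring. }
  assert (hu : cu (param Y) 0 = (1 + Y Iu 0%Z)%C).
  { unfold cu. rewrite param_in by exact H0. cbn [fst snd]. rewrite (hol_0 _ _ (nb_norm Y Iu)). ring. }
  assert (hz1 : c1 (cz (param Y)) = (1 + Y Ip 0%Z)%C).
  { rewrite (c1_ext _ (fun u => u + hol (sh 1 (Y Ip)) u)%C).
    - assert (Hh := c1_hol _ _ (nb_sh1 Y)). unfold c1 in *.
      assert (Hc := Ccont_cis _ (proj1 (Adisc_hol _ _ (nb_sh1 Y)))).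
      rewrite (mean_ext _ (fun t => 1 + hol (sh 1 (Y Ip)) (cis t) * Cconj (cis t))%C).
      + rewrite mean_plus, mean_const, Hh; [unfold sh; simpl; reflexivity|intros; ccont|intros; ccont].
      + intros t. rewrite <- (cis_conj t). ring.
    - intros t. unfold cz. rewrite param_in by (rewrite Cmod_cis; lra). reflexivity. }
  assert (hw1 : c1 (cw (param Y)) = Y Iw 1%Z).
  { rewrite <- (c1_hol _ _ (nb_norm Y Iw)). apply c1_ext. intros t. unfold cw. rewrite param_in by (rewrite Cmod_cis; lra). cbn [fst snd]. ring. }
  unfold coordF, coordE. rewrite hz, hw, hu, hz1, hw1. nat8 k; simpl; try reflexivity; unfold Re, Im; simpl; ring.
Qed.

(** The coordinates depend only on the map on the disc, so a linear relation between maps becomes a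
    relation between coordinates. *)
Lemma hols_zero_coordE W : (forall z, Cmod z <= 1 -> hols W z = c4zero) -> forall k, coordE W k = 0.
Proof.
  intros H k.
  assert (Hc : forall z, Cmod z <= 1 -> hol (sh 1 (W Ip)) z = 0 /\ hol (W Iw) z = 0 /\ hol (W Iu) z = 0).
  { intros z Hz. assert (h := H z Hz). unfold hols in h. destruct (Rle_dec (Cmod z) 1); [|contradiction].
    repeat split; [exact (f_equal (fun u : C4 => fst (fst u)) h)|exact (f_equal (fun u : C4 => snd (fst u)) h)|exact (f_equal (fun u : C4 => fst (snd u)) h)]. }
  assert (H0 : Cmod 0 <= 1) by (rewrite Cmod_0; lra).
  assert (Ht : forall t, Cmod (cis t) <= 1) by (intros; rewrite Cmod_cis; lra).
  assert (hz : W Ip (-1)%Z = 0) by (rewrite <- (proj1 (Hc 0 H0)), (hol_0 _ _ (nb_sh1 W)); reflexivity).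
  assert (hw : W Iw 0%Z = 0) by (rewrite <- (proj1 (proj2 (Hc 0 H0))), (hol_0 _ _ (nb_norm W Iw)); reflexivity).
  assert (hu : W Iu 0%Z = 0) by (rewrite <- (proj2 (proj2 (Hc 0 H0))), (hol_0 _ _ (nb_norm W Iu)); reflexivity).
  assert (hc0 : c1 (fun _ => RtoC 0) = 0).
  { unfold c1. rewrite (mean_ext _ (fun _ => RtoC 0)) by (intros; ring). apply mean_const. }
  assert (hz1 : W Ip 0%Z = 0).
  { change (sh 1 (W Ip) 1%Z = 0). rewrite <- (c1_hol _ _ (nb_sh1 W)), <- hc0. apply c1_ext. intros t. apply (Hc _ (Ht t)). }
  assert (hw1 : W Iw 1%Z = 0).
  { rewrite <- (c1_hol _ _ (nb_norm W Iw)), <- hc0. apply c1_ext. intros t. apply (Hc _ (Ht t)). }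
  unfold coordE. rewrite hz, hw, hu, hz1, hw1. nat8 k; reflexivity.
Qed.

Lemma InA_f0lift alpha : 0 < alpha < 1 -> InA alpha f0lift.
Proof.
  intros Ha. replace f0lift with (param E0); [now apply param_InA|].
  apply functional_extensionality; intros z. unfold param. replace (hols E0 z) with (hols (Esc 0 E0) z).
  - rewrite hols_sc. c4.
  - f_equal. Eext. ring.
Qed.

Lemma coordF_f0lift k : coordF f0lift k = 0.
Proof.
  replace f0lift with (param E0).
  - rewrite coordF_param. nat8 k; reflexivity.
  - apply functional_extensionality; intros z. unfold param. replace (hols E0 z) with (hols (Esc 0 E0) z).
    + rewrite hols_sc. c4.
    + f_equal. Eext. ring.
Qed.

(** Lipschitz for the uniform norm alone; the factor 2 is the one lost in [mean_bound]. *)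
Lemma coordF_lip alpha F G c k : 0 < alpha < 1 -> InA alpha F -> InA alpha G ->
  (forall z, Cmod z <= 1 -> c4norm (c4minus (F z) (G z)) <= c) -> Rabs (coordF F k - coordF G k) <= 2 * c.
Proof.
  intros Ha HF HG H.
  destruct (InA_Adisc alpha F ltac:(lra) HF) as [Fz [Fw [Fu _]]].
  destruct (InA_Adisc alpha G ltac:(lra) HG) as [Gz [Gw [Gu _]]].
  assert (Hc : forall z, Cmod z <= 1 -> Cmod (cz F z - cz G z) <= c /\ Cmod (cw F z - cw G z) <= c /\ Cmod (cu F z - cu G z) <= c).
  { intros z Hz. destruct (c4minus_norm_ge (F z) (G z)) as [h1 [h2 [h3 _]]]. assert (h := H z Hz).
    repeat split; (eapply Rle_trans; [eassumption|exact h]). }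
  assert (H0 : Cmod 0 <= 1) by (rewrite Cmod_0; lra). destruct (Hc 0 H0) as [a1 [a2 a3]].
  assert (Hc1 : forall f g, Adisc f -> Adisc g -> (forall z, Cmod z <= 1 -> Cmod (f z - g z) <= c) -> Cmod (c1 f - c1 g) <= 2 * c).
  { intros f g Hf Hg Hfg. assert (cf := Ccont_cis f (proj1 Hf)). assert (cg := Ccont_cis g (proj1 Hg)).
    assert (h := Ccont_cis _ (proj1 (Adisc_minus f g Hf Hg))). cbv beta in h.
    assert (hcb := Ccis_conj).
    unfold c1. rewrite <- mean_minus by (intros; ccont).
    rewrite (mean_ext _ (fun t => (f (cis t) - g (cis t)) * Cconj (cis t))%C) by (intros; ring).
    apply mean_bound.
    - intros t. apply (Ccont_mult (fun t => f (cis t) - g (cis t))%C); auto.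
    - intros t. rewrite Cmod_mult, Cmod_conj, Cmod_cis, Rmult_1_r. apply Hfg. rewrite Cmod_cis; lra. }
  assert (b1 := Hc1 _ _ Fz Gz (fun z Hz => proj1 (Hc z Hz))).
  assert (b2 := Hc1 _ _ Fw Gw (fun z Hz => proj1 (proj2 (Hc z Hz)))).
  assert (hc0 : 0 <= c) by (apply Rle_trans with (2 := a1); apply Cmod_ge_0).
  assert (P1 : forall a b : C, Cmod (a - b) <= 2 * c -> Rabs (Re a - Re b) <= 2 * c) by (intros a b h; apply Rle_trans with (2 := h); apply (re_le_Cmod (a - b))).
  assert (P2 : forall a b : C, Cmod (a - b) <= 2 * c -> Rabs (Im a - Im b) <= 2 * c) by (intros a b h; apply Rle_trans with (2 := h); apply (im_le_Cmod (a - b))).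
  nat8 k; unfold coordF; try (apply P1; lra); try (apply P2; lra).
  replace (Re (cu F 0) - 1 - (Re (cu G 0) - 1)) with (Re (cu F 0) - Re (cu G 0)) by ring. apply P1; lra.
Qed.

(** * Hölder balls *)

(** The constant 1, unlike the 4 of [c4norm_triangle], is what makes balls open. Cauchy-Schwarz is
    obtained from the squares in Lagrange's identity. *)
Lemma c4norm_minkowski u v : c4norm (c4plus u v) <= c4norm u + c4norm v.
Proof.
  destruct u as [[a b] [c d]], v as [[a' b'] [c' d']]. unfold c4norm, c4plus, c2plus. cbn [fst snd].
  assert (h1 := Cmod_triangle a a'). assert (h2 := Cmod_triangle b b'). assert (h3 := Cmod_triangle c c'). assert (h4 := Cmod_triangle d d').
  assert (p1 := Cmod_ge_0 (a + a')). assert (p2 := Cmod_ge_0 (b + b')). assert (p3 := Cmod_ge_0 (c + c')). assert (p4 := Cmod_ge_0 (d + d')).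
  set (A := Cmod a) in *. set (B := Cmod b) in *. set (G := Cmod c) in *. set (D := Cmod d) in *.
  set (A' := Cmod a') in *. set (B' := Cmod b') in *. set (G' := Cmod c') in *. set (D' := Cmod d') in *.
  set (X := A ^ 2 + B ^ 2 + G ^ 2 + D ^ 2). set (X' := A' ^ 2 + B' ^ 2 + G' ^ 2 + D' ^ 2).
  assert (hX : 0 <= X) by (unfold X; generalize (pow2_ge_0 A) (pow2_ge_0 B) (pow2_ge_0 G) (pow2_ge_0 D); lra).
  assert (hX' : 0 <= X') by (unfold X'; generalize (pow2_ge_0 A') (pow2_ge_0 B') (pow2_ge_0 G') (pow2_ge_0 D'); lra).
  assert (cs : A * A' + B * B' + G * G' + D * D' <= sqrt X * sqrt X').
  { rewrite <- sqrt_mult by assumption. apply Rle_trans with (Rabs (A * A' + B * B' + G * G' + D * D')); [apply Rle_abs|].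
    rewrite <- sqrt_Rsqr_abs. apply sqrt_le_1_alt. unfold Rsqr, X, X'.
    generalize (pow2_ge_0 (A * B' - B * A')) (pow2_ge_0 (A * G' - G * A')) (pow2_ge_0 (A * D' - D * A'))
      (pow2_ge_0 (B * G' - G * B')) (pow2_ge_0 (B * D' - D * B')) (pow2_ge_0 (G * D' - D * G')). lra. }
  assert (s1 := sqrt_pos X). assert (s2 := sqrt_pos X').
  apply Rle_trans with (sqrt ((sqrt X + sqrt X') ^ 2)); [|rewrite sqrt_pow2; lra].
  apply sqrt_le_1_alt.
  assert (e1' := sqrt_sqrt X hX). assert (e2' := sqrt_sqrt X' hX').
  apply Rle_trans with ((A + A') ^ 2 + (B + B') ^ 2 + (G + G') ^ 2 + (D + D') ^ 2).
  - repeat apply Rplus_le_compat; apply pow_incr; split; assumption.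
  - unfold X, X' in *. lra.
Qed.

Lemma hbound_trans alpha (P Q S : C -> C4) c d :
  hbound alpha (fun z => c4minus (P z) (Q z)) c -> hbound alpha (fun z => c4minus (Q z) (S z)) d ->
  hbound alpha (fun z => c4minus (P z) (S z)) (c + d).
Proof.
  intros [H1 H2] [H3 H4]. split.
  - intros z Hz. replace (c4minus (P z) (S z)) with (c4plus (c4minus (P z) (Q z)) (c4minus (Q z) (S z))) by c4.
    apply Rle_trans with (1 := c4norm_minkowski _ _). generalize (H1 z Hz) (H3 z Hz). lra.
  - intros z w Hz Hw Hn.
    replace (c4minus (c4minus (P z) (S z)) (c4minus (P w) (S w))) with
      (c4plus (c4minus (c4minus (P z) (Q z)) (c4minus (P w) (Q w))) (c4minus (c4minus (Q z) (S z)) (c4minus (Q w) (S w)))) by c4.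
    apply Rle_trans with (1 := c4norm_minkowski _ _). generalize (H2 z w Hz Hw Hn) (H4 z w Hz Hw Hn). lra.
Qed.

(** Membership comes with a bound strictly below [eps]; half of the gap is room for perturbation. *)
Lemma hball_open alpha F0 eps H : hball alpha F0 eps H ->
  exists e, 0 < e /\ forall H', hbound alpha (fun z => c4minus (H' z) (H z)) e -> hball alpha F0 eps H'.
Proof.
  intros [c [Hc Hb]]. exists ((eps - c) / 2). split; [lra|]. intros H' Hb'.
  exists ((eps - c) / 2 + c). split; [lra|]. now apply hbound_trans with H.
Qed.

(** * Smoothness *)

Lemma hCk_sub alpha d (U U' : Rn d -> Prop) k phi : (forall x, U' x -> U x) -> hCk alpha U k phi -> hCk alpha U' k phi.
Proof.
  intros HU. revert phi. induction k as [|k IH]; intros phi [H1 H2].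
  - split; [|exact I]. intros x Hx eps He. destruct (H1 x (HU x Hx) eps He) as [d' [Hd h]]. exists d'. split; auto.
  - split.
    + intros x Hx eps He. destruct (H1 x (HU x Hx) eps He) as [d' [Hd h]]. exists d'. split; auto.
    + intros i. destruct (H2 i) as [psi [h1 h2]]. exists psi. split; [|now apply IH].
      intros x Hx. apply h1. auto.
Qed.

(** * The chart and its derivatives *)

Section Chart.
Variables (lam alpha K rad r0 : R).
Hypothesis Halpha : 0 < alpha < 1.
Hypothesis Hlam : 1 - lam ^ 2 <> 0.
Hypothesis HB : Ebil (Bop lam) K.
Hypothesis Hrad : 0 < rad.
Hypothesis HKrad : 8 * K * rad <= 1.
Hypothesis Hrad2 : rad <= 1 / 16.
Hypothesis Hr0 : 0 < r0.
Hypothesis HCr0 : Ceta lam * r0 <= rad / 2.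

(** By the bound on [r0], the image of the box under [eta] lies in the ball of radius rad / 2, where
    the fixed point exists. *)
Definition box (x : Rn 8) : Prop := forall i, Rabs (x i) < r0.

Let Ceta0 : 0 <= Ceta lam.
Proof. unfold Ceta. generalize (Rabs_pos lam) (pow2_ge_0 lam). lra. Qed.

Lemma box_open : open_Rn box.
Proof.
  intros x Hx.
  assert (H : forall k : nat, exists d, 0 < d /\ forall v, Rabs (v - f8 x k) < d -> Rabs v < r0).
  { intros k. exists (r0 - Rabs (f8 x k)). assert (h : Rabs (f8 x k) < r0) by (nat8 k; apply Hx). split; [lra|].
    intros v Hv. replace v with ((v - f8 x k) + f8 x k) by ring. apply Rle_lt_trans with (1 := Rabs_triang _ _). lra. }
  destruct (H 0%nat) as [d0 [p0 q0]]. destruct (H 1%nat) as [d1 [p1 q1']]. destruct (H 2%nat) as [d2 [p2 q2]].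
  destruct (H 3%nat) as [d3 [p3 q3]]. destruct (H 4%nat) as [d4 [p4 q4]]. destruct (H 5%nat) as [d5 [p5 q5]].
  destruct (H 6%nat) as [d6 [p6 q6]]. destruct (H 7%nat) as [d7 [p7 q7]].
  set (m := Rmin (Rmin (Rmin d0 d1) (Rmin d2 d3)) (Rmin (Rmin d4 d5) (Rmin d6 d7))).
  assert (Hm : 0 < m) by (unfold m; repeat apply Rmin_pos; assumption).
  assert (L : m <= d0 /\ m <= d1 /\ m <= d2 /\ m <= d3 /\ m <= d4 /\ m <= d5 /\ m <= d6 /\ m <= d7).
  { unfold m, Rmin. repeat destruct (Rle_dec _ _); lra. }
  exists m. split; [exact Hm|]. intros y Hy.
  unfold box; apply (fin8_ind (fun i => Rabs (y i) < r0)); [apply q0|apply q1'|apply q2|apply q3|apply q4|apply q5|apply q6|apply q7];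
  (eapply Rlt_le_trans; [apply Hy|apply L]).
Qed.

Let Hdm x : box x -> nrm (eta lam x) <= rad / 2.
Proof.
  intros Hx. apply Rle_trans with (2 := HCr0). apply eta_bound; [lra|]. intros j. left. apply Hx.
Qed.

Definition Yx (x : Rn 8) : E := Ysol (Bop lam) rad 8 (eta lam) x.
Definition phi (x : Rn 8) : C -> C4 := param (Yx x).

Let HY x : box x -> is_ysol (Bop lam) rad (eta lam x) (Yx x).
Proof. intros Hx. exact (Ysol_spec (Bop lam) K rad HB Hrad HKrad 8 (eta lam) box Hdm x Hx). Qed.

Lemma phi_InA x : InA alpha (phi x).
Proof. now apply param_InA. Qed.

Lemma phi_sup x z : box x -> Cmod z <= 1 -> c4norm (c4minus (phi x z) (f0lift z)) <= 152 * rad.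
Proof.
  intros Hx Hz. destruct (HY x Hx) as [h _].
  replace (c4minus (phi x z) (f0lift z)) with (hols (Yx x) z) by (unfold phi, param; c4).
  apply Rle_trans with (1 := hols_sup _ _ Hz). lra.
Qed.

Lemma phi_stationary x : box x -> stationary_lift (rho lam) (phi x).
Proof.
  intros Hx. destruct (HY x Hx) as [h1 h2]. apply (param_stationary lam x (Yx x) Hlam h2). lra.
Qed.

(** [coordF] is a left inverse of the chart: [eta] contributes [x] and the quadratic term
    contributes nothing. *)
Lemma phi_coordF x k : box x -> coordF (phi x) k = f8 x k.
Proof.
  intros Hx. destruct (HY x Hx) as [_ h]. unfold phi. rewrite coordF_param, h, coordE_add, coordE_eta, coordE_B. ring.
Qed.

Lemma Econt_hcont f : Econt 8 box f -> hcont alpha box (fun x => hols (f x)).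
Proof.
  intros Hf x Hx eps He. destruct (Hf x Hx (eps / 304)) as [d [Hd h]]; [lra|]. exists d. split; [exact Hd|].
  intros y Hy Hs. apply hbound_ext with (hols (Esub (f y) (f x))); [intros; apply hols_sub|].
  replace eps with (304 * (eps / 304)) by field. apply hols_hbound; [exact Halpha|now apply h].
Qed.

Lemma Epart_hpartial i f g : Epart 8 box i f g -> hpartial alpha box (fun x => hols (f x)) i (fun x => hols (g x)).
Proof.
  intros Hf x Hx eps He. destruct (Hf x Hx (eps / 304)) as [d [Hd h]]; [lra|]. exists d. split; [exact Hd|].
  intros t Ht. apply hbound_ext with (hols (Esub (Esc (/ t) (Esub (f (shift x i t)) (f x))) (g x))).
  - intros z _. now rewrite hols_sub, hols_sc, hols_sub.
  - replace eps with (304 * (eps / 304)) by field. apply hols_hbound; [exact Halpha|now apply h].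
Qed.

(** Induction on the order for the whole class at once: each partial derivative exists and belongs
    to it again. *)
Lemma diff_closed_hCk k f : diff_closed (Bop lam) rad 8 (eta lam) f -> hCk alpha box k (fun x => hols (f x)).
Proof.
  revert f. induction k as [|k IH]; intros f Hf; (split; [apply Econt_hcont; now apply (diff_closed_cont (Bop lam) K rad HB Hrad HKrad 8 (eta lam) (Ceta lam) box Ceta0 (eta_lip lam) Hdm)|]).
  - exact I.
  - intros i. destruct (diff_closed_part (Bop lam) K rad HB Hrad HKrad 8 (eta lam) (kap lam) (Ceta lam) box Ceta0 (eta_shift lam) (eta_lip lam) Hdm box_open f i Hf) as [g [Hg1 Hg2]].
    exists (fun x => hols (g x)). split; [now apply Epart_hpartial|now apply IH].
Qed.

(** The partial derivative of [Yx] in the direction [i], by [Ysol_part]; writing it as a linearised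
    solution keeps it in [diff_closed]. *)
Definition Zx (i : Fin.t 8) (x : Rn 8) : E := lsol (Bop lam) (Yx x) (kap lam i).

Lemma phi_cont : hcont alpha box phi.
Proof.
  intros x Hx eps He. assert (h : hcont alpha box (fun x => hols (Yx x))).
  { apply Econt_hcont. apply (Ysol_cont (Bop lam) K rad HB Hrad HKrad 8 (eta lam) (Ceta lam) box Ceta0 (eta_lip lam) Hdm). }
  destruct (h x Hx eps He) as [d [Hd h']]. exists d. split; [exact Hd|]. intros y Hy Hs.
  apply hbound_ext with (2 := h' y Hy Hs). intros z _. unfold phi, param. c4.
Qed.

Lemma phi_part i : hpartial alpha box phi i (fun x => hols (Zx i x)).
Proof.
  intros x Hx eps He.
  assert (h : hpartial alpha box (fun x => hols (Yx x)) i (fun x => hols (Zx i x))).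
  { apply Epart_hpartial. apply (Ysol_part (Bop lam) K rad HB Hrad HKrad 8 (eta lam) (kap lam) (Ceta lam) box Ceta0 (eta_shift lam) (eta_lip lam) Hdm box_open i). }
  destruct (h x Hx eps He) as [d [Hd h']]. exists d. split; [exact Hd|]. intros t Ht.
  apply hbound_ext with (2 := h' t Ht). intros z _. unfold phi, param. c4.
Qed.

Lemma Zx_coordE i x k : box x -> coordE (Zx i x) k = f8 (unitv i) k.
Proof.
  intros Hx. destruct (HY x Hx) as [h1 _].
  assert (h := lsol_spec (Bop lam) K rad HB HKrad (Yx x) (kap lam i) h1). unfold is_lsol in h. fold (Zx i x) in h.
  rewrite h, !coordE_add, !coordE_B. unfold kap. rewrite coordE_eta. ring.
Qed.

(** Each coordinate of the vanishing combination is one of the [a i], since the derivatives have the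
    unit vectors as coordinates. *)
Lemma phi_immersion x (a : Rn 8) : box x ->
  (forall z, Cmod z <= 1 -> finsum (fun i => c4rscal (a i) (hols (Zx i x) z)) = c4zero) -> forall i, a i = 0.
Proof.
  intros Hx H.
  set (i0 := @Fin.F1 7). set (i1 := Fin.FS (@Fin.F1 6)). set (i2 := Fin.FS (Fin.FS (@Fin.F1 5))).
  set (i3 := Fin.FS (Fin.FS (Fin.FS (@Fin.F1 4)))). set (i4 := Fin.FS (Fin.FS (Fin.FS (Fin.FS (@Fin.F1 3))))).
  set (i5 := Fin.FS (Fin.FS (Fin.FS (Fin.FS (Fin.FS (@Fin.F1 2)))))).
  set (i6 := Fin.FS (Fin.FS (Fin.FS (Fin.FS (Fin.FS (Fin.FS (@Fin.F1 1))))))).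
  set (i7 := Fin.FS (Fin.FS (Fin.FS (Fin.FS (Fin.FS (Fin.FS (Fin.FS (@Fin.F1 0)))))))).
  pose (T := fun i => Esc (a i) (Zx i x)).
  pose (W := Eadd (T i0) (Eadd (T i1) (Eadd (T i2) (Eadd (T i3) (Eadd (T i4) (Eadd (T i5) (Eadd (T i6) (Eadd (T i7) E0)))))))).
  assert (HW : forall k, coordE W k = 0).
  { apply hols_zero_coordE. intros z Hz. rewrite <- (H z Hz). unfold W, T. rewrite !hols_add, !hols_sc.
    replace (hols E0 z) with c4zero; [reflexivity|].
    unfold hols. destruct (Rle_dec (Cmod z) 1); [|reflexivity].
    assert (hh : forall b, (forall n, b n = RtoC 0) -> hol b z = 0).
    { intros b Hb0. assert (nbb : nb b 0) by (intros n; rewrite Hb0, Cmod_0; apply div_wt_nonneg; lra).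
      apply Cmod_eq_0. apply Rle_antisym; [|apply Cmod_ge_0]. generalize (hol_bound b 0 z nbb Hz). lra. }
    rewrite !hh by (intros; reflexivity). reflexivity. }
  assert (HT : forall i k, coordE (T i) k = a i * f8 (unitv i) k) by (intros i k; unfold T; rewrite coordE_sc, Zx_coordE by exact Hx; reflexivity).
  assert (HE : forall k, coordE E0 k = 0) by (intros k; nat8 k; reflexivity).
  assert (HW' : forall k, a i0 * f8 (unitv i0) k + (a i1 * f8 (unitv i1) k + (a i2 * f8 (unitv i2) k + (a i3 * f8 (unitv i3) k
     + (a i4 * f8 (unitv i4) k + (a i5 * f8 (unitv i5) k + (a i6 * f8 (unitv i6) k + (a i7 * f8 (unitv i7) k + 0))))))) = 0).
  { intros k. apply eq_trans with (2 := HW k). unfold W. rewrite !coordE_add, !HT, HE. reflexivity. }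
  apply (fin8_ind (fun i => a i = 0)); [generalize (HW' 0%nat)|generalize (HW' 1%nat)|generalize (HW' 2%nat)|generalize (HW' 3%nat)|
    generalize (HW' 4%nat)|generalize (HW' 5%nat)|generalize (HW' 6%nat)|generalize (HW' 7%nat)];
  cbv [f8 unitv Fin.eq_dec i0 i1 i2 i3 i4 i5 i6 i7]; simpl; lra.
Qed.

End Chart.

Definition mk8 (g : nat -> R) : Rn 8 := fun i => g (proj1_sig (Fin.to_nat i)).

Lemma f8_mk8 g k : (k < 8)%nat -> f8 (mk8 g) k = g k.
Proof. intros H. do 8 (destruct k as [|k]; [reflexivity|]). lia. Qed.

Lemma f8_inj x y : (forall k, (k < 8)%nat -> f8 x k = f8 y k) -> x = y.
Proof.
  intros H. apply functional_extensionality. apply (fin8_ind (fun i => x i = y i)).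
  - apply (H 0%nat); lia.
  - apply (H 1%nat); lia.
  - apply (H 2%nat); lia.
  - apply (H 3%nat); lia.
  - apply (H 4%nat); lia.
  - apply (H 5%nat); lia.
  - apply (H 6%nat); lia.
  - apply (H 7%nat); lia.
Qed.

Theorem theorem3p1 (lam alpha : R) :
  0 <= lam -> lam <> 1 -> 0 < alpha < 1 ->
  exists V : (C -> C4) -> Prop,
    is_nbhd_A alpha f0lift V /\
    smooth_submanifold alpha 8
      (fun F => V F /\ stationary_lift (rho lam) F).
Proof.
  intros Hl Hl1 Ha.
  assert (Hlam : 1 - lam ^ 2 <> 0) by nra.
  destruct (uniqueness lam alpha Hl Hl1 Ha) as [ep [Hep Huniq]].
  destruct (Bop_bil lam) as [K HB]. assert (HK := bil_K _ _ HB).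
  (* Three demands: contraction of the quadratic map, fixed points small enough to give stationary
     lifts, and chart values within [ep] of [f0lift], 152 being the constant of [hols_sup]. *)
  set (rad := Rmin (/ (8 * (K + 1))) (Rmin (1 / 16) (ep / 152))).
  assert (Hrad : 0 < rad).
  { unfold rad. repeat apply Rmin_pos; try lra. apply Rinv_0_lt_compat; lra. }
  assert (Hr1 : rad <= / (8 * (K + 1))) by apply Rmin_l.
  assert (Hr2 : rad <= 1 / 16) by (apply Rle_trans with (1 := Rmin_r _ _); apply Rmin_l).
  assert (Hr3 : rad <= ep / 152) by (apply Rle_trans with (1 := Rmin_r _ _); apply Rmin_r).
  assert (HKrad : 8 * K * rad <= 1).
  { apply Rle_trans with (8 * (K + 1) * / (8 * (K + 1))); [|right; field; lra]. apply Rmult_le_compat; lra. }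
  assert (HC0 : 0 <= Ceta lam) by (unfold Ceta; generalize (Rabs_pos lam) (pow2_ge_0 lam); lra).
  set (r0 := rad / (2 * (Ceta lam + 1))).
  assert (Hr0 : 0 < r0) by (apply Rdiv_lt_0_compat; lra).
  assert (HCr0 : Ceta lam * r0 <= rad / 2).
  { apply Rle_trans with ((Ceta lam + 1) * r0); [apply Rmult_le_compat_r; lra|]. right. unfold r0. field. lra. }
  (* Within [ep] uniqueness applies; within r0 / 2 the coordinates fall into the box, since
     [coordF_lip] doubles distances. *)
  set (ev := Rmin ep (r0 / 2)). assert (Hev : 0 < ev) by (apply Rmin_pos; lra).
  assert (Hev1 : ev <= ep) by apply Rmin_l. assert (Hev2 : ev <= r0 / 2) by apply Rmin_r.
  pose (V := fun F => InA alpha F /\ hball alpha f0lift ev F).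
  exists V. split.
  { split; [intros F [h _]; exact h|]. exists ev. split; [exact Hev|]. intros F h1 h2. now split. }
  set (ph := phi lam rad). set (bx := box r0).
  assert (Pst := phi_stationary lam K rad r0 Hlam HB Hrad HKrad Hr2 Hr0 HCr0). fold ph bx in Pst.
  assert (PcF := phi_coordF lam K rad r0 HB Hrad HKrad Hr0 HCr0). fold ph bx in PcF.
  assert (PIn := phi_InA lam alpha rad Ha). fold ph in PIn.
  assert (Psup := phi_sup lam K rad r0 HB Hrad HKrad Hr0 HCr0). fold ph bx in Psup.
  assert (Pcont := phi_cont lam alpha K rad r0 Ha HB Hrad HKrad Hr0 HCr0). fold ph bx in Pcont.
  (* Surjectivity: a lift in V and the chart value at its own coordinates agree in all eight
     coordinates, hence coincide by uniqueness. *)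
  assert (Hsol : forall G, V G -> stationary_lift (rho lam) G -> exists x, bx x /\ ph x = G).
  { intros G [G1 [c [Hc [G2 _]]]] G3.
    assert (Hk : forall k, Rabs (coordF G k) < r0).
    { intros k. replace (coordF G k) with (coordF G k - coordF f0lift k) by (rewrite coordF_f0lift; ring).
      apply Rle_lt_trans with (2 * c); [|lra]. now apply coordF_lip with alpha; [|  |apply InA_f0lift|]. }
    exists (mk8 (coordF G)). assert (Hx : bx (mk8 (coordF G))) by (intros i; apply Hk). split; [exact Hx|].
    assert (E : forall k, (k < 8)%nat -> coordF (ph (mk8 (coordF G))) k = coordF G k).
    { intros k Hk8. rewrite PcF by exact Hx. now apply f8_mk8. }
    apply Huniq; auto.
    - intros z Hz. apply Rle_trans with (1 := Psup _ z Hx Hz). lra.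
    - intros z Hz. apply Rle_trans with (1 := G2 z Hz). lra.
    - apply C_eq; [apply (E 0%nat); lia|apply (E 1%nat); lia].
    - apply (E 2%nat); lia.
    - apply C_eq; [apply (E 3%nat); lia|apply (E 4%nat); lia].
    - apply C_eq; [apply (E 5%nat); lia|apply (E 6%nat); lia].
    - generalize (E 7%nat ltac:(lia)). simpl. lra. }
  split; [intros F [[h _] _]; exact h|].
  intros F HF.
  (* One map serves as chart around every F. The ball of radius [ev] keeps its values in V; the
     radius 1 around F is arbitrary, because the map already covers all lifts in V. *)
  pose (U := fun x => bx x /\ hball alpha f0lift ev (ph x) /\ hball alpha F 1 (ph x)).
  assert (HU : forall x, U x -> bx x) by (intros x [h _]; exact h).
  exists U, ph, 1. split; [|split; [lra|split; [|split; [|split; [|split]]]]].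
  - intros x [h1 [h2 h3]]. destruct (box_open r0 x h1) as [d1 [D1 o1]].
    destruct (hball_open _ _ _ _ h2) as [e2' [E2' o2]]. destruct (hball_open _ _ _ _ h3) as [e3' [E3' o3]].
    destruct (Pcont x h1 _ E2') as [d2 [D2 q2]]. destruct (Pcont x h1 _ E3') as [d3 [D3 q3]].
    exists (Rmin d1 (Rmin d2 d3)). split; [repeat apply Rmin_pos; assumption|]. intros y Hy.
    assert (b1 := Rmin_l d1 (Rmin d2 d3)). assert (b2 := Rmin_r d1 (Rmin d2 d3)). assert (b3 := Rmin_l d2 d3). assert (b4 := Rmin_r d2 d3).
    assert (Hyb : bx y) by (apply o1; intros i; generalize (Hy i); lra).
    split; [exact Hyb|split].
    + apply o2, q2; [exact Hyb|intros i; generalize (Hy i); lra].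
    + apply o3, q3; [exact Hyb|intros i; generalize (Hy i); lra].
  - intros x _. apply PIn.
  - split.
    + intros x Hx eps He. destruct (Pcont x (HU x Hx) eps He) as [d [Hd h]]. exists d. split; auto.
    + exists (fun i x => hols (Zx lam rad i x)). split.
      * intros i. split.
        -- intros x Hx. apply (phi_part lam alpha K rad r0 Ha HB Hrad HKrad Hr0 HCr0 i x (HU x Hx)).
        -- intros k. apply hCk_sub with (1 := HU). apply (diff_closed_hCk lam alpha K rad r0 Ha HB Hrad HKrad Hr0 HCr0).
           apply diff_closed_lsol, diff_closed_const.
      * intros x Hx a. apply (phi_immersion lam K rad r0 HB Hrad HKrad Hr0 HCr0 x a (HU x Hx)).
  - intros G. split.
    + intros [[G1 G2] G3]. destruct (Hsol G G1 G2) as [x [Hx <-]]. exists x. split; [|reflexivity].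
      split; [exact Hx|]. split; [apply G1|exact G3].
    + intros [x [[h1 [h2 h3]] <-]]. split; [split; [split; [apply PIn|exact h2]|now apply Pst]|exact h3].
  - intros x y Hx Hy Hxy. apply f8_inj. intros k _. rewrite <- !PcF by auto. now rewrite Hxy.
  (* Continuity of the inverse chart: the parameters are the coordinates of the lift, which move by
     at most twice the distance. *)
  - intros x Hx eps He. exists (eps / 4). split; [lra|]. intros y Hy [c [Hc [h _]]].
    assert (Hk : forall k, Rabs (f8 y k - f8 x k) < eps).
    { intros k. rewrite <- !PcF by auto. apply Rle_lt_trans with (2 * c); [|].
      - now apply coordF_lip with alpha.
      - assert (0 <= c); [|lra]. apply Rle_trans with (2 := h 0 ltac:(rewrite Cmod_0; lra)). apply sqrt_pos. }
    change (forall i, Rabs (y i - x i) < eps); apply (fin8_ind (fun i => Rabs (y i - x i) < eps)); [apply (Hk 0%nat)|apply (Hk 1%nat)|apply (Hk 2%nat)|apply (Hk 3%nat)|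
      apply (Hk 4%nat)|apply (Hk 5%nat)|apply (Hk 6%nat)|apply (Hk 7%nat)].
Qed.
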